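(* Fix an integer $\ell\ge 2$ and $\alpha\in(0,1)$. Let $\Lambda_0=(\lambda_0,\lambda_0')$ be a non-degenerate steady periodic point vortex configuration. Then there exist $\rho_1>0$ and a curve $$\mathscr C_{\mathrm{loc}}=\{(f(\rho),w(\rho),Q(\rho),\lambda(\rho),\rho): |\rho|<\rho_1\},$$ depending real-analytically on $\rho$, such that for each $0<|\rho|<\rho_1$ the tuple $(f(\rho),w(\rho),Q(\rho),\Lambda=(\lambda(\rho),\lambda_0'),\rho)$ is a steady periodic hollow vortex configuration of class $C^{\ell+\alpha}$, and $$f(0)=\mathrm{id},\qquad w(0)=w^0_{\Lambda_0},\qquad Q(0)=0,\qquad \lambda(0)=\lambda_0 .$$
   Context: **Point vortices.** Fix an integer $M\ge1$. Parameters: $\Lambda=(\zeta_1,\dots,\zeta_M,\gamma_1,\dots,\gamma_M,c,T)\in\mathbb P:=\mathbb C^M\times\mathbb R^M\times\mathbb C\times\mathbb R$ (centers, circulations, wave speed, horizontal period), regarded as a real vector space. Put $$\mathcal V_k(\Lambda)=\sum_{j\ne k}\frac{\gamma_j}{2iT}\cot\Big(\frac{\pi(\zeta_k-\zeta_j)}{T}\Big)-c,\qquad \mathcal V=(\mathcal V_1,\dots,\mathcal V_M)\in\mathbb C^M .$$ A steady periodic point vortex configuration is a $\Lambda$ with $\mathcal V(\Lambda)=0$, $T>0$, all $\gamma_k\neq0$, and $\zeta_j-\zeta_k\notin T\mathbb Z$ for $j\ne k$. It is non-degenerate if the real-linear map $D_\Lambda\mathcal V(\Lambda_0):\mathbb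 P\to\mathbb C^M$ has full rank. In that case one can split the real coordinates of $\mathbb P$ into two groups, $\mathbb P=\mathcal P\times\mathcal P'\ni\Lambda=(\lambda,\lambda')$, such that $D_\lambda\mathcal V(\Lambda_0)$ is an isomorphism; such a splitting is fixed, $\Lambda_0=(\lambda_0,\lambda_0')$, and $\lambda'$ is held at $\lambda_0'$. The point vortex potential is the multivalued function $w^0_\Lambda=\sum_{k=1}^M\frac{\gamma_k}{2\pi i}\log\sin\big(\frac{\pi}{T}(\cdot-\zeta_k)\big)$. **Hollow vortices.** For $\rho\in\mathbb R$ let $\mathcal D_\rho=\mathcal D_\rho(\Lambda)=\mathbb C\setminus\bigcup_{k=1}^M\bigcup_{n\in\mathbb Z}(\overline{B_{|\rho|}(\zeta_k)}+nT)$ (with $\mathcal D_0=\mathbb C\setminus\bigcup_k(\zeta_k+T\mathbb Z)$). A tuple $(f,w,Q,\Lambda,\rho)$ with $Q=(Q_1,\dots,Q_M)\in\mathbb R^M$, $\rho\ne0$ is a steady periodic hollow vortex configuration of class $C^{\ell+\alpha}$ if the closed disks $\overline{B_{|\rho|}(\zeta_k)}+nT$ ($k=1,\dots,M$, $n\in\mathbb Z$) are pairwise disjoint; $f$ is holomorphic in $\mathcal D_\rho$, $f-\mathrm{id}$ is $T$-periodic of class $C^{\ell+\alpha}(\overline{\mathcal D_\rho})$, $f$ is injective with $\partial_\zeta f\ne0$ on $\overline{\mathcal D_\rho}$, $\partial_\zeta f\to1$ as $\operatorname{Im}\zeta\to\pm\infty$; $w-w^0_\Lambda$ is single-valued, holomorphic,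 $T$-periodic, of class $C^{\ell+\alpha}(\overline{\mathcal D_\rho})$, with derivative tending to $0$ as $\operatorname{Im}\zeta\to\pm\infty$; and for each $k$: (circulation) $\int_{\partial B_{|\rho|}(\zeta_k)}\partial_\zeta w\,d\zeta=\gamma_k$; (kinematic) $\operatorname{Im}(w-cf)$ is constant on $\partial B_{|\rho|}(\zeta_k)$; (Bernoulli) $|\partial_\zeta w/\partial_\zeta f-c|=q_k$ on $\partial B_{|\rho|}(\zeta_k)$ for a real constant $q_k$ with $\rho^2q_k^2=\frac{\gamma_k^2}{4\pi^2}+\rho Q_k$. The physical fluid domain is $f(\mathcal D_\rho)$ with potential $w\circ f^{-1}$. **Regularity of curves.** With $\mathbb T$ the unit circle and $\mathring C^{\ell+\alpha}(\mathbb T)$ the real-valued mean-zero $C^{\ell+\alpha}$ functions on $\mathbb T$, $f$ and $w$ are represented as $f=\mathrm{id}+\rho^2\mathcal Z^\rho(\Lambda)[\mu]$, $w=w^0_\Lambda+\rho\,\mathcal Z^\rho(\Lambda)[\nu]$ with densities $\mu,\nu\in\mathring C^{\ell+\alpha}(\mathbb T)^M$, where $$\mathcal Z^\rho(\Lambda)[\mu](\zeta)=\sum_{k=1}^M\frac1{2iT}\int_{\mathbb T}\mu_k(\sigma)\cot\Big(\frac\pi T(\rho\sigma+\zeta_k-\zeta)\Big)\rho\,d\sigma .$$ Real-analytic dependence of $(f,w,Q,\lambda)$ on $\rho$ means real-analytic dependence of $(\mu,\nu,Q,\lambda)\in\mathring C^{\ell+\alpha}(\mathbb T)^M\times\mathring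 C^{\ell+\alpha}(\mathbb T)^M\times\mathbb R^M\times\mathcal P$. *)

(* Defs.v *)
From Stdlib Require Import Reals FunctionalExtensionality.
From mathcomp Require Import boot.ssreflect boot.ssrfun boot.ssrbool boot.eqtype
  boot.ssrnat boot.seq boot.choice boot.fintype boot.bigop.
From Coquelicot Require Import Coquelicot.

Set Implicit Arguments.
Unset Strict Implicit.
Unset Printing Implicit Defensive.

Local Open Scope R_scope.

(* Coquelicot puts a uniform structure on function types but no algebra or
   norm: add the pointwise module structure and, over a finite index type, the
   maximum norm. *)
Section FunctionModules.
Variable K : AbsRing.

Section Algebra.
Variables (T : Type) (V : ModuleSpace K).
Implicit Types f g : T -> V.

Definition fct_plus f g : T -> V := fun t => plus (f t) (g t).
Definition fct_opp f : T -> V := fun t => opp (f t).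
Definition fct_zero : T -> V := fun _ => zero.
Definition fct_scal (k : K) f : T -> V := fun t => scal k (f t).

Definition fct_AbelianMonoid_mixin : AbelianMonoid.mixin_of (T -> V).
Proof.
apply: (@AbelianMonoid.Mixin _ fct_plus fct_zero) => *;
  apply: functional_extensionality => t.
- exact: plus_comm.
- exact: plus_assoc.
- exact: plus_zero_r.
Defined.

Definition fct_AbelianMonoid :=
  AbelianMonoid.Pack _ fct_AbelianMonoid_mixin (T -> V).

Definition fct_AbelianGroup_mixin : AbelianGroup.mixin_of fct_AbelianMonoid.
Proof.
apply: (@AbelianGroup.Mixin fct_AbelianMonoid fct_opp) => f.
apply: functional_extensionality => t; exact: plus_opp_r.
Defined.

Definition fct_AbelianGroup :=
  AbelianGroup.Pack _ (AbelianGroup.Class _ _ fct_AbelianGroup_mixin) (T -> V).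

Definition fct_ModuleSpace_mixin : ModuleSpace.mixin_of K fct_AbelianGroup.
Proof.
apply: (@ModuleSpace.Mixin K fct_AbelianGroup fct_scal) => *;
  apply: functional_extensionality => t.
- exact: scal_assoc.
- exact: scal_one.
- exact: scal_distr_l.
- exact: scal_distr_r.
Defined.

Definition fct_ModuleSpace : ModuleSpace K :=
  ModuleSpace.Pack K _ (ModuleSpace.Class K _ _ fct_ModuleSpace_mixin) (T -> V).

End Algebra.

Section Norm.
Variables (I : finType) (V : NormedModule K).
Implicit Types f g : I -> V.

Definition fin_norm f : R := \big[Rmax/0]_(i : I) norm (f i).

Lemma fin_norm_ge0 f : 0 <= fin_norm f.
Proof.
rewrite /fin_norm; elim/big_rec: _ => [|i x _ Hx]; first exact: Rle_refl.
exact: Rle_trans Hx (Rmax_r _ _).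
Qed.

Lemma le_fin_norm f i : norm (f i) <= fin_norm f.
Proof.
rewrite /fin_norm; move: (mem_index_enum i); elim: (index_enum I) => // j s IH.
rewrite inE big_cons => /orP [/eqP <-|/IH H]; first exact: Rmax_l.
exact: Rle_trans H (Rmax_r _ _).
Qed.

Lemma fin_norm_le f b : 0 <= b -> (forall i, norm (f i) <= b) -> fin_norm f <= b.
Proof.
by move=> b0 H; rewrite /fin_norm; elim/big_rec: _ => // i x _ Hx; apply: Rmax_lub.
Qed.

Lemma fin_norm_lt f b : 0 < b -> (forall i, norm (f i) < b) -> fin_norm f < b.
Proof.
by move=> b0 H; rewrite /fin_norm; elim/big_rec: _ => // i x _ Hx; apply: Rmax_lub_lt.
Qed.

Definition fin_NormedModuleAux : NormedModuleAux K :=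
  NormedModuleAux.Pack K _
    (NormedModuleAux.Class K _ (ModuleSpace.class _ (fct_ModuleSpace I V))
       (UniformSpace.class (fct_UniformSpace I V))) (I -> V).

Definition fin_NormedModule_mixin : NormedModule.mixin_of K fin_NormedModuleAux.
Proof.
apply: (@NormedModule.Mixin K fin_NormedModuleAux fin_norm (@norm_factor K V)).
- move=> f g; apply: fin_norm_le => [|i].
    by apply: Rplus_le_le_0_compat; apply: fin_norm_ge0.
  apply: Rle_trans (norm_triangle _ _) _.
  by apply: Rplus_le_compat; apply: le_fin_norm.
- move=> l f; apply: fin_norm_le => [|i].
    by apply: Rmult_le_pos; [apply: abs_ge_0|apply: fin_norm_ge0].
  apply: Rle_trans (norm_scal _ _) _.
  by apply: Rmult_le_compat_l; [apply: abs_ge_0|apply: le_fin_norm].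
- move=> f g eps H; change (forall i, ball (f i) eps (g i)) => i.
  apply: norm_compat1.
  exact: Rle_lt_trans (@le_fin_norm (fun i => minus (g i) (f i)) i) H.
- move=> f g eps H; change (forall i, ball (f i) eps (g i)) in H.
  apply: fin_norm_lt => [|i].
    by apply: Rmult_lt_0_compat; [apply: norm_factor_gt_0|apply: cond_pos].
  exact: norm_compat2 (H i).
- move=> f Hf; apply: functional_extensionality => i; apply: norm_eq_zero.
  apply: Rle_antisym; last exact: norm_ge_0.
  by rewrite -[X in _ <= X]Hf; apply: le_fin_norm.
Defined.

Definition fin_NormedModule : NormedModule K :=
  NormedModule.Pack K _ (NormedModule.Class K _ _ fin_NormedModule_mixin) (I -> V).

End Norm.
End FunctionModules.

Local Open Scope C_scope.

Definition Cexp (z : C) : C := RtoC (exp (Re z)) * (cos (Im z), sin (Im z)).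
Definition Csin (z : C) : C := (Cexp (Ci * z) - Cexp (- (Ci * z))) / (2 * Ci).
Definition Ccos (z : C) : C := (Cexp (Ci * z) + Cexp (- (Ci * z))) / 2.
Definition Ccot (z : C) : C := Ccos z / Csin z.

Definition unit_pt (t : R) : C := (cos t, sin t).

Section PointVortices.
Variable M : nat.

(* (centers, circulations, wave speed, period) *)
Definition params : Type := (('I_M -> C) * ('I_M -> R) * C * R)%type.

Definition params_NormedModule : NormedModule R_AbsRing :=
  prod_NormedModule R_AbsRing
    (prod_NormedModule R_AbsRing
       (prod_NormedModule R_AbsRing
          (fin_NormedModule 'I_M C_R_NormedModule)
          (fin_NormedModule 'I_M R_NormedModule))
       C_R_NormedModule)
    R_NormedModule.

Definition velocity_NormedModule : NormedModule R_AbsRing :=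
  fin_NormedModule 'I_M C_R_NormedModule.

Definition center (L : params) : 'I_M -> C := L.1.1.1.
Definition circ (L : params) : 'I_M -> R := L.1.1.2.
Definition speed (L : params) : C := L.1.2.
Definition period (L : params) : R := L.2.

(* The 3 M + 3 real coordinates of the parameter space. *)
Inductive coord : Type :=
  | CenterRe of 'I_M
  | CenterIm of 'I_M
  | Circulation of 'I_M
  | SpeedRe
  | SpeedIm
  | Period.

Definition coord_val (i : coord) (L : params) : R :=
  match i with
  | CenterRe k => Re (center L k)
  | CenterIm k => Im (center L k)
  | Circulation k => circ L k
  | SpeedRe => Re (speed L)
  | SpeedIm => Im (speed L)
  | Period => period L
  end.

Definition velocity (L : params) : 'I_M -> C := fun k =>
  \big[Cplus/RtoC 0]_(j < M | j != k)
     (circ L j / (2 * Ci * period L)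
      * Ccot (PI * (center L k - center L j) / period L))
  - speed L.

Definition steady_point_vortex (L : params) : Prop :=
  (forall k, velocity L k = 0)
  /\ (0 < period L)%R
  /\ (forall k, circ L k <> 0%R)
  /\ (forall j k, j <> k ->
        forall n : Z, center L j - center L k <> RtoC (period L * IZR n)).

Definition velocity_diff (L : params) (D : params -> 'I_M -> C) : Prop :=
  filterdiff (K := R_AbsRing) (U := params_NormedModule)
    (V := velocity_NormedModule) velocity
    (locally (T := params_NormedModule) L) D.

(* Full rank of a real-linear map from dimension 3 M + 3 to dimension 2 M. *)
Definition nondegenerate (L : params) : Prop :=
  exists D, velocity_diff L D /\ forall v : 'I_M -> C, exists h, D h = v.

(* [sel] selects the coordinates forming lambda, the others form lambda'; the
   lambda-space is identified with the vectors whose other coordinates vanish,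
   and the partial derivative with the restriction of the full one to it. *)
Definition splitting (sel : coord -> bool) (L : params) : Prop :=
  exists D, velocity_diff L D /\
    forall v : 'I_M -> C,
      exists! h : params,
        (forall i, sel i = false -> coord_val i h = 0%R) /\ D h = v.

(* A multivalued function is the relation between a point and its values.
   The values of the potential come from all choices, made independently, of
   the M logarithms. *)
Definition mfun : Type := C -> C -> Prop.

Definition pv_potential (L : params) : mfun := fun z v =>
  exists s : 'I_M -> C,
    (forall k, Cexp (s k) = Csin (PI / period L * (z - center L k)))
    /\ v = \big[Cplus/RtoC 0]_(k < M) (circ L k / (2 * PI * Ci) * s k).

Definition mfun_shift (w : mfun) (g : C -> C) : mfun := fun z v =>
  exists v0, w z v0 /\ v = v0 + g z.

Definition closed_disk (L : params) (rho : R) (k : 'I_M) (n : Z) (z : C) : Prop :=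
  (Cmod (z - (center L k + RtoC (IZR n * period L))) <= Rabs rho)%R.

Definition disk_boundary (L : params) (rho : R) (k : 'I_M) (z : C) : Prop :=
  Cmod (z - center L k) = Rabs rho.

Definition conf_domain (L : params) (rho : R) (z : C) : Prop :=
  forall k n, ~ closed_disk L rho k n z.

Definition disjoint_disks (L : params) (rho : R) : Prop :=
  forall k n k' n' z,
    closed_disk L rho k n z -> closed_disk L rho k' n' z -> k = k' /\ n = n'.

End PointVortices.

Definition Cclosure (D : C -> Prop) (z : C) : Prop :=
  forall eps : posreal, exists y, D y /\ (Cmod (y - z) < eps)%R.

Definition continuous_within (A : C -> Prop) (g : C -> C) : Prop :=
  forall z, A z -> filterlim g (within A (locally z)) (locally (g z)).

(* Both derivatives below are required on the open set [D] only; together with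
   [continuous_within (Cclosure D) g'] this makes [g'] the derivative on the
   closure, boundary values being limits from inside. *)
Definition derivative_on (D : C -> Prop) (g g' : C -> C) : Prop :=
  forall z, D z ->
    is_derive (K := C_AbsRing) (V := C_NormedModule) g z (g' z).

(* Derivative of a multivalued function, through local holomorphic branches. *)
Definition mderivative_on (D : C -> Prop) (w : mfun) (w' : C -> C) : Prop :=
  forall z, D z ->
    exists b : C -> C,
      locally z (fun y => w y (b y) /\
        is_derive (K := C_AbsRing) (V := C_NormedModule) b y (w' y)).

(* Class C^{l+a} on the closure of [D] for a holomorphic [g]: the partial
   derivatives of order [j] are, up to powers of i, the complex derivative of
   order [j]; [G j] is this derivative together with its boundary values. *)
Definition holder_holomorphic (D : C -> Prop) (l : nat) (a : R) (g : C -> C) : Prop :=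
  exists G : nat -> C -> C,
    (forall z, Cclosure D z -> G 0%N z = g z)
    /\ (forall j, (j < l)%coq_nat -> derivative_on D (G j) (G j.+1))
    /\ (forall j, (j <= l)%coq_nat -> continuous_within (Cclosure D) (G j))
    /\ (exists B : R, forall j z, (j <= l)%coq_nat -> Cclosure D z ->
          (Cmod (G j z) <= B)%R)
    /\ (exists B : R, forall x y, Cclosure D x -> Cclosure D y -> x <> y ->
          (Cmod (G l x - G l y) <= B * Rpower (Cmod (x - y)) a)%R).

Definition at_im_infty (P : C -> Prop) : Prop :=
  exists Y : R, forall z : C, (Y < Rabs (Im z))%R -> P z.

Definition hollow_vortex (M l : nat) (a : R) (f : C -> C) (w : mfun)
    (Q : 'I_M -> R) (L : params M) (rho : R) : Prop :=
  let D := conf_domain L rho in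
  let T := RtoC (period L) in
  rho <> 0%R /\ disjoint_disks L rho /\
  exists f' w' h h' : C -> C,
    derivative_on D f f' /\ continuous_within (Cclosure D) f'
    /\ (forall z, Cclosure D z -> f (z + T) - (z + T) = f z - z)
    /\ holder_holomorphic D l a (fun z => f z - z)
    /\ (forall x y, Cclosure D x -> Cclosure D y -> f x = f y -> x = y)
    /\ (forall z, Cclosure D z -> f' z <> 0)
    /\ filterlim f' at_im_infty (locally (RtoC 1))
    (* h is w - w^0 *)
    /\ (forall z, Cclosure D z ->
          forall v, w z v <-> mfun_shift (pv_potential L) h z v)
    /\ derivative_on D h h'
    /\ (forall z, Cclosure D z -> h (z + T) = h z)
    /\ holder_holomorphic D l a h
    /\ filterlim h' at_im_infty (locally (RtoC 0))
    /\ mderivative_on D w w' /\ continuous_within (Cclosure D) w'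
    /\ forall k : 'I_M,
         is_RInt (V := C_R_NormedModule)
           (fun t => w' (center L k + Rabs rho * unit_pt t)
                     * (Rabs rho * Ci * unit_pt t))
           0%R (2 * PI)%R (RtoC (circ L k))
         /\ (exists m : R, forall z, disk_boundary L rho k z ->
               forall v, w z v -> Im (v - speed L * f z) = m)
         /\ (exists q : R,
               (rho ^ 2 * q ^ 2 = circ L k ^ 2 / (4 * PI ^ 2) + rho * Q k)%R
               /\ forall z, disk_boundary L rho k z ->
                    Cmod (w' z / f' z - speed L) = q).

(* Functions on the unit circle are 2 pi-periodic functions of the angle. The
   norm is the maximum of the sup norms of the derivatives of order <= l and
   of the Hoelder seminorm of the last one. *)
Definition holder_norm (l : nat) (a : R) (u : R -> R) : Rbar :=
  Lub_Rbar (fun y =>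
    (exists j x, (j <= l)%coq_nat /\ y = Rabs (Derive_n u j x)) \/
    (exists x x', x <> x' /\
       y = (Rabs (Derive_n u l x - Derive_n u l x') / Rpower (Rabs (x - x')) a)%R)).

Definition holder_circle0 (l : nat) (a : R) (u : R -> R) : Prop :=
  (forall x, u (x + 2 * PI)%R = u x)
  /\ (forall j x, (j <= l)%coq_nat -> ex_derive_n u j x)
  /\ is_finite (holder_norm l a u)
  /\ is_RInt u 0%R (2 * PI)%R 0%R.

(* Z^rho(L)[mu], with sigma = exp (i t) and d sigma = i exp (i t) dt. *)
Definition layer (M : nat) (L : params M) (rho : R) (mu : 'I_M -> R -> R) (z : C) : C :=
  \big[Cplus/RtoC 0]_(k < M)
    (/ (2 * Ci * period L) *
     RInt (V := C_R_CompleteNormedModule)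
       (fun t => mu k t
          * Ccot (PI / period L * (rho * unit_pt t + center L k - z))
          * rho * (Ci * unit_pt t))
       0%R (2 * PI)%R).

(* Real-analyticity of [phi : (-r1, r1) -> X], with [X] the normed space of
   the [x] satisfying [mem], normed by [nrm]. *)
Definition analytic_curve (V : ModuleSpace R_Ring) (mem : V -> Prop) (nrm : V -> R)
    (r1 : R) (phi : R -> V) : Prop :=
  (forall r, (Rabs r < r1)%R -> mem (phi r)) /\
  forall r0, (Rabs r0 < r1)%R ->
    exists (A : nat -> V) (d : posreal),
      (forall n, mem (A n)) /\
      forall r, (Rabs r < r1)%R -> (Rabs (r - r0) < d)%R ->
        is_lim_seq
          (fun n => nrm (minus (phi r)
             (sum_n (fun m => scal ((r - r0) ^ m)%R (A m)) n)))
          0%R.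

(* Tuples (mu, nu, Q, L). *)
Definition unknowns (M : nat) : ModuleSpace R_Ring :=
  prod_ModuleSpace R_Ring
    (prod_ModuleSpace R_Ring
       (prod_ModuleSpace R_Ring
          (fct_ModuleSpace (K := R_AbsRing) 'I_M
             (fct_ModuleSpace (K := R_AbsRing) R R_ModuleSpace))
          (fct_ModuleSpace (K := R_AbsRing) 'I_M
             (fct_ModuleSpace (K := R_AbsRing) R R_ModuleSpace)))
       (fin_NormedModule 'I_M R_NormedModule))
    (params_NormedModule M).

Definition unknowns_mem (M l : nat) (a : R) (x : unknowns M) : Prop :=
  forall k : 'I_M, holder_circle0 l a (x.1.1.1 k) /\ holder_circle0 l a (x.1.1.2 k).

Definition unknowns_norm (M l : nat) (a : R) (x : unknowns M) : R :=
  (\big[Rmax/0]_(k < M) real (holder_norm l a (x.1.1.1 k))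
   + \big[Rmax/0]_(k < M) real (holder_norm l a (x.1.1.2 k))
   + norm (V := fin_NormedModule 'I_M R_NormedModule) x.1.2
   + norm (V := params_NormedModule M) x.2)%R.

(* Main.v *)
Require Import Defs.
From Stdlib Require Import Reals Lra Lia ZArith List FunctionalExtensionality ClassicalEpsilon.
From HB Require Import structures.
From mathcomp Require Import boot.ssreflect boot.ssrfun boot.ssrbool boot.eqtype
  boot.choice boot.fintype boot.bigop.
From Coquelicot Require Import Coquelicot.

Local Open Scope R_scope.
Local Open Scope C_scope.

(** The unknowns are expanded in powers of rho, with coefficients that are Laurent polynomials in
    the boundary point tau = exp(i t). The densities of the two layer potentials are taken as twice
    the real part of a series with negative exponents only. Seen from outside a disk, the
    nonnegative modes of a density contribute nothing and the negative ones may be integrated over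
    |tau| = 1/2 ([density_int]). The potentials are then integrals whose singularities lie strictly
    inside the disks, so no singular integral appears. Integration by parts and Cauchy's formula
    express their derivatives at the boundary point center + rho tau as minus the series itself plus
    rho times an integral operator with regular kernel ([jet1_boundary]).

    Both boundary conditions concern P = i rho tau (w' - c f'). The kinematic condition says that P
    is real, and the Bernoulli condition then reads P^2 = (gamma^2/(4 pi^2) + rho Q) |f'|^2. One
    looks for P in the form gamma/(2 pi) + i rho^2 (v - conj v), v having positive frequencies only;
    this is real by construction. The part of i rho tau (w' - c f') regular inside the disk must
    produce v ([interior_eq]) and the exterior part must produce conj v, which fixes the density of
    w ([exterior_eq]). After division by rho^2 the Bernoulli equation has a linear leading part and
    is solved frequency by frequency ([bernoulli_quad]): frequency 0 gives Q, frequencies of modulus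
    at least 2 give the density of f, and the frequencies 1 and -1, which that density lacks, give
    the first mode of v. What remains is the mode of frequency 1 in the interior equation: the point
    vortex velocity at Lambda must be rho^2 times a quantity already determined. With lambda =
    lambda_0 + rho y this becomes a linear equation for y with operator the partial differential of
    the velocity at Lambda_0, which the chosen splitting makes solvable ([velocity_matrix],
    [velocity_eq]).

    Compositions are made polynomial by further unknowns: reciprocals through an equation d (1 + p)
    = 1, tangents through their differential equation ([tan_series]), and cot y - 1/y from the
    tangent by the duplication formula ([C1_cot]). The whole problem becomes one fixed-point system
    Y = S4 Y for finitely many series, in which the coefficient of rho^n depends on earlier
    coefficients only. Hence a formal solution exists. Every operation is bounded for a weighted
    norm, and each factor rho gains a factor r, so for small r a bound on truncations reproduces
    itself and the series converge ([fixpoint_conv], [system_solution]).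

    It remains to read the flow off the series ([vortex_hollow]): f is the identity plus a map with
    Lipschitz constant at most 1/2, hence injective ([fmap_inj]); local branches of the potential
    come from local logarithms ([log_branch]); regularity follows from bounds on all derivatives
    ([holder_of_SD]). Finally all unknowns depend linearly on the weights rho^n attached to the
    coefficients, and re-expanding these weights at another point gives real-analyticity in the
    Hoelder norm ([curve_analytic]). *)

(** * Complex exponential, sine and cosine *)

Lemma Ceq (a b : C) : Re a = Re b -> Im a = Im b -> a = b.
Proof. by case: a b => [a1 a2] [b1 b2] /= -> ->. Qed.

Lemma Re_plus (a b : C) : Re (a + b) = (Re a + Re b)%R. Proof. by []. Qed.
Lemma Im_plus (a b : C) : Im (a + b) = (Im a + Im b)%R. Proof. by []. Qed.
Lemma Re_mult (a b : C) : Re (a * b) = (Re a * Re b - Im a * Im b)%R. Proof. by []. Qed.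
Lemma Im_mult (a b : C) : Im (a * b) = (Re a * Im b + Im a * Re b)%R. Proof. by []. Qed.
Lemma Re_opp (a : C) : Re (- a) = (- Re a)%R. Proof. by []. Qed.
Lemma Im_opp (a : C) : Im (- a) = (- Im a)%R. Proof. by []. Qed.
Lemma Re_minus (a b : C) : Re (a - b) = (Re a - Re b)%R. Proof. by []. Qed.
Lemma Im_minus (a b : C) : Im (a - b) = (Im a - Im b)%R. Proof. by []. Qed.

Lemma Cmod_le_abs (z : C) : (Cmod z <= Rabs (Re z) + Rabs (Im z))%R.
Proof.
rewrite {1}(_ : z = RtoC (Re z) + Ci * RtoC (Im z)); last first.
  apply: Ceq; rewrite ?Re_plus ?Im_plus ?Re_mult ?Im_mult /=; ring.
apply: Rle_trans (Cmod_triangle _ _) _; rewrite Cmod_mult !Cmod_R.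
have -> : Cmod Ci = 1%R by rewrite /Cmod /= !Rmult_0_l Rplus_0_l !Rmult_1_r sqrt_1.
lra.
Qed.

Lemma Cmod_sqr (z : C) : (Cmod z ^ 2 = Re z ^ 2 + Im z ^ 2)%R.
Proof. by rewrite /Cmod pow2_sqrt //; case: z => a b /=; nra. Qed.

Lemma Ci_neq0 : Ci <> 0.
Proof. by move=> H; have := f_equal Im H; rewrite /=; lra. Qed.

Lemma Ci_sqr : Ci * Ci = - (1).
Proof. apply: Ceq; rewrite ?Re_mult ?Im_mult /=; ring. Qed.

Lemma RtoC_neq0 (x : R) : x <> 0%R -> RtoC x <> 0.
Proof. by move=> H E; apply: H; have := f_equal Re E. Qed.

Lemma C2_neq0 : RtoC 2 <> 0.
Proof. apply: RtoC_neq0; lra. Qed.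

Lemma CPI_neq0 : RtoC PI <> 0.
Proof. apply: RtoC_neq0; exact: PI_neq0. Qed.

Ltac cfield := field; repeat split; try exact: Ci_neq0; try exact: C2_neq0;
  try exact: CPI_neq0; try assumption.

Lemma Cexp_add (a b : C) : Cexp (a + b) = Cexp a * Cexp b.
Proof.
rewrite /Cexp Re_plus Im_plus exp_plus cos_plus sin_plus RtoC_mult.
apply: Ceq; rewrite ?Re_mult ?Im_mult /=; ring.
Qed.

Lemma Cexp_0 : Cexp 0 = 1.
Proof.
rewrite /Cexp /= exp_0 cos_0 sin_0; apply: Ceq; rewrite ?Re_mult ?Im_mult /=; ring.
Qed.

Lemma Cexp_oppM (a : C) : Cexp (- a) * Cexp a = 1.
Proof. by rewrite -Cexp_add -[RHS]Cexp_0; congr Cexp; ring. Qed.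

Lemma Cmod_unit (t : R) : Cmod (unit_pt t) = 1%R.
Proof.
rewrite /Cmod /unit_pt /= !Rmult_1_r -sqrt_1; congr sqrt.
by have := sin2_cos2 t; rewrite /Rsqr; lra.
Qed.

Lemma Cmod_Cexp (a : C) : Cmod (Cexp a) = exp (Re a).
Proof.
rewrite /Cexp Cmod_mult Cmod_R Rabs_pos_eq; last by apply/Rlt_le/exp_pos.
by rewrite -[(cos _, _)]/(unit_pt (Im a)) Cmod_unit Rmult_1_r.
Qed.

Lemma Cexp_neq0 (a : C) : Cexp a <> 0.
Proof.
by move/(f_equal Cmod); rewrite Cmod_Cexp Cmod_0; have := exp_pos (Re a); lra.
Qed.

Lemma Cexp_opp (a : C) : Cexp (- a) = / Cexp a.
Proof.
have H := Cexp_neq0 a; rewrite -[LHS]Cmult_1_r -(Cinv_r (Cexp a)) // Cmult_assoc.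
by rewrite Cexp_oppM Cmult_1_l.
Qed.

Lemma Csin_add (a b : C) : Csin (a + b) = Csin a * Ccos b + Ccos a * Csin b.
Proof.
rewrite /Csin /Ccos Cmult_plus_distr_l !Cexp_opp Cexp_add.
have Ha := Cexp_neq0 (Ci * a); have Hb := Cexp_neq0 (Ci * b).
have := Ci_neq0; have := C2_neq0 => H2 Hi; cfield.
Qed.

Lemma Ccos_add (a b : C) : Ccos (a + b) = Ccos a * Ccos b - Csin a * Csin b.
Proof.
rewrite /Csin /Ccos Cmult_plus_distr_l !Cexp_opp Cexp_add.
have Ha := Cexp_neq0 (Ci * a); have Hb := Cexp_neq0 (Ci * b).
have Hi := Ci_neq0; have H2 := C2_neq0.
move: (Cexp (Ci * a)) (Cexp (Ci * b)) Ha Hb => x y Hx Hy.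
have -> : (x - / x) / (2 * Ci) * ((y - / y) / (2 * Ci))
   = (x - / x) * (y - / y) / (4 * (Ci * Ci)) by cfield.
by rewrite Ci_sqr; field; repeat split.
Qed.

Lemma Csin_0 : Csin 0 = 0.
Proof.
rewrite /Csin Cmult_0_r (_ : - 0 = 0); last by ring.
by rewrite Cexp_0 /Cminus Cplus_opp_r /Cdiv Cmult_0_l.
Qed.

Lemma Ccos_0 : Ccos 0 = 1.
Proof.
rewrite /Ccos Cmult_0_r (_ : - 0 = 0); last by ring.
by rewrite Cexp_0; cfield.
Qed.

Lemma Csin_opp (a : C) : Csin (- a) = - Csin a.
Proof.
rewrite /Csin (_ : Ci * - a = - (Ci * a)); last by ring.
rewrite (_ : - - (Ci * a) = Ci * a); last by ring.
by cfield.
Qed.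

Lemma Ccos_opp (a : C) : Ccos (- a) = Ccos a.
Proof.
rewrite /Ccos (_ : Ci * - a = - (Ci * a)); last by ring.
rewrite (_ : - - (Ci * a) = Ci * a); last by ring.
by cfield.
Qed.

Lemma Csin2_Ccos2 (a : C) : Csin a * Csin a + Ccos a * Ccos a = 1.
Proof.
have := Ccos_add a (- a); rewrite Ccos_opp Csin_opp (_ : a + - a = 0); last by ring.
by rewrite Ccos_0 => ->; ring.
Qed.

Lemma Csin_sub (a b : C) : Csin (a - b) = Csin a * Ccos b - Ccos a * Csin b.
Proof. by rewrite /Cminus Csin_add Ccos_opp Csin_opp; ring. Qed.

Lemma Csin_comp (z : C) :
  Csin z = (sin (Re z) * cosh (Im z), cos (Re z) * sinh (Im z))%R.
Proof.
have H : 2 * Ci * Csin z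
   = 2 * Ci * (sin (Re z) * cosh (Im z), cos (Re z) * sinh (Im z))%R.
  rewrite /Csin (_ : forall a, 2 * Ci * (a / (2 * Ci)) = a); last first.
    by move=> a; cfield.
  rewrite /Cexp; case: z => x y; rewrite /cosh /sinh.
  apply: Ceq; rewrite ?(Re_minus, Im_minus, Re_mult, Im_mult, Re_opp, Im_opp) /=;
    rewrite !(Rmult_0_l, Rmult_1_l, Rplus_0_l, Rminus_0_l, Rplus_0_r, Ropp_involutive)
      ?cos_neg ?sin_neg; field.
have H2 : 2 * Ci <> 0 by apply: Cmult_neq_0; [exact: C2_neq0|exact: Ci_neq0].
have E a : a = / (2 * Ci) * (2 * Ci * a) by cfield.
by rewrite (E (Csin z)) H -E.
Qed.

Lemma Ccos_comp (z : C) :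
  Ccos z = (cos (Re z) * cosh (Im z), - (sin (Re z) * sinh (Im z)))%R.
Proof.
rewrite /Ccos /Cexp; case: z => x y; rewrite /cosh /sinh /Cdiv -RtoC_inv; last by lra.
apply: Ceq; rewrite ?(Re_plus, Im_plus, Re_mult, Im_mult, Re_opp, Im_opp) /=;
  rewrite !(Rmult_0_l, Rmult_1_l, Rplus_0_l, Rminus_0_l, Rplus_0_r, Ropp_involutive)
    ?cos_neg ?sin_neg; field.
Qed.

Lemma cosh2_sinh2 (y : R) : (cosh y ^ 2 = 1 + sinh y ^ 2)%R.
Proof.
rewrite /cosh /sinh; have H : (exp y * exp (- y) = 1)%R by rewrite -exp_plus Rplus_opp_r exp_0.
nra.
Qed.

Lemma Cmod_Csin (z : C) : (Cmod (Csin z) ^ 2 = sin (Re z) ^ 2 + sinh (Im z) ^ 2)%R.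
Proof.
rewrite Cmod_sqr Csin_comp /=.
have := cosh2_sinh2 (Im z); have := sin2_cos2 (Re z); rewrite /Rsqr /=.
set s := sin _; set c := cos _; set S := sinh _; set K := cosh _ => H1 H2.
have -> : (K * (K * 1) = 1 + S * (S * 1) -> s * K * (s * K * 1) + c * S * (c * S * 1)
   = s * s * (K * (K * 1)) + (c * c) * (S * S))%R by move=> _; ring.
  rewrite H2 (_ : (c * c = 1 - s * s)%R); [ring|lra].
exact: H2.
Qed.

Lemma Cmod_Ccos (z : C) : (Cmod (Ccos z) ^ 2 = cos (Re z) ^ 2 + sinh (Im z) ^ 2)%R.
Proof.
rewrite Cmod_sqr Ccos_comp /=.
have := cosh2_sinh2 (Im z); have := sin2_cos2 (Re z); rewrite /Rsqr /=.
set s := sin _; set c := cos _; set S := sinh _; set K := cosh _ => H1 H2.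
have -> : (K * (K * 1) = 1 + S * (S * 1) -> c * K * (c * K * 1) + - (s * S) * (- (s * S) * 1)
   = c * c * (K * (K * 1)) + (s * s) * (S * S))%R by move=> _; ring.
  rewrite H2 (_ : (s * s = 1 - c * c)%R); [ring|lra].
exact: H2.
Qed.

Lemma sinh_sqr_ge (y : R) : (y ^ 2 <= sinh y ^ 2)%R.
Proof.
have H x : (0 <= x)%R -> (x <= sinh x)%R.
  move=> Hx; rewrite /sinh.
  case: (Rle_lt_or_eq_dec _ _ Hx) => [{}Hx|<-]; last by rewrite Ropp_0; lra.
  have [||c [Hc1 Hc2]] := MVT_gen (fun x => exp x - exp (- x) - 2 * x)%R 0 x
     (fun x => exp x + exp (- x) - 2)%R.
  - by move=> z _; auto_derive => //; ring.
  - by move=> z _; apply: derivable_continuous_pt; apply/ex_derive_Reals_0; auto_derive.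
  move: Hc2; rewrite Ropp_0 => Hc2.
  have Hp : (0 <= exp c + exp (- c) - 2)%R.
    have H1 : (exp c * exp (- c) = 1)%R by rewrite -exp_plus Rplus_opp_r exp_0.
    have := exp_pos c; have := exp_pos (- c); have := Rle_0_sqr (exp c - exp (- c))%R.
    rewrite /Rsqr; nra.
  have : (0 <= (exp c + exp (- c) - 2) * (x - 0))%R by apply: Rmult_le_pos; lra.
  lra.
case: (Rle_lt_dec 0 y) => Hy; first by have := H _ Hy; nra.
have := H (- y)%R ltac:(lra).
by rewrite (_ : sinh (- y) = - sinh y)%R; [nra|rewrite /sinh Ropp_involutive; lra].
Qed.

Lemma Csin_eq0 (z : C) : Csin z = 0 -> exists n : Z, z = RtoC (IZR n * PI).
Proof.
move=> H; have := Cmod_Csin z; rewrite H Cmod_0 => E.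
have Hs := sinh_sqr_ge (Im z).
have H0 : Im z = 0%R by nra.
have H1 : sin (Re z) = 0%R by nra.
have [n Hn] := sin_eq_0_0 _ H1.
by exists n; apply: Ceq; rewrite /= -?Hn.
Qed.

Lemma Csin_PI (n : Z) : Csin (RtoC (IZR n * PI)) = 0.
Proof.
rewrite Csin_comp /=; have -> : sinh 0 = 0%R by rewrite /sinh Ropp_0; lra.
rewrite (sin_eq_0_1 (IZR n * PI)); last by exists n.
by apply: Ceq => /=; ring.
Qed.

(** Up to pi/3 the slope of the sine is at least 1/2; beyond it the sine is at least sqrt 3 / 2,
    while u/3 is at most pi/6. *)
Lemma sin_ge_third (u : R) : (0 <= u <= PI / 2)%R -> (u / 3 <= sin u)%R.
Proof.
move=> Hu; have Hpi := PI_RGT_0.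
case: (Rle_lt_dec u (PI / 3)) => H.
  case: (Rle_lt_or_eq_dec _ _ (proj1 Hu)) => [H0|<-]; last by rewrite sin_0; lra.
  have [||c [Hc1 Hc2]] := MVT_gen sin 0 u cos.
  - by move=> z _; auto_derive => //; ring.
  - by move=> z _; apply: continuity_sin.
  move: Hc2 Hc1; rewrite sin_0 Rmin_left ?Rmax_right; try lra.
  move=> Hc2 [Hc1 Hc3].
  have Hc : (1 / 2 <= cos c)%R.
    rewrite -cos_PI3; apply: cos_decr_1; lra.
  by nra.
have H1 : (sin (PI / 3) <= sin u)%R by apply: sin_incr_1; lra.
move: H1; rewrite sin_PI3 => H1.
have H3 : (1.7 <= sqrt 3)%R.
  by rewrite -(sqrt_pow2 1.7); [apply: sqrt_le_1; lra|lra].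
by have := PI_4; lra.
Qed.

Lemma nearest_PI (x : R) : exists n : Z, (Rabs (x - IZR n * PI) <= PI / 2)%R.
Proof.
have Hpi := PI_RGT_0.
exists (up (x / PI - 1 / 2)); have [H1 H2] := archimed (x / PI - 1 / 2).
set n := IZR _ in H1 H2 *.
have E : (x = x / PI * PI)%R by field; lra.
apply/Rabs_le; rewrite E; move: (x / PI)%R H1 H2 => y H1 H2; split; nra.
Qed.

Lemma sin_shift_abs (x : R) (n : Z) : Rabs (sin (x - IZR n * PI)) = Rabs (sin x).
Proof.
rewrite sin_minus (sin_eq_0_1 (IZR n * PI)); last by exists n.
have := sin2_cos2 (IZR n * PI); rewrite (sin_eq_0_1 (IZR n * PI)); last by exists n.
rewrite /Rsqr => H; rewrite Rmult_0_r Rminus_0_r Rabs_mult.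
have -> : Rabs (cos (IZR n * PI)) = 1%R; last by ring.
by rewrite -Rabs_R1; apply: Rsqr_eq_abs_0; rewrite /Rsqr; lra.
Qed.

(* The region where the cotangent and all its derivatives are bounded. *)
Definition away (d : R) (w : C) : Prop :=
  forall n : Z, (d <= Cmod (w - RtoC (IZR n * PI)))%R.

(** Shift by the nearest multiple of pi: the real part then lies in [-pi/2, pi/2], where
    [sin_ge_third] applies, and the imaginary part is controlled by |sinh y| >= |y|. *)
Lemma Csin_lower (d : R) (w : C) : (0 <= d)%R -> away d w ->
  (d ^ 2 / 9 <= Cmod (Csin w) ^ 2)%R.
Proof.
move=> Hd Hw; have [n Hn] := nearest_PI (Re w).
have := Hw n => H; have {}H : (d ^ 2 <= Cmod (w - RtoC (IZR n * PI)) ^ 2)%R.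
  by apply: pow_incr.
rewrite Cmod_sqr Re_minus Im_minus [Re (RtoC _)]/= [Im (RtoC _)]/= Rminus_0_r in H.
rewrite Cmod_Csin; have Hs := sinh_sqr_ge (Im w).
have H1 : ((Re w - IZR n * PI) ^ 2 / 9 <= sin (Re w) ^ 2)%R.
  rewrite -(pow2_abs (sin _)) -(sin_shift_abs _ n) -(pow2_abs (_ - _)%R) pow2_abs.
  set u := (_ - _)%R in Hn *.
  have Hu : (Rabs u / 3 <= Rabs (sin u))%R.
    case: (Rle_lt_dec 0 u) => H0.
      rewrite Rabs_pos_eq // in Hn *.
      by have := sin_ge_third u (conj H0 Hn); have := Rle_abs (sin u); lra.
    rewrite Rabs_left // in Hn *.
    have := sin_ge_third (- u) ltac:(lra); rewrite sin_neg.
    by have := Rle_abs (- sin u); rewrite Rabs_Ropp; lra.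
  rewrite -(pow2_abs u); have := Rabs_pos u; move: Hu; move: (Rabs _) (Rabs _) => p q Hu Hp; nra.
nra.
Qed.

Lemma away_Csin (d : R) (w : C) : (0 < d)%R -> away d w -> Csin w <> 0.
Proof.
by move=> Hd /Csin_lower H H0; move: H; rewrite H0 Cmod_0; nra.
Qed.

Lemma Ccot_sqr (w : C) : Csin w <> 0 -> 1 + Ccot w * Ccot w = / (Csin w * Csin w).
Proof.
move=> H; transitivity ((Csin w * Csin w + Ccos w * Ccos w) / (Csin w * Csin w)).
  by rewrite /Ccot; field.
by rewrite Csin2_Ccos2; field.
Qed.

Lemma im_le_Cmod (z : C) : (Rabs (Im z) <= Cmod z)%R.
Proof. exact: Rle_trans (Rmax_r _ _) (Rmax_Cmod z). Qed.

Lemma exp_quad (x : R) : (Rabs x <= 1 / 2)%R -> (Rabs (exp x - 1 - x) <= 2 * x ^ 2)%R.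
Proof.
move=> /Rabs_le_between H.
have H1 : (1 + x <= exp x)%R by exact: exp_ineq1_le.
have H2 : (1 - x <= exp (- x))%R by have := exp_ineq1_le (- x); lra.
have H3 : (exp x * exp (- x) = 1)%R by rewrite -exp_plus Rplus_opp_r exp_0.
have H4 : (exp x * (1 - x) <= 1)%R by rewrite -[X in (_ <= X)%R]H3; apply: Rmult_le_compat_l => //; exact: Rlt_le (exp_pos x).
have H5 : (0 <= x ^ 2)%R by nra.
rewrite Rabs_pos_eq; last by lra.
suff : (exp x <= 1 + x + 2 * x ^ 2)%R by lra.
apply: (Rmult_le_reg_r (1 - x)); first lra.
have : (0 <= x ^ 2 * (1 - 2 * x))%R by apply: Rmult_le_pos; lra.
nra.
Qed.

Lemma sin_abs_le (y : R) : (Rabs (sin y) <= Rabs y)%R.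
Proof.
have [||c [_ Hc]] := MVT_gen sin 0 y cos.
- by move=> z _; auto_derive => //; ring.
- by move=> z _; apply: continuity_sin.
move: Hc; rewrite sin_0 !Rminus_0_r => ->; rewrite Rabs_mult.
have := COS_bound c => -[? ?]; have : (Rabs (cos c) <= 1)%R by apply/Rabs_le; lra.
by have := Rabs_pos y; nra.
Qed.

Lemma cos_quad (y : R) : (Rabs (cos y - 1) <= y ^ 2 / 2)%R.
Proof.
have -> : (cos y = 1 - 2 * sin (y / 2) ^ 2)%R.
  by rewrite {1}(_ : y = 2 * (y / 2))%R ?cos_2a_sin /=; [ring|field].
have H := sin_abs_le (y / 2).
have H1 : (sin (y / 2) ^ 2 <= (y / 2) ^ 2)%R.
  rewrite -(pow2_abs (sin _)) -(pow2_abs (y / 2)); apply: pow_incr; split=> //; exact: Rabs_pos.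
rewrite Rabs_left1; nra.
Qed.

Lemma sin_quad (y : R) : (Rabs (sin y - y) <= Rabs y ^ 3 / 2)%R.
Proof.
have [||c [Hc1 Hc]] := MVT_gen (fun y => sin y - y)%R 0 y (fun y => cos y - 1)%R.
- by move=> z _; auto_derive => //; ring.
- by move=> z _; apply: derivable_continuous_pt; apply/ex_derive_Reals_0; auto_derive.
move: Hc; rewrite sin_0 !Rminus_0_r => ->; rewrite Rabs_mult.
have H := cos_quad c.
have Hcy : (c ^ 2 <= Rabs y ^ 2)%R.
  rewrite -(pow2_abs c); apply: pow_incr; split; first exact: Rabs_pos.
  move: Hc1; rewrite /Rmin /Rmax; case: Rle_dec => ?; move=> [? ?]; rewrite /Rabs; do 2 case: Rcase_abs => ?; lra.
have := Rabs_pos y; nra.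
Qed.

Lemma Cexp_quad (h : C) : (Cmod h <= 1 / 2)%R -> (Cmod (Cexp h - 1 - h) <= 4 * Cmod h ^ 2)%R.
Proof.
move=> Hh; have Hx := Rle_trans _ _ _ (re_le_Cmod h) Hh; have Hy := Rle_trans _ _ _ (im_le_Cmod h) Hh.
rewrite Cmod_sqr; apply: Rle_trans (Cmod_le_abs _) _.
case: h Hx Hy {Hh} => x y Hx Hy; rewrite [Re (x, y)]/= in Hx *; rewrite [Im (x, y)]/= in Hy *.
have E1 := exp_quad _ Hx.
have E2 := cos_quad y; have E3 := sin_quad y; have E4 := sin_abs_le y.
have E5 : (Rabs (cos y) <= 1)%R by apply/Rabs_le; have := COS_bound y; lra.
have -> : (Re (Cexp (x, y) - 1 - (x, y)) = (exp x - 1 - x) * cos y + (1 + x) * (cos y - 1))%R.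
  by rewrite /Cexp /=; ring.
have -> : (Im (Cexp (x, y) - 1 - (x, y)) = (exp x - 1 - x) * sin y + x * sin y + (sin y - y))%R.
  by rewrite /Cexp /=; ring.
have Hp : (0 <= Rabs x)%R := Rabs_pos x; have Hq : (0 <= Rabs y)%R := Rabs_pos y.
have X2 : (x ^ 2 = Rabs x ^ 2)%R by rewrite pow2_abs.
have Y2 : (y ^ 2 = Rabs y ^ 2)%R by rewrite pow2_abs.
have H1x : (Rabs (1 + x) <= 3 / 2)%R by move/Rabs_le_between: Hx => ?; apply/Rabs_le; lra.
have B1 : (Rabs ((exp x - 1 - x) * cos y + (1 + x) * (cos y - 1)) <= 2 * x ^ 2 * 1 + 3 / 2 * (y ^ 2 / 2))%R.
  apply: Rle_trans (Rabs_triang _ _) _; rewrite !Rabs_mult.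
  by apply: Rplus_le_compat; apply: Rmult_le_compat => //; exact: Rabs_pos.
have B2 : (Rabs ((exp x - 1 - x) * sin y + x * sin y + (sin y - y))
   <= 2 * x ^ 2 * Rabs y + Rabs x * Rabs y + Rabs y ^ 3 / 2)%R.
  apply: Rle_trans (Rabs_triang _ _) _; apply: Rplus_le_compat => //.
  apply: Rle_trans (Rabs_triang _ _) _; rewrite !Rabs_mult.
  by apply: Rplus_le_compat; apply: Rmult_le_compat => //; try exact: Rabs_pos; exact: Rle_refl.
move: B1 B2; rewrite X2 Y2 /= !Rmult_1_r.
move: (Rabs x) (Rabs y) Hx Hy Hp Hq => p q Hx Hy Hp Hq {}B1 B2.
have : (p * p * q <= p * p * (1 / 2))%R by apply: Rmult_le_compat_l => //; nra.
have : (q * q * q <= q * q * (1 / 2))%R by apply: Rmult_le_compat_l => //; nra.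
have := Rle_0_sqr (p - q); rewrite /Rsqr.
nra.
Qed.

Lemma Cmod_Ci : Cmod Ci = 1%R.
Proof. by rewrite /Cmod /= !Rmult_0_l Rplus_0_l !Rmult_1_r sqrt_1. Qed.

Lemma Cmod_sub_le (a b : C) : (Cmod (a - b) <= Cmod a + Cmod b)%R.
Proof. by rewrite -(Cmod_opp b); exact: Cmod_triangle. Qed.

Lemma Cmod_sub_ge (a b : C) : (Cmod a - Cmod b <= Cmod (a - b))%R.
Proof.
have := Cmod_triangle (a - b) b; rewrite (_ : a - b + b = a); last by ring.
lra.
Qed.

Lemma Cmod_subC (a b : C) : Cmod (a - b) = Cmod (b - a).
Proof. by rewrite -Cmod_opp; congr Cmod; ring. Qed.

Lemma Csin_quad (h : C) : (Cmod h <= 1 / 2)%R -> (Cmod (Csin h - h) <= 4 * Cmod h ^ 2)%R.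
Proof.
move=> Hh; have E : Csin h - h = ((Cexp (Ci * h) - 1 - Ci * h) - (Cexp (- (Ci * h)) - 1 - - (Ci * h))) / (2 * Ci).
  by rewrite /Csin; cfield.
have H1 : Cmod (Ci * h) = Cmod h by rewrite Cmod_mult Cmod_Ci Rmult_1_l.
have H2 : Cmod (- (Ci * h)) = Cmod h by rewrite Cmod_opp.
have A1 := Cexp_quad (Ci * h); have A2 := Cexp_quad (- (Ci * h)).
rewrite H1 in A1; rewrite H2 in A2.
have nz : 2 * Ci <> 0 by apply: Cmult_neq_0; [exact: C2_neq0|exact: Ci_neq0].
rewrite E Cmod_div // Cmod_mult Cmod_Ci Cmod_R Rabs_pos_eq ?Rmult_1_r; try lra.
have := Cmod_sub_le (Cexp (Ci * h) - 1 - Ci * h) (Cexp (- (Ci * h)) - 1 - - (Ci * h)).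
have := A1 Hh; have := A2 Hh; lra.
Qed.

Lemma Ccos_quad (h : C) : (Cmod h <= 1 / 2)%R -> (Cmod (Ccos h - 1) <= 4 * Cmod h ^ 2)%R.
Proof.
move=> Hh; have E : Ccos h - 1 = ((Cexp (Ci * h) - 1 - Ci * h) + (Cexp (- (Ci * h)) - 1 - - (Ci * h))) / 2.
  by rewrite /Ccos; cfield.
have H1 : Cmod (Ci * h) = Cmod h by rewrite Cmod_mult Cmod_Ci Rmult_1_l.
have H2 : Cmod (- (Ci * h)) = Cmod h by rewrite Cmod_opp.
have A1 := Cexp_quad (Ci * h); have A2 := Cexp_quad (- (Ci * h)).
rewrite H1 in A1; rewrite H2 in A2.
rewrite E Cmod_div; last exact: C2_neq0.
rewrite Cmod_R Rabs_pos_eq; try lra.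
have := Cmod_triangle (Cexp (Ci * h) - 1 - Ci * h) (Cexp (- (Ci * h)) - 1 - - (Ci * h)).
have := A1 Hh; have := A2 Hh; lra.
Qed.

(** What is needed for small increments: cos h stays away from 0, sin h is comparable with h, and h
    cos h - sin h is of second order, which bounds cot h - 1/h. *)
Lemma small_trig (h : C) : (Cmod h <= 1 / 8)%R ->
  [/\ (1 / 2 <= Cmod (Ccos h))%R, (Cmod (Csin h) <= 2 * Cmod h)%R,
      (Cmod h / 2 <= Cmod (Csin h))%R
    & (Cmod (h * Ccos h - Csin h) <= 5 * Cmod h ^ 2)%R].
Proof.
move=> Hh; have H0 := Cmod_ge_0 h.
have A1 := Csin_quad h ltac:(lra); have A2 := Ccos_quad h ltac:(lra).
have T1 := Cmod_triangle (Csin h - h) h.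
have T2 := Cmod_triangle (1 - Ccos h) (Ccos h).
have T3 := Cmod_triangle (h - Csin h) (Csin h).
have T4 := Cmod_triangle (h * (Ccos h - 1)) (h - Csin h).
rewrite (_ : Csin h - h + h = Csin h) in T1; last by ring.
rewrite (_ : 1 - Ccos h + Ccos h = 1) in T2; last by ring.
rewrite (_ : h - Csin h + Csin h = h) in T3; last by ring.
rewrite (_ : h * (Ccos h - 1) + (h - Csin h) = h * Ccos h - Csin h) in T4; last by ring.
rewrite (Cmod_subC h) in T3 T4; rewrite (Cmod_subC 1) in T2; rewrite Cmod_1 in T2.
rewrite Cmod_mult in T4.
have Hs : (Cmod h ^ 2 <= Cmod h / 8)%R by nra.
by split; nra.
Qed.

(** * Estimates for the cotangent and a quantitative notion of differentiability *)

Lemma cot_bound (d : R) (w : C) : (0 < d)%R -> away d w -> (Cmod (Ccot w) <= 1 + 3 / d)%R.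
Proof.
move=> Hd Hw; have Hs := Csin_lower d w ltac:(lra) Hw.
have nz : Csin w <> 0 by exact: away_Csin Hw.
have Hc : (Cmod (Ccos w) ^ 2 <= 1 + Cmod (Csin w) ^ 2)%R.
  rewrite Cmod_Ccos Cmod_Csin; have := sin2_cos2 (Re w); rewrite /Rsqr; nra.
have S0 := Cmod_gt_0 (Csin w); have Sp : (0 < Cmod (Csin w))%R by apply/S0.
rewrite /Ccot Cmod_div //.
set s := Cmod (Csin w) in Hs Hc Sp *; set c := Cmod (Ccos w) in Hc *.
have c0 : (0 <= c)%R by exact: Cmod_ge_0.
have Hds : (d / 3 <= s)%R by apply: Rnot_lt_le => H; nra.
have H1 : (c <= 1 + s)%R by nra.
apply: (Rmult_le_reg_r s) => //.
rewrite (_ : (c / s * s = c)%R); last by field; lra.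
have : (1 <= 3 / d * s)%R.
  by rewrite (_ : (1 = 3 / d * (d / 3))%R); [apply: Rmult_le_compat_l => //; apply/Rlt_le/Rdiv_lt_0_compat; lra|field; lra].
nra.
Qed.

(** The addition formula with denominators cleared. Dividing by cos h, bounded below for small h,
    gives two-point estimates without a path from x to x + h, which could leave the region
    [away d]. *)
Lemma cot_diff (x h : C) : Csin x <> 0 -> Csin (x + h) <> 0 ->
  (Ccot x - Ccot (x + h)) * Ccos h = (1 + Ccot x * Ccot (x + h)) * Csin h.
Proof.
move=> H1 H2; have E : Csin h = Csin (x + h) * Ccos x - Ccos (x + h) * Csin x.
  by rewrite -Csin_sub; congr Csin; ring.
have F : Ccos h = Ccos (x + h) * Ccos x + Csin (x + h) * Csin x.
  have := Ccos_add (x + h) (- x); rewrite Ccos_opp Csin_opp (_ : x + h + - x = h); last by ring.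
  by move=> ->; ring.
by rewrite /Ccot E F; field.
Qed.

Lemma cot_lip (d : R) (x y : C) : (0 < d)%R -> away d x -> away d y ->
  (Cmod (Ccot y - Ccot x) <= 16 * (1 + 3 / d) ^ 2 * Cmod (y - x))%R.
Proof.
move=> Hd Hx Hy; have B1 := cot_bound _ _ Hd Hx; have B2 := cot_bound _ _ Hd Hy.
have E : y = x + (y - x) by ring.
have Hd3 : (0 < 3 / d)%R by apply: Rdiv_lt_0_compat; lra.
set B := (1 + 3 / d)%R in B1 B2 *; have HB : (1 <= B)%R by rewrite /B; lra.
have HB2 : (B <= B ^ 2)%R by nra.
move: (y - x) E => h E.
have h0 := Cmod_ge_0 h.
(* Beyond distance 1/8 the supremum bound of cot suffices; below it [cot_diff] is used. *)
case: (Rle_lt_dec (Cmod h) (1 / 8)) => Hh; last first.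
  have := Cmod_sub_le (Ccot y) (Ccot x).
  have : (B ^ 2 * (1 / 8) <= B ^ 2 * Cmod h)%R by apply: Rmult_le_compat_l; [nra|lra].
  nra.
have [C1 C2 C3 C4] := small_trig _ Hh.
have := cot_diff x h (away_Csin _ _ Hd Hx); rewrite -E => /(_ (away_Csin _ _ Hd Hy)) D.
rewrite Cmod_subC; move/(f_equal Cmod): D; rewrite (Cmod_mult (_ - _)) (Cmod_mult (1 + _)) => D.
have T : (Cmod (1 + Ccot x * Ccot y) <= 1 + B * B)%R.
  apply: Rle_trans (Cmod_triangle _ _) _; rewrite Cmod_1 Cmod_mult; apply: Rplus_le_compat_l.
  by apply: Rmult_le_compat => //; exact: Cmod_ge_0.
have T2 : (Cmod (1 + Ccot x * Ccot y) * Cmod (Csin h) <= (1 + B * B) * (2 * Cmod h))%R.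
  by apply: Rmult_le_compat => //; exact: Cmod_ge_0.
have T3 : (Cmod (Ccot x - Ccot y) * (1 / 2) <= Cmod (Ccot x - Ccot y) * Cmod (Ccos h))%R.
  by apply: Rmult_le_compat_l => //; exact: Cmod_ge_0.
have : ((1 + B * B) * Cmod h <= 2 * B ^ 2 * Cmod h)%R by apply: Rmult_le_compat_r => //; nra.
have : (0 <= B ^ 2 * Cmod h)%R by apply: Rmult_le_pos => //; nra.
rewrite D in T3; move: T2 T3; move: (Cmod _) (Cmod _) (Cmod _) => p q r; lra.
Qed.

(* Uniform C^{1,1} regularity: [O] need be neither open nor convex. *)
Definition SD (O : C -> Prop) (g g' : C -> C) : Prop :=
  exists B : R, (0 <= B)%R /\
  (forall x, O x -> (Cmod (g x) <= B)%R /\ (Cmod (g' x) <= B)%R) /\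
  forall x y, O x -> O y ->
    [/\ (Cmod (g y - g x) <= B * Cmod (y - x))%R,
        (Cmod (g' y - g' x) <= B * Cmod (y - x))%R
      & (Cmod (g y - g x - (y - x) * g' x) <= B * Cmod (y - x) ^ 2)%R].

Lemma SD_sub (O O' : C -> Prop) g g' : (forall x, O' x -> O x) -> SD O g g' -> SD O' g g'.
Proof.
move=> H [B [B0 [B1 B2]]]; exists B; split=> //; split=> [x /H /B1 //|x y /H Hx /H Hy].
exact: B2.
Qed.

Lemma SD_ext (O : C -> Prop) f f' g g' : (forall x, O x -> f x = g x) ->
  (forall x, O x -> f' x = g' x) -> SD O f f' -> SD O g g'.
Proof.
move=> H H' [B [B0 [B1 B2]]]; exists B; split=> //; split=> [x Hx|x y Hx Hy].
  by rewrite -H // -H' //; apply: B1.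
by rewrite -!H // -!H' //; apply: B2.
Qed.

Lemma SD_const (O : C -> Prop) (c : C) : SD O (fun=> c) (fun=> 0).
Proof.
exists (Cmod c); have := Cmod_ge_0 c; split=> //; split=> [x _|x y _ _].
  by rewrite Cmod_0; split=> //; apply: Rle_refl.
have P : (0 <= Cmod c * Cmod (y - x))%R by apply: Rmult_le_pos => //; exact: Cmod_ge_0.
have P2 : (0 <= Cmod c * Cmod (y - x) ^ 2)%R by apply: Rmult_le_pos => //; exact: pow2_ge_0.
have E1 : c - c = 0 by ring.
have E2 : RtoC 0 - 0 = 0 by ring.
have E3 : c - c - (y - x) * 0 = 0 by ring.
by split; rewrite ?E3 ?E1 ?E2 Cmod_0.
Qed.

Lemma SD_id (O : C -> Prop) (b : R) : (forall x, O x -> (Cmod x <= b)%R) -> SD O id (fun=> 1).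
Proof.
move=> Hb; exists (Rmax b 1); have M1 := Rmax_l b 1; have M2 := Rmax_r b 1.
split; first lra; split=> [x /Hb Hx|x y _ _]; first by rewrite Cmod_1; split=> /=; lra.
have h0 := Cmod_ge_0 (y - x).
have P : (0 <= Rmax b 1 * Cmod (y - x))%R by apply: Rmult_le_pos; lra.
have P2 : (0 <= Rmax b 1 * Cmod (y - x) ^ 2)%R by apply: Rmult_le_pos; [lra|exact: pow2_ge_0].
have E2 : RtoC 1 - 1 = 0 by ring.
have E3 : y - x - (y - x) * 1 = 0 by ring.
split; rewrite /id ?E3 ?E2 ?Cmod_0 //.
by rewrite -[X in (X <= _)%R]Rmult_1_l; apply: Rmult_le_compat_r.
Qed.

Lemma SD_plus (O : C -> Prop) f f' g g' : SD O f f' -> SD O g g' ->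
  SD O (fun x => f x + g x) (fun x => f' x + g' x).
Proof.
move=> [A [A0 [A1 A2]]] [B [B0 [B1 B2]]]; exists (A + B)%R; split; first lra.
split=> [x Hx|x y Hx Hy].
  have [? ?] := A1 _ Hx; have [? ?] := B1 _ Hx.
  have := Cmod_triangle (f x) (g x); have := Cmod_triangle (f' x) (g' x).
  by split; lra.
have [? ? ?] := A2 _ _ Hx Hy; have [? ? ?] := B2 _ _ Hx Hy.
split; rewrite Rmult_plus_distr_r.
- rewrite (_ : _ - _ = (f y - f x) + (g y - g x)); last by ring.
  by apply: Rle_trans (Cmod_triangle _ _) _; lra.
- rewrite (_ : _ - _ = (f' y - f' x) + (g' y - g' x)); last by ring.
  by apply: Rle_trans (Cmod_triangle _ _) _; lra.
- rewrite (_ : _ - _ = (f y - f x - (y - x) * f' x) + (g y - g x - (y - x) * g' x)); last by ring.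
  by apply: Rle_trans (Cmod_triangle _ _) _; lra.
Qed.

Lemma Cmod_mult_le (a b : C) (p q : R) : (Cmod a <= p)%R -> (Cmod b <= q)%R ->
  (Cmod (a * b) <= p * q)%R.
Proof. by move=> H1 H2; rewrite Cmod_mult; apply: Rmult_le_compat => //; exact: Cmod_ge_0. Qed.

Lemma Cmod_plus_le (a b : C) (p q : R) : (Cmod a <= p)%R -> (Cmod b <= q)%R ->
  (Cmod (a + b) <= p + q)%R.
Proof. by move=> H1 H2; apply: Rle_trans (Cmod_triangle _ _) _; lra. Qed.

Lemma SD_mult (O : C -> Prop) f f' g g' : SD O f f' -> SD O g g' ->
  SD O (fun x => f x * g x) (fun x => f' x * g x + f x * g' x).
Proof.
move=> [A [A0 [A1 A2]]] [B [B0 [B1 B2]]]; exists (4 * (A * B))%R.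
have AB0 : (0 <= A * B)%R by nra.
split; first nra.
split=> [x Hx|x y Hx Hy].
  have [F G] := A1 _ Hx; have [F' G'] := B1 _ Hx.
  split; first by have := Cmod_mult_le _ _ _ _ F F'; nra.
  have := Cmod_plus_le _ _ _ _ (Cmod_mult_le _ _ _ _ G F') (Cmod_mult_le _ _ _ _ F G'); nra.
have [F1 F2 F3] := A2 _ _ Hx Hy; have [G1 G2 G3] := B2 _ _ Hx Hy.
have [fx f'x] := A1 _ Hx; have [gx g'x] := B1 _ Hx.
have [fy f'y] := A1 _ Hy; have [gy g'y] := B1 _ Hy.
have h0 := Cmod_ge_0 (y - x).
set h := Cmod (y - x) in F1 F2 F3 G1 G2 G3 h0 *.
have hAB : (0 <= A * B * h)%R by nra.
split.
- rewrite (_ : _ - _ = (f y - f x) * g y + f x * (g y - g x)); last by ring.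
  have := Cmod_plus_le _ _ _ _ (Cmod_mult_le _ _ _ _ F1 gy) (Cmod_mult_le _ _ _ _ fx G1); nra.
- rewrite (_ : _ - _ = ((f' y - f' x) * g y + f' x * (g y - g x))
     + ((f y - f x) * g' y + f x * (g' y - g' x))); last by ring.
  have := Cmod_plus_le _ _ _ _
    (Cmod_plus_le _ _ _ _ (Cmod_mult_le _ _ _ _ F2 gy) (Cmod_mult_le _ _ _ _ f'x G1))
    (Cmod_plus_le _ _ _ _ (Cmod_mult_le _ _ _ _ F1 g'y) (Cmod_mult_le _ _ _ _ fx G2)); nra.
- rewrite (_ : _ - _ = ((f y - f x - (y - x) * f' x) * g x + f x * (g y - g x - (y - x) * g' x))
     + (f y - f x) * (g y - g x)); last by ring.
  have := Cmod_plus_le _ _ _ _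
    (Cmod_plus_le _ _ _ _ (Cmod_mult_le _ _ _ _ F3 gx) (Cmod_mult_le _ _ _ _ fx G3))
    (Cmod_mult_le _ _ _ _ F1 G1); nra.
Qed.

Lemma SD_scal (O : C -> Prop) (c : C) f f' : SD O f f' ->
  SD O (fun x => c * f x) (fun x => c * f' x).
Proof.
move=> H; apply: SD_ext (SD_mult _ _ _ _ _ (SD_const O c) H) => x _ //.
by ring.
Qed.

Lemma SD_affine (O O' : C -> Prop) (a b : C) f f' : (forall x, O' x -> O (a * x + b)) ->
  SD O f f' -> SD O' (fun x => f (a * x + b)) (fun x => a * f' (a * x + b)).
Proof.
move=> HO [A [A0 [A1 A2]]]; set m := Cmod a; have m0 : (0 <= m)%R := Cmod_ge_0 a.
exists (A * (1 + m) ^ 2)%R; have K1 : (1 <= (1 + m) ^ 2)%R by nra.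
have K2 : (m <= (1 + m) ^ 2)%R by nra.
have K3 : (m ^ 2 <= (1 + m) ^ 2)%R by nra.
split; first nra.
split=> [x /HO Hx|x y /HO Hx /HO Hy].
  have [F G] := A1 _ Hx; rewrite Cmod_mult -/m; split; first nra.
  have : (m * Cmod (f' (a * x + b)%C) <= m * A)%R by apply: Rmult_le_compat_l.
  nra.
have [F1 F2 F3] := A2 _ _ Hx Hy.
have E : a * y + b - (a * x + b) = a * (y - x) by ring.
have h0 := Cmod_ge_0 (y - x).
rewrite E Cmod_mult -/m in F1 F2; rewrite E [X in (_ <= X)%R]Rmult_comm Cmod_mult -/m in F3.
split.
- apply: Rle_trans F1 _; rewrite -Rmult_assoc; apply: Rmult_le_compat_r => //; nra.
- rewrite (_ : _ - _ = a * (f' (a * y + b) - f' (a * x + b))); last by ring.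
  rewrite Cmod_mult -/m.
  have : (m * Cmod (f' (a * y + b)%C - f' (a * x + b)%C) <= m * (A * (m * Cmod (y - x))))%R.
    by apply: Rmult_le_compat_l.
  have : (0 <= A * Cmod (y - x))%R by nra.
  nra.
- rewrite (_ : _ - _ = f (a * y + b) - f (a * x + b) - a * (y - x) * f' (a * x + b)); last by ring.
  apply: Rle_trans F3 _; rewrite Rpow_mult_distr.
  have : (0 <= A * Cmod (y - x) ^ 2)%R by apply: Rmult_le_pos => //; nra.
  nra.
Qed.

(** The derivative of cot is a polynomial in cot, so its Lipschitz bound follows from that of cot;
    only the quadratic remainder needs [cot_diff] again. *)
Lemma SD_cot (d : R) : (0 < d)%R -> SD (away d) Ccot (fun w => - (1 + Ccot w * Ccot w)).
Proof.
move=> Hd; have Hd3 : (0 < 3 / d)%R by apply: Rdiv_lt_0_compat; lra.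
set B := (1 + 3 / d)%R; have HB : (1 <= B)%R by rewrite /B; lra.
have HB2 : (B <= B ^ 2)%R by nra.
have HB3 : (B ^ 2 <= B ^ 3)%R by rewrite /=; nra.
exists (200 * B ^ 3)%R; split; first lra; split=> [x Hx|x y Hx Hy].
  have H := cot_bound _ _ Hd Hx; rewrite -/B in H; split; first lra.
  rewrite Cmod_opp; apply: Rle_trans (Cmod_triangle _ _) _; rewrite Cmod_1.
  have := Cmod_mult_le _ _ _ _ H H; nra.
have Bx := cot_bound _ _ Hd Hx; have By := cot_bound _ _ Hd Hy; rewrite -/B in Bx By.
have L := cot_lip _ _ _ Hd Hx Hy; rewrite -/B in L.
have h0 := Cmod_ge_0 (y - x).
split.
- apply: Rle_trans L _; apply: Rmult_le_compat_r => //; nra.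
- rewrite (_ : _ - _ = (Ccot y - Ccot x) * (- (Ccot y + Ccot x))); last by ring.
  have S : (Cmod (- (Ccot y + Ccot x)) <= B + B)%R by rewrite Cmod_opp; apply: Cmod_plus_le.
  apply: Rle_trans (Cmod_mult_le _ _ _ _ L S) _.
  rewrite (_ : (16 * B ^ 2 * Cmod (y - x) * (B + B) = 32 * B ^ 3 * Cmod (y - x))%R); last by ring.
  by apply: Rmult_le_compat_r => //; nra.
have E : y = x + (y - x) by ring.
have D := cot_diff x (y - x) (away_Csin _ _ Hd Hx); rewrite -E in D.
have {}D := D (away_Csin _ _ Hd Hy).
move: (y - x) E h0 L D => h E h0 L D.
case: (Rle_lt_dec (Cmod h) (1 / 8)) => Hh; last first.
  rewrite (_ : _ - _ = (Ccot y - Ccot x) + h * (1 + Ccot x * Ccot x)); last by ring.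
  have Q : (Cmod (1 + Ccot x * Ccot x) <= 1 + B * B)%R.
    by apply: Cmod_plus_le; [rewrite Cmod_1; lra|exact: Cmod_mult_le].
  apply: Rle_trans (Cmod_plus_le _ _ _ _ L (Cmod_mult_le _ _ _ _ (Rle_refl (Cmod h)) Q)) _.
  have : (16 * B ^ 2 + (1 + B * B) <= 18 * B ^ 3)%R by nra.
  have : (18 * B ^ 3 * Cmod h <= 18 * B ^ 3 * (8 * Cmod h ^ 2))%R.
    by apply: Rmult_le_compat_l; nra.
  have : (0 <= B ^ 3 * Cmod h ^ 2)%R by apply: Rmult_le_pos; nra.
  nra.
have [C1 C2 C3 C4] := small_trig _ Hh.
(* The Taylor remainder times cos h is a combination of h cos h - sin h and of (cot y - cot x) sin
   h, both of second order in h. *)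
set X := (_ - _ - _).
have EX : X * Ccos h = (1 + Ccot x * Ccot x) * (h * Ccos h - Csin h)
    - Ccot x * (Ccot y - Ccot x) * Csin h.
  rewrite (_ : X * Ccos h = - ((Ccot x - Ccot y) * Ccos h) + h * (1 + Ccot x * Ccot x) * Ccos h);
    last by rewrite /X; ring.
  by rewrite D; ring.
have Q : (Cmod (1 + Ccot x * Ccot x) <= 1 + B * B)%R.
  by apply: Cmod_plus_le; [rewrite Cmod_1; lra|exact: Cmod_mult_le].
have U := Cmod_plus_le _ _ _ _ (Cmod_mult_le _ _ _ _ Q C4)
  (Rle_trans _ _ _ (Req_le _ _ (Cmod_opp _)) (Cmod_mult_le _ _ _ _ (Cmod_mult_le _ _ _ _ Bx L) C2)).
have {}U : (Cmod (X * Ccos h) <= (1 + B * B) * (5 * Cmod h ^ 2)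
    + B * (16 * B ^ 2 * Cmod h) * (2 * Cmod h))%R by rewrite EX; exact: U.
rewrite Cmod_mult in U.
have V : (Cmod X * (1 / 2) <= Cmod X * Cmod (Ccos h))%R.
  by apply: Rmult_le_compat_l => //; exact: Cmod_ge_0.
have W : ((1 + B * B) * (5 * Cmod h ^ 2) + B * (16 * B ^ 2 * Cmod h) * (2 * Cmod h)
   <= 42 * B ^ 3 * Cmod h ^ 2)%R.
  have : (0 <= Cmod h ^ 2)%R by nra.
  have : (1 + B * B <= 2 * B ^ 3)%R by nra.
  nra.
have : (0 <= B ^ 3 * Cmod h ^ 2)%R by apply: Rmult_le_pos; nra.
nra.
Qed.

(** * Derivatives and integrals of complex functions of a real variable *)

Lemma Cmult_eq0_r (a b : C) : a <> 0 -> a * b = 0 -> b = 0.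
Proof. by move=> Ha H; rewrite -[LHS]Cmult_1_l -(Cinv_l a) // -Cmult_assoc H Cmult_0_r. Qed.

(** Taken by components, so that the calculus of real functions applies directly; [cder_is_derive]
    and [is_derive_cder] show the equivalence with the derivative in the real normed space C. *)
Definition cder (f : R -> C) (t : R) (l : C) : Prop :=
  is_derive (fun s => Re (f s)) t (Re l) /\ is_derive (fun s => Im (f s)) t (Im l).

Lemma cder_ext f g t l : (forall s, f s = g s) -> cder f t l -> cder g t l.
Proof.
by move=> E [H1 H2]; split; [apply: is_derive_ext H1|apply: is_derive_ext H2] => s; rewrite E.
Qed.

Lemma cder_eq f t l l' : l = l' -> cder f t l -> cder f t l'.
Proof. by move=> ->. Qed.

Lemma cder_const (c : C) t : cder (fun=> c) t 0.
Proof. by split; exact: is_derive_const. Qed.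

Lemma cder_RtoC (f : R -> R) t l : is_derive f t l -> cder (fun s => RtoC (f s)) t (RtoC l).
Proof. by move=> H; split=> //; exact: is_derive_const. Qed.

Lemma cder_plus f g t l m : cder f t l -> cder g t m -> cder (fun s => f s + g s) t (l + m).
Proof. by move=> [A B] [P Q]; split; [exact: is_derive_plus A P|exact: is_derive_plus B Q]. Qed.

Lemma cder_opp f t l : cder f t l -> cder (fun s => - f s) t (- l).
Proof. by move=> [A B]; split; [exact: is_derive_opp A|exact: is_derive_opp B]. Qed.

Lemma cder_minus f g t l m : cder f t l -> cder g t m -> cder (fun s => f s - g s) t (l - m).
Proof. by move=> H1 H2; apply: cder_plus => //; exact: cder_opp. Qed.

Lemma is_derive_eq (f : R -> R) (t l l' : R) : l = l' -> is_derive f t l -> is_derive f t l'.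
Proof. by move=> ->. Qed.

Lemma is_derive_Rmult (f g : R -> R) (t l m : R) : is_derive f t l -> is_derive g t m ->
  is_derive (fun s => f s * g s)%R t (l * g t + f t * m)%R.
Proof. by move=> A B; exact: is_derive_mult A B Rmult_comm. Qed.

Lemma is_derive_Rplus (f g : R -> R) (t l m : R) : is_derive f t l -> is_derive g t m ->
  is_derive (fun s => f s + g s)%R t (l + m)%R.
Proof. by move=> A B; exact: is_derive_plus A B. Qed.

Lemma is_derive_Rminus (f g : R -> R) (t l m : R) : is_derive f t l -> is_derive g t m ->
  is_derive (fun s => f s - g s)%R t (l - m)%R.
Proof. by move=> A B; exact: is_derive_minus A B. Qed.

Lemma cder_mult f g t l m : cder f t l -> cder g t m ->
  cder (fun s => f s * g s) t (l * g t + f t * m).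
Proof.
move=> [A B] [P Q]; split.
  apply: is_derive_eq (is_derive_Rminus _ _ _ _ _ (is_derive_Rmult _ _ _ _ _ A P) (is_derive_Rmult _ _ _ _ _ B Q)).
  by rewrite Re_plus !Re_mult; ring.
apply: is_derive_eq (is_derive_Rplus _ _ _ _ _ (is_derive_Rmult _ _ _ _ _ A Q) (is_derive_Rmult _ _ _ _ _ B P)).
by rewrite Im_plus !Im_mult; ring.
Qed.

Lemma cder_scal (c : C) f t l : cder f t l -> cder (fun s => c * f s) t (c * l).
Proof. move=> H; apply: cder_eq (cder_mult _ _ _ _ _ (cder_const c t) H); ring. Qed.

Lemma rder_epsP (f : R -> R) (t l : R) : is_derive f t l <->
  forall eps : R, (0 < eps)%R -> exists d : R, (0 < d)%R /\ forall s, (Rabs (s - t) < d)%R ->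
   (Rabs (f s - f t - (s - t) * l) <= eps * Rabs (s - t))%R.
Proof.
rewrite is_derive_Reals; split=> [H eps Heps|H eps Heps].
  have [d Hd] := H eps Heps; exists d; split; first exact: cond_pos.
  move=> s Hs; case: (Req_dec s t) => [->|Hst].
    by rewrite !Rminus_eq_0 Rmult_0_l Rminus_0_r Rabs_R0; lra.
  have := Hd (s - t)%R ltac:(lra) Hs; rewrite (_ : t + (s - t) = s)%R; last by ring.
  move=> /Rlt_le H1.
  rewrite (_ : f s - f t - (s - t) * l = ((f s - f t) / (s - t) - l) * (s - t))%R; last by field; lra.
  by rewrite Rabs_mult; apply: Rmult_le_compat_r => //; exact: Rabs_pos.
have [d [d0 Hd]] := H (eps / 2)%R ltac:(lra).
exists (mkposreal d d0) => h h0 Hh.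
have := Hd (t + h)%R; rewrite (_ : t + h - t = h)%R; last by ring.
move=> /(_ Hh) H1.
rewrite (_ : (f (t + h) - f t) / h - l = (f (t + h) - f t - h * l) / h)%R; last by field.
have hp : (0 < Rabs h)%R by exact: Rabs_pos_lt.
rewrite Rabs_div //; apply: (Rmult_lt_reg_r (Rabs h)) => //.
rewrite (_ : (Rabs (f (t + h) - f t - h * l) / Rabs h * Rabs h = Rabs (f (t + h) - f t - h * l))%R);
  last by field; lra.
by nra.
Qed.

Lemma cder_epsP (f : R -> C) (t : R) (l : C) : cder f t l <->
  forall eps : R, (0 < eps)%R -> exists d : R, (0 < d)%R /\ forall s, (Rabs (s - t) < d)%R ->
   (Cmod (f s - f t - RtoC (s - t) * l) <= eps * Rabs (s - t))%R.
Proof.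
rewrite /cder !rder_epsP; split=> [[A B] eps Heps|H].
  have [d1 [d10 H1]] := A (eps / 2)%R ltac:(lra); have [d2 [d20 H2]] := B (eps / 2)%R ltac:(lra).
  exists (Rmin d1 d2); split; first by apply: Rmin_pos.
  move=> s Hs; apply: Rle_trans (Cmod_le_abs _) _.
  have := H1 s (Rlt_le_trans _ _ _ Hs (Rmin_l _ _)).
  have := H2 s (Rlt_le_trans _ _ _ Hs (Rmin_r _ _)).
  rewrite !Re_minus !Im_minus Re_mult Im_mult [Re (RtoC _)]/= [Im (RtoC _)]/=.
  rewrite !Rmult_0_l Rminus_0_r Rplus_0_r; lra.
split=> eps Heps; have [d [d0 Hd]] := H _ Heps; exists d; split=> // s Hs; apply: Rle_trans (Hd s Hs).
  apply: Rle_trans (re_le_Cmod _); apply: Req_le; congr Rabs.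
  by rewrite !Re_minus Re_mult [Re (RtoC _)]/= [Im (RtoC _)]/=; ring.
apply: Rle_trans (im_le_Cmod _); apply: Req_le; congr Rabs.
by rewrite !Im_minus Im_mult [Re (RtoC _)]/= [Im (RtoC _)]/=; ring.
Qed.

Lemma cder_is_derive (f : R -> C) (t : R) (l : C) : cder f t l ->
  is_derive (V := C_R_NormedModule) f t l.
Proof.
move=> /cder_epsP H; split; first exact: is_linear_scal_l.
move=> x /is_filter_lim_locally_unique <- eps.
have [d [d0 Hd]] := H _ (cond_pos eps); exists (mkposreal d d0) => s Hs.
have := Hd s Hs; rewrite -!Cmod_norm; apply: Rle_trans; apply: Req_le; congr Cmod.
apply: Ceq; rewrite ?Re_minus ?Im_minus ?Re_mult ?Im_mult /= /minus /plus /opp /scal /= /mult /=; rewrite /Re /Im; ring.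
Qed.

Lemma is_derive_cder (f : R -> C) (t : R) (l : C) :
  is_derive (V := C_R_NormedModule) f t l -> cder f t l.
Proof.
move=> [_ H]; apply/cder_epsP => eps Heps.
have [d Hd] := H t (fun P HP => HP) (mkposreal eps Heps).
exists d; split; first exact: cond_pos.
move=> s Hs; have := Hd s Hs; rewrite -!Cmod_norm; apply: Rle_trans; apply: Req_le; congr Cmod.
by apply: Ceq; rewrite ?Re_minus ?Im_minus ?Re_mult ?Im_mult /= /minus /plus /opp /scal /= /mult /=; rewrite /Re /Im; ring.
Qed.

Lemma cder_unit (t : R) : cder unit_pt t (Ci * unit_pt t).
Proof.
split; rewrite ?Re_mult ?Im_mult /=; auto_derive => //; ring.
Qed.

Lemma cder_cont (f : R -> C) (t : R) (l : C) : cder f t l ->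
  exists d K : R, [/\ (0 < d)%R, (0 <= K)%R & forall s, (Rabs (s - t) < d)%R ->
     (Cmod (f s - f t) <= K * Rabs (s - t))%R].
Proof.
move=> /cder_epsP /(_ 1%R Rlt_0_1) [d [d0 H]]; exists d, (1 + Cmod l)%R.
have l0 := Cmod_ge_0 l; split=> //; first lra.
move=> s /H Hs; rewrite (_ : f s - f t = (f s - f t - RtoC (s - t) * l) + RtoC (s - t) * l); last by ring.
apply: Rle_trans (Cmod_triangle _ _) _; rewrite Cmod_mult Cmod_R; lra.
Qed.

Lemma SD_cder (O : C -> Prop) g g' (z : R -> C) (t : R) (l : C) :
  SD O g g' -> (forall s, O (z s)) -> cder z t l -> cder (fun s => g (z s)) t (g' (z t) * l).
Proof.
move=> [B [B0 [B1 B2]]] Oz Hz; apply/cder_epsP => eps Heps.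
have [d1 [K [d10 K0 H1]]] := cder_cont _ _ _ Hz.
have [_ Hg'] := B1 _ (Oz t).
move/cder_epsP: Hz => Hz.
have BK : (0 <= B * K ^ 2)%R by apply: Rmult_le_pos => //; exact: pow2_ge_0.
have [d2 [d20 H2]] := Hz (eps / (2 * (B + 1)))%R ltac:(apply: Rdiv_lt_0_compat; lra).
(* Within [d3] the quadratic remainder of [g] is at most half of eps |s - t|; the linearization
   error of [z] takes the other half. *)
set d3 := (eps / (2 * (B * K ^ 2 + 1)))%R.
have d30 : (0 < d3)%R by apply: Rdiv_lt_0_compat; lra.
exists (Rmin d3 (Rmin d1 d2)); split; first by do 2 apply: Rmin_pos => //.
move=> s Hs; have Hs3 := Rlt_le_trans _ _ _ Hs (Rmin_l _ _).
have Hs' := Rlt_le_trans _ _ _ Hs (Rmin_r _ _).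
have {}H1 := H1 s (Rlt_le_trans _ _ _ Hs' (Rmin_l _ _)).
have {}H2 := H2 s (Rlt_le_trans _ _ _ Hs' (Rmin_r _ _)).
have [_ _ H3] := B2 _ _ (Oz t) (Oz s).
rewrite (_ : _ - _ = (g (z s) - g (z t) - (z s - z t) * g' (z t))
   + (z s - z t - RtoC (s - t) * l) * g' (z t)); last by ring.
have p0 := Rabs_pos (s - t).
apply: Rle_trans (Cmod_plus_le _ _ _ _ H3 (Cmod_mult_le _ _ _ _ H2 Hg')) _.
have E1 : (B * Cmod (z s - z t) ^ 2 <= B * K ^ 2 * Rabs (s - t) ^ 2)%R.
  rewrite Rmult_assoc -Rpow_mult_distr; apply: Rmult_le_compat_l => //; apply: pow_incr; split=> //.
  exact: Cmod_ge_0.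
have E2 : (eps / (2 * (B + 1)) * Rabs (s - t) * B <= eps / 2 * Rabs (s - t))%R.
  rewrite (_ : _ * B = eps / 2 * Rabs (s - t) * (B / (B + 1)))%R; last by field; lra.
  rewrite -[X in (_ <= X)%R]Rmult_1_r; apply: Rmult_le_compat_l; first by nra.
  by apply: (Rmult_le_reg_r (B + 1)); [lra|rewrite /Rdiv Rmult_assoc Rinv_l; lra].
have E3 : (B * K ^ 2 * Rabs (s - t) ^ 2 <= eps / 2 * Rabs (s - t))%R.
  rewrite (_ : Rabs (s - t) ^ 2 = Rabs (s - t) * Rabs (s - t))%R; last by ring.
  rewrite -Rmult_assoc; apply: Rmult_le_compat_r => //.
  apply: Rle_trans (_ : (B * K ^ 2 * d3 <= _)%R); first by apply: Rmult_le_compat_l => //; lra.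
  rewrite /d3 (_ : B * K ^ 2 * (eps / (2 * (B * K ^ 2 + 1))) = eps / 2 * (B * K ^ 2 / (B * K ^ 2 + 1)))%R; last by field; lra.
  rewrite -[X in (_ <= X)%R]Rmult_1_r; apply: Rmult_le_compat_l; first by lra.
  by apply: (Rmult_le_reg_r (B * K ^ 2 + 1)); [lra|rewrite /Rdiv Rmult_assoc Rinv_l; lra].
lra.
Qed.

Definition ccont (f : R -> C) : Prop :=
  forall t, continuous (fun s => Re (f s)) t /\ continuous (fun s => Im (f s)) t.

Lemma ccont_const (c : C) : ccont (fun=> c).
Proof. by move=> t; split; exact: continuous_const. Qed.

Lemma ccont_plus f g : ccont f -> ccont g -> ccont (fun s => f s + g s).
Proof.
by move=> F G t; have [A B] := F t; have [P Q] := G t; split; [exact: continuous_plus A P|exact: continuous_plus B Q].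
Qed.

Lemma ccont_mult f g : ccont f -> ccont g -> ccont (fun s => f s * g s).
Proof.
move=> F G t; have [A B] := F t; have [P Q] := G t; split.
  exact: (continuous_minus _ _ _ (continuous_mult _ _ _ A P) (continuous_mult _ _ _ B Q)).
exact: (continuous_plus _ _ _ (continuous_mult _ _ _ A Q) (continuous_mult _ _ _ B P)).
Qed.

Lemma ccont_scal (c : C) f : ccont f -> ccont (fun s => c * f s).
Proof. by move=> F; apply: ccont_mult => //; exact: ccont_const. Qed.

Lemma ccont_ext f g : (forall s, f s = g s) -> ccont f -> ccont g.
Proof.
by move=> E H t; have [A B] := H t; split; [apply: continuous_ext A|apply: continuous_ext B] => s; rewrite E.
Qed.

Lemma cder_ccont (f f' : R -> C) : (forall t, cder f t (f' t)) -> ccont f.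
Proof.
move=> H t; have [A B] := H t.
split; apply: (ex_derive_continuous (K := R_AbsRing) (V := R_NormedModule)); by [exists (Re (f' t))|exists (Im (f' t))].
Qed.

Lemma ccont_unit : ccont unit_pt.
Proof. exact: cder_ccont cder_unit. Qed.

Lemma rcont_epsP (f : R -> R) (t : R) :
  (forall eps : R, (0 < eps)%R -> exists d : R, (0 < d)%R /\ forall s, (Rabs (s - t) < d)%R ->
     (Rabs (f s - f t) < eps)%R) <-> continuous f t.
Proof.
split=> H.
  apply/filterlim_locally => eps; have [d [d0 Hd]] := H eps (cond_pos eps).
  by exists (mkposreal d d0) => s Hs; exact: Hd.
move=> eps Heps; have [d Hd] := (proj1 (filterlim_locally _ _) H) (mkposreal eps Heps).
by exists d; split; [exact: cond_pos|exact: Hd].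
Qed.

Lemma ccont_epsP (f : R -> C) :
  (forall t (eps : R), (0 < eps)%R -> exists d : R, (0 < d)%R /\ forall s, (Rabs (s - t) < d)%R ->
     (Cmod (f s - f t) < eps)%R) <-> ccont f.
Proof.
split=> [H t|H t eps Heps].
  split; apply/rcont_epsP => eps Heps; have [d [d0 Hd]] := H t eps Heps;
    exists d; split=> // s /Hd; apply: Rle_lt_trans; rewrite -?Re_minus -?Im_minus;
    [exact: re_le_Cmod|exact: im_le_Cmod].
have [/rcont_epsP A /rcont_epsP B] := H t.
have [d1 [d10 H1]] := A (eps / 2)%R ltac:(lra); have [d2 [d20 H2]] := B (eps / 2)%R ltac:(lra).
exists (Rmin d1 d2); split; first by apply: Rmin_pos.
move=> s Hs; apply: Rle_lt_trans (Cmod_le_abs _) _; rewrite Re_minus Im_minus.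
have := H1 s (Rlt_le_trans _ _ _ Hs (Rmin_l _ _)).
have := H2 s (Rlt_le_trans _ _ _ Hs (Rmin_r _ _)); lra.
Qed.

Lemma SD_ccont (O : C -> Prop) g g' (z : R -> C) :
  SD O g g' -> (forall s, O (z s)) -> ccont z -> ccont (fun s => g (z s)) /\ ccont (fun s => g' (z s)).
Proof.
move=> [B [B0 [B1 B2]]] Oz /ccont_epsP Hz.
have K t eps : (0 < eps)%R -> exists d : R, (0 < d)%R /\ forall s, (Rabs (s - t) < d)%R ->
    (Cmod (g (z s) - g (z t)) < eps)%R /\ (Cmod (g' (z s) - g' (z t)) < eps)%R.
  move=> Heps; have [d [d0 Hd]] := Hz t (eps / (B + 1))%R ltac:(apply: Rdiv_lt_0_compat; lra).
  exists d; split=> // s /Hd Hs; have [H1 H2 _] := B2 _ _ (Oz t) (Oz s).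
  have h0 := Cmod_ge_0 (z s - z t).
  have E : (eps = eps / (B + 1) * (B + 1))%R by field; lra.
  by move: Hs H1 H2; rewrite {2 3}E; move: (eps / _)%R (Cmod (z s - z t)) h0 => e h h0 Hs H1 H2; split; nra.
by split; apply/ccont_epsP => t eps /(K t) [d [d0 Hd]]; exists d; split=> // s /Hd [].
Qed.

(** The integral over one period, by components; [cint_RInt] identifies it with [RInt] for
    continuous integrands. *)
Definition cint (f : R -> C) : C :=
  (RInt (fun t => Re (f t)) 0 (2 * PI), RInt (fun t => Im (f t)) 0 (2 * PI)).

Lemma ccont_ex (f : R -> C) : ccont f ->
  ex_RInt (fun t => Re (f t)) 0 (2 * PI) /\ ex_RInt (fun t => Im (f t)) 0 (2 * PI).
Proof.
by move=> H; split; apply: (ex_RInt_continuous (V := R_CompleteNormedModule)) => z _; have [A B] := H z.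
Qed.

Lemma is_cint (f : R -> C) : ccont f -> is_RInt (V := C_R_NormedModule) f 0 (2 * PI)%R (cint f).
Proof.
move=> /ccont_ex [A B].
apply: (is_RInt_fct_extend_pair (U := R_NormedModule) (V := R_NormedModule)); exact: RInt_correct.
Qed.

Lemma cint_RInt (f : R -> C) : ccont f -> RInt (V := C_R_CompleteNormedModule) f 0 (2 * PI)%R = cint f.
Proof. by move=> /is_cint H; exact: (is_RInt_unique (V := C_R_CompleteNormedModule)). Qed.

Lemma cint_is (f : R -> C) (v : C) : is_RInt (V := C_R_NormedModule) f 0 (2 * PI)%R v -> cint f = v.
Proof.
move=> H; apply: Ceq; rewrite /cint /=; apply: is_RInt_unique.
  exact: (is_RInt_fct_extend_fst (U := R_NormedModule) (V := R_NormedModule) f).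
exact: (is_RInt_fct_extend_snd (U := R_NormedModule) (V := R_NormedModule) f).
Qed.

Lemma cint_ext f g : (forall t, f t = g t) -> cint f = cint g.
Proof. by move=> E; apply: Ceq; apply: RInt_ext => t _; rewrite E. Qed.

Lemma cint_plus f g : ccont f -> ccont g -> cint (fun t => f t + g t) = cint f + cint g.
Proof.
move=> F G; apply: cint_is.
exact: (is_RInt_plus (V := C_R_NormedModule) f g _ _ _ _ (is_cint _ F) (is_cint _ G)).
Qed.

Lemma cint_scal (c : C) f : ccont f -> cint (fun t => c * f t) = c * cint f.
Proof.
move=> /ccont_ex [A B]; case: c => a b.
have H : forall u v : R, ex_RInt (fun t => u * Re (f t) + v * Im (f t))%R 0 (2 * PI) /\
   RInt (fun t => u * Re (f t) + v * Im (f t))%R 0 (2 * PI) = (u * Re (cint f) + v * Im (cint f))%R.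
  move=> u v.
  have X := is_RInt_plus _ _ _ _ _ _ (is_RInt_scal _ _ _ u _ (RInt_correct _ _ _ A))
     (is_RInt_scal _ _ _ v _ (RInt_correct _ _ _ B)).
  by split; [eexists; exact: X|exact: is_RInt_unique].
apply: Ceq.
  change (RInt (fun t => Re ((a, b) * f t)) 0 (2 * PI) = (a * Re (cint f) - b * Im (cint f))%R).
  rewrite (_ : a * _ - b * _ = a * Re (cint f) + (- b) * Im (cint f))%R; last by ring.
  rewrite -(proj2 (H a (- b)%R)); apply: RInt_ext => t _; rewrite Re_mult /=; ring.
change (RInt (fun t => Im ((a, b) * f t)) 0 (2 * PI) = (a * Im (cint f) + b * Re (cint f))%R).
rewrite (_ : a * _ + b * _ = b * Re (cint f) + a * Im (cint f))%R; last by ring.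
rewrite -(proj2 (H b a)); apply: RInt_ext => t _; rewrite Im_mult /=; ring.
Qed.

Lemma cint_const (c : C) : cint (fun=> c) = 2 * PI * c.
Proof.
by rewrite /cint !RInt_const /scal /= /mult /=; apply: Ceq; rewrite /Re /Im /=; ring.
Qed.

Lemma cint_minus f g : ccont f -> ccont g -> cint (fun t => f t - g t) = cint f - cint g.
Proof.
move=> F G; rewrite (cint_ext _ (fun t => f t + (- (1)) * g t)); last by move=> t; ring.
rewrite cint_plus ?cint_scal //; last by exact: ccont_scal.
ring.
Qed.

Lemma two_PI_pos : (0 < 2 * PI)%R.
Proof. by have := PI_RGT_0; lra. Qed.

Lemma cint_bound f (b : R) : ccont f -> (forall t, (Cmod (f t) <= b)%R) -> (Cmod (cint f) <= 2 * PI * b)%R.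
Proof.
move=> F H; have P := two_PI_pos; rewrite Cmod_norm -{1}(Rminus_0_r (2 * PI)).
apply: (norm_RInt_le_const (V := C_R_NormedModule) f 0%R (2 * PI)%R) (is_cint _ F); first lra.
by move=> x _; rewrite -Cmod_norm.
Qed.

Lemma cint_derive (F f : R -> C) : (forall t, cder F t (f t)) -> ccont f ->
  cint f = F (2 * PI)%R - F 0%R.
Proof.
move=> H Hf; apply: cint_is.
apply: (is_RInt_derive (V := C_R_CompleteNormedModule) F f) => x _.
  exact: cder_is_derive.
apply/filterlim_locally => eps.
have [d [d0 Hd]] := proj2 (ccont_epsP f) Hf x eps (cond_pos eps).
exists (mkposreal d d0) => s Hs; split; have := Hd s Hs; apply: Rle_lt_trans.
  exact: (re_le_Cmod (f s - f x)).
exact: (im_le_Cmod (f s - f x)).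
Qed.

Lemma unit_pt_period (t : R) : unit_pt (t + 2 * PI) = unit_pt t.
Proof. by rewrite /unit_pt cos_plus sin_plus cos_2PI sin_2PI; congr (_, _); ring. Qed.

Lemma unit_pt_2PI : unit_pt (2 * PI) = unit_pt 0.
Proof. by rewrite -[(2 * PI)%R]Rplus_0_l unit_pt_period. Qed.

(** * Deformation of circles and uniqueness for a linear differential equation *)

(** Quadratic increments force a zero derivative inside the interval; the ends are reached by
    applying the increment bound on two shrinking end intervals. *)
Lemma quad_const (F : R -> C) (a b K : R) : (a <= b)%R -> (0 <= K)%R ->
  (forall x y, (a <= x <= b)%R -> (a <= y <= b)%R -> (Cmod (F y - F x) <= K * (y - x) ^ 2)%R) -> F a = F b.
Proof.
move=> Hab K0 H; case: (Rle_lt_or_eq_dec _ _ Hab) => [{}Hab|->] //.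
have D t : (a < t < b)%R -> cder F t 0.
  move=> Ht; apply/cder_epsP => eps Heps.
  exists (Rmin (eps / (K + 1)) (Rmin (t - a) (b - t))); split.
    by apply: Rmin_pos; [apply: Rdiv_lt_0_compat|apply: Rmin_pos]; lra.
  move=> s Hs; have Hs1 := Rlt_le_trans _ _ _ Hs (Rmin_l _ _).
  have Hs2 := Rlt_le_trans _ _ _ Hs (Rmin_r _ _).
  have Hs3 := Rlt_le_trans _ _ _ Hs2 (Rmin_l _ _).
  have Hs4 := Rlt_le_trans _ _ _ Hs2 (Rmin_r _ _).
  move/Rabs_lt_between: Hs3 => Hs3; move/Rabs_lt_between: Hs4 => Hs4.
  rewrite Cmult_0_r (_ : _ - 0 = F s - F t); last by ring.
  apply: Rle_trans (H t s _ _) _; [lra|lra|].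
  rewrite -pow2_abs; have p0 := Rabs_pos (s - t).
  have E : (eps = eps / (K + 1) * (K + 1))%R by field; lra.
  rewrite [X in (_ <= X * _)%R]E; move: Hs1 p0; move: (eps / _)%R (Rabs (s - t)) => e h Hs1 h0.
  have H1 : (h * h <= h * e)%R by apply: Rmult_le_compat_l => //; lra.
  have H2 : (K * (h * h) <= K * (h * e))%R by apply: Rmult_le_compat_l.
  nra.
have CT (g : R -> R) : (forall x y, (a <= x <= b)%R -> (a <= y <= b)%R -> (Rabs (g y - g x) <= K * (y - x) ^ 2)%R) ->
    (forall t, (a < t < b)%R -> is_derive g t 0) -> g a = g b.
  move=> Hg Dg.
  (* values at the ends are recovered from the interior by continuity *)
  have I x y : (a < x < b)%R -> (a < y < b)%R -> g x = g y.
    move=> Hx Hy; have [||c [_ Hc]] := MVT_gen g x y (fun=> 0%R).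
    - by move=> z [Hz1 Hz2]; apply: Dg; split; [apply: Rlt_trans Hz1|apply: Rlt_trans Hz2 _];
        rewrite /Rmin /Rmax; case: Rle_dec => ?; lra.
    - move=> z [Hz1 Hz2]; apply: derivable_continuous_pt; apply/ex_derive_Reals_0; exists 0%R; apply: Dg.
      split; [apply: Rlt_le_trans Hz1|apply: Rle_lt_trans Hz2 _];
        rewrite /Rmin /Rmax; case: Rle_dec => ?; lra.
    by lra.
  have E : forall n : R, (2 < n)%R -> (Rabs (g b - g a) <= 2 * K * (b - a) ^ 2 / n)%R.
    move=> n Hn; set e := ((b - a) / n)%R.
    have e0 : (0 < e)%R by apply: Rdiv_lt_0_compat; lra.
    have e1 : (e < (b - a) / 2)%R.
      by apply: Rmult_lt_compat_l; [lra|apply: Rinv_lt_contravar; lra].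
    have -> : (g b - g a = (g b - g (b - e)) + (g (a + e) - g a))%R.
      by rewrite (I (b - e)%R (a + e)%R); [ring|lra|lra].
    apply: Rle_trans (Rabs_triang _ _) _.
    have H1 := Hg (b - e)%R b ltac:(lra) ltac:(lra).
    have H2 := Hg a (a + e)%R ltac:(lra) ltac:(lra).
    rewrite (_ : b - (b - e) = e)%R in H1; last by ring.
    rewrite (_ : a + e - a = e)%R in H2; last by ring.
    have H3 : (e ^ 2 <= (b - a) ^ 2 / n)%R.
      rewrite /e (_ : ((b - a) / n) ^ 2 = (b - a) ^ 2 / n * / n)%R; last by field; lra.
      rewrite -[X in (_ <= X)%R]Rmult_1_r; apply: Rmult_le_compat_l.
        by apply: Rlt_le; apply: Rdiv_lt_0_compat; [nra|lra].
      by rewrite -Rinv_1; apply: Rinv_le_contravar; lra.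
    have H4 : (K * e ^ 2 <= K * ((b - a) ^ 2 / n))%R by apply: Rmult_le_compat_l.
    rewrite (_ : 2 * K * (b - a) ^ 2 / n = 2 * (K * ((b - a) ^ 2 / n)))%R; last by field; lra.
    lra.
  case: (Req_dec (g b) (g a)) => [//|Hne].
  have P : (0 < Rabs (g b - g a))%R by apply: Rabs_pos_lt; lra.
  set d := Rabs _ in P E.
  have Q : (0 <= 2 * K * (b - a) ^ 2)%R by apply: Rmult_le_pos; [lra|exact: pow2_ge_0].
  (* With this number of pieces the bound falls below [d], the assumed positive difference. *)
  have := E (3 + 2 * K * (b - a) ^ 2 / d)%R.
  have Q2 : (0 <= 2 * K * (b - a) ^ 2 / d)%R by apply: Rmult_le_pos => //; apply: Rlt_le; exact: Rinv_0_lt_compat.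
  move=> /(_ ltac:(lra)) X; exfalso.
  move: Q Q2 X; move: (2 * K * (b - a) ^ 2)%R => q Q Q2 X.
  have := Rmult_le_compat_r (3 + q / d) _ _ ltac:(lra) X.
  rewrite (_ : q / (3 + q / d) * (3 + q / d) = q)%R; last by field; split; [lra|nra].
  rewrite (_ : d * (3 + q / d) = 3 * d + q)%R; last by field; lra.
  lra.
apply: Ceq; [apply: (CT (fun t => Re (F t)))|apply: (CT (fun t => Im (F t)))] => [x y Hx Hy|t /D []|x y Hx Hy|t /D []] //.
  by apply: Rle_trans (H x y Hx Hy); rewrite -Re_minus; exact: re_le_Cmod.
by apply: Rle_trans (H x y Hx Hy); rewrite -Im_minus; exact: im_le_Cmod.
Qed.

Definition circ (s : R) (g : C -> C) : C :=
  cint (fun t => g (s * unit_pt t) * (Ci * (s * unit_pt t))).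

Definition annulus (a b : R) (z : C) : Prop := (a <= Cmod z <= b)%R.

Lemma Cmod_circle (s t : R) : (0 <= s)%R -> Cmod (s * unit_pt t) = s.
Proof. by move=> Hs; rewrite Cmod_mult Cmod_unit Rmult_1_r Cmod_R Rabs_pos_eq. Qed.

Lemma cder_circle (s t : R) : cder (fun u => s * unit_pt u) t (Ci * (s * unit_pt t)).
Proof. by apply: cder_eq (cder_scal _ _ _ _ (cder_unit t)); ring. Qed.

Lemma ccont_circle (s : R) : ccont (fun u => s * unit_pt u).
Proof. exact: cder_ccont (cder_circle s). Qed.

(* Both the radial derivative of the integrand and the angular derivative of
   its primitive equal the same function, so the integral does not depend on
   the radius. *)
Lemma circ_const (a b : R) (g g' : C -> C) : (0 <= a <= b)%R -> SD (annulus a b) g g' ->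
  circ a g = circ b g.
Proof.
move=> [a0 ab] Hg.
have Hid : SD (annulus a b) id (fun=> 1) by apply: (SD_id _ b) => x [].
have [B [B0 [B1 B2]]] := SD_mult _ _ _ _ _ Hid Hg.
set G := (fun x => id x * g x) in B1 B2; set G' := (fun x => 1 * g x + id x * g' x) in B1 B2.
have HG : SD (annulus a b) G G' by exists B.
have Ann s t : (a <= s <= b)%R -> annulus a b (s * unit_pt t).
  by move=> Hs; rewrite /annulus Cmod_circle; lra.
have E s : (a <= s <= b)%R -> circ s g = cint (fun t => Ci * G (s * unit_pt t)).
  by move=> Hs; apply: cint_ext => t; rewrite /G /id; ring.
have CG s : (a <= s <= b)%R -> ccont (fun t => G (s * unit_pt t)) /\ ccont (fun t => G' (s * unit_pt t)).
  by move=> Hs; apply: SD_ccont HG _ (ccont_circle s) => t; exact: Ann.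
have Z s : (a <= s <= b)%R -> cint (fun t => unit_pt t * G' (s * unit_pt t)) = 0.
  (* At radius 0 the integrand is a constant times exp(i t), of mean zero; at positive radius it is,
     up to the factor i s, the angular derivative of a periodic function. *)
  move=> Hs; case: (Req_dec s 0) => [->|s0].
    rewrite (cint_ext _ (fun t => G' 0 * unit_pt t)); last by move=> t; rewrite Cmult_0_l; ring.
    rewrite cint_scal; last exact: ccont_unit.
    rewrite (_ : cint unit_pt = 0) ?Cmult_0_r //.
    rewrite (cint_derive (fun t => - Ci * unit_pt t)); [|move=> t|exact: ccont_unit].
      by rewrite unit_pt_2PI; ring.
    apply: cder_eq (cder_scal _ _ _ _ (cder_unit t)); rewrite Cmult_assoc (_ : - Ci * Ci = - (Ci * Ci)); last by ring.
    by rewrite Ci_sqr; ring.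
  have [_ CG'] := CG s Hs.
  have CC : ccont (fun t => unit_pt t * G' (s * unit_pt t)) by apply: ccont_mult => //; exact: ccont_unit.
  have : cint (fun t => (Ci * s) * (unit_pt t * G' (s * unit_pt t))) = 0.
    rewrite (cint_derive (fun t => G (s * unit_pt t))); [by rewrite unit_pt_2PI; ring|move=> t|exact: ccont_scal].
    apply: cder_eq (SD_cder _ _ _ _ _ _ HG _ (cder_circle s t)); first by ring.
    by move=> u; exact: Ann.
  rewrite cint_scal // => H.
  have nz : Ci * s <> 0 by apply: Cmult_neq_0; [exact: Ci_neq0|exact: RtoC_neq0].
  exact: Cmult_eq0_r nz H.
apply: (quad_const (fun s => circ s g) a b (2 * PI * B)) => //.
  by apply: Rmult_le_pos => //; have := two_PI_pos; lra.
move=> x y Hx Hy; rewrite !E //.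
have [Cx Cx'] := CG x Hx; have [Cy _] := CG y Hy.
have CU : ccont (fun t => unit_pt t * G' (x * unit_pt t)) by apply: ccont_mult => //; exact: ccont_unit.
rewrite !cint_scal // (_ : Ci * _ - Ci * _ = Ci * (cint (fun t => G (y * unit_pt t)) - cint (fun t => G (x * unit_pt t))
   - (y - x)%R * cint (fun t => unit_pt t * G' (x * unit_pt t)))); last by rewrite Z //; ring.
rewrite Cmod_mult Cmod_Ci Rmult_1_l -cint_scal // -!cint_minus //; last first.
- exact: ccont_scal.
- apply: ccont_ext (ccont_plus _ _ Cy (ccont_scal (- (1)) _ Cx)) => s; ring.
rewrite Rmult_assoc; apply: cint_bound => [|t].
  apply: ccont_ext (ccont_plus _ _ (ccont_plus _ _ Cy (ccont_scal (- (1)) _ Cx)) (ccont_scal (- (y - x)%R) _ CU)) => s.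
  by ring.
have [_ _] := B2 _ _ (Ann x t Hx) (Ann y t Hy).
rewrite (_ : y * unit_pt t - x * unit_pt t = (y - x)%R * unit_pt t); last by rewrite RtoC_minus; ring.
rewrite (Cmod_mult (y - x)%R (unit_pt t)) Cmod_unit Rmult_1_r Cmod_R pow2_abs => H.
apply: Rle_trans H; apply: Req_le; congr Cmod; rewrite /G /G' /id; ring.
Qed.

(** Gronwall: p = |D|^2 satisfies p' = 2 Re(a) p, so p(e u) exp(-2 A u) does not increase for u >= 0
    and vanishes at 0. The sign e = 1 or -1 handles both directions. *)
Lemma ode_zero (D a : R -> C) (r A : R) :
  (forall s, (Rabs s < r)%R -> cder D s (a s * D s)) -> D 0%R = 0 ->
  (forall s, (Rabs s < r)%R -> (Cmod (a s) <= A)%R) ->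
  forall s, (Rabs s < r)%R -> D s = 0.
Proof.
move=> HD D0 HA.
pose p s := (Re (D s) * Re (D s) + Im (D s) * Im (D s))%R.
have Dp s : (Rabs s < r)%R -> is_derive p s (2 * Re (a s) * p s)%R.
  move=> /HD [H1 H2]; apply: is_derive_eq (is_derive_Rplus _ _ _ _ _ (is_derive_Rmult _ _ _ _ _ H1 H1) (is_derive_Rmult _ _ _ _ _ H2 H2)).
  by rewrite Re_mult Im_mult /p; ring.
have p0 : p 0%R = 0%R by rewrite /p D0 /=; ring.
have pp s : (0 <= p s)%R by rewrite /p; nra.
suff P s : (Rabs s < r)%R -> p s = 0%R.
  by move=> s /P; rewrite /p => H; apply: Ceq => /=; nra.
move=> Hs; have [e [e1 He]] : exists e : R, (e = 1 \/ e = -1)%R /\ Rabs s = (e * s)%R.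
  by case: (Rle_lt_dec 0 s) => H; [exists 1%R|exists (-1)%R]; (split; first by [left|right]);
    rewrite /Rabs; case: Rcase_abs => ?; lra.
have ee : (e * e = 1)%R by case: e1 => ->; ring.
have eabs : Rabs e = 1%R by case: e1 => ->; rewrite /Rabs; case: Rcase_abs => ?; lra.
pose q u := (p (e * u) * exp (- (2 * A) * u))%R.
have Dq u : (0 <= u < r)%R -> is_derive q u (exp (- (2 * A) * u) * p (e * u) * (2 * (e * Re (a (e * u))) - 2 * A))%R.
  move=> Hu; have Heu : (Rabs (e * u) < r)%R.
    by rewrite Rabs_mult eabs Rmult_1_l Rabs_pos_eq; lra.
  have H1 : is_derive (fun u => p (e * u)%R) u (e * (2 * Re (a (e * u)) * p (e * u)))%R.
    apply: (is_derive_comp p (fun u => e * u)%R); first exact: Dp.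
    by auto_derive => //; ring.
  have H2 : is_derive (fun u => exp (- (2 * A) * u))%R u (- (2 * A) * exp (- (2 * A) * u))%R.
    by auto_derive => //; ring.
  by apply: is_derive_eq (is_derive_Rmult _ _ _ _ _ H1 H2); ring.
have Hs0 : (0 <= Rabs s < r)%R by split=> //; exact: Rabs_pos.
have [||c [Hc1 Hc]] := MVT_gen q 0 (Rabs s) (fun u => exp (- (2 * A) * u) * p (e * u) * (2 * (e * Re (a (e * u))) - 2 * A))%R.
- by rewrite Rmin_left ?Rmax_right; try lra; move=> x Hx; apply: Dq; lra.
- rewrite Rmin_left ?Rmax_right; try lra; move=> x Hx.
  by apply: derivable_continuous_pt; apply/ex_derive_Reals_0; eexists; apply: Dq; lra.
move: Hc1; rewrite Rmin_left ?Rmax_right; try lra; move=> Hc1.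
have Hc2 : (Rabs (e * c) < r)%R.
  by rewrite Rabs_mult eabs Rmult_1_l Rabs_pos_eq; lra.
have Ha : (e * Re (a (e * c)%R) <= A)%R.
  apply: Rle_trans (HA _ Hc2); apply: Rle_trans (re_le_Cmod _).
  by case: e1 => ->; have := Rle_abs (Re (a (1 * c)%R)); have := Rle_abs (- Re (a (-1 * c)%R)); rewrite Rabs_Ropp; lra.
have q0 : q 0%R = 0%R by rewrite /q Rmult_0_r p0; ring.
have Q : (q (Rabs s) <= 0)%R.
  have : (q (Rabs s) - q 0 <= 0)%R.
    rewrite Hc Rminus_0_r; have X : (0 <= exp (- (2 * A) * c) * p (e * c))%R.
      by apply: Rmult_le_pos => //; apply: Rlt_le; exact: exp_pos.
    have : (0 <= exp (- (2 * A) * c) * p (e * c) * (2 * A - 2 * (e * Re (a (e * c)%R))) * Rabs s)%R.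
      by apply: Rmult_le_pos; [apply: Rmult_le_pos => //; lra|lra].
    nra.
  lra.
move: Q; rewrite /q {1}He -Rmult_assoc ee Rmult_1_l => Q.
have E := exp_pos (- (2 * A) * Rabs s); have := pp s; nra.
Qed.

(** * Laurent polynomials and their weighted norm *)

Definition zpow (z : C) (e : Z) : C :=
  match e with
  | Z0 => 1
  | Zpos p => Cpow z (Pos.to_nat p)
  | Zneg p => / Cpow z (Pos.to_nat p)
  end.

Lemma zpow_nat (z : C) (n : nat) : zpow z (Z.of_nat n) = Cpow z n.
Proof. by case: n => // n; rewrite /= SuccNat2Pos.id_succ. Qed.

Lemma zpow_neg (z : C) (n : nat) : zpow z (- Z.of_nat n) = / Cpow z n.
Proof.
case: n => [|n]; last by rewrite /= SuccNat2Pos.id_succ.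
by rewrite /= -RtoC_inv ?Rinv_1 //; lra.
Qed.

Lemma zpow_nonneg (z : C) (e : Z) : (0 <= e)%Z -> zpow z e = Cpow z (Z.to_nat e).
Proof. by move=> He; rewrite -zpow_nat Z2Nat.id. Qed.

Lemma zpow_sub (z : C) (n m : nat) : z <> 0 ->
  zpow z (Z.of_nat n - Z.of_nat m) = Cpow z n * / Cpow z m.
Proof.
move=> Hz; case: (Nat.le_ge_cases m n) => H.
  rewrite -Nat2Z.inj_sub // zpow_nat -{2}(Nat.sub_add m n) // Cpow_add_r.
  by field; exact: Cpow_nz.
rewrite (_ : Z.of_nat n - Z.of_nat m = - Z.of_nat (m - n))%Z; last by lia.
rewrite zpow_neg -{2}(Nat.sub_add n m) // Cpow_add_r; field.
by split; exact: Cpow_nz.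
Qed.

Lemma Z_nat_sub (a : Z) : a = (Z.of_nat (Z.to_nat a) - Z.of_nat (Z.to_nat (- a)))%Z.
Proof. lia. Qed.

Lemma zpow_add (z : C) (a b : Z) : z <> 0 -> zpow z (a + b) = zpow z a * zpow z b.
Proof.
move=> Hz; rewrite (Z_nat_sub a) (Z_nat_sub b).
move: (Z.to_nat a) (Z.to_nat (- a)) (Z.to_nat b) (Z.to_nat (- b)) => p q p' q'.
rewrite (_ : _ + _ = Z.of_nat (p + p') - Z.of_nat (q + q'))%Z; last by lia.
rewrite !zpow_sub // !Cpow_add_r; field.
by split; exact: Cpow_nz.
Qed.

Lemma zpow_add_nonneg (z : C) (a b : Z) : (0 <= a)%Z -> (0 <= b)%Z ->
  zpow z (a + b) = zpow z a * zpow z b.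
Proof. by move=> Ha Hb; rewrite !zpow_nonneg ?Z2Nat.inj_add ?Cpow_add_r //; lia. Qed.

Lemma zpow_unit (t : R) (e : Z) : zpow (unit_pt t) e = unit_pt (IZR e * t).
Proof.
have P n : Cpow (unit_pt t) n = unit_pt (INR n * t).
  elim: n => [|n IH]; first by rewrite /unit_pt /= Rmult_0_l cos_0 sin_0.
  rewrite Cpow_S IH S_INR Rmult_plus_distr_r Rmult_1_l /unit_pt cos_plus sin_plus.
  by apply: Ceq; rewrite ?Re_mult ?Im_mult /=; ring.
case: (Z_lt_le_dec e 0) => He; last first.
  by rewrite zpow_nonneg // P INR_IZR_INZ Z2Nat.id.
have E : e = (- Z.of_nat (Z.to_nat (- e)))%Z by lia.
rewrite {1}E zpow_neg P INR_IZR_INZ Z2Nat.id; last by lia.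
rewrite opp_IZR Ropp_mult_distr_l_reverse; set x := (IZR e * t)%R.
have nz : unit_pt (- x) <> 0 by move/(f_equal Cmod); rewrite Cmod_unit Cmod_0; lra.
rewrite -[LHS]Cmult_1_l; have -> : RtoC 1 = unit_pt x * unit_pt (- x).
  rewrite /unit_pt cos_neg sin_neg; have := sin2_cos2 x; rewrite /Rsqr => H.
  by apply: Ceq; rewrite ?Re_mult ?Im_mult /=; [rewrite -H; ring|ring].
by field.
Qed.

(** The supremum of |z^e| over the annulus 1/4 <= |z| <= 4. The annulus contains the circles of
    radius 1 and 1/2 in its interior, and the weight dominates every power of |e|, so it controls
    all angular derivatives. *)
Definition wt (e : Z) : R := (4 ^ Z.abs_nat e)%R.

Lemma wt_ge1 e : (1 <= wt e)%R.
Proof. by apply: pow_R1_Rle; lra. Qed.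

Lemma wt_add a b : (wt (a + b) <= wt a * wt b)%R.
Proof. by rewrite /wt -pow_add; apply: Rle_pow; [lra|lia]. Qed.

Lemma zpow_le_wt (z : C) (e : Z) : (/ 4 <= Cmod z <= 4)%R -> (Cmod (zpow z e) <= wt e)%R.
Proof.
move=> [H1 H2]; have nz : z <> 0 by move=> E; move: H1; rewrite E Cmod_0; lra.
case: (Z_lt_le_dec e 0) => He; last first.
  rewrite zpow_nonneg // Cmod_pow /wt (_ : Z.abs_nat e = Z.to_nat e); last by lia.
  by apply: pow_incr; split=> //; exact: Cmod_ge_0.
have E : e = (- Z.of_nat (Z.to_nat (- e)))%Z by lia.
rewrite {1}E zpow_neg Cmod_inv; last exact: Cpow_nz.
rewrite Cmod_pow -pow_inv /wt (_ : Z.abs_nat e = Z.to_nat (- e)); last by lia.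
apply: pow_incr; split; first by apply: Rlt_le; apply: Rinv_0_lt_compat; lra.
by rewrite -(Rinv_inv 4); apply: Rinv_le_contravar; lra.
Qed.

Lemma zpow_le_wt_nonneg (z : C) (e : Z) : (0 <= e)%Z -> (Cmod z <= 4)%R -> (Cmod (zpow z e) <= wt e)%R.
Proof.
move=> He H; rewrite zpow_nonneg // Cmod_pow /wt (_ : Z.abs_nat e = Z.to_nat e); last by lia.
by apply: pow_incr; split=> //; exact: Cmod_ge_0.
Qed.

Definition mono : Type := (C * Z)%type.
(* Laurent polynomials as finite sums of monomials [c tau^e], without
   uniqueness of the representation. *)
Definition lp : Type := list mono.

Definition csumL {A : Type} (f : A -> C) (l : list A) : C := fold_right (fun x s => f x + s) 0 l.
Definition rsumL {A : Type} (f : A -> R) (l : list A) : R := fold_right (fun x s => f x + s)%R 0%R l.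

Lemma csumL_app {A} (f : A -> C) l1 l2 : csumL f (l1 ++ l2) = csumL f l1 + csumL f l2.
Proof. by elim: l1 => [|x l IH] /=; [ring|rewrite IH; ring]. Qed.

Lemma rsumL_app {A} (f : A -> R) l1 l2 : rsumL f (l1 ++ l2) = (rsumL f l1 + rsumL f l2)%R.
Proof. by elim: l1 => [|x l IH] /=; [ring|rewrite IH; ring]. Qed.

Lemma csumL_map {A B} (g : A -> B) (f : B -> C) l : csumL f (map g l) = csumL (fun x => f (g x)) l.
Proof. by elim: l => //= x l ->. Qed.

Lemma rsumL_map {A B} (g : A -> B) (f : B -> R) l : rsumL f (map g l) = rsumL (fun x => f (g x)) l.
Proof. by elim: l => //= x l ->. Qed.

Lemma csumL_flat_map {A B} (g : A -> list B) (f : B -> C) l :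
  csumL f (flat_map g l) = csumL (fun x => csumL f (g x)) l.
Proof. by elim: l => //= x l IH; rewrite csumL_app IH. Qed.

Lemma rsumL_flat_map {A B} (g : A -> list B) (f : B -> R) l :
  rsumL f (flat_map g l) = rsumL (fun x => rsumL f (g x)) l.
Proof. by elim: l => //= x l IH; rewrite rsumL_app IH. Qed.

Lemma csumL_ext {A} (f g : A -> C) l : (forall x, In x l -> f x = g x) -> csumL f l = csumL g l.
Proof.
elim: l => //= x l IH H; rewrite IH ?H //; first by left.
by move=> y Hy; apply: H; right.
Qed.

Lemma rsumL_le {A} (f g : A -> R) l : (forall x, In x l -> (f x <= g x)%R) -> (rsumL f l <= rsumL g l)%R.
Proof.
elim: l => [_|x l IH H] /=; first by lra.
apply: Rplus_le_compat; first by apply: H; left.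
by apply: IH => y Hy; apply: H; right.
Qed.

Lemma csumL_scal {A} (c : C) (f : A -> C) l : csumL (fun x => c * f x) l = c * csumL f l.
Proof. by elim: l => [|x l IH] /=; [ring|rewrite IH; ring]. Qed.

Lemma rsumL_scal {A} (c : R) (f : A -> R) l : rsumL (fun x => c * f x)%R l = (c * rsumL f l)%R.
Proof. by elim: l => [|x l IH] /=; [ring|rewrite IH; ring]. Qed.

Lemma csumL_add {A} (f g : A -> C) l : csumL (fun x => f x + g x) l = csumL f l + csumL g l.
Proof. by elim: l => [|x l IH] /=; [ring|rewrite IH; ring]. Qed.

Lemma csumL_mul {A B} (f : A -> C) (g : B -> C) l1 l2 :
  csumL (fun x => csumL (fun y => f x * g y) l2) l1 = csumL f l1 * csumL g l2.
Proof. by elim: l1 => [|x l IH] /=; [ring|rewrite IH csumL_scal; ring]. Qed.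

Lemma rsumL_mul {A B} (f : A -> R) (g : B -> R) l1 l2 :
  rsumL (fun x => rsumL (fun y => f x * g y)%R l2) l1 = (rsumL f l1 * rsumL g l2)%R.
Proof. by elim: l1 => [|x l IH] /=; [ring|rewrite IH rsumL_scal; ring]. Qed.

Lemma csumL_bound {A} (f : A -> C) (g : A -> R) l : (forall x, In x l -> (Cmod (f x) <= g x)%R) ->
  (Cmod (csumL f l) <= rsumL g l)%R.
Proof.
elim: l => [_|x l IH H] /=; first by rewrite Cmod_0; lra.
apply: Cmod_plus_le; first by apply: H; left.
by apply: IH => y Hy; apply: H; right.
Qed.

Lemma csumL_conj {A} (f : A -> C) l : Cconj (csumL f l) = csumL (fun x => Cconj (f x)) l.
Proof. by elim: l => [|x l IH] /=; [apply: Ceq => /=; ring|rewrite Cplus_conj IH]. Qed.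

Definition wn (x : mono) : R := (Cmod x.1 * wt x.2)%R.

Lemma wn_ge0 x : (0 <= wn x)%R.
Proof. by apply: Rmult_le_pos; [exact: Cmod_ge_0|have := wt_ge1 x.2; lra]. Qed.

Definition lnorm (l : lp) : R := rsumL wn l.

Lemma rsumL_ge0 {A} (f : A -> R) l : (forall x, (0 <= f x)%R) -> (0 <= rsumL f l)%R.
Proof. by move=> H; elim: l => [|x l IH] /=; [lra|have := H x; lra]. Qed.

Lemma lnorm_ge0 l : (0 <= lnorm l)%R.
Proof. exact: rsumL_ge0 wn_ge0. Qed.

Definition lev (l : lp) (z : C) : C := csumL (fun x => x.1 * zpow z x.2) l.

Definition lsupp (P : Z -> Prop) (l : lp) : Prop := forall x, In x l -> P x.2.

(* The points at which the weighted norm controls the value. *)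
Definition evalok (l : lp) (z : C) : Prop :=
  (/ 4 <= Cmod z <= 4)%R \/ ((Cmod z <= 4)%R /\ lsupp (fun e => (0 <= e)%Z) l).

Lemma lev_bound l z : evalok l z -> (Cmod (lev l z) <= lnorm l)%R.
Proof.
move=> H; apply: csumL_bound => x Hx; rewrite Cmod_mult; apply: Rmult_le_compat_l; first exact: Cmod_ge_0.
case: H => [H|[H1 H2]]; first exact: zpow_le_wt.
by apply: zpow_le_wt_nonneg => //; exact: H2.
Qed.

(** * Series in rho with Laurent polynomial coefficients *)

(** The entry of index n is the coefficient of rho^n. *)
Definition ser : Type := nat -> lp.

(** Sum over the indices below m: the empty truncation m = 0 starts the induction in
    [fixpoint_conv]. *)
Fixpoint rs (m : nat) (f : nat -> R) : R :=
  match m with O => 0%R | S m' => (rs m' f + f m')%R end.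

Lemma rs_le m f g : (forall i, (i < m)%nat -> (f i <= g i)%R) -> (rs m f <= rs m g)%R.
Proof.
elim: m => [_|m IH H] /=; first by lra.
by apply: Rplus_le_compat; [apply: IH => i Hi; apply: H; lia|apply: H; lia].
Qed.

Lemma rs_ext m f g : (forall i, (i < m)%nat -> f i = g i) -> rs m f = rs m g.
Proof. by elim: m => [//|m IH H] /=; rewrite IH ?H //; move=> i Hi; apply: H; lia. Qed.

Lemma rs_ge0 m f : (forall i, (0 <= f i)%R) -> (0 <= rs m f)%R.
Proof. by move=> H; elim: m => [|m IH] /=; [lra|have := H m; lra]. Qed.

Lemma rs_mono m m' f : (forall i, (0 <= f i)%R) -> (m <= m')%nat -> (rs m f <= rs m' f)%R.
Proof. by move=> H; elim=> [|p _ IH] /=; [lra|have := H p; lra]. Qed.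

Lemma rs_scal m c f : rs m (fun i => c * f i)%R = (c * rs m f)%R.
Proof. by elim: m => [|m IH] /=; [ring|rewrite IH; ring]. Qed.

Lemma rs_add m f g : rs m (fun i => f i + g i)%R = (rs m f + rs m g)%R.
Proof. by elim: m => [|m IH] /=; [ring|rewrite IH; ring]. Qed.

Lemma rs_shift m f : rs (S m) f = (f 0%nat + rs m (fun i => f (S i)))%R.
Proof. by elim: m => [|m IH]; [rewrite /=; ring|rewrite [LHS]/= -/(rs (S m) f) IH /=; ring]. Qed.

(** The pairs with i + j < m form a subset of those with i < m and j < m. *)
Lemma rs_cauchy m (a b : nat -> R) : (forall i, (0 <= a i)%R) -> (forall i, (0 <= b i)%R) ->
  (rs m (fun n => rs (S n) (fun i => a i * b (n - i)%nat)%R) <= rs m a * rs m b)%R.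
Proof.
move=> Ha Hb.
have -> : rs m (fun n => rs (S n) (fun i => a i * b (n - i)%nat)%R) = rs m (fun i => a i * rs (m - i) b)%R.
  elim: m => [//|m IH].
  transitivity (rs m (fun i => a i * rs (m - i) b) + rs (S m) (fun i => a i * b (m - i)%nat))%R.
    by rewrite -IH.
  transitivity (rs m (fun i => a i * rs (S m - i) b) + a m * rs (S m - m) b)%R; last by [].
  rewrite (_ : (S m - m = 1)%nat); last by lia.
  rewrite (rs_ext _ (fun i => a i * rs (S m - i) b)%R (fun i => a i * rs (m - i) b + a i * b (m - i)%nat)%R).
    by rewrite rs_add /= Nat.sub_diag; ring.
  by move=> i Hi; rewrite Nat.sub_succ_l; [rewrite /=; ring|lia].
rewrite Rmult_comm -rs_scal; apply: rs_le => i Hi; rewrite Rmult_comm; apply: Rmult_le_compat_r => //.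
by apply: rs_mono => //; lia.
Qed.

Definition N (r : R) (m : nat) (X : ser) : R := rs m (fun n => lnorm (X n) * r ^ n)%R.

Definition sadd (X Y : ser) : ser := fun n => X n ++ Y n.
Definition slin (g : mono -> mono) (X : ser) : ser := fun n => map g (X n).
Definition sfil (P : Z -> bool) (X : ser) : ser := fun n => filter (fun x => P x.2) (X n).
(* Multiplication by [rho]. *)
Definition ssh (X : ser) : ser := fun n => match n with O => nil | S n' => X n' end.
Definition scst (l : lp) : ser := fun n => match n with O => l | S _ => nil end.
Definition mscal (c : C) (x : mono) : mono := (c * x.1, x.2).
Definition lbil (f : mono -> mono -> mono) (l1 l2 : lp) : lp := flat_map (fun x => map (f x) l2) l1.
(** The Cauchy product built from a bilinear operation on monomials. The weight [w n i] on the
    contribution of orders i and n - i permits differentiation and integration in rho inside a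
    product. *)
Definition sbil (f : mono -> mono -> mono) (w : nat -> nat -> R) (X Y : ser) : ser :=
  fun n => flat_map (fun i => map (mscal (w n i)) (lbil f (X i) (Y (n - i)%nat))) (seq 0 (S n)).
Fixpoint sbig {J : Type} (l : list J) (F : J -> ser) : ser :=
  match l with nil => scst nil | cons j l' => sadd (F j) (sbig l' F) end.

Lemma N_ge0 r m X : (0 < r)%R -> (0 <= N r m X)%R.
Proof.
by move=> r0; apply: rs_ge0 => i; apply: Rmult_le_pos; [exact: lnorm_ge0|apply: pow_le; lra].
Qed.

Lemma N_mono r m m' X : (0 < r)%R -> (m <= m')%nat -> (N r m X <= N r m' X)%R.
Proof.
by move=> r0; apply: rs_mono => i; apply: Rmult_le_pos; [exact: lnorm_ge0|apply: pow_le; lra].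
Qed.

Lemma N_sadd r m X Y : N r m (sadd X Y) = (N r m X + N r m Y)%R.
Proof.
by rewrite /N -rs_add; apply: rs_ext => i _; rewrite /sadd /lnorm rsumL_app; ring.
Qed.

Lemma N_slin r m g X K : (0 < r)%R -> (forall x, (wn (g x) <= K * wn x)%R) -> (N r m (slin g X) <= K * N r m X)%R.
Proof.
move=> r0 H; rewrite /N -rs_scal; apply: rs_le => i _.
rewrite -Rmult_assoc; apply: Rmult_le_compat_r; first by apply: pow_le; lra.
by rewrite /lnorm /slin rsumL_map -rsumL_scal; apply: rsumL_le => x _; exact: H.
Qed.

Lemma lnorm_filter P l : (lnorm (filter P l) <= lnorm l)%R.
Proof.
elim: l => [|x l IH] /=; first by lra.
by case: (P x) => /=; have := wn_ge0 x; rewrite /lnorm /= -/(lnorm l) -/(lnorm (filter P l)); lra.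
Qed.

Lemma N_sfil r m P X : (0 < r)%R -> (N r m (sfil P X) <= N r m X)%R.
Proof.
move=> r0; apply: rs_le => i _; apply: Rmult_le_compat_r; first by apply: pow_le; lra.
exact: lnorm_filter.
Qed.

Lemma N_ssh r m X : N r (S m) (ssh X) = (r * N r m X)%R.
Proof.
rewrite /N rs_shift {1}/lnorm /= Rmult_0_l Rplus_0_l -rs_scal.
by apply: rs_ext => i _; rewrite /=; ring.
Qed.

Lemma N_scst r m l : (N r m (scst l) <= lnorm l)%R.
Proof.
case: m => [|m]; first by rewrite /N /=; exact: lnorm_ge0.
rewrite /N rs_shift (rs_ext _ _ (fun i => 0 * 0)%R) ?rs_scal /=; last by move=> i _; rewrite /lnorm /=; ring.
lra.
Qed.

Lemma lnorm_sbil f w X Y n K : (0 <= K)%R -> (forall x y, (wn (f x y) <= K * (wn x * wn y))%R) ->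
  (forall n i, (i <= n)%nat -> (Rabs (w n i) <= 1)%R) ->
  (lnorm (sbil f w X Y n) <= K * rs (S n) (fun i => lnorm (X i) * lnorm (Y (n - i)%nat)))%R.
Proof.
move=> K0 Hf Hw; rewrite /lnorm /sbil rsumL_flat_map.
have S : forall p (g : nat -> R), rsumL g (seq 0 p) = rs p g.
  move=> p g; elim: p => [//|p IH]; rewrite seq_S rsumL_app IH /=; ring.
rewrite S -rs_scal; apply: rs_le => i Hi.
rewrite rsumL_map /lbil rsumL_flat_map -rsumL_mul -rsumL_scal.
apply: rsumL_le => x _; rewrite rsumL_map -rsumL_scal; apply: rsumL_le => y _.
apply: Rle_trans (Hf x y); rewrite {1}/wn /mscal /= Cmod_mult Cmod_R -/(wn (f x y)) /wn.
rewrite Rmult_assoc -[X in (_ <= X)%R]Rmult_1_l; apply: Rmult_le_compat_r; first exact: wn_ge0.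
by apply: Hw; lia.
Qed.

Lemma N_sbil r m f w X Y K : (0 < r)%R -> (0 <= K)%R -> (forall x y, (wn (f x y) <= K * (wn x * wn y))%R) ->
  (forall n i, (i <= n)%nat -> (Rabs (w n i) <= 1)%R) ->
  (N r m (sbil f w X Y) <= K * (N r m X * N r m Y))%R.
Proof.
move=> r0 K0 Hf Hw.
apply: Rle_trans (_ : (K * rs m (fun n => rs (S n) (fun i => (lnorm (X i) * r ^ i) * (lnorm (Y (n - i)%nat) * r ^ (n - i))))%R <= _)%R).
  rewrite /N -rs_scal; apply: rs_le => n _.
  apply: Rle_trans (Rmult_le_compat_r _ _ _ _ (lnorm_sbil f w X Y n K K0 Hf Hw)) _; first by apply: pow_le; lra.
  rewrite Rmult_assoc; apply: Rmult_le_compat_l => //; rewrite Rmult_comm -rs_scal; apply: rs_le => i Hi.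
  by rewrite {1}(_ : n = i + (n - i))%nat ?pow_add; [apply: Req_le; ring|lia].
apply: Rmult_le_compat_l => //; apply: rs_cauchy => i;
  by apply: Rmult_le_pos; [exact: lnorm_ge0|apply: pow_le; lra].
Qed.

Definition conv (r : R) (X : ser) : Prop := exists b : R, forall m, (N r m X <= b)%R.

(** * Strict operators and convergence of their fixed points *)

Section Operators.
Variables (I : Type) (lI : list I).
Hypothesis lI_full : forall i, In i lI.

Definition env : Type := I -> ser.

(* [wk]: the coefficient of rho^n depends on coefficients up to order n; [st]:
   only on those of order < n, so that iteration converges; moreover the bound
   of a strict operator is independent of that of its argument, once the radius
   [r] is small. *)
Definition wk (F : env -> ser) : Prop :=
  (forall n (Y Y' : env), (forall i k, (k <= n)%nat -> Y i k = Y' i k) -> F Y n = F Y' n) /\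
  forall b : R, (0 <= b)%R -> exists c r0 : R, [/\ (0 <= c)%R, (0 < r0 <= 1)%R &
    forall r m Y, (0 < r <= r0)%R -> (forall i, (N r m (Y i) <= b)%R) -> (N r m (F Y) <= c)%R].

Definition st (F : env -> ser) : Prop :=
  (forall n (Y Y' : env), (forall i k, (k < n)%nat -> Y i k = Y' i k) -> F Y n = F Y' n) /\
  exists c : R, (0 <= c)%R /\ forall b : R, (0 <= b)%R -> exists r0 : R, (0 < r0 <= 1)%R /\
    forall r m Y, (0 < r <= r0)%R -> (forall i, (N r m (Y i) <= b)%R) -> (N r (S m) (F Y) <= c)%R.

Lemma st_wk F : st F -> wk F.
Proof.
move=> [H [c [c0 B]]]; split=> [n Y Y' E|b b0].
  by apply: H => i k Hk; apply: E; lia.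
have [r0 [Hr H0]] := B b b0; exists c, r0; split=> // r m Y Hr' HY.
apply: Rle_trans (H0 r m Y Hr' HY); apply: N_mono; [lra|lia].
Qed.

Lemma wk_var i : wk (fun Y => Y i).
Proof.
split=> [n Y Y' E|b b0]; first by apply: E; lia.
by exists b, 1%R; split=> //; lra.
Qed.

Lemma st_cst l : st (fun=> scst l).
Proof.
split=> //; exists (lnorm l); split; first exact: lnorm_ge0.
by move=> b _; exists 1%R; split; [lra|move=> r m Y _ _; exact: N_scst].
Qed.

Lemma wk_cst l : wk (fun=> scst l).
Proof. exact/st_wk/st_cst. Qed.

Lemma wk_add F G : wk F -> wk G -> wk (fun Y => sadd (F Y) (G Y)).
Proof.
move=> [F1 F2] [G1 G2]; split=> [n Y Y' E|b b0]; first by rewrite /sadd (F1 _ _ _ E) (G1 _ _ _ E).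
have [c [r0 [c0 Hr H]]] := F2 b b0; have [c' [r0' [c0' Hr' H']]] := G2 b b0.
have M1 := Rmin_l r0 r0'; have M2 := Rmin_r r0 r0'.
exists (c + c')%R, (Rmin r0 r0'); split; [lra|split; [apply: Rmin_pos|]; lra|].
move=> r m Y Hr1 HY; rewrite N_sadd.
have := H r m Y ltac:(lra) HY; have := H' r m Y ltac:(lra) HY; lra.
Qed.

Lemma st_add F G : st F -> st G -> st (fun Y => sadd (F Y) (G Y)).
Proof.
move=> [F1 [c [c0 F2]]] [G1 [c' [c0' G2]]]; split=> [n Y Y' E|]; first by rewrite /sadd (F1 _ _ _ E) (G1 _ _ _ E).
exists (c + c')%R; split; first lra.
move=> b b0; have [r0 [Hr H]] := F2 b b0; have [r0' [Hr' H']] := G2 b b0.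
have M1 := Rmin_l r0 r0'; have M2 := Rmin_r r0 r0'.
exists (Rmin r0 r0'); split; [split; [apply: Rmin_pos|]; lra|].
move=> r m Y Hr1 HY; rewrite N_sadd.
have := H r m Y ltac:(lra) HY; have := H' r m Y ltac:(lra) HY; lra.
Qed.

Definition bounded_mono (g : mono -> mono) : Prop :=
  exists K : R, (0 <= K)%R /\ forall x, (wn (g x) <= K * wn x)%R.

Lemma wk_lin g F : bounded_mono g -> wk F -> wk (fun Y => slin g (F Y)).
Proof.
move=> [K [K0 HK]] [F1 F2]; split=> [n Y Y' E|b b0]; first by rewrite /slin (F1 _ _ _ E).
have [c [r0 [c0 Hr H]]] := F2 b b0; exists (K * c)%R, r0; split=> //; first by apply: Rmult_le_pos.
move=> r m Y Hr1 HY; apply: Rle_trans (N_slin r m g _ K _ HK) _; first lra.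
by apply: Rmult_le_compat_l => //; exact: H.
Qed.

Lemma st_lin g F : bounded_mono g -> st F -> st (fun Y => slin g (F Y)).
Proof.
move=> [K [K0 HK]] [F1 [c [c0 F2]]]; split=> [n Y Y' E|]; first by rewrite /slin (F1 _ _ _ E).
exists (K * c)%R; split; first by apply: Rmult_le_pos.
move=> b b0; have [r0 [Hr H]] := F2 b b0; exists r0; split=> //.
move=> r m Y Hr1 HY; apply: Rle_trans (N_slin r _ g _ K _ HK) _; first lra.
by apply: Rmult_le_compat_l => //; exact: H.
Qed.

Lemma wk_fil P F : wk F -> wk (fun Y => sfil P (F Y)).
Proof.
move=> [F1 F2]; split=> [n Y Y' E|b b0]; first by rewrite /sfil (F1 _ _ _ E).
have [c [r0 [c0 Hr H]]] := F2 b b0; exists c, r0; split=> // r m Y Hr1 HY.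
by apply: Rle_trans (N_sfil r m P _ _) _; [lra|exact: H].
Qed.

Lemma st_fil P F : st F -> st (fun Y => sfil P (F Y)).
Proof.
move=> [F1 [c [c0 F2]]]; split=> [n Y Y' E|]; first by rewrite /sfil (F1 _ _ _ E).
exists c; split=> // b b0; have [r0 [Hr H]] := F2 b b0; exists r0; split=> // r m Y Hr1 HY.
by apply: Rle_trans (N_sfil r _ P _ _) _; [lra|exact: H].
Qed.

(** Multiplication by rho gains a factor r in the norm. With r <= 1/(c + 1) the output is bounded by
    1, whatever bound b the argument has. *)
Lemma st_sh F : wk F -> st (fun Y => ssh (F Y)).
Proof.
move=> [F1 F2]; split=> [[//|n] Y Y' E|].
  by rewrite /= (F1 n Y Y') // => i k Hk; apply: E; lia.
exists 1%R; split; first lra.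
move=> b b0; have [c [r0 [c0 Hr H]]] := F2 b b0.
have M1 := Rmin_l r0 (/ (c + 1)); have M2 := Rmin_r r0 (/ (c + 1)).
have P : (0 < / (c + 1))%R by apply: Rinv_0_lt_compat; lra.
exists (Rmin r0 (/ (c + 1))); split; [split; [apply: Rmin_pos|]; lra|].
move=> r m Y Hr1 HY; rewrite N_ssh.
have H1 := H r m Y ltac:(lra) HY.
have : (r * N r m (F Y) <= / (c + 1) * c)%R.
  by apply: Rmult_le_compat; [lra|apply: N_ge0; lra|lra|lra].
have : (/ (c + 1) * (c + 1) = 1)%R by field; lra.
nra.
Qed.

Definition bounded_bil (f : mono -> mono -> mono) : Prop :=
  exists K : R, (0 <= K)%R /\ forall x y, (wn (f x y) <= K * (wn x * wn y))%R.

Definition contracting (w : nat -> nat -> R) : Prop :=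
  forall n i, (i <= n)%nat -> (Rabs (w n i) <= 1)%R.

Lemma flat_map_ext_in' {A B} (f g : A -> list B) l : (forall x, In x l -> f x = g x) ->
  flat_map f l = flat_map g l.
Proof.
elim: l => //= x l IH H; rewrite H ?IH //; last by left.
by move=> y Hy; apply: H; right.
Qed.

Lemma wk_bil f w F G : bounded_bil f -> contracting w -> wk F -> wk G ->
  wk (fun Y => sbil f w (F Y) (G Y)).
Proof.
move=> [K [K0 HK]] Hw [F1 F2] [G1 G2]; split=> [n Y Y' E|b b0].
  apply: flat_map_ext_in' => i /in_seq Hi; rewrite (F1 i Y Y') ?(G1 (n - i)%nat Y Y') //;
    by move=> j k Hk; apply: E; lia.
have [c [r0 [c0 Hr H]]] := F2 b b0; have [c' [r0' [c0' Hr' H']]] := G2 b b0.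
have M1 := Rmin_l r0 r0'; have M2 := Rmin_r r0 r0'.
exists (K * (c * c'))%R, (Rmin r0 r0'); split; [by do 2 apply: Rmult_le_pos => //|split; [apply: Rmin_pos|]; lra|].
move=> r m Y Hr1 HY; apply: Rle_trans (N_sbil r m f w _ _ K _ K0 HK Hw) _; first lra.
apply: Rmult_le_compat_l => //; apply: Rmult_le_compat; try (apply: N_ge0; lra).
  by apply: H => //; lra.
by apply: H' => //; lra.
Qed.

Lemma st_bil f w F G : bounded_bil f -> contracting w -> st F -> st G ->
  st (fun Y => sbil f w (F Y) (G Y)).
Proof.
move=> [K [K0 HK]] Hw [F1 [c [c0 F2]]] [G1 [c' [c0' G2]]]; split=> [n Y Y' E|].
  apply: flat_map_ext_in' => i /in_seq Hi; rewrite (F1 i Y Y') ?(G1 (n - i)%nat Y Y') //;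
    by move=> j k Hk; apply: E; lia.
exists (K * (c * c'))%R; split; first by do 2 apply: Rmult_le_pos => //.
move=> b b0; have [r0 [Hr H]] := F2 b b0; have [r0' [Hr' H']] := G2 b b0.
have M1 := Rmin_l r0 r0'; have M2 := Rmin_r r0 r0'.
exists (Rmin r0 r0'); split; [split; [apply: Rmin_pos|]; lra|].
move=> r m Y Hr1 HY; apply: Rle_trans (N_sbil r _ f w _ _ K _ K0 HK Hw) _; first lra.
apply: Rmult_le_compat_l => //; apply: Rmult_le_compat; try (apply: N_ge0; lra).
  by apply: H => //; lra.
by apply: H' => //; lra.
Qed.

Lemma wk_big {J : Type} (l : list J) (F : J -> env -> ser) : (forall j, wk (F j)) ->
  wk (fun Y => sbig l (fun j => F j Y)).
Proof. by move=> H; elim: l => [|j l IH] /=; [exact: wk_cst|exact: wk_add]. Qed.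

Lemma st_big {J : Type} (l : list J) (F : J -> env -> ser) : (forall j, st (F j)) ->
  st (fun Y => sbig l (fun j => F j Y)).
Proof. by move=> H; elim: l => [|j l IH] /=; [exact: st_cst|exact: st_add]. Qed.

(** There are finitely many components, so the constants, chosen before b, have a common bound and
    the radii a common minimum. *)
Lemma st_unif (S : env -> env) : (forall i, st (fun Y => S Y i)) ->
  exists c : R, (0 <= c)%R /\ forall b : R, (0 <= b)%R -> exists r0 : R, (0 < r0 <= 1)%R /\
    forall r m Y, (0 < r <= r0)%R -> (forall i, (N r m (Y i) <= b)%R) ->
      forall i, (N r (Datatypes.S m) (S Y i) <= c)%R.
Proof.
move=> H.
suff [c [c0 Hc]] : exists c : R, (0 <= c)%R /\ forall b : R, (0 <= b)%R -> exists r0 : R, (0 < r0 <= 1)%R /\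
    forall r m Y, (0 < r <= r0)%R -> (forall i, (N r m (Y i) <= b)%R) ->
      forall i, In i lI -> (N r (Datatypes.S m) (S Y i) <= c)%R.
  exists c; split=> // b b0; have [r0 [Hr H0]] := Hc b b0; exists r0; split=> // r m Y Hr1 HY i.
  by apply: H0.
elim: lI => [|j l [c [c0 IH]]]; first by exists 0%R; split; [lra|move=> b _; exists 1%R; split; [lra|]].
have [_ [c' [c0' H']]] := H j.
exists (Rmax c c'); have M1 := Rmax_l c c'; have M2 := Rmax_r c c'; split; first lra.
move=> b b0; have [r0 [Hr H0]] := IH b b0; have [r0' [Hr' H0']] := H' b b0.
have M3 := Rmin_l r0 r0'; have M4 := Rmin_r r0 r0'.
exists (Rmin r0 r0'); split; [split; [apply: Rmin_pos|]; lra|].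
move=> r m Y Hr1 HY i [<-|Hi].
  by apply: Rle_trans M2; apply: H0' => //; lra.
by apply: Rle_trans M1; apply: (H0 r) => //; lra.
Qed.

(** The output of a strict S is bounded by a constant known beforehand, so F is used with that
    single bound. Thus a term without a factor rho becomes strict once its argument is replaced by a
    strict expression. *)
Lemma st_comp (S : env -> env) F : (forall i, st (fun Y => S Y i)) -> wk F -> st (fun Y => F (S Y)).
Proof.
move=> HS [F1 F2]; split=> [n Y Y' E|].
  apply: F1 => i k Hk; have [H _] := HS i; apply: H => j p Hp; apply: E; lia.
have [c [c0 Hc]] := st_unif S HS; have [c' [r1 [c0' Hr1 H']]] := F2 c c0.
exists c'; split=> // b b0; have [r0 [Hr H0]] := Hc b b0.
have M1 := Rmin_l r0 r1; have M2 := Rmin_r r0 r1.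
exists (Rmin r0 r1); split; [split; [apply: Rmin_pos|]; lra|].
by move=> r m Y Hr2 HY; apply: H'; [lra|apply: H0 => //; lra].
Qed.

(* The solution exists as a formal series by strictness, and converges because
   the bound of its truncations propagates. *)
Lemma fixpoint_conv (S : env -> env) : (forall i, st (fun Y => S Y i)) ->
  exists (Y : env) (r : R), [/\ (0 < r)%R, (forall i n, Y i n = S Y i n) & forall i, conv r (Y i)].
Proof.
move=> HS; pose it k := Nat.iter k S (fun _ _ => nil).
have A n : forall k k' i j, (n <= k)%nat -> (n <= k')%nat -> (j < n)%nat -> it k i j = it k' i j.
  elim: n => [|n IH] k k' i j Hk Hk' Hj; first by lia.
  case: k Hk => [|k] Hk; first by lia.
  case: k' Hk' => [|k'] Hk'; first by lia.
  have [H _] := HS i; rewrite /= ; apply: H => i' p Hp; apply: IH; lia.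
(* Diagonal choice: the coefficient of order n no longer changes after n + 1 iterations. *)
pose Y : env := fun i n => it (Datatypes.S n) i n.
have E i n : Y i n = S Y i n.
  have [H _] := HS i; rewrite {1}/Y /=; apply: H => i' p Hp; rewrite /Y.
  by apply: (A (Datatypes.S p)); lia.
(* The radius is taken for the bound c itself: a truncation of length m bounded by c then yields one
   of length m + 1 bounded by c. *)
have [c [c0 Hc]] := st_unif S HS; have [r [Hr H]] := Hc c c0.
exists Y, r; split=> //; first lra.
move=> i; exists c => m; elim: m i => [|m IH] i; first by rewrite /N.
rewrite /N (rs_ext _ _ (fun n => lnorm (S Y i n) * r ^ n)%R); last by move=> n _; rewrite E.
by apply: H => //; lra.
Qed.
End Operators.
Arguments wk {I} F.
Arguments st {I} F.

Ltac rring := match goal with |- @eq _ ?a ?b => change (@eq R a b) end; ring.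

Lemma Cminus_eq0 (a b : C) : a - b = 0 -> a = b.
Proof. by move=> H; transitivity ((a - b) + b); [ring|rewrite H; ring]. Qed.

(** * Sums of power series with complex coefficients *)

Fixpoint cs (m : nat) (f : nat -> C) : C :=
  match m with O => 0 | S m' => cs m' f + f m' end.

Lemma Re_cs m f : Re (cs m f) = rs m (fun i => Re (f i)).
Proof. by elim: m => //= m <-. Qed.

Lemma Im_cs m f : Im (cs m f) = rs m (fun i => Im (f i)).
Proof. by elim: m => //= m <-. Qed.

Lemma cs_ext m f g : (forall i, (i < m)%nat -> f i = g i) -> cs m f = cs m g.
Proof. by elim: m => [//|m IH H] /=; rewrite IH ?H //; move=> i Hi; apply: H; lia. Qed.

Lemma cs_bound m f g : (forall i, (Cmod (f i) <= g i)%R) -> (Cmod (cs m f) <= rs m g)%R.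
Proof.
move=> H; elim: m => [|m IH] /=; first by rewrite Cmod_0; lra.
exact: Cmod_plus_le.
Qed.

Lemma cs_diff_bound m p f g : (m <= p)%nat -> (forall i, (Cmod (f i) <= g i)%R) ->
  (Cmod (cs p f - cs m f) <= rs p g - rs m g)%R.
Proof.
move=> Hm H; elim: Hm => [|q _ IH] /=.
  by rewrite (_ : _ - _ = 0) ?Cmod_0; [lra|ring].
rewrite (_ : _ - _ = (cs q f - cs m f) + f q); last by ring.
by apply: Rle_trans (Cmod_plus_le _ _ _ _ IH (H q)) _; lra.
Qed.

Lemma csumL_seq f m : csumL f (seq 0 m) = cs m f.
Proof. elim: m => [//|m IH]; rewrite seq_S csumL_app IH /=; ring. Qed.

Lemma rs_sum_n f m : sum_n f m = rs (S m) f.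
Proof.
elim: m => [|m IH]; first by rewrite sum_O /= Rplus_0_l.
by rewrite sum_Sn IH.
Qed.

Lemma rs_sum_f f m : sum_f_R0 f m = rs (S m) f.
Proof. by rewrite -sum_n_Reals rs_sum_n. Qed.

Lemma ex_series_bounded (a : nat -> R) (b : R) : (forall n, (0 <= a n)%R) ->
  (forall m, (rs m a <= b)%R) -> ex_series a.
Proof.
move=> a0 H; have [l Hl] : ex_finite_lim_seq (sum_n a).
  apply: (ex_finite_lim_seq_incr _ b) => n; rewrite !rs_sum_n; last exact: H.
  by rewrite [X in (_ <= X)%R]/=; have := a0 (S n); rewrite /=; lra.
by exists l.
Qed.

Definition asum (c : nat -> C) (x : R) : Prop :=
  ex_series (fun n => Rabs (Re (c n) * x ^ n)) /\ ex_series (fun n => Rabs (Im (c n) * x ^ n)).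

Definition bsum (c : nat -> C) (x b : R) : Prop :=
  forall m, (rs m (fun n => Cmod (c n) * Rabs x ^ n) <= b)%R.

Lemma Rabs_Re_pow (z : C) x n : (Rabs (Re z * x ^ n) <= Cmod z * Rabs x ^ n)%R.
Proof.
rewrite Rabs_mult -RPow_abs; apply: Rmult_le_compat_r; last exact: re_le_Cmod.
by apply: pow_le; exact: Rabs_pos.
Qed.

Lemma Rabs_Im_pow (z : C) x n : (Rabs (Im z * x ^ n) <= Cmod z * Rabs x ^ n)%R.
Proof.
rewrite Rabs_mult -RPow_abs; apply: Rmult_le_compat_r; last exact: im_le_Cmod.
by apply: pow_le; exact: Rabs_pos.
Qed.

Lemma bsum_asum c x b : bsum c x b -> asum c x.
Proof.
move=> H; split; apply: (ex_series_bounded _ b) => [n|m]; try exact: Rabs_pos;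
  apply: Rle_trans (H m); apply: rs_le => i _; [exact: Rabs_Re_pow|exact: Rabs_Im_pow].
Qed.

(* The sum of a power series with complex coefficients at a real point. *)
Definition CS (c : nat -> C) (x : R) : C :=
  (PSeries (fun n => Re (c n)) x, PSeries (fun n => Im (c n)) x).

Lemma is_series_rs (a : nat -> R) (l : R) : is_series a l ->
  forall eps, (0 < eps)%R -> exists P, forall p, (P <= p)%nat -> (Rabs (rs p a - l) < eps)%R.
Proof.
move=> /filterlim_locally H eps Heps; have [P HP] := H (mkposreal eps Heps).
exists (S P) => -[|p] Hp; first by lia.
by rewrite -rs_sum_n; apply: HP; lia.
Qed.

Lemma asum_series c x : asum c x -> is_series (fun n => Re (c n) * x ^ n)%R (Re (CS c x)) /\
  is_series (fun n => Im (c n) * x ^ n)%R (Im (CS c x)).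
Proof. by move=> [A B]; split; apply: Series_correct; apply: ex_series_Rabs. Qed.

Definition cterm (c : nat -> C) (x : R) : nat -> C := fun n => RtoC (x ^ n) * c n.

Lemma CS_lim c x : asum c x -> forall eps, (0 < eps)%R ->
  exists P, forall p, (P <= p)%nat -> (Cmod (cs p (cterm c x) - CS c x) < eps)%R.
Proof.
move=> /asum_series [/is_series_rs A /is_series_rs B] eps Heps.
have [P HP] := A (eps / 2)%R ltac:(lra); have [Q HQ] := B (eps / 2)%R ltac:(lra).
exists (P + Q)%nat => p Hp; apply: Rle_lt_trans (Cmod_le_abs _) _.
have := HP p ltac:(lia); have := HQ p ltac:(lia).
rewrite Re_minus Im_minus Re_cs Im_cs.
rewrite (rs_ext _ (fun i => Re (cterm c x i)) (fun n => Re (c n) * x ^ n)%R); last first.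
  by move=> i _; rewrite /cterm Re_mult /=; ring.
rewrite (rs_ext _ (fun i => Im (cterm c x i)) (fun n => Im (c n) * x ^ n)%R); last first.
  by move=> i _; rewrite /cterm Im_mult /=; ring.
lra.
Qed.

Lemma CS_ext c d x : (forall n, c n = d n) -> CS c x = CS d x.
Proof. by move=> E; rewrite /CS; congr (_, _); apply: Series_ext => n; rewrite E. Qed.

Lemma is_series_CS c x u v : is_series (fun n => Re (c n) * x ^ n)%R u ->
  is_series (fun n => Im (c n) * x ^ n)%R v -> CS c x = (u, v).
Proof. by move=> A B; rewrite /CS /PSeries; congr (_, _); exact: is_series_unique. Qed.

Lemma CS_plus c d x : asum c x -> asum d x -> CS (fun n => c n + d n) x = CS c x + CS d x.
Proof.
move=> /asum_series [A B] /asum_series [P Q]; apply: is_series_CS.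
  apply: is_series_ext (is_series_plus _ _ _ _ A P) => n; by rewrite Re_plus Rmult_plus_distr_r.
apply: is_series_ext (is_series_plus _ _ _ _ B Q) => n; by rewrite Im_plus Rmult_plus_distr_r.
Qed.

Lemma CS_mult c d x : asum c x -> asum d x ->
  CS (fun n => cs (S n) (fun i => c i * d (n - i)%nat)) x = CS c x * CS d x.
Proof.
move=> Hc Hd; have [A B] := asum_series _ _ Hc; have [P Q] := asum_series _ _ Hd.
case: Hc => A' B'; case: Hd => P' Q'.
have AP := is_series_mult _ _ _ _ A P A' P'; have BQ := is_series_mult _ _ _ _ B Q B' Q'.
have AQ := is_series_mult _ _ _ _ A Q A' Q'; have BP := is_series_mult _ _ _ _ B P B' P'.
have T u v n : sum_f_R0 (fun k => u k * x ^ k * (v (n - k)%nat * x ^ (n - k)))%R n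
   = (x ^ n * rs (S n) (fun k => u k * v (n - k)%nat))%R.
  rewrite rs_sum_f -rs_scal; apply: rs_ext => i Hi.
  have -> : (x ^ n = x ^ i * x ^ (n - i))%R by rewrite -pow_add; congr pow; lia.
  by ring.
apply: is_series_CS.
  apply: is_series_ext (is_series_minus _ _ _ _ AP BQ) => n.
  transitivity (x ^ n * rs (S n) (fun k => Re (c k) * Re (d (n - k)%nat)) - x ^ n * rs (S n) (fun k => Im (c k) * Im (d (n - k)%nat)))%R.
    by rewrite -(T (fun k => Re (c k)) (fun k => Re (d k))) -(T (fun k => Im (c k)) (fun k => Im (d k))).
  rewrite Re_cs (rs_ext _ (fun i => Re (c i * d (n - i)%nat))
    (fun i => Re (c i) * Re (d (n - i)%nat) + (-1) * (Im (c i) * Im (d (n - i)%nat)))%R);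
    last by move=> i _; rewrite Re_mult; ring.
  by rewrite rs_add rs_scal; rring.
apply: is_series_ext (is_series_plus _ _ _ _ AQ BP) => n.
transitivity (x ^ n * rs (S n) (fun k => Re (c k) * Im (d (n - k)%nat)) + x ^ n * rs (S n) (fun k => Im (c k) * Re (d (n - k)%nat)))%R.
  by rewrite -(T (fun k => Re (c k)) (fun k => Im (d k))) -(T (fun k => Im (c k)) (fun k => Re (d k))).
rewrite Im_cs (rs_ext _ (fun i => Im (c i * d (n - i)%nat))
  (fun i => Re (c i) * Im (d (n - i)%nat) + (Im (c i) * Re (d (n - i)%nat)))%R);
  last by move=> i _; rewrite Im_mult; ring.
by rewrite rs_add; rring.
Qed.

Lemma CS_scal (k : C) c x : asum c x -> CS (fun n => k * c n) x = k * CS c x.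
Proof.
move=> /asum_series [A B].
have S u v := is_series_plus _ _ _ _ (is_series_scal u _ _ A) (is_series_scal v _ _ B).
rewrite (is_series_CS (fun n => k * c n) x (Re k * Re (CS c x) + - Im k * Im (CS c x))%R
  (Im k * Re (CS c x) + Re k * Im (CS c x))%R).
- apply: Ceq.
    by change (Re k * Re (CS c x) + - Im k * Im (CS c x) = Re (k * CS c x))%R; rewrite Re_mult; ring.
  by change (Im k * Re (CS c x) + Re k * Im (CS c x) = Im (k * CS c x))%R; rewrite Im_mult; ring.
- by apply: is_series_ext (S (Re k) (- Im k)%R) => n; rewrite Re_mult /plus /scal /= /mult /=; rring.
- by apply: is_series_ext (S (Im k) (Re k)) => n; rewrite Im_mult /plus /scal /= /mult /=; rring.
Qed.

Lemma CS_shift c x : CS (fun n => match n with O => 0 | S n' => c n' end) x = x * CS c x.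
Proof.
have E (f : C -> R) : f 0 = 0%R ->
   PSeries (fun n => f (match n with O => 0 | S n' => c n' end)) x = (x * PSeries (fun n => f (c n)) x)%R.
  by move=> f0; rewrite -PSeries_incr_1; apply: PSeries_ext => -[|n].
by apply: Ceq; rewrite ?Re_mult ?Im_mult /CS /= E //; ring.
Qed.

Lemma CS_cst (k : C) x : CS (fun n => match n with O => k | S _ => 0 end) x = k.
Proof.
have E (f : C -> R) : f 0 = 0%R ->
   PSeries (fun n => f (match n with O => k | S _ => 0 end)) x = f k.
  move=> f0; rewrite /PSeries; apply: is_series_unique.
  rewrite -[X in is_series _ X]Rplus_0_r.
  apply: is_series_decr_1; rewrite /plus /opp /= Rmult_1_r (_ : f k + 0 + - f k = 0)%R; last by ring.
  apply: (is_series_ext (fun=> 0%R)); first by move=> n; rewrite f0; rring.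
  apply: filterlim_ext (filterlim_const 0%R) => n.
  by elim: n => [|n IH]; rewrite ?sum_O ?sum_Sn // -IH /plus /= Rplus_0_r.
by apply: Ceq; rewrite /CS /= E.
Qed.

Lemma CS_conj c x : CS (fun n => Cconj (c n)) x = Cconj (CS c x).
Proof. by apply: Ceq => //; rewrite /CS /= -PSeries_opp. Qed.

Lemma CS_at0 c : CS c 0 = c 0%nat.
Proof. by apply: Ceq; rewrite /CS /= PSeries_0. Qed.

Lemma rs_bounded_lim (x : nat -> R) (b : R) : (forall n, (0 <= x n)%R) -> (forall m, (rs m x <= b)%R) ->
  exists B : R, (forall m, (rs m x <= B)%R) /\ forall eps, (0 < eps)%R -> exists P, forall p, (P <= p)%nat -> (B - rs p x < eps)%R.
Proof.
move=> x0 H; have [l Hl] := ex_series_bounded _ _ x0 H; have Hl' := is_series_rs _ _ Hl.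
have U m : (rs m x <= l)%R.
  apply: Rnot_lt_le => Hm; have [P HP] := Hl' (rs m x - l)%R ltac:(lra).
  have := HP (P + m)%nat ltac:(lia); have := rs_mono m (P + m) x x0 ltac:(lia).
  by move=> Hmono; rewrite Rabs_pos_eq; lra.
exists l; split=> // eps Heps; have [P HP] := Hl' _ Heps; exists P => p Hp.
have := HP p Hp; have Up := U p; rewrite Rabs_minus_sym Rabs_pos_eq; lra.
Qed.

(** The majorant alone bounds the tail, hence uniformly in any parameter on which the coefficients
    depend; continuity and termwise integration rest on this. *)
Lemma CS_tail c x (y : nat -> R) (B : R) : (forall n, (Cmod (c n) * Rabs x ^ n <= y n)%R) ->
  (forall m, (rs m y <= B)%R) -> forall m, (Cmod (CS c x - cs m (cterm c x)) <= B - rs m y)%R.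
Proof.
move=> Hy HB m; apply: Rnot_lt_le => H.
have As : asum c x.
  by apply: (bsum_asum _ _ B) => p; apply: Rle_trans (HB p); apply: rs_le => i _; exact: Hy.
have [P HP] := CS_lim c x As (Cmod (CS c x - cs m (cterm c x)) - (B - rs m y))%R ltac:(lra).
have H1 := HP (P + m)%nat ltac:(lia).
have H2 : (Cmod (cs (P + m) (cterm c x) - cs m (cterm c x)) <= rs (P + m) y - rs m y)%R.
  apply: cs_diff_bound; first by lia.
  by move=> i; rewrite /cterm Cmod_mult Cmod_R -RPow_abs Rmult_comm.
have H3 := HB (P + m)%nat.
have := Cmod_triangle (CS c x - cs (P + m) (cterm c x)) (cs (P + m) (cterm c x) - cs m (cterm c x)).
rewrite (_ : _ + _ = CS c x - cs m (cterm c x)); last by ring.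
rewrite (Cmod_subC (CS c x) (cs (P + m) _)); lra.
Qed.

Lemma CS_bound c x (y : nat -> R) (B : R) : (forall n, (Cmod (c n) * Rabs x ^ n <= y n)%R) ->
  (forall m, (rs m y <= B)%R) -> (Cmod (CS c x) <= B)%R.
Proof.
move=> Hy HB; have := CS_tail c x y B Hy HB 0%nat; rewrite /= Rminus_0_r.
by rewrite (_ : CS c x - 0 = CS c x) //; ring.
Qed.

Lemma ccont_cs m (f : nat -> R -> C) : (forall n, ccont (f n)) -> ccont (fun t => cs m (fun n => f n t)).
Proof. by move=> H; elim: m => [|m IH] /=; [exact: ccont_const|exact: ccont_plus]. Qed.

Lemma cint_cs m (f : nat -> R -> C) : (forall n, ccont (f n)) ->
  cint (fun t => cs m (fun n => f n t)) = cs m (fun n => cint (f n)).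
Proof.
move=> H; elim: m => [|m IH] /=; first by rewrite cint_const; ring.
by rewrite cint_plus ?IH //; exact: ccont_cs.
Qed.

Lemma CS_ccont (c : R -> nat -> C) x (y : nat -> R) (b : R) :
  (forall n, ccont (fun t => c t n)) -> (forall t n, (Cmod (c t n) * Rabs x ^ n <= y n)%R) ->
  (forall n, (0 <= y n)%R) -> (forall m, (rs m y <= b)%R) ->
  ccont (fun t => CS (c t) x).
Proof.
move=> Cc Hy y0 Hb; have [B [HB HB']] := rs_bounded_lim y b y0 Hb.
apply/ccont_epsP => t eps Heps; have [P HP] := HB' (eps / 3)%R ltac:(lra).
have Cp : ccont (fun t => cs P (cterm (c t) x)).
  by apply: (ccont_cs P (fun n t => RtoC (x ^ n) * c t n)) => n; exact: ccont_scal.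
have [d [d0 Hd]] := proj2 (ccont_epsP _) Cp t (eps / 3)%R ltac:(lra).
exists d; split=> // s /Hd H.
have T1 := CS_tail (c s) x y B (Hy s) HB P; have T2 := CS_tail (c t) x y B (Hy t) HB P.
have T3 := HP P (Nat.le_refl P).
rewrite (_ : _ - _ = (CS (c s) x - cs P (cterm (c s) x)) + (cs P (cterm (c s) x) - cs P (cterm (c t) x))
   + - (CS (c t) x - cs P (cterm (c t) x))); last by ring.
have := Cmod_plus_le _ _ _ _ (Cmod_plus_le _ _ _ _ T1 (Rlt_le _ _ H)) (Rle_trans _ _ _ (Req_le _ _ (Cmod_opp _)) T2).
move=> X; apply: Rle_lt_trans X _; lra.
Qed.

(** Both sides are compared with the same truncation; the two errors are at most 2 pi times the tail
    of the majorant. *)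
Lemma cint_CS (c : R -> nat -> C) x (y : nat -> R) (b : R) :
  (forall n, ccont (fun t => c t n)) -> (forall t n, (Cmod (c t n) * Rabs x ^ n <= y n)%R) ->
  (forall n, (0 <= y n)%R) -> (forall m, (rs m y <= b)%R) ->
  cint (fun t => CS (c t) x) = CS (fun n => cint (fun t => c t n)) x.
Proof.
move=> Cc Hy y0 Hb; have [B [HB HB']] := rs_bounded_lim y b y0 Hb.
have CC := CS_ccont c x y b Cc Hy y0 Hb.
have TP := two_PI_pos.
have Hy' n : (Cmod (cint (fun t => c t n)) * Rabs x ^ n <= 2 * PI * y n)%R.
  rewrite -[(Rabs x ^ n)%R]Rabs_pos_eq; last by apply: pow_le; exact: Rabs_pos.
  rewrite -Cmod_R Rmult_comm -Cmod_mult -cint_scal //; apply: cint_bound; first exact: ccont_scal.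
  move=> t; rewrite Cmod_mult Cmod_R Rabs_pos_eq 1?Rmult_comm //.
  by apply: pow_le; exact: Rabs_pos.
have HB2 m : (rs m (fun n => 2 * PI * y n) <= 2 * PI * B)%R.
  by rewrite rs_scal; apply: Rmult_le_compat_l => //; lra.
have E : forall eps, (0 < eps)%R -> (Cmod (cint (fun t => CS (c t) x) - CS (fun n => cint (fun t => c t n)) x) <= eps)%R.
  move=> eps Heps; have [P HP] := HB' (eps / (4 * PI))%R ltac:(apply: Rdiv_lt_0_compat; lra).
  have {}HP := HP P (Nat.le_refl P).
  have T2 := CS_tail (fun n => cint (fun t => c t n)) x _ _ Hy' HB2 P.
  rewrite rs_scal in T2.
  have Cp : forall n, ccont (fun t => RtoC (x ^ n) * c t n) by move=> n; exact: ccont_scal.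
  have T1 : (Cmod (cint (fun t => CS (c t) x) - cs P (cterm (fun n => cint (fun t => c t n)) x)) <= 2 * PI * (B - rs P y))%R.
    have -> : cs P (cterm (fun n => cint (fun t => c t n)) x) = cint (fun t => cs P (cterm (c t) x)).
      rewrite (cint_cs P (fun n t => RtoC (x ^ n) * c t n)) //; apply: cs_ext => i _.
      by rewrite cint_scal.
    have CP : ccont (fun t => cs P (cterm (c t) x)) by exact: (ccont_cs P (fun n t => RtoC (x ^ n) * c t n)).
    rewrite -cint_minus //; apply: cint_bound => [|t]; last exact: CS_tail.
    by apply: ccont_ext (ccont_plus _ _ CC (ccont_scal (- (1)) _ CP)) => s; ring.
  rewrite (_ : _ - _ = (cint (fun t => CS (c t) x) - cs P (cterm (fun n => cint (fun t => c t n)) x))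
    + - (CS (fun n => cint (fun t => c t n)) x - cs P (cterm (fun n => cint (fun t => c t n)) x))); last by ring.
  have := Cmod_plus_le _ _ _ _ T1 (Rle_trans _ _ _ (Req_le _ _ (Cmod_opp _)) T2).
  move=> X; apply: Rle_trans X _.
  have : (2 * PI * (B - rs P y) <= eps / 2)%R.
    apply: Rle_trans (_ : 2 * PI * (eps / (4 * PI)) <= _)%R; last by apply: Req_le; field; lra.
    by apply: Rmult_le_compat_l; lra.
  lra.
have Z : Cmod (cint (fun t => CS (c t) x) - CS (fun n => cint (fun t => c t n)) x) = 0%R.
  apply: Rle_antisym (Cmod_ge_0 _); apply: Rnot_lt_le => H.
  by have := E _ (Rmult_lt_0_compat _ _ H (Rinv_0_lt_compat 2 ltac:(lra))); lra.
exact/Cminus_eq0/Cmod_eq_0.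
Qed.

Lemma bsum_CV (c : nat -> C) (r b : R) : (0 < r)%R -> bsum c r b ->
  Rbar_le r (CV_radius (fun n => Re (c n))) /\ Rbar_le r (CV_radius (fun n => Im (c n))).
Proof.
move=> r0 H.
have K n : (Cmod (c n) * Rabs r ^ n <= b)%R.
  apply: Rle_trans (H (S n)); rewrite /= -[X in (X <= _)%R]Rplus_0_l; apply: Rplus_le_compat_r.
  by apply: rs_ge0 => i; apply: Rmult_le_pos; [exact: Cmod_ge_0|apply: pow_le; exact: Rabs_pos].
split; [have [U _] := CV_radius_bounded (fun n => Re (c n))|have [U _] := CV_radius_bounded (fun n => Im (c n))];
  apply: U; exists b => n; apply: Rle_trans (K n); [exact: Rabs_Re_pow|exact: Rabs_Im_pow].
Qed.

Definition cderiv (c : nat -> C) : nat -> C := fun n => RtoC (INR (S n)) * c (S n).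

Lemma CS_cder (c : nat -> C) (r b x : R) : bsum c r b -> (Rabs x < r)%R ->
  cder (CS c) x (CS (cderiv c) x) /\ asum (cderiv c) x.
Proof.
move=> H Hx; have r0 : (0 < r)%R by have := Rabs_pos x; lra.
have [A B] := bsum_CV c r b r0 H.
have A' : Rbar_lt (Rabs x) (CV_radius (fun n => Re (c n))) by exact: Rbar_lt_le_trans A.
have B' : Rbar_lt (Rabs x) (CV_radius (fun n => Im (c n))) by exact: Rbar_lt_le_trans B.
have Er n : Re (cderiv c n) = PS_derive (fun n => Re (c n)) n.
  by change (INR (S n) * Re (c (S n)) - 0 * Im (c (S n)) = INR (S n) * Re (c (S n)))%R; ring.
have Ei n : Im (cderiv c n) = PS_derive (fun n => Im (c n)) n.
  by change (INR (S n) * Im (c (S n)) + 0 * Re (c (S n)) = INR (S n) * Im (c (S n)))%R; ring.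
split.
  split; [apply: is_derive_eq (is_derive_PSeries _ _ A')|apply: is_derive_eq (is_derive_PSeries _ _ B')].
    exact: (PSeries_ext _ _ _ (fun n => esym (Er n))).
  exact: (PSeries_ext _ _ _ (fun n => esym (Ei n))).
split; [apply: (ex_series_ext (fun n => Rabs (PS_derive (fun n => Re (c n)) n * x ^ n)))
       |apply: (ex_series_ext (fun n => Rabs (PS_derive (fun n => Im (c n)) n * x ^ n)))];
  try (by move=> n; rewrite ?Er ?Ei); by apply: CV_disk_inside; rewrite CV_radius_derive.
Qed.

Lemma cder_Cexp z t l : cder z t l -> cder (fun s => Cexp (z s)) t (l * Cexp (z t)).
Proof.
move=> [A B].
have E : is_derive (fun s => exp (Re (z s))) t (Re l * exp (Re (z t)))%R.
  by apply: (is_derive_comp exp (fun s => Re (z s))) => //; exact: is_derive_exp.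
have K : is_derive (fun s => cos (Im (z s))) t (Im l * - sin (Im (z t)))%R.
  by apply: (is_derive_comp cos (fun s => Im (z s))) => //; exact: is_derive_cos.
have S : is_derive (fun s => sin (Im (z s))) t (Im l * cos (Im (z t)))%R.
  by apply: (is_derive_comp sin (fun s => Im (z s))) => //; exact: is_derive_sin.
split.
  apply: (is_derive_ext (fun s => exp (Re (z s)) * cos (Im (z s)))%R).
    by move=> s; rewrite /Cexp Re_mult /=; ring.
  by apply: is_derive_eq (is_derive_Rmult _ _ _ _ _ E K); rewrite Re_mult /Cexp Re_mult Im_mult /=; ring.
apply: (is_derive_ext (fun s => exp (Re (z s)) * sin (Im (z s)))%R).
  by move=> s; rewrite /Cexp Im_mult /=; ring.
by apply: is_derive_eq (is_derive_Rmult _ _ _ _ _ E S); rewrite Im_mult /Cexp Re_mult Im_mult /=; ring.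
Qed.

Lemma cder_Csin z t l : cder z t l -> cder (fun s => Csin (z s)) t (l * Ccos (z t)).
Proof.
move=> H; have H1 := cder_Cexp _ _ _ (cder_scal Ci _ _ _ H).
have H2 := cder_Cexp _ _ _ (cder_opp _ _ _ (cder_scal Ci _ _ _ H)).
apply: (cder_ext (fun s => / (2 * Ci) * (Cexp (Ci * z s) - Cexp (- (Ci * z s))))).
  by move=> s; rewrite /Csin; cfield.
by apply: cder_eq (cder_scal _ _ _ _ (cder_minus _ _ _ _ _ H1 H2)); rewrite /Ccos; cfield.
Qed.

Lemma cder_Ccos z t l : cder z t l -> cder (fun s => Ccos (z s)) t (- (l * Csin (z t))).
Proof.
move=> H; have H1 := cder_Cexp _ _ _ (cder_scal Ci _ _ _ H).
have H2 := cder_Cexp _ _ _ (cder_opp _ _ _ (cder_scal Ci _ _ _ H)).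
apply: (cder_ext (fun s => / 2 * (Cexp (Ci * z s) + Cexp (- (Ci * z s))))).
  by move=> s; rewrite /Ccos; cfield.
apply: cder_eq (cder_scal _ _ _ _ (cder_plus _ _ _ _ _ H1 H2)); rewrite /Csin.
move: (Cexp (Ci * z t)) (Cexp (- (Ci * z t))) => x y.
rewrite (_ : - (l * ((x - y) / (2 * Ci))) = - (l * ((x - y) * (Ci / (2 * (Ci * Ci)))))); last by cfield.
by rewrite Ci_sqr; cfield.
Qed.

(** * Evaluation of series at a point *)

Definition ann (z : C) : Prop := (/ 4 <= Cmod z <= 4)%R.
Definition supp (P : Z -> Prop) (X : ser) : Prop := forall n, lsupp P (X n).
Definition nonneg (e : Z) : Prop := (0 <= e)%Z.
(** Where the norm controls the values of X. The second alternative serves the kernels, which have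
    no negative exponents and are evaluated near 0. *)
Definition OK (z : C) (X : ser) : Prop := ann z \/ ((Cmod z <= 4)%R /\ supp nonneg X).

Definition val (X : ser) (x : R) (z : C) : C := CS (fun n => lev (X n) z) x.

Lemma ann_neq0 z : ann z -> z <> 0.
Proof. by move=> [H _] E; move: H; rewrite E Cmod_0; lra. Qed.

Lemma OK_lev z X n : OK z X -> (Cmod (lev (X n) z) <= lnorm (X n))%R.
Proof. by move=> [H|[H1 H2]]; apply: lev_bound; [left|right; split=> //; exact: H2]. Qed.

Lemma lev_dom z X r m x : OK z X -> (Rabs x <= r)%R ->
  (rs m (fun n => Cmod (lev (X n) z) * Rabs x ^ n) <= N r m X)%R.
Proof.
move=> H Hx; apply: rs_le => i _; apply: Rmult_le_compat; first exact: Cmod_ge_0.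
- by apply: pow_le; exact: Rabs_pos.
- exact: OK_lev.
- by apply: pow_incr; split=> //; exact: Rabs_pos.
Qed.

Lemma conv_bsum z X r x : OK z X -> conv r X -> (Rabs x <= r)%R ->
  exists b, bsum (fun n => lev (X n) z) x b.
Proof. by move=> H [b Hb] Hx; exists b => m; apply: Rle_trans (lev_dom _ _ _ _ _ H Hx) (Hb m). Qed.

Lemma conv_asum z X r x : OK z X -> conv r X -> (Rabs x <= r)%R -> asum (fun n => lev (X n) z) x.
Proof. by move=> H K Hx; have [b /bsum_asum] := conv_bsum z X r x H K Hx. Qed.

Lemma lev_app l1 l2 z : lev (l1 ++ l2) z = lev l1 z + lev l2 z.
Proof. exact: csumL_app. Qed.

Definition mmul (x y : mono) : mono := (x.1 * y.1, (x.2 + y.2)%Z).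

Lemma lev_lbil_mmul l1 l2 z :
  (forall x y, In x l1 -> In y l2 -> zpow z (x.2 + y.2) = zpow z x.2 * zpow z y.2) ->
  lev (lbil mmul l1 l2) z = lev l1 z * lev l2 z.
Proof.
move=> H; rewrite /lev /lbil csumL_flat_map -csumL_mul; apply: csumL_ext => x Hx.
by rewrite csumL_map; apply: csumL_ext => y Hy; rewrite /= H //; ring.
Qed.

Lemma lev_map_mscal c l z : lev (map (mscal c) l) z = c * lev l z.
Proof. by rewrite /lev csumL_map -csumL_scal; apply: csumL_ext => x _; rewrite /=; ring. Qed.

Lemma lev_sbil_mmul w X Y z n : OK z X -> OK z Y ->
  lev (sbil mmul w X Y n) z = cs (S n) (fun i => RtoC (w n i) * (lev (X i) z * lev (Y (n - i)%nat) z)).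
Proof.
move=> HX HY; rewrite /sbil /lev csumL_flat_map csumL_seq; apply: cs_ext => i _.
rewrite -/(lev _ z) lev_map_mscal lev_lbil_mmul // => x y Hx Hy.
case: HX => [H|[_ HX]]; first by apply: zpow_add; exact: ann_neq0.
case: HY => [H|[_ HY]]; first by apply: zpow_add; exact: ann_neq0.
by apply: zpow_add_nonneg; [exact: (HX i)|exact: (HY (n - i)%nat)].
Qed.

Lemma supp_sbil P Q S f w X Y : (forall x y, P x.2 -> Q y.2 -> S (f x y).2) ->
  supp P X -> supp Q Y -> supp S (sbil f w X Y).
Proof.
move=> H HX HY n x /in_flat_map [i [_ /in_map_iff [y [<- /in_flat_map [a [Ha /in_map_iff [b [<- Hb]]]]]]]].
by apply: H; [exact: (HX i)|exact: (HY (n - i)%nat)].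
Qed.

Lemma supp_sadd P X Y : supp P X -> supp P Y -> supp P (sadd X Y).
Proof. by move=> HX HY n x /in_app_iff [/HX|/HY]. Qed.

Lemma supp_ssh P X : supp P X -> supp P (ssh X).
Proof. by move=> H [|n] // x /H. Qed.

Lemma supp_scst P l : lsupp P l -> supp P (scst l).
Proof. by move=> H [|n] // x. Qed.

Lemma supp_slin P Q g X : (forall x, P x.2 -> Q (g x).2) -> supp P X -> supp Q (slin g X).
Proof. by move=> H HX n x /in_map_iff [y [<- /HX /H]]. Qed.

Lemma supp_sfil P (b : Z -> bool) X : supp P X -> supp (fun e => P e /\ b e) (sfil b X).
Proof. by move=> H n x /filter_In [/H]. Qed.

Lemma supp_sub (P Q : Z -> Prop) X : (forall e, P e -> Q e) -> supp P X -> supp Q X.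
Proof. by move=> H HX n x /HX /H. Qed.

Lemma OK_sub z X Y : (supp nonneg X -> supp nonneg Y) -> OK z X -> OK z Y.
Proof. by move=> H [|[H1 H2]]; [left|right; split=> //; exact: H]. Qed.

Lemma OK_sub2 z X Y W : (supp nonneg X -> supp nonneg Y -> supp nonneg W) -> OK z X -> OK z Y -> OK z W.
Proof.
move=> H [|[H1 H2]]; first by left.
by move=> [|[H1' H2']]; [left|right; split=> //; exact: H].
Qed.

Lemma OK_smul z w X Y : OK z X -> OK z Y -> OK z (sbil mmul w X Y).
Proof. by apply: OK_sub2; apply: supp_sbil; rewrite /nonneg => p q /=; lia. Qed.

(** Convergence, admissibility of z and value in one predicate: the value of an expression in series
    is then obtained by following its syntax. *)
Definition hv (r x : R) (z : C) (X : ser) (v : C) : Prop :=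
  [/\ conv r X, OK z X & val X x z = v].

Definition smul (X Y : ser) : ser := sbil mmul (fun _ _ => 1%R) X Y.
(** The numerator is the factor produced by differentiating rho X at order n - i. The denominator is
    the one produced by integration at order n + 2, where the double shift in [tan_eq] places the
    product. *)
Definition w2 (n i : nat) : R := (INR (S (n - i)) / INR (n + 3))%R.

Lemma w2_contracting : contracting w2.
Proof.
move=> n i Hi; rewrite /w2.
have P : (0 < INR (n + 3))%R by apply: lt_0_INR; lia.
have Q : (0 <= INR (S (n - i)))%R by exact: pos_INR.
have L : (INR (S (n - i)) <= INR (n + 3))%R by apply: le_INR; lia.
rewrite Rabs_pos_eq; last by apply: Rmult_le_pos => //; apply: Rlt_le; exact: Rinv_0_lt_compat.
by apply: (Rmult_le_reg_r (INR (n + 3))) => //; rewrite /Rdiv Rmult_assoc Rinv_l; lra.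
Qed.

Lemma one_contracting : contracting (fun _ _ => 1%R).
Proof. by move=> n i _; rewrite Rabs_R1; lra. Qed.

Lemma mmul_bounded : bounded_bil mmul.
Proof.
exists 1%R; split; first lra; move=> x y; rewrite /wn /mmul /= Cmod_mult Rmult_1_l.
have := wt_add x.2 y.2 => H.
rewrite (_ : Cmod x.1 * wt x.2 * (Cmod y.1 * wt y.2) = Cmod x.1 * Cmod y.1 * (wt x.2 * wt y.2))%R; last by ring.
by apply: Rmult_le_compat_l => //; apply: Rmult_le_pos; exact: Cmod_ge_0.
Qed.

Lemma conv_sadd r X Y : conv r X -> conv r Y -> conv r (sadd X Y).
Proof. by move=> [a A] [b B]; exists (a + b)%R => m; rewrite N_sadd; have := A m; have := B m; lra. Qed.

Lemma conv_ssh r X : (0 < r)%R -> conv r X -> conv r (ssh X).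
Proof.
move=> r0 [a A]; exists (r * a)%R => m; apply: Rle_trans (_ : N r (S m) (ssh X) <= _)%R.
  by apply: N_mono => //; lia.
by rewrite N_ssh; apply: Rmult_le_compat_l; [lra|].
Qed.

Lemma conv_scst r l : conv r (scst l).
Proof. by exists (lnorm l) => m; exact: N_scst. Qed.

Lemma conv_slin r g X : (0 < r)%R -> bounded_mono g -> conv r X -> conv r (slin g X).
Proof.
move=> r0 [K [K0 HK]] [a A]; exists (K * a)%R => m; apply: Rle_trans (N_slin r m g X K r0 HK) _.
exact: Rmult_le_compat_l.
Qed.

Lemma conv_sfil r P X : (0 < r)%R -> conv r X -> conv r (sfil P X).
Proof. by move=> r0 [a A]; exists a => m; apply: Rle_trans (N_sfil r m P X r0) (A m). Qed.

Lemma conv_sbil r f w X Y : (0 < r)%R -> bounded_bil f -> contracting w -> conv r X -> conv r Y ->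
  conv r (sbil f w X Y).
Proof.
move=> r0 [K [K0 HK]] Hw [a A] [b B]; exists (K * (a * b))%R => m.
apply: Rle_trans (N_sbil r m f w X Y K r0 K0 HK Hw) _.
by apply: Rmult_le_compat_l => //; apply: Rmult_le_compat => //; exact: N_ge0.
Qed.

Section Values.
Variables (r x : R) (z : C).
Hypothesis Hx : (Rabs x < r)%R.

Let r0 : (0 < r)%R.
Proof. by have := Rabs_pos x; lra. Qed.

Lemma hv_asum X v : hv r x z X v -> asum (fun n => lev (X n) z) x.
Proof. by move=> [H1 H2 _]; apply: (conv_asum z X r) => //; lra. Qed.

Lemma hv_add X Y u v : hv r x z X u -> hv r x z Y v -> hv r x z (sadd X Y) (u + v).
Proof.
move=> HX HY; case: (HX) => A1 A2 A3; case: (HY) => B1 B2 B3; split.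
- exact: conv_sadd.
- by apply: OK_sub2 A2 B2; exact: supp_sadd.
rewrite -A3 -B3 /val -CS_plus; [|exact: hv_asum HX|exact: hv_asum HY].
by apply: CS_ext => n; rewrite lev_app.
Qed.

Lemma hv_mul X Y u v : hv r x z X u -> hv r x z Y v -> hv r x z (smul X Y) (u * v).
Proof.
move=> HX HY; case: (HX) => A1 A2 A3; case: (HY) => B1 B2 B3; split.
- by apply: conv_sbil => //; [exact: mmul_bounded|exact: one_contracting].
- exact: OK_smul.
rewrite -A3 -B3 /val -CS_mult; [|exact: hv_asum HX|exact: hv_asum HY].
by apply: CS_ext => n; rewrite lev_sbil_mmul //; apply: cs_ext => i _; rewrite Cmult_1_l.
Qed.

Lemma hv_sh X u : hv r x z X u -> hv r x z (ssh X) (x * u).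
Proof.
move=> [A1 A2 <-]; split; [exact: conv_ssh|by apply: OK_sub A2; exact: supp_ssh|].
by rewrite /val -CS_shift; apply: CS_ext => -[|n].
Qed.

Lemma hv_eq X u v : hv r x z X u -> u = v -> hv r x z X v.
Proof. by move=> H <-. Qed.

Lemma hv_cst c : (Cmod z <= 4)%R -> hv r x z (scst ((c, 0%Z) :: nil)) c.
Proof.
move=> Hz; split; first exact: conv_scst.
  by right; split=> //; apply: supp_scst => y [<-|//]; rewrite /nonneg /=; lia.
rewrite /val -{2}(CS_cst c x); apply: CS_ext => -[|n] //; rewrite /lev /=; ring.
Qed.

Lemma bounded_mscal c : bounded_mono (mscal c).
Proof.
exists (Cmod c); split; first exact: Cmod_ge_0.
by move=> y; rewrite /wn /mscal /= Cmod_mult; lra.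
Qed.

Lemma hv_scal c X u : hv r x z X u -> hv r x z (slin (mscal c) X) (c * u).
Proof.
move=> HX; case: (HX) => A1 A2 A3; split.
- by apply: conv_slin => //; exact: bounded_mscal.
- by apply: OK_sub A2; exact: supp_slin.
rewrite -A3 /val -CS_scal; last exact: hv_asum HX.
by apply: CS_ext => n; rewrite lev_map_mscal.
Qed.

Definition mexp (e : Z) (y : mono) : mono := (y.1, (y.2 + e)%Z).

Lemma bounded_mexp e : bounded_mono (mexp e).
Proof.
exists (wt e); split; first by have := wt_ge1 e; lra.
move=> y; rewrite /wn /mexp /= (Rmult_comm (wt e)) Rmult_assoc; apply: Rmult_le_compat_l; first exact: Cmod_ge_0.
exact: wt_add.
Qed.

Lemma hv_exp_ann e X u : ann z -> hv r x z X u -> hv r x z (slin (mexp e) X) (zpow z e * u).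
Proof.
move=> Hz HX; case: (HX) => A1 A2 A3; split.
- by apply: conv_slin => //; exact: bounded_mexp.
- by left.
rewrite -A3 /val -CS_scal; last exact: hv_asum HX.
apply: CS_ext => n; rewrite /lev /slin csumL_map -csumL_scal; apply: csumL_ext => y _.
by rewrite /= zpow_add; [ring|exact: ann_neq0].
Qed.

Lemma hv_exp_nonneg e X u : (0 <= e)%Z -> (Cmod z <= 4)%R -> supp nonneg X ->
  hv r x z X u -> hv r x z (slin (mexp e) X) (zpow z e * u).
Proof.
move=> He Hz SX HX; case: (HX) => A1 A2 A3; split.
- by apply: conv_slin => //; exact: bounded_mexp.
- by right; split=> //; apply: supp_slin SX => y; rewrite /nonneg /=; lia.
rewrite -A3 /val -CS_scal; last exact: hv_asum HX.
apply: CS_ext => n; rewrite /lev /slin csumL_map -csumL_scal; apply: csumL_ext => y Hy.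
by rewrite /= zpow_add_nonneg //; [ring|exact: (SX n)].
Qed.

(* Conjugation on the unit circle, where [conj z = 1 / z]. *)
Definition mconj (y : mono) : mono := (Cconj y.1, (- y.2)%Z).

Lemma Cmod_Cconj (c : C) : Cmod (Cconj c) = Cmod c.
Proof. by rewrite /Cmod /Cconj /=; congr sqrt; ring. Qed.

Lemma bounded_mconj : bounded_mono mconj.
Proof.
exists 1%R; split; first lra; move=> y.
rewrite /wn /mconj /= Cmod_Cconj /wt (_ : Z.abs_nat (- y.2) = Z.abs_nat y.2); last by lia.
lra.
Qed.

Lemma zpow_conj e : Cmod z = 1%R -> zpow z (- e) = Cconj (zpow z e).
Proof.
move=> Hz; have nz : z <> 0 by move=> E; move: Hz; rewrite E Cmod_0; lra.
have K w : Cmod w = 1%R -> / w = Cconj w.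
  move=> Hw; have wz : w <> 0 by move=> E; move: Hw; rewrite E Cmod_0; lra.
  rewrite -[LHS]Cmult_1_r (_ : RtoC 1 = w * Cconj w); first by field.
  have := Cmod_sqr w; rewrite Hw; case: w {Hw wz} => p q; rewrite /Re /Im /= => H.
  by apply: Ceq; rewrite /Re /Im /=; [lra|ring].
have E : zpow z (- e) * zpow z e = 1 by rewrite -zpow_add // (_ : - e + e = 0)%Z //; lia.
have M : Cmod (zpow z e) = 1%R.
  have P n : Cmod (Cpow z n) = 1%R by rewrite Cmod_pow Hz pow1.
  case: e {E} => [|p|p] /=; [exact: Cmod_1|exact: P|].
  by rewrite Cmod_inv ?P ?Rinv_1 //; exact: Cpow_nz.
rewrite -K //; have Z : zpow z e <> 0 by move=> E0; move: M; rewrite E0 Cmod_0; lra.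
by rewrite -[RHS]Cmult_1_l -E; field.
Qed.

Lemma hv_conj X u : Cmod z = 1%R -> hv r x z X u -> hv r x z (slin mconj X) (Cconj u).
Proof.
move=> Hz HX; case: (HX) => A1 A2 A3; split.
- by apply: conv_slin => //; exact: bounded_mconj.
- by left; rewrite /ann Hz; lra.
rewrite -A3 /val -CS_conj; apply: CS_ext => n; rewrite /lev /slin csumL_map csumL_conj.
by apply: csumL_ext => y _; rewrite /= zpow_conj // Cmult_conj.
Qed.

Lemma hv_self X : conv r X -> OK z X -> hv r x z X (val X x z).
Proof. by split. Qed.

Lemma hv_fil P X u : hv r x z X u -> hv r x z (sfil P X) (val (sfil P X) x z).
Proof.
move=> [A1 A2 _]; apply: hv_self; first exact: conv_sfil.
by apply: OK_sub A2 => H; apply: supp_sub (supp_sfil nonneg P X H) => e [].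
Qed.

Lemma val_fil_split (P : Z -> bool) X u : hv r x z X u ->
  u = val (sfil P X) x z + val (sfil (fun e => negb (P e)) X) x z.
Proof.
move=> HX; have [_ _ <-] := HX; rewrite /val -CS_plus; try by apply: hv_asum; apply: hv_fil HX.
apply: CS_ext => n; rewrite /sfil /lev; elim: (X n) => [|y l IH] /=; first by ring.
by case: (P y.2) => /=; rewrite IH /csumL; ring.
Qed.

Lemma val_ext X Y : (forall n, lev (X n) z = lev (Y n) z) -> val X x z = val Y x z.
Proof. by move=> H; apply: CS_ext. Qed.

Lemma hv_big {J : Type} (l : list J) (F : J -> ser) (v : J -> C) : (Cmod z <= 4)%R ->
  (forall j, hv r x z (F j) (v j)) -> hv r x z (sbig l F) (csumL v l).
Proof.
move=> Hz H; elim: l => [|j l IH] /=; last exact: hv_add.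
split; [exact: conv_scst|by right; split=> //; apply: supp_scst|].
by rewrite /val -[RHS](CS_cst 0 x); apply: CS_ext => -[|n].
Qed.

End Values.

(* Evaluation at [tau = 1] of a series, as a series constant in [tau]. *)
Definition msc (y : mono) : mono := (y.1, 0%Z).

Lemma bounded_msc : bounded_mono msc.
Proof.
exists 1%R; split; first lra; move=> y; rewrite /wn /msc /= {1}/wt /= Rmult_1_r Rmult_1_l.
have := Rmult_le_compat_l _ _ _ (Cmod_ge_0 y.1) (wt_ge1 y.2); lra.
Qed.

Lemma lev_msc l z : lev (map msc l) z = lev l 1.
Proof.
rewrite /lev csumL_map; apply: csumL_ext => y _; rewrite /=.
by case: (y.2) => [|p|p] /=; rewrite ?Cpow_1_l // -RtoC_inv ?Rinv_1 //; lra.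
Qed.

Lemma supp_msc (P : Z -> Prop) X : P 0%Z -> supp P (slin msc X).
Proof. by move=> H; apply: (supp_slin (fun=> True)). Qed.

Lemma hv_sc r x z X u : (Rabs x < r)%R -> (Cmod z <= 4)%R -> hv r x 1 X u -> hv r x z (slin msc X) u.
Proof.
move=> Hx Hz [A1 A2 A3]; split.
- by apply: conv_slin => //; [have := Rabs_pos x; lra|exact: bounded_msc].
- by right; split=> //; apply: supp_msc; rewrite /nonneg; lia.
by rewrite -A3; apply: CS_ext => n; rewrite lev_msc.
Qed.

(** * The tangent of a series through its differential equation *)

Lemma cs_shift m f : cs (S m) f = f 0%nat + cs m (fun i => f (S i)).
Proof. by elim: m => [|m IH]; [rewrite /=; ring|rewrite [LHS]/= -/(cs (S m) f) IH /=; ring]. Qed.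

Lemma asum_bsum c x : asum c x -> exists b, bsum c x b.
Proof.
move=> [A B]; exists (Series (fun n => Rabs (Re (c n) * x ^ n)) + Series (fun n => Rabs (Im (c n) * x ^ n)))%R => m.
have L (a : nat -> R) : (forall n, (0 <= a n)%R) -> ex_series a -> (rs m a <= Series a)%R.
  move=> a0 /Series_correct /is_series_rs H; apply: Rnot_lt_le => Hm.
  have [P HP] := H (rs m a - Series a)%R ltac:(lra).
  have := HP (P + m)%nat ltac:(lia); have := rs_mono m (P + m) a a0 ltac:(lia).
  by move=> H1; rewrite Rabs_pos_eq; lra.
apply: Rle_trans (_ : (rs m (fun n => Rabs (Re (c n) * x ^ n)) + rs m (fun n => Rabs (Im (c n) * x ^ n)))%R <= _)%R.
  rewrite -rs_add; apply: rs_le => i _; rewrite !Rabs_mult -!RPow_abs -Rmult_plus_distr_r.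
  by apply: Rmult_le_compat_r; [apply: pow_le; exact: Rabs_pos|exact: Cmod_le_abs].
by apply: Rplus_le_compat; apply: L => // n; exact: Rabs_pos.
Qed.

Lemma bsum_le c x y b : (Rabs y <= Rabs x)%R -> bsum c x b -> bsum c y b.
Proof.
move=> H Hb m; apply: Rle_trans (Hb m); apply: rs_le => i _; apply: Rmult_le_compat_l; first exact: Cmod_ge_0.
by apply: pow_incr; split=> //; exact: Rabs_pos.
Qed.

Lemma bsum_CS c x b : bsum c x b -> (Cmod (CS c x) <= b)%R.
Proof. by move=> H; apply: CS_bound H => n; exact: Rle_refl. Qed.

(** The differential equation of the tangent, integrated and compared coefficientwise; the two
    shifts are the factor rho^2 in (rho u)^2. *)
Definition tan_eq (z : C) (X u : ser) : Prop := forall n,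
  lev (u n) z = lev (X n) z + lev (ssh (ssh (sbil mmul w2 (smul u u) X)) n) z.

(* [u] solves [(rho u)' = (1 + (rho u)^2) (rho X)'], that is [rho u = tan (rho X)]. *)
Lemma tan_series r z X u : conv r X -> conv r u -> OK z X -> OK z u -> tan_eq z X u ->
  forall x, (Rabs x < r)%R ->
  Csin (x * val X x z) = x * val u x z * Ccos (x * val X x z).
Proof.
move=> CX Cu OX Ou E x Hx; have r0 : (0 < r)%R by have := Rabs_pos x; lra.
pose a := fun n => lev (ssh X n) z; pose b := fun n => lev (ssh u n) z.
have OX' : OK z (ssh X) by apply: OK_sub OX; exact: supp_ssh.
have Ou' : OK z (ssh u) by apply: OK_sub Ou; exact: supp_ssh.
have CX' := conv_ssh r X r0 CX; have Cu' := conv_ssh r u r0 Cu.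
have rr : (Rabs r <= r)%R by rewrite Rabs_pos_eq; lra.
have [ba Ha] := conv_bsum z (ssh X) r r OX' CX' rr.
have [bb Hb] := conv_bsum z (ssh u) r r Ou' Cu' rr.
have Ea s : (CS a s = s * val X s z).
  by rewrite /val -CS_shift; apply: CS_ext => -[|n].
have Eb s : (CS b s = s * val u s z).
  by rewrite /val -CS_shift; apply: CS_ext => -[|n].
pose p := fun n => lev (smul (ssh u) (ssh u) n) z.
have Ep n : p n = cs (S n) (fun i => b i * b (n - i)%nat).
  by rewrite /p lev_sbil_mmul //; apply: cs_ext => i _; rewrite Cmult_1_l.
(* Coefficientwise form of (rho u)' = (1 + (rho u)^2) (rho X)'; the orders 0 and 1 of (rho u)^2
   vanish, whence the separate cases. *)
have D n : cderiv b n = cderiv a n + cs (S n) (fun i => p i * cderiv a (n - i)%nat).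
  have P0 : p 0%nat = 0 by rewrite Ep /= /b /lev /=; ring.
  have P1 : p 1%nat = 0 by rewrite Ep /= /b /lev /=; ring.
  have P2 i : p (S (S i)) = lev (smul u u i) z.
    rewrite Ep cs_shift (_ : b 0%nat = 0) // Cmult_0_l Cplus_0_l.
    have Y : cs (S (S i)) (fun i0 => b (S i0) * b (S (S i) - S i0)%nat)
       = cs (S i) (fun i0 => b (S i0) * b (S (S i) - S i0)%nat) + b (S (S i)) * b (S (S i) - S (S i))%nat by [].
    rewrite Y Nat.sub_diag (_ : b 0%nat = 0) //.
    rewrite lev_sbil_mmul // Cmult_0_r Cplus_0_r; apply: cs_ext => j Hj.
    by rewrite Cmult_1_l /b (_ : S (S i) - S j = S (i - j))%nat //; lia.
  have Da m : cderiv a m = RtoC (INR (S m)) * lev (X m) z by [].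
  rewrite (_ : cderiv b n = RtoC (INR (S n)) * lev (u n) z) // E Da.
  case: n => [|[|n]].
  - by rewrite /= P0 /lev /=; ring.
  - by rewrite cs_shift P0 /= P1 /lev /=; ring.
  rewrite 2!cs_shift P0 P1 !Cmult_0_l !Cplus_0_l.
  rewrite [ssh (ssh _) _]/= lev_sbil_mmul //; last exact: OK_smul.
  rewrite Cmult_plus_distr_l; congr (_ + _).
  have Q : forall m f, RtoC (INR (S (S (S n)))) * cs m f = cs m (fun i => RtoC (INR (S (S (S n)))) * f i).
    by elim=> [|m IH] f /=; rewrite ?Cmult_0_r // Cmult_plus_distr_l IH.
  rewrite Q; apply: cs_ext => i Hi; cbv beta; rewrite P2 Da /w2.
  rewrite (_ : S (S n) - S (S i) = n - i)%nat; last by lia.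
  rewrite (_ : n + 3 = S (S (S n)))%nat; last by lia.
  rewrite /Rdiv RtoC_mult RtoC_inv; last by apply: not_0_INR; lia.
  by field; apply: RtoC_neq0; apply: not_0_INR; lia.
pose r1 := ((Rabs x + r) / 2)%R.
have Hr1 : (Rabs x < r1 < r)%R by rewrite /r1; have := Rabs_pos x; lra.
have Hr1' : (Rabs r1 < r)%R by rewrite Rabs_pos_eq; have := Rabs_pos x; lra.
have Ha' : bsum a r ba by []. have Hb' : bsum b r bb by [].
have [_ As] := CS_cder a r ba r1 Ha' Hr1'.
have [bd Hd] := asum_bsum _ _ As.
(* With b' = (1 + b^2) a' the function b cos a - sin a satisfies D' = a' b D and vanishes at 0, so
   [ode_zero] applies. *)
pose Dd s := CS b s * Ccos (CS a s) - Csin (CS a s).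
have HD s : (Rabs s < r1)%R -> cder Dd s (CS (cderiv a) s * CS b s * Dd s).
  move=> Hs; have Hsr : (Rabs s < r)%R by lra.
  have [A1 A2] := CS_cder a r ba s Ha' Hsr; have [B1 B2] := CS_cder b r bb s Hb' Hsr.
  have Ub : asum b s by apply: (conv_asum z (ssh u) r) => //; lra.
  have Sp : asum p s.
    apply: (conv_asum z (smul (ssh u) (ssh u)) r); [exact: OK_smul| |by lra].
    by apply: conv_sbil => //; [exact: mmul_bounded|exact: one_contracting].
  have Vp : CS p s = CS b s * CS b s by rewrite -CS_mult //; apply: CS_ext.
  have VD : CS (cderiv b) s = (1 + CS b s * CS b s) * CS (cderiv a) s.
    have Q : CS (fun n => cderiv b n + - cderiv a n) s = CS p s * CS (cderiv a) s.
      by rewrite -CS_mult //; apply: CS_ext => n; rewrite D; ring.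
    have As' : asum (fun n => - cderiv a n) s.
      by case: A2 => P1 P2; split; [apply: ex_series_ext P1|apply: ex_series_ext P2] => n;
        rewrite ?Re_opp ?Im_opp -Rabs_Ropp; congr Rabs; ring.
    rewrite CS_plus // Vp in Q; rewrite (_ : CS (fun n => - cderiv a n) s = - CS (cderiv a) s) in Q.
      transitivity ((CS (cderiv b) s + - CS (cderiv a) s) + CS (cderiv a) s); first by ring.
      by rewrite Q; ring.
    rewrite (CS_ext _ (fun n => (- (1)) * cderiv a n)); last by move=> n; ring.
    by rewrite CS_scal //; ring.
  apply: cder_eq (cder_minus _ _ _ _ _ (cder_mult _ _ _ _ _ B1 (cder_Ccos _ _ _ A1)) (cder_Csin _ _ _ A1)).
  by rewrite VD /Dd; ring.
have D0 : Dd 0%R = 0 by rewrite /Dd !CS_at0 /a /b /= /lev /= Csin_0; ring.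
have HA s : (Rabs s < r1)%R -> (Cmod (CS (cderiv a) s * CS b s) <= bd * bb)%R.
  move=> Hs; apply: Cmod_mult_le.
    by apply: bsum_CS; apply: bsum_le Hd; rewrite (Rabs_pos_eq r1); have := Rabs_pos x; lra.
  by apply: bsum_CS; apply: bsum_le Hb'; rewrite (Rabs_pos_eq r); lra.
have := ode_zero Dd _ r1 _ HD D0 HA x (proj1 Hr1).
by rewrite /Dd Ea Eb => H; symmetry; apply: Cminus_eq0.
Qed.

(** * The Cauchy-type integral over the circle of radius 1/2 as an operator on series *)

Lemma cint_unit_int (k : Z) : cint (fun t => unit_pt (IZR k * t)) = if Z.eqb k 0 then 2 * PI else 0.
Proof.
case: Z.eqb_spec => [->|Hk].
  rewrite (cint_ext _ (fun=> 1)) ?cint_const; first by ring.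
  by move=> t; rewrite /unit_pt Rmult_0_l cos_0 sin_0.
have k0 : IZR k <> 0%R by apply: not_0_IZR.
have D t : cder (fun t => unit_pt (IZR k * t)) t (IZR k * (Ci * unit_pt (IZR k * t))).
  split; rewrite ?Re_mult ?Im_mult /=; auto_derive => //; ring.
have Cc : ccont (fun t => unit_pt (IZR k * t)) by exact: cder_ccont D.
have H : cint (fun t => (IZR k * Ci) * unit_pt (IZR k * t)) = 0.
  rewrite (cint_derive (fun t => unit_pt (IZR k * t))); [|move=> t|exact: ccont_scal].
    have -> : unit_pt (IZR k * (2 * PI)) = 1.
      have [n [Hn|Hn]] : exists n : nat, IZR k = INR n \/ IZR k = (- INR n)%R.
        exists (Z.abs_nat k); rewrite INR_IZR_INZ Zabs2Nat.id_abs.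
        by case: (Z.abs_spec k) => -[_ ->]; [left|right]; rewrite ?opp_IZR ?Ropp_involutive.
      - rewrite Hn /unit_pt (_ : INR n * (2 * PI) = 0 + 2 * INR n * PI)%R; last by ring.
        by rewrite cos_period sin_period cos_0 sin_0.
      rewrite Hn /unit_pt (_ : - INR n * (2 * PI) = - (0 + 2 * INR n * PI))%R; last by ring.
      by rewrite cos_neg sin_neg cos_period sin_period cos_0 sin_0 Ropp_0.
    by rewrite /unit_pt Rmult_0_r cos_0 sin_0; apply: Ceq => /=; ring.
  by apply: cder_eq (D t); ring.
rewrite cint_scal // in H; apply: Cmult_eq0_r H.
by apply: Cmult_neq_0; [exact: RtoC_neq0|exact: Ci_neq0].
Qed.

(** The inner contour: points of the unit circle are at distance at least 1/2 from it, so kernels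
    evaluated at the boundary remain regular. *)
Definition hc (t : R) : C := RtoC (/ 2) * unit_pt t.

Lemma Cmod_hc t : Cmod (hc t) = (/ 2)%R.
Proof. by rewrite /hc Cmod_circle //; lra. Qed.

Lemma ccont_hc : ccont hc.
Proof. exact: ccont_circle. Qed.

Lemma hc_neq0 t : hc t <> 0.
Proof. by move=> E; have := Cmod_hc t; rewrite E Cmod_0; lra. Qed.

Lemma zpow_mult (a b : C) e : a <> 0 -> b <> 0 -> zpow (a * b) e = zpow a e * zpow b e.
Proof.
move=> Ha Hb; case: e => [|p|p] /=; first by ring.
  exact: Cpow_mult_l.
by rewrite Cpow_mult_l; field; split; exact: Cpow_nz.
Qed.

Lemma unit_neq0 t : unit_pt t <> 0.
Proof. by move=> E; have := Cmod_unit t; rewrite E Cmod_0; lra. Qed.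

Lemma zpow_hc t e : zpow (hc t) e = zpow (RtoC (/ 2)) e * unit_pt (IZR e * t).
Proof.
rewrite /hc zpow_mult; [by rewrite zpow_unit|apply: RtoC_neq0; lra|exact: unit_neq0].
Qed.

Lemma ccont_zpow_hc e : ccont (fun t => zpow (hc t) e).
Proof.
apply: (ccont_ext (fun t => zpow (RtoC (/ 2)) e * unit_pt (IZR e * t))).
  by move=> t; rewrite zpow_hc.
apply: ccont_scal; apply: (cder_ccont _ (fun t => IZR e * (Ci * unit_pt (IZR e * t)))) => t.
split; rewrite ?Re_mult ?Im_mult /=; auto_derive => //; ring.
Qed.

(* [rcz p e] is the coefficient of [z^(p+1+e)] in the residue of
   [w^e ((w - z) / 2)^p] at [w = 0]. *)
Fixpoint rcz (p : nat) (e : Z) : R :=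
  match p with
  | O => if Z.eqb e (-1) then 1%R else 0%R
  | S p' => ((rcz p' (e + 1) - rcz p' e) / 2)%R
  end.

Lemma rcz_bound p e : (Rabs (rcz p e) <= 1)%R.
Proof.
elim: p e => [|p IH] e /=.
  by case: Z.eqb_spec => _; rewrite ?Rabs_R1 ?Rabs_R0; lra.
have := IH (e + 1)%Z; have := IH e.
by rewrite /Rabs; do 3 case: Rcase_abs => ?; lra.
Qed.

Lemma rcz_low p e : (Z.of_nat p + 1 + e < 0)%Z -> rcz p e = 0%R.
Proof.
elim: p e => [|p IH] e H /=; first by case: Z.eqb_spec => //; lia.
by rewrite !IH; [lra|lia|lia].
Qed.

Lemma ccont_pow f p : ccont f -> ccont (fun t => Cpow (f t) p).
Proof.
move=> H; elim: p => [|p IH]; first exact: (ccont_const 1).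
by apply: (ccont_ext (fun t => f t * Cpow (f t) p)); [move=> t; rewrite Cpow_S|exact: ccont_mult].
Qed.

Lemma ccont_hdiff z : ccont (fun t => (hc t - z) / 2).
Proof.
apply: (ccont_ext (fun t => / 2 * (hc t + - z))); first by move=> t; field; exact: C2_neq0.
by apply: ccont_scal; apply: ccont_plus; [exact: ccont_hc|exact: ccont_const].
Qed.

Lemma mono_int z p e :
  cint (fun t => zpow (hc t) e * Cpow ((hc t - z) / 2) p * (Ci * hc t))
  = 2 * PI * Ci * rcz p e * Cpow z (Z.to_nat (Z.of_nat p + 1 + e)).
Proof.
elim: p e => [|p IH] e.
  rewrite (cint_ext _ (fun t => (Ci * zpow (RtoC (/ 2)) (e + 1)) * unit_pt (IZR (e + 1) * t))); last first.
    move=> t; transitivity (Ci * zpow (hc t) (e + 1)); last by rewrite zpow_hc; ring.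
    by rewrite zpow_add; [rewrite /=; ring|exact: hc_neq0].
  rewrite cint_scal; last first.
    apply: (cder_ccont _ (fun t => IZR (e + 1) * (Ci * unit_pt (IZR (e + 1) * t)))) => t.
    by split; rewrite ?Re_mult ?Im_mult /=; auto_derive => //; ring.
  rewrite cint_unit_int /=; case: Z.eqb_spec => H; case: Z.eqb_spec => H'; try lia; last by ring.
  by rewrite H' /=; ring.
have Cz q e' : ccont (fun t => zpow (hc t) e' * Cpow ((hc t - z) / 2) q * (Ci * hc t)).
  apply: ccont_mult; last by apply: ccont_scal; exact: ccont_hc.
  by apply: ccont_mult; [exact: ccont_zpow_hc|apply: ccont_pow; exact: ccont_hdiff].
(* One factor (w - z)/2 is expanded, which is exactly the recursion of [rcz]. *)
rewrite (cint_ext _ (fun t => / 2 * (zpow (hc t) (e + 1) * Cpow ((hc t - z) / 2) p * (Ci * hc t))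
    + (- (z / 2)) * (zpow (hc t) e * Cpow ((hc t - z) / 2) p * (Ci * hc t)))); last first.
  move=> t; rewrite Cpow_S zpow_add; last exact: hc_neq0.
  rewrite (_ : zpow (hc t) 1 = hc t); last by rewrite /= Cmult_1_r.
  by field; exact: C2_neq0.
rewrite cint_plus ?cint_scal ?IH //; try exact: ccont_scal.
rewrite (_ : Z.of_nat p + 1 + (e + 1) = Z.of_nat (S p) + 1 + e)%Z; last by lia.
rewrite [rcz (S p) e]/= /Rdiv RtoC_mult RtoC_minus RtoC_inv; last by lra.
case: (Z_lt_le_dec (Z.of_nat p + 1 + e) 0) => H.
  by rewrite (rcz_low p e) //; field; exact: C2_neq0.
rewrite (_ : Z.to_nat (Z.of_nat (S p) + 1 + e) = S (Z.to_nat (Z.of_nat p + 1 + e))); last by lia.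
by rewrite Cpow_S; field; exact: C2_neq0.
Qed.

(** The residue at w = 0 of a kernel monomial in (w - z)/2 times a density monomial in w. The
    halving divides the binomial coefficients by 2^p, so that the operator is bounded. For
    nonnegative kernel exponents [Z.max] acts only where the coefficient is zero, and makes the
    nonnegative support visible in the syntax. *)
Definition rmono (x y : mono) : mono :=
  (x.1 * y.1 * rcz (Z.to_nat x.2) y.2, Z.max 0 (x.2 + 1 + y.2)).
Definition rop (K X : ser) : ser := sbil rmono (fun _ _ => 1%R) K X.

Lemma wt_le a b : (Z.abs a <= b)%Z -> (wt a <= 4 ^ Z.to_nat b)%R.
Proof. by move=> H; apply: Rle_pow; [lra|lia]. Qed.

Lemma rmono_bounded : bounded_bil rmono.
Proof.
exists 4%R; split; first lra; move=> x y; rewrite /wn /rmono /= !Cmod_mult Cmod_R.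
have H1 : (wt (Z.max 0 (x.2 + 1 + y.2)) <= 4 * (wt x.2 * wt y.2))%R.
  apply: Rle_trans (wt_le _ (1 + (Z.abs x.2 + Z.abs y.2)) _) _; first lia.
  rewrite /wt (_ : Z.to_nat _ = 1 + (Z.abs_nat x.2 + Z.abs_nat y.2))%nat; last by lia.
  by rewrite !pow_add /=; lra.
have H2 := rcz_bound (Z.to_nat x.2) y.2.
have H3 : (0 <= Cmod x.1 * Cmod y.1)%R by apply: Rmult_le_pos; exact: Cmod_ge_0.
rewrite (_ : 4 * (Cmod x.1 * wt x.2 * (Cmod y.1 * wt y.2)) = (Cmod x.1 * Cmod y.1) * 1 * (4 * (wt x.2 * wt y.2)))%R; last by ring.
apply: Rmult_le_compat => //; last by apply: Rmult_le_compat_l.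
  by apply: Rmult_le_pos => //; exact: Rabs_pos.
by have := wt_ge1 (Z.max 0 (x.2 + 1 + y.2)); lra.
Qed.

Lemma supp_rop K X : supp nonneg (rop K X).
Proof.
apply: (supp_sbil (fun=> True) (fun=> True)) => // x y _ _; rewrite /nonneg /=; lia.
Qed.

Lemma cint_csumL {A} (f : A -> R -> C) l : (forall a, ccont (f a)) ->
  ccont (fun t => csumL (fun a => f a t) l) /\ cint (fun t => csumL (fun a => f a t) l) = csumL (fun a => cint (f a)) l.
Proof.
move=> H; elim: l => [|a l [IH1 IH2]] /=.
  by split; [exact: ccont_const|rewrite cint_const; ring].
by split; [exact: ccont_plus|rewrite cint_plus ?IH2].
Qed.

Lemma ccont_lev_hc l : ccont (fun t => lev l (hc t)).
Proof.
have H : forall y : mono, ccont (fun t => y.1 * zpow (hc t) y.2) by move=> y; apply: ccont_scal; exact: ccont_zpow_hc.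
exact: (proj1 (cint_csumL (fun y t => y.1 * zpow (hc t) y.2) l H)).
Qed.

Lemma ann_hc t : ann (hc t).
Proof. by rewrite /ann Cmod_hc; lra. Qed.

Lemma conv_le r r' X : (0 < r' <= r)%R -> conv r X -> conv r' X.
Proof.
move=> Hr [b Hb]; exists b => m; apply: Rle_trans (Hb m); apply: rs_le => i _.
by apply: Rmult_le_compat_l; [exact: lnorm_ge0|apply: pow_incr; lra].
Qed.

(** The product is expanded in rho and in monomials and integrated term by term, each term being
    given by [mono_int]. The kernel argument (w - z)/2 stays in the disk where nonnegative exponents
    are controlled. *)
Lemma rop_val r x z K X : (Rabs x < r)%R -> conv r K -> conv r X -> supp nonneg K -> (Cmod z <= 1)%R ->
  2 * PI * Ci * val (rop K X) x z
  = cint (fun t => val K x ((hc t - z) / 2) * val X x (hc t) * (Ci * hc t)).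
Proof.
move=> Hx CK CX SK Hz.
have Oh t : OK (hc t) X by left; exact: ann_hc.
have Od t : OK ((hc t - z) / 2) K.
  right; split=> //; rewrite Cmod_div; last exact: C2_neq0.
  rewrite Cmod_R Rabs_pos_eq; last lra.
  by have := Cmod_sub_le (hc t) z; rewrite Cmod_hc; lra.
have r0 : (0 < r)%R by have := Rabs_pos x; lra.
pose c t n := (Ci * hc t) * cs (S n) (fun i => lev (K i) ((hc t - z) / 2) * lev (X (n - i)%nat) (hc t)).
have Cz0 p : ccont (fun t => zpow ((hc t - z) / 2) (Z.of_nat p)).
  by apply: (ccont_ext (fun t => Cpow ((hc t - z) / 2) p)) => [t|]; [rewrite zpow_nat|apply: ccont_pow; exact: ccont_hdiff].
have CKl l : lsupp nonneg l -> ccont (fun t => lev l ((hc t - z) / 2)).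
  elim: l => [|y l IH] H; first exact: (ccont_const 0).
  apply: (ccont_plus (fun t => y.1 * zpow ((hc t - z) / 2) y.2) (fun t => lev l ((hc t - z) / 2))); last first.
    by apply: IH => w Hw; apply: H; right.
  apply: ccont_scal; have Hy : (0 <= y.2)%Z by apply: H; left.
  by rewrite -(Z2Nat.id y.2).
have Cc n : ccont (fun t => c t n).
  apply: ccont_mult; first by apply: ccont_scal; exact: ccont_hc.
  apply: (ccont_cs (S n) (fun i t => lev (K i) ((hc t - z) / 2) * lev (X (n - i)%nat) (hc t))) => i.
  by apply: ccont_mult; [apply: CKl; exact: SK|exact: ccont_lev_hc].
pose y n := (rs (S n) (fun i => lnorm (K i) * lnorm (X (n - i)%nat)) * Rabs x ^ n)%R.
have y0 n : (0 <= y n)%R.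
  apply: Rmult_le_pos; last by apply: pow_le; exact: Rabs_pos.
  by apply: rs_ge0 => i; apply: Rmult_le_pos; exact: lnorm_ge0.
have Hy t n : (Cmod (c t n) * Rabs x ^ n <= y n)%R.
  apply: Rmult_le_compat_r; first by apply: pow_le; exact: Rabs_pos.
  rewrite /c (Cmod_mult (Ci * hc t)) (Cmod_mult Ci) Cmod_Ci Cmod_hc Rmult_1_l.
  have H : (Cmod (cs (S n) (fun i => lev (K i) ((hc t - z) / 2) * lev (X (n - i)%nat) (hc t))%C)
     <= rs (S n) (fun i => lnorm (K i) * lnorm (X (n - i)%nat)))%R.
    by apply: cs_bound => i; apply: Cmod_mult_le; exact: OK_lev.
  by have := Cmod_ge_0 (cs (S n) (fun i => lev (K i) ((hc t - z) / 2) * lev (X (n - i)%nat) (hc t))%C); lra.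
case: (CK) => bK HK; case: (CX) => bX HX.
have Hb m : (rs m y <= bK * bX)%R.
  have Hr : (0 < (Rabs x + r) / 2 <= r)%R by have := Rabs_pos x; lra.
  have NK : (rs m (fun i => lnorm (K i) * Rabs x ^ i) <= bK)%R.
    apply: Rle_trans (HK m); apply: rs_le => i _; apply: Rmult_le_compat_l; first exact: lnorm_ge0.
    by apply: pow_incr; split; [exact: Rabs_pos|lra].
  have NX : (rs m (fun i => lnorm (X i) * Rabs x ^ i) <= bX)%R.
    apply: Rle_trans (HX m); apply: rs_le => i _; apply: Rmult_le_compat_l; first exact: lnorm_ge0.
    by apply: pow_incr; split; [exact: Rabs_pos|lra].
  have P X' i : (0 <= lnorm X' * Rabs x ^ i)%R.
    by apply: Rmult_le_pos; [exact: lnorm_ge0|apply: pow_le; exact: Rabs_pos].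
  apply: Rle_trans (_ : (rs m (fun i => lnorm (K i) * Rabs x ^ i) * rs m (fun i => lnorm (X i) * Rabs x ^ i) <= _)%R); last first.
    by apply: Rmult_le_compat => //; apply: rs_ge0 => i; exact: P.
  apply: Rle_trans (rs_cauchy m _ _ (fun i => P (K i) i) (fun i => P (X i) i)); apply: rs_le => n _.
  rewrite /y Rmult_comm -rs_scal; apply: rs_le => i Hi.
  have -> : (Rabs x ^ n = Rabs x ^ i * Rabs x ^ (n - i))%R by rewrite -pow_add; congr pow; lia.
  by apply: Req_le; ring.
rewrite (cint_ext _ (fun t => CS (c t) x)); last first.
  move=> t; have A1 : asum (fun n => lev (K n) ((hc t - z) / 2)) x by apply: (conv_asum _ K r) => //; lra.
  have A2 : asum (fun n => lev (X n) (hc t)) x by apply: (conv_asum _ X r) => //; lra.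
  rewrite /val -CS_mult // Cmult_comm -CS_scal //.
  apply: (bsum_asum _ _ (2 * (bK * bX))) => m; apply: Rle_trans (_ : (2 * rs m y <= _)%R).
    rewrite -rs_scal; apply: rs_le => n _; have := Hy t n; rewrite /c (Cmod_mult (Ci * hc t)) (Cmod_mult Ci) Cmod_Ci Cmod_hc.
    have : (0 <= Rabs x ^ n)%R by apply: pow_le; exact: Rabs_pos.
    move: (Rabs x ^ n)%R (y n) (Cmod _) => p q w; nra.
  by apply: Rmult_le_compat_l; [lra|].
rewrite (cint_CS c x y (bK * bX)) //.
rewrite -CS_scal; last first.
  have Co : conv r (rop K X) by apply: conv_sbil => //; [exact: rmono_bounded|exact: one_contracting].
  apply: (conv_asum z (rop K X) r) => //; last by lra.
  by right; split; [lra|exact: supp_rop].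
apply: CS_ext => n; rewrite /c.
rewrite (cint_ext _ (fun t => cs (S n) (fun i => (Ci * hc t) * (lev (K i) ((hc t - z) / 2) * lev (X (n - i)%nat) (hc t))))); last first.
  by move=> t; elim: (S n) => [|m IH]; [rewrite /=; ring|rewrite [cs (S m) _]/= [RHS]/= -IH; ring].
rewrite (cint_cs (S n) (fun i t => (Ci * hc t) * (lev (K i) ((hc t - z) / 2) * lev (X (n - i)%nat) (hc t)))); last first.
  move=> i; apply: ccont_mult; first by apply: ccont_scal; exact: ccont_hc.
  by apply: ccont_mult; [apply: CKl; exact: SK|exact: ccont_lev_hc].
rewrite {1}/lev /rop /sbil csumL_flat_map csumL_seq.
have Q : forall m k f, k * cs m f = cs m (fun i => k * f i).
  by elim=> [|m IH] k f /=; rewrite ?Cmult_0_r // Cmult_plus_distr_l IH.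
rewrite Q; apply: cs_ext => i Hi; rewrite -/(lev _ z) lev_map_mscal Cmult_1_l.
move: (K i) (SK i) (X (n - i)%nat) => lK SlK lX.
transitivity (csumL (fun u => csumL (fun v => 2 * PI * Ci * ((rmono u v).1 * zpow z (rmono u v).2)) lX) lK).
  rewrite /lev /lbil csumL_flat_map -csumL_scal; apply: csumL_ext => u _.
  by rewrite csumL_map -csumL_scal.
have E1 : cint (fun t => (Ci * hc t) * (lev lK ((hc t - z) / 2) * lev lX (hc t)))
   = cint (fun t => csumL (fun u => csumL (fun v => (u.1 * v.1) *
        (zpow (hc t) v.2 * zpow ((hc t - z) / 2) u.2 * (Ci * hc t))) lX) lK).
  apply: cint_ext => t; rewrite /lev -csumL_mul -csumL_scal; apply: csumL_ext => u _.
  by rewrite -csumL_scal; apply: csumL_ext => v _; ring.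
rewrite {}E1.
elim: lK SlK => [|u lK IH] SlK; first by rewrite /= cint_const; ring.
have Hu : (0 <= u.2)%Z by apply: SlK; left.
have Cuv (b : mono) : (0 <= b.2)%Z -> forall v : mono, ccont (fun t => (b.1 * v.1) * (zpow (hc t) v.2 * zpow ((hc t - z) / 2) b.2 * (Ci * hc t))).
  move=> Hu' v; apply: ccont_scal; apply: ccont_mult; last by apply: ccont_scal; exact: ccont_hc.
  by apply: ccont_mult; [exact: ccont_zpow_hc|rewrite -(Z2Nat.id b.2)].
have Cl (b : mono) : (0 <= b.2)%Z -> ccont (fun t => csumL (fun v => (b.1 * v.1) * (zpow (hc t) v.2 * zpow ((hc t - z) / 2) b.2 * (Ci * hc t))) lX).
  move=> Hu'; exact: (proj1 (cint_csumL (fun (v : mono) t => (b.1 * v.1) * (zpow (hc t) v.2 * zpow ((hc t - z) / 2) b.2 * (Ci * hc t))) lX (Cuv _ Hu'))).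
have SlK' : lsupp nonneg lK by move=> w Hw; apply: SlK; right.
rewrite /= cint_plus -?IH //.
- congr (_ + _).
  rewrite (proj2 (cint_csumL (fun (v : mono) t => (u.1 * v.1) * (zpow (hc t) v.2 * zpow ((hc t - z) / 2) u.2 * (Ci * hc t))) lX (Cuv _ Hu))).
  apply: csumL_ext => v _; rewrite cint_scal; last first.
    apply: ccont_mult; last by apply: ccont_scal; exact: ccont_hc.
    by apply: ccont_mult; [exact: ccont_zpow_hc|rewrite -(Z2Nat.id u.2)].
  rewrite (cint_ext _ (fun t => zpow (hc t) v.2 * Cpow ((hc t - z) / 2) (Z.to_nat u.2) * (Ci * hc t))); last first.
    by move=> t; rewrite (zpow_nonneg ((hc t - z) / 2)).
  rewrite mono_int Z2Nat.id // zpow_nonneg; last by lia.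
  by rewrite (_ : Z.to_nat (Z.max 0 _) = Z.to_nat (u.2 + 1 + v.2)); [ring|lia].
- exact: Cl.
elim: lK SlK' {IH SlK} => [|u' lK IH'] S'; first exact: (ccont_const 0).
apply: ccont_plus; first by apply: Cl; apply: S'; left.
by apply: IH' => w Hw; apply: S'; right.
Qed.

Notation "X [+] Y" := (sadd X Y) (at level 50, left associativity).
Notation "X [*] Y" := (smul X Y) (at level 40, left associativity).
Notation "c [:] X" := (slin (mscal c) X) (at level 40, left associativity).

(** * The system of equations for the unknown series *)

Definition sK (c : C) : ser := scst ((c, 0%Z) :: nil).
Definition sW (X Y : ser) : ser := sbil mmul w2 X Y.
Definition sconj (X : ser) : ser := slin mconj X.
Definition sc (X : ser) : ser := slin msc X.
Definition stau (e : Z) (X : ser) : ser := slin (mexp e) X.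

(** On nonnegative exponents, the substitution of tau/2 for tau ([val_half]). *)
Definition mhalf (y : mono) : mono := (RtoC (/ 2 ^ Z.abs_nat y.2) * y.1, y.2).
(* Turns the expansion of [tan y] into that of [cot y - 1 / y]: the duplication
   formula [cot y = cot (y/2) / 2 - tan (y/2) / 2] is diagonal on powers of [y]. *)
Definition omega (p : nat) : R := (- (/ 2 ^ S p) / (1 - / 2 ^ S p))%R.
Definition momega (y : mono) : mono := (RtoC (omega (Z.abs_nat y.2)) * y.1, y.2).

Lemma half_pow_bound p : (0 < / 2 ^ p <= 1)%R.
Proof.
have H : (1 <= 2 ^ p)%R by apply: pow_R1_Rle; lra.
by split; [apply: Rinv_0_lt_compat; lra|rewrite -Rinv_1; apply: Rinv_le_contravar; lra].
Qed.

Lemma half_pow_S p : (/ 2 ^ S p = / 2 ^ p / 2)%R.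
Proof. by rewrite /=; field; apply: pow_nonzero; lra. Qed.

Lemma bounded_mhalf : bounded_mono mhalf.
Proof.
exists 1%R; split; first lra; move=> y; rewrite /wn /mhalf /= Cmod_mult Cmod_R Rabs_pos_eq.
  have := half_pow_bound (Z.abs_nat y.2); have := wn_ge0 y; rewrite /wn.
  by move: (Cmod y.1) (wt y.2) (/ _)%R => p q h; nra.
by have := half_pow_bound (Z.abs_nat y.2); lra.
Qed.

Lemma omega_bound p : (Rabs (omega p) <= 1)%R.
Proof.
rewrite /omega half_pow_S; move: (/ 2 ^ p)%R (half_pow_bound p) => h H.
have E : (- (h / 2) / (1 - h / 2) = - (h / (2 - h)))%R by field; lra.
have P : (0 <= h / (2 - h))%R by apply: Rmult_le_pos; [lra|apply: Rlt_le; apply: Rinv_0_lt_compat; lra].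
rewrite E Rabs_Ropp Rabs_pos_eq //; apply: (Rmult_le_reg_r (2 - h)); first lra.
by rewrite /Rdiv Rmult_assoc Rinv_l; lra.
Qed.

Lemma bounded_momega : bounded_mono momega.
Proof.
exists 1%R; split; first lra; move=> y; rewrite /wn /momega /= Cmod_mult Cmod_R.
rewrite Rmult_assoc; apply: Rmult_le_compat_r; [exact: wn_ge0|exact: omega_bound].
Qed.

Definition idx (M : nat) : list 'I_M := index_enum 'I_M.

(** The unknowns. [YC]: increments of the real parameters divided by rho. [TT], [SS]: reciprocals of
    the period and of the circulations. [AA]: tangent of the angle increment of a pair, over rho;
    [DD]: reciprocal of 1 + cot times that tangent. [UU], [EE]: the same for the angle 2 pi rho tau
    / T. [V1], [V2]: the modes of v of frequency 1 and of frequency at least 2. [MM], [NN]: exterior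
    data with f' = 1 - rho^2 (MM - rho R) and w' = w0' - rho (NN - rho R) on the boundary, R being
    the respective regular integral. [QQ]: Q divided by rho. *)
Inductive comp (M : nat) : Type :=
  | YC of coord M | TT | SS of 'I_M | AA of 'I_M & 'I_M | DD of 'I_M & 'I_M
  | UU | EE of 'I_M & 'I_M | V1 of 'I_M | V2 of 'I_M | MM of 'I_M | NN of 'I_M | QQ of 'I_M.
Arguments YC {M} _. Arguments TT {M}. Arguments SS {M} _. Arguments AA {M} _ _.
Arguments DD {M} _ _. Arguments UU {M}. Arguments EE {M} _ _. Arguments V1 {M} _.
Arguments V2 {M} _. Arguments MM {M} _. Arguments NN {M} _. Arguments QQ {M} _.

Section System.
Variables (M : nat) (z0 : 'I_M -> C) (g0 : 'I_M -> R) (c0 : C) (T0 : R) (zm : coord M -> 'I_M -> C).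
Implicit Types (Y : comp M -> ser) (k j : 'I_M).

Definition e0 k j : C := Ccot (PI * (z0 k - z0 j) / T0).

(* Increments divided by rho; the parameters are [lambda_0 + rho (increment)]. *)
Definition zh Y k : ser := Y (YC (CenterRe k)) [+] Ci [:] Y (YC (CenterIm k)).
Definition gh Y k : ser := Y (YC (Circulation k)).
Definition chh Y : ser := Y (YC (SpeedRe M)) [+] Ci [:] Y (YC (SpeedIm M)).
Definition Th Y : ser := Y (YC (Period M)).

Definition gam Y k : ser := sK (g0 k) [+] ssh (gh Y k).
Definition spd Y : ser := sK c0 [+] ssh (chh Y).
Definition zhd Y k j : ser := zh Y k [+] (- (1)) [:] zh Y j.
Definition zd Y k j : ser := sK (z0 k - z0 j) [+] ssh (zhd Y k j).
Definition th Y : ser := (- / T0) [:] (Th Y [*] Y TT).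
(** The increment of the angle pi (z_k - z_j)/T over its value at Lambda_0, divided by rho
    ([angle_eq]). *)
Definition Ah Y k j : ser :=
  (PI / T0) [:] (zhd Y k j [+] (- (1)) [:] (Th Y [*] Y TT [*] zd Y k j)).
(** From cot(A + b) - cot A = -(1 + cot^2 A) tan b / (1 + cot A tan b), divided by rho. *)
Definition eh Y k j : ser := (- (1 + e0 k j * e0 k j)) [:] (Y (AA k j) [*] Y (DD k j)).
Definition ee Y k j : ser := sK (e0 k j) [+] ssh (eh Y k j).
Definition Xu Y : ser := (2 * PI) [:] stau 1 (Y TT).
Definition E1 Y k j : ser := (- (1)) [:] ((sK 1 [+] ee Y k j [*] ee Y k j) [*] (Y UU [*] Y (EE k j))).
Definition C1 Y : ser := slin momega (Y UU).
Definition K1 Y k j : ser := PI [:] (Y TT [*] (if k == j then C1 Y else E1 Y k j)).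
(** At a nonzero argument u this is [Kern] at 2 rho u ([Kt_val]). The doubling undoes the halving in
    the residue operator. For k = j the pole is already removed and the kernel carries a factor
    rho. *)
Definition Kt Y k j : ser :=
  if k == j then ssh (K1 Y k j) else PI [:] (Y TT [*] ee Y k j) [+] ssh (K1 Y k j).
Definition Rr Y (Z : 'I_M -> ser) k : ser := sbig (idx M) (fun j => rop (Kt Y j k) (Z j)).
Definition RM Y k : ser := Rr Y (fun j => Y (MM j)) k.
Definition RN Y k : ser := Rr Y (fun j => Y (NN j)) k.

Definition vv Y k : ser := Y (V1 k) [+] Y (V2 k).
Definition vi Y k : ser := vv Y k [+] (- (1)) [:] sconj (vv Y k).
Definition gg Y k : ser := Y (MM k) [+] (- (1)) [:] ssh (RM Y k).
Definition g4 Y k : ser := (/ (4 * PI * PI)) [:] (gam Y k [*] gam Y k).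
(** Half of the remainder of the Bernoulli equation after division by rho^2; written as [Hh] plus
    its conjugate, the remainder is real. *)
Definition Hh Y k : ser :=
  (/ 2) [:] ((- (1)) [:] (vi Y k [*] vi Y k)
     [+] Y (QQ k) [*] (gg Y k [+] sconj (gg Y k))
     [+] (- (1)) [:] ((ssh (ssh (Y (QQ k))) [+] g4 Y k) [*] (gg Y k [*] sconj (gg Y k)))).
Definition Er Y k : ser := Hh Y k [+] sconj (Hh Y k).

Definition f0 (X : ser) : ser := sfil (Z.eqb 0) X.
Definition fm1 (X : ser) : ser := sfil (Z.eqb (-1)) X.
Definition fm2 (X : ser) : ser := sfil (fun e => Z.leb e (-2)) X.
Definition fp1 (X : ser) : ser := sfil (Z.leb 1) X.

(** Frequencies 1 and -1 of the Bernoulli equation. [MM] has no such mode, so the leading linear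
    term to be matched is the one in the first mode of v. *)
Definition V1h Y k : ser :=
  sconj ((PI / Ci) [:] (Y (SS k) [*] (ssh (fm1 (Er Y k)) [+] (- (1)) [:] (g4 Y k [*] fm1 (sconj (RM Y k)))))).
(** Modes of frequency at least 2 in the interior equation. The kernels have positive exponents
    here, and the factor tau is the one in i rho tau (w' - c f'). *)
Definition V2a Y k : ser :=
  stau 1 (sbig (idx M) (fun j => (/ (2 * PI * Ci)) [:] (gam Y j [*] slin mhalf (K1 Y k j)))).
Definition V2b Y k : ser :=
  stau 1 (fp1 (RN Y k)) [+] (- (1)) [:] (spd Y [*] ssh (stau 1 (fp1 (RM Y k)))).
(** Frequencies at most -2 of the Bernoulli equation solved for [MM]: 4 pi i / gamma is i gamma / pi
    divided by gamma^2/(4 pi^2). *)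
Definition MMa Y k : ser := (4 * PI * Ci) [:] (Y (SS k) [*] sconj (Y (V2 k))).
Definition MMb Y k : ser :=
  fm2 (sconj (RM Y k)) [+] (- (4 * PI * PI)) [:] (Y (SS k) [*] Y (SS k) [*] ssh (fm2 (Er Y k))).
(** The exterior part of the kinematic condition, tau NN = conj v + rho c tau MM, solved for
    [NN]. *)
Definition NNa Y k : ser := stau (-1) (sconj (vv Y k)).
Definition NNb Y k : ser := spd Y [*] Y (MM k).
Definition QQa Y k : ser :=
  (- (1)) [:] (g4 Y k [*] (f0 (RM Y k) [+] sconj (f0 (RM Y k)))) [+] ssh (f0 (Hh Y k) [+] sconj (f0 (Hh Y k))).

(** What the point vortex velocity at Lambda, divided by rho^2, has to be for the frequency 1 of the
    interior equation to hold. *)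
Definition Bv Y k : ser :=
  stau (-1) (V1h Y k) [+] (- (1)) [:] f0 (RN Y k) [+] spd Y [*] ssh (f0 (RM Y k)).
Definition te Y k j : ser := th Y [*] ee Y k j [+] (/ T0) [:] eh Y k j.
(** The part of a summand of the velocity beyond first order in the increments, divided by rho^2 and
    by 1/(2 i); [term_eq] is the exact expansion. *)
Definition rest1 Y k j : ser :=
  (gh Y j [+] (- (g0 j / T0)) [:] Th Y) [*] te Y k j
  [+] (- (g0 j / T0 * (1 + e0 k j * e0 k j))) [:]
    ((- (PI / T0)) [:] (Th Y [*] (th Y [*] zd Y k j [+] (/ T0) [:] zhd Y k j))
      [+] ssh (sW (Y (AA k j) [*] Y (AA k j)) (Ah Y k j))
      [+] (- e0 k j) [:] (Y (AA k j) [*] Y (AA k j) [*] Y (DD k j))).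
Definition rest Y k : ser :=
  sbig (idx M) (fun j => if j == k then scst nil else (/ (2 * Ci)) [:] rest1 Y k j).
(** The matrix [zm] represents a real solution of a real-linear equation as twice a real part, so
    the increment is rho times [yv] plus its conjugate. *)
Definition yv Y i : ser :=
  sbig (idx M) (fun j => zm i j [:] (Bv Y j [+] (- (1)) [:] rest Y j)).

(** Four nested layers make the system strict: a term without a factor rho is evaluated at the
    output of the preceding layer, hence involves lower orders only. Components not yet treated get
    a placeholder that a later layer overwrites. The projection [sc] makes parameter series constant
    in tau by their syntax. *)
Definition S1 Y : comp M -> ser := fun i =>
  match i with
  | YC i => sc (ssh (yv Y i [+] sconj (yv Y i)))
  | TT => sc (sK (/ T0) [+] ssh (th Y))
  | SS k => sc (sK (/ g0 k) [+] ssh ((- / g0 k) [:] (gh Y k [*] Y (SS k))))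
  | DD k j => sc (sK 1 [+] ssh ((- e0 k j) [:] (Y (AA k j) [*] Y (DD k j))))
  | EE k j => sK 1 [+] ssh ((- (1)) [:] (ee Y k j [*] Y UU [*] Y (EE k j)))
  | _ => scst nil
  end.

Definition S2 Y : comp M -> ser := fun i =>
  match i with
  | AA k j => sc (Ah (S1 Y) k j [+] ssh (ssh (sW (Y (AA k j) [*] Y (AA k j)) (Ah Y k j))))
  | UU => Xu (S1 Y) [+] ssh (ssh (sW (Y UU [*] Y UU) (Xu Y)))
  | i => S1 Y i
  end.

Definition S3 Y : comp M -> ser := fun i =>
  match i with
  | V1 k => ssh (V1h Y k)
  | V2 k => V2a (S2 Y) k [+] ssh (V2b Y k)
  | i => S2 Y i
  end.

Definition S4 Y : comp M -> ser := fun i =>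
  match i with
  | MM k => MMa (S3 Y) k [+] ssh (MMb Y k)
  | NN k => NNa (S3 Y) k [+] ssh (NNb Y k)
  | QQ k => ssh (QQa Y k)
  | i => S3 Y i
  end.

Lemma wk_mul F G : wk F -> wk G -> wk (fun Y => F Y [*] G Y).
Proof. by move=> HF HG; apply: wk_bil => //; [exact: mmul_bounded|exact: one_contracting]. Qed.

Lemma st_mul F G : st F -> st G -> st (fun Y => F Y [*] G Y).
Proof. by move=> HF HG; apply: st_bil => //; [exact: mmul_bounded|exact: one_contracting]. Qed.

Lemma wk_W F G : wk F -> wk G -> wk (fun Y => sW (F Y) (G Y)).
Proof. by move=> HF HG; apply: wk_bil => //; [exact: mmul_bounded|exact: w2_contracting]. Qed.

Lemma wk_rop F G : wk F -> wk G -> wk (fun Y => rop (F Y) (G Y)).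
Proof. by move=> HF HG; apply: wk_bil => //; [exact: rmono_bounded|exact: one_contracting]. Qed.

Ltac wk_step := lazymatch goal with
  | |- wk (fun Y => sadd (@?F Y) (@?G Y)) => apply: (wk_add _ F G)
  | |- wk (fun Y => smul (@?F Y) (@?G Y)) => apply: (wk_mul F G)
  | |- wk (fun Y => sW (@?F Y) (@?G Y)) => apply: (wk_W F G)
  | |- wk (fun Y => slin ?g (@?F Y)) => apply: (wk_lin _ g F);
      [first [exact: bounded_mscal|exact: bounded_mexp|exact: bounded_mconj
      |exact: bounded_msc|exact: bounded_mhalf|exact: bounded_momega]|]
  | |- wk (fun Y => sfil ?P (@?F Y)) => apply: (wk_fil _ P F)
  | |- wk (fun Y => ssh (@?F Y)) => apply: st_wk; apply: (st_sh _ F)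
  | |- wk (fun Y => scst _) => apply: wk_cst
  | |- wk (fun Y => Y _) => apply: wk_var
  end.

Ltac wks := try unfold env; rewrite /sc /sconj /stau /sK /f0 /fm1 /fm2 /fp1; repeat wk_step.

Ltac st_step := lazymatch goal with
  | |- st (fun Y => sadd (@?F Y) (@?G Y)) => apply: (st_add _ F G)
  | |- st (fun Y => slin ?g (@?F Y)) => apply: (st_lin _ g F);
      [first [exact: bounded_mscal|exact: bounded_mexp|exact: bounded_mconj
      |exact: bounded_msc|exact: bounded_mhalf|exact: bounded_momega]|]
  | |- st (fun Y => sfil ?P (@?F Y)) => apply: (st_fil _ P F)
  | |- st (fun Y => ssh (@?F Y)) => apply: (st_sh _ F)
  | |- st (fun Y => scst _) => apply: st_cst
  end.

Ltac sts := try unfold env; rewrite /sc /sK /fm2; repeat st_step.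

Lemma wk_zd k j : wk (fun Y => zd Y k j).
Proof. by rewrite /zd /zhd /zh; wks. Qed.
Lemma wk_ee k j : wk (fun Y => ee Y k j).
Proof. by rewrite /ee /eh; wks. Qed.
Lemma wk_Ah k j : wk (fun Y => Ah Y k j).
Proof. by rewrite /Ah /zd /zhd /zh /Th; wks. Qed.
Lemma wk_K1 k j : wk (fun Y => K1 Y k j).
Proof. by rewrite /K1 /C1 /E1 /ee /eh; case: (k == j); cbv iota; wks. Qed.
Lemma wk_Kt k j : wk (fun Y => Kt Y k j).
Proof.
rewrite /Kt; case: (k == j); first by apply/st_wk/st_sh/wk_K1.
by cbv iota; rewrite /ee /eh; wks; exact: wk_K1.
Qed.
Lemma wk_RM k : wk (fun Y => RM Y k).
Proof. by apply: wk_big => j; apply: wk_rop; [exact: wk_Kt|exact: wk_var]. Qed.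
Lemma wk_RN k : wk (fun Y => RN Y k).
Proof. by apply: wk_big => j; apply: wk_rop; [exact: wk_Kt|exact: wk_var]. Qed.
Lemma wk_g4 k : wk (fun Y => g4 Y k).
Proof. by rewrite /g4 /gam /gh; wks. Qed.
Lemma wk_spd : wk (fun Y => spd Y).
Proof. by rewrite /spd /chh; wks. Qed.
Lemma wk_Hh k : wk (fun Y => Hh Y k).
Proof.
have Hg : wk (fun Y => gg Y k) by rewrite /gg; wks; exact: wk_RM.
by rewrite /Hh /vi /vv; wks => //; exact: wk_g4.
Qed.
Lemma wk_Er k : wk (fun Y => Er Y k).
Proof. by rewrite /Er; wks; exact: wk_Hh. Qed.
Lemma wk_V1h k : wk (fun Y => V1h Y k).
Proof. by rewrite /V1h; wks; [exact: wk_Er|exact: wk_g4|exact: wk_RM]. Qed.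
Lemma wk_rest k : wk (fun Y => rest Y k).
Proof.
apply: wk_big => j; case: (j == k); first exact: wk_cst.
by cbv iota; rewrite /rest1 /te /th /gh /Th /eh /zhd /zh; wks; first [exact: wk_ee|exact: wk_zd|exact: wk_Ah].
Qed.
Lemma wk_yv i : wk (fun Y => yv Y i).
Proof.
apply: wk_big => j; rewrite /Bv; wks; [exact: wk_V1h|exact: wk_RN|exact: wk_spd|exact: wk_RM|exact: wk_rest].
Qed.
Lemma wk_V2a k : wk (fun Y => V2a Y k).
Proof.
rewrite /V2a; apply: wk_lin; first exact: bounded_mexp.
by apply: wk_big => j; rewrite /gam /gh; wks; exact: wk_K1.
Qed.
Lemma wk_V2b k : wk (fun Y => V2b Y k).
Proof. by rewrite /V2b; wks; [exact: wk_RN|exact: wk_spd|exact: wk_RM]. Qed.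

Definition all_comp : list (comp M) :=
  let co := (map (@CenterRe M) (idx M) ++ map (@CenterIm M) (idx M) ++ map (@Circulation M) (idx M)
    ++ SpeedRe M :: SpeedIm M :: Period M :: nil) in
  let pr (F : 'I_M -> 'I_M -> comp M) := flat_map (fun k => map (F k) (idx M)) (idx M) in
  TT :: UU :: map YC co ++ map SS (idx M) ++ pr AA ++ pr DD ++ pr EE ++ map V1 (idx M)
   ++ map V2 (idx M) ++ map MM (idx M) ++ map NN (idx M) ++ map QQ (idx M).

Lemma In_idx k : In k (idx M).
Proof.
have := mem_index_enum k; rewrite /idx; elim: (index_enum _) => //= j l IH.
by rewrite seq.inE => /orP [/eqP ->|/IH]; [left|right].
Qed.

Lemma all_comp_full i : In i all_comp.
Proof.
have P F k j : In (F k j) (flat_map (fun k => map (F k) (idx M)) (idx M)).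
  by apply/in_flat_map; exists k; split; [exact: In_idx|apply: in_map; exact: In_idx].
have Q (A : Type) (F : 'I_M -> A) k : In (F k) (map F (idx M)) by apply: in_map; exact: In_idx.
rewrite /all_comp; case: i => [i||k|k j|k j||k j|k|k|k|k|k]; [|by left| | | |by right; left| | | | | |];
  right; right; rewrite !in_app_iff; [|by auto 12..].
by left; apply: in_map; rewrite !in_app_iff; case: i => [k|k|k|||]; rewrite /=; auto 12.
Qed.

Let cmp := @st_comp _ all_comp all_comp_full.

Lemma st_S1 i : st (fun Y => S1 Y i).
Proof.
case: i => [i||k|k j|k j||k j|k|k|k|k|k]; cbv beta iota delta [S1]; sts.
- by wks; exact: wk_yv.
- by rewrite /th /Th; wks.
- by rewrite /gh; wks.
- by wks.
- by wks; exact: wk_ee.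
Qed.

Lemma st_S2 i : st (fun Y => S2 Y i).
Proof.
case: i => [i||k|k j|k j||k j|k|k|k|k|k]; try exact: (st_S1 (YC _)); try exact: (st_S1 TT);
  try exact: (st_S1 (SS _)); try exact: (st_S1 (DD _ _)); try exact: (st_S1 (EE _ _)); try exact: st_cst;
  cbv beta iota delta [S2]; sts.
- exact: (cmp S1 _ st_S1 (wk_Ah k j)).
- by wks; exact: wk_Ah.
- by apply: (cmp S1 _ st_S1); rewrite /Xu; wks.
- by rewrite /Xu; wks.
Qed.

Lemma st_S3 i : st (fun Y => S3 Y i).
Proof.
case: i => [i||k|k j|k j||k j|k|k|k|k|k]; try exact: (st_S1 (YC _)); try exact: (st_S1 TT);
  try exact: (st_S1 (SS _)); try exact: (st_S1 (DD _ _)); try exact: (st_S1 (EE _ _)); try exact: st_cst.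
- exact: (st_S2 (AA k j)).
- exact: (st_S2 UU).
- by apply: st_sh; exact: wk_V1h.
- by cbv beta iota delta [S3]; sts; [exact: (cmp S2 _ st_S2 (wk_V2a k))|exact: wk_V2b].
Qed.

Lemma st_S4 i : st (fun Y => S4 Y i).
Proof.
have HM k : wk (fun Y => MMa Y k) by rewrite /MMa; wks.
have HN k : wk (fun Y => NNa Y k) by rewrite /NNa /vv; wks.
case: i => [i||k|k j|k j||k j|k|k|k|k|k]; try exact: (st_S3 (YC _)); try exact: (st_S3 TT);
  try exact: (st_S3 (SS _)); try exact: (st_S3 (DD _ _)); try exact: (st_S3 (EE _ _));
  try exact: (st_S3 (AA _ _)); try exact: (st_S3 UU); try exact: (st_S3 (V1 _)); try exact: (st_S3 (V2 _));
  cbv beta iota delta [S4]; sts.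
- exact: (cmp S3 _ st_S3 (HM k)).
- by rewrite /MMb; wks; [exact: wk_RM|exact: wk_Er].
- exact: (cmp S3 _ st_S3 (HN k)).
- by rewrite /NNb; wks; exact: wk_spd.
- by rewrite /QQa; wks; [exact: wk_g4|exact: wk_RM|exact: wk_RM|exact: wk_Hh|exact: wk_Hh].
Qed.

Lemma system_solution : exists (Y : comp M -> ser) (r : R),
  [/\ (0 < r)%R, Y = S4 Y & forall i, conv r (Y i)].
Proof.
have [Y [r [r0 H1 H2]]] := fixpoint_conv (comp M) all_comp all_comp_full S4 st_S4.
exists Y, r; split=> //; apply: functional_extensionality => i; apply: functional_extensionality => n.
exact: H1.
Qed.
End System.

(** * The periodic kernel, the boundary quantity and the splitting by frequency *)

Section Kernel.
Variables (M : nat) (L : params M) (x : R).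
Implicit Types (k j : 'I_M).

Definition kap : R := (PI / period L)%R.
Definition Kern k j (X : C) : C :=
  if k == j then kap * Ccot (kap * X) - / X else kap * Ccot (kap * (center L k - center L j + X)).

(* [X (0 < |X| < 1) = 1/(2 pi i) int_{|s| = 1/2} X(s) K(x (s - z)) ds] summed over the vortices. *)
Definition potl (X : 'I_M -> ser) k (z : C) : C :=
  / (2 * PI * Ci) * csumL (fun j => cint (fun t => Kern j k (x * (hc t - z)) * val (X j) x (hc t) * (Ci * hc t))) (idx M).

(* [i x tau (w' - c f')] at the point [tau] of the boundary of the k-th disk. *)
Definition bdry (mm nn : 'I_M -> ser) k (z : C) : C :=
  Defs.circ L k / (2 * PI) + Ci * x * z * (csumL (fun j => Defs.circ L j / (2 * PI * Ci) * Kern k j (x * z)) (idx M)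
   + x * (x * potl nn k z - val (nn k) x z)
   - speed L * (1 - x * x * (val (mm k) x z - x * potl mm k z))).
End Kernel.
Arguments kap {M} L.
Arguments Kern {M} L k j X.
Arguments potl {M} L x X k z.
Arguments bdry {M} L x mm nn k z.

(** Here p is tan b and d is 1/(1 + p cot A), both given by division-free equations, as the series
    satisfy them; nonvanishing of the new sine comes out as well. *)
Lemma cot_add_tan (A b p d : C) : Csin A <> 0 -> Csin b = p * Ccos b -> d * (1 + Ccot A * p) = 1 ->
  Csin (A + b) <> 0 /\ Ccot (A + b) = Ccot A - (1 + Ccot A * Ccot A) * p * d.
Proof.
move=> HA Hb Hd.
have cb : Ccos b <> 0.
  move=> E; have := Csin2_Ccos2 b; rewrite Hb E => H.
  by have := f_equal Re H; rewrite /= !(Rmult_0_r, Rmult_0_l); lra.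
have d0 : d <> 0 by move=> E; have := f_equal Re Hd; rewrite E Cmult_0_l /=; lra.
have q0 : 1 + Ccot A * p <> 0 by move=> E; have := f_equal Re Hd; rewrite E Cmult_0_r /=; lra.
have Es : Csin (A + b) = Csin A * Ccos b * (1 + Ccot A * p).
  by rewrite Csin_add Hb /Ccot; field.
have nz : Csin (A + b) <> 0 by rewrite Es; apply: Cmult_neq_0 => //; exact: Cmult_neq_0.
split=> //.
have Ed : d = / (1 + Ccot A * p).
  by transitivity (d * (1 + Ccot A * p) * / (1 + Ccot A * p)); [field|rewrite Hd; ring].
rewrite {1}/Ccot Es Ccos_add Hb Ed.
have -> : Ccos A * Ccos b - Csin A * (p * Ccos b) = Csin A * Ccos b * (Ccot A - p) by rewrite /Ccot; field.
by field; repeat split.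
Qed.

Definition fp1e (X : ser) : ser := sfil (Z.eqb 1) X.
Definition fp2 (X : ser) : ser := sfil (Z.leb 2) X.

(** The frequency bands 0, -1, at most -2, 1 and at least 2, in which the Bernoulli equation is
    solved separately. *)
Lemma lev_split5 X n z : lev (X n) z = lev (f0 X n) z + lev (fm1 X n) z + lev (fm2 X n) z
  + lev (fp1e X n) z + lev (fp2 X n) z.
Proof.
rewrite /f0 /fm1 /fm2 /fp1e /fp2 /sfil /lev; elim: (X n) => [|y l IH]; first by rewrite /=; ring.
have G (P : Z -> bool) : csumL (fun x => x.1 * zpow z x.2) (filter (fun x => P x.2) (y :: l))
  = (if P y.2 then y.1 * zpow z y.2 else 0) + csumL (fun x => x.1 * zpow z x.2) (filter (fun x => P x.2) l).
  by rewrite /=; case: (P y.2); rewrite /csumL /=; ring.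
rewrite (G (Z.eqb 0)) (G (Z.eqb (-1))) (G (fun e => Z.leb e (-2))) (G (Z.eqb 1)) (G (Z.leb 2)).
rewrite {1}/csumL [LHS]/= -/(csumL (fun x => x.1 * zpow z x.2) l) IH.
case: (Z.eqb_spec 0 y.2) => E0; case: (Z.eqb_spec (-1) y.2) => E1; case: (Z.leb_spec y.2 (-2)) => E2;
  case: (Z.eqb_spec 1 y.2) => E3; case: (Z.leb_spec 2 y.2) => E4; try lia; ring.
Qed.


Section Splitting.
Variables (r x : R) (z : C).
Hypothesis Hx : (Rabs x < r)%R.

Lemma hv_filP P X : conv r X -> OK z X -> hv r x z (sfil P X) (val (sfil P X) x z).
Proof. by move=> H1 H2; apply: hv_fil (hv_self r x z X H1 H2). Qed.

Lemma val_split5 X : conv r X -> OK z X ->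
  val X x z = val (f0 X) x z + val (fm1 X) x z + val (fm2 X) x z + val (fp1e X) x z + val (fp2 X) x z.
Proof.
move=> H1 H2; rewrite {1}/val.
have A P : asum (fun n => lev (sfil P X n) z) x by apply: (hv_asum r x z Hx); exact: hv_filP.
have S P Q := hv_add r x z Hx _ _ _ _ (hv_filP P X H1 H2) (hv_filP Q X H1 H2).
have H5 := hv_add r x z Hx _ _ _ _ (hv_add r x z Hx _ _ _ _ (hv_add r x z Hx _ _ _ _ (S (Z.eqb 0) (Z.eqb (-1)))
   (hv_filP (fun e => Z.leb e (-2)) X H1 H2)) (hv_filP (Z.eqb 1) X H1 H2)) (hv_filP (Z.leb 2) X H1 H2).
case: H5 => _ _ <-; apply: CS_ext => n; rewrite lev_split5 /sadd !lev_app //.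
Qed.

Lemma val_fp1 X : conv r X -> OK z X -> val (fp1 X) x z = val (fp1e X) x z + val (fp2 X) x z.
Proof.
move=> H1 H2; have [_ _ <-] := hv_add r x z Hx _ _ _ _ (hv_filP (Z.eqb 1) X H1 H2) (hv_filP (Z.leb 2) X H1 H2).
apply: CS_ext => n; rewrite /sadd lev_app /fp1 /sfil /lev; elim: (X n) => [|y l IH]; first by rewrite /=; ring.
have G (P : Z -> bool) : csumL (fun x => x.1 * zpow z x.2) (filter (fun x => P x.2) (y :: l))
  = (if P y.2 then y.1 * zpow z y.2 else 0) + csumL (fun x => x.1 * zpow z x.2) (filter (fun x => P x.2) l).
  by rewrite /=; case: (P y.2); rewrite /csumL /=; ring.
rewrite (G (Z.leb 1)) (G (Z.eqb 1)) (G (Z.leb 2)) IH.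
by case: (Z.leb_spec 1 y.2) => E1; case: (Z.eqb_spec 1 y.2) => E3; case: (Z.leb_spec 2 y.2) => E4; try lia; ring.
Qed.

Hypothesis Hz : Cmod z = 1%R.

Lemma OKz X : OK z X.
Proof. by left; rewrite /ann Hz; lra. Qed.

Lemma val_conj X : conv r X -> val (sconj X) x z = Cconj (val X x z).
Proof. by move=> H; have [_ _] := hv_conj r x z Hx _ _ Hz (hv_self r x z X H (OKz X)). Qed.

Lemma val_fil_conj P Q X : conv r X -> (forall e, P (- e)%Z = Q e) ->
  val (sfil P (sconj X)) x z = Cconj (val (sfil Q X) x z).
Proof.
move=> H E; rewrite -val_conj; last by apply: conv_sfil => //; have := Rabs_pos x; lra.
apply: CS_ext => n; congr lev; rewrite /sfil /sconj /slin; elim: (X n) => //= y l ->.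
by rewrite E; case: (Q y.2).
Qed.
End Splitting.

Lemma val_fil_empty P X x z : (forall e, nonneg e -> P e = false) -> supp nonneg X -> val (sfil P X) x z = 0.
Proof.
move=> HP HX; transitivity (CS (fun n => match n with O => 0 | S _ => 0 end) x); last by rewrite CS_cst.
apply: CS_ext => n.
have -> : sfil P X n = nil; last by case: n.
rewrite /sfil; move: (HX n); elim: (X n) => //= y l IH H.
by rewrite HP; [apply: IH => w Hw; apply: H; right|apply: H; left].
Qed.

Lemma lev_half l z : lsupp nonneg l -> lev (map mhalf l) z = lev l (z / 2).
Proof.
move=> H; rewrite /lev csumL_map; apply: csumL_ext => y Hy; have Hn := H y Hy.
rewrite /= !zpow_nonneg // (_ : Z.abs_nat y.2 = Z.to_nat y.2); last by rewrite /nonneg in Hn; lia.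
rewrite RtoC_inv; last by apply: pow_nonzero; lra.
by rewrite /Cdiv Cpow_mult_l Cpow_inv ?RtoC_pow; [ring|exact: C2_neq0].
Qed.

Lemma val_half X x z : supp nonneg X -> val (slin mhalf X) x z = val X x (z / 2).
Proof. by move=> H; apply: CS_ext => n; apply: lev_half; exact: H. Qed.


Lemma lsupp_sbil (P Q S : Z -> Prop) f w (X Y : ser) n : (forall x y, P x.2 -> Q y.2 -> S (f x y).2) ->
  (forall i, (i <= n)%nat -> lsupp P (X i)) -> (forall i, (i <= n)%nat -> lsupp Q (Y i)) ->
  lsupp S (sbil f w X Y n).
Proof.
move=> H HX HY x /in_flat_map [i [/in_seq Hi /in_map_iff [y [<- /in_flat_map [a [Ha /in_map_iff [b [<- Hb]]]]]]]].
by apply: H; [apply: (HX i) => //; lia|apply: (HY (n - i)%nat) => //; lia].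
Qed.

Lemma lev_sc X n z : lev (sc X n) z = lev (X n) 1.
Proof. exact: lev_msc. Qed.

Definition zero_exp (e : Z) : Prop := e = 0%Z.

Lemma supp_sc X : supp zero_exp (sc X).
Proof. exact: supp_msc. Qed.

Lemma supp0_nonneg X : supp zero_exp X -> supp nonneg X.
Proof. by apply: supp_sub => e ->; rewrite /nonneg; lia. Qed.

Lemma supp0_mul X Y : supp zero_exp X -> supp zero_exp Y -> supp zero_exp (X [*] Y).
Proof. by apply: supp_sbil => x y; rewrite /zero_exp /=; lia. Qed.

Lemma supp_nn_mul X Y : supp nonneg X -> supp nonneg Y -> supp nonneg (X [*] Y).
Proof. by apply: supp_sbil => x y; rewrite /nonneg /=; lia. Qed.

Lemma supp_scal P c X : supp P X -> supp P (c [:] X).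
Proof. by apply: supp_slin. Qed.

Lemma supp_K (P : Z -> Prop) c : P 0%Z -> supp P (sK c).
Proof. by move=> H; apply: supp_scst => x [<-|]. Qed.

Lemma supp_big {J} P (l : list J) F : (forall j, supp P (F j)) -> supp P (sbig l F).
Proof. by move=> H; elim: l => [|j l IH] /=; [exact: supp_scst|exact: supp_sadd]. Qed.

Lemma val_supp0 X x z : supp zero_exp X -> val X x z = val X x 1.
Proof.
move=> H; apply: CS_ext => n; rewrite /lev; apply: csumL_ext => y /H.
by rewrite /zero_exp => ->.
Qed.

Lemma ann1 : ann 1.
Proof. by rewrite /ann Cmod_1; lra. Qed.

Lemma OK1 X : OK 1 X.
Proof. by left; exact: ann1. Qed.

Lemma hv_supp0 r x z X : conv r X -> (Cmod z <= 4)%R -> supp zero_exp X -> hv r x z X (val X x 1).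
Proof. by move=> H1 H2 H3; split=> //; [right; split=> //; exact: supp0_nonneg|exact: val_supp0]. Qed.

(** * A solution of the system satisfies the boundary conditions *)

Section Solution.
Variables (M : nat) (z0 : 'I_M -> C) (g0 : 'I_M -> R) (c0 : C) (T0 : R) (zm : coord M -> 'I_M -> C).
Variables (Y : comp M -> ser) (r : R).
Hypothesis Yfix : Y = S4 M z0 g0 c0 T0 zm Y.
Hypothesis Yconv : forall i, conv r (Y i).
Implicit Types (k j : 'I_M).

Local Notation eeY := (ee M z0 T0 Y).
Local Notation AhY := (Ah M z0 T0 Y).
Local Notation E1Y := (E1 M z0 T0 Y).
Local Notation K1Y := (K1 M z0 T0 Y).
Local Notation KtY := (Kt M z0 T0 Y).
Local Notation RMY := (RM M z0 T0 Y).
Local Notation RNY := (RN M z0 T0 Y).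
Local Notation HhY := (Hh M z0 g0 T0 Y).
Local Notation ErY := (Er M z0 g0 T0 Y).
Local Notation V1hY := (V1h M z0 g0 T0 Y).
Local Notation S1Y := (S1 M z0 g0 c0 T0 zm Y).
Local Notation S2Y := (S2 M z0 g0 c0 T0 zm Y).
Local Notation S3Y := (S3 M z0 g0 c0 T0 zm Y).

Lemma Yat i : Y i = S4 M z0 g0 c0 T0 zm Y i.
Proof. exact: (f_equal (fun f => f i) Yfix). Qed.

Lemma Y_YC i : Y (YC i) = sc (ssh (yv M z0 g0 c0 T0 zm Y i [+] sconj (yv M z0 g0 c0 T0 zm Y i))).
Proof. exact: Yat. Qed.
Lemma Y_TT : Y TT = sc (sK (/ T0) [+] ssh (th M T0 Y)).
Proof. exact: Yat. Qed.
Lemma Y_SS k : Y (SS k) = sc (sK (/ g0 k) [+] ssh ((- / g0 k) [:] (gh M Y k [*] Y (SS k)))).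
Proof. exact: Yat. Qed.
Lemma Y_DD k j : Y (DD k j) = sc (sK 1 [+] ssh ((- e0 M z0 T0 k j) [:] (Y (AA k j) [*] Y (DD k j)))).
Proof. exact: Yat. Qed.
Lemma Y_EE k j : Y (EE k j) = sK 1 [+] ssh ((- (1)) [:] (eeY k j [*] Y UU [*] Y (EE k j))).
Proof. exact: Yat. Qed.

(** At the fixed point each layer agrees with Y on the components it defines, so the nested
    substitutions disappear from the equations. *)
Lemma S1_YC i : S1Y (YC i) = Y (YC i). Proof. exact: (esym (Yat (YC i))). Qed.
Lemma S1_TT : S1Y TT = Y TT. Proof. exact: (esym (Yat TT)). Qed.
Lemma S2_YC i : S2Y (YC i) = Y (YC i). Proof. exact: (esym (Yat (YC i))). Qed.
Lemma S2_TT : S2Y TT = Y TT. Proof. exact: (esym (Yat TT)). Qed.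
Lemma S2_AA k j : S2Y (AA k j) = Y (AA k j). Proof. exact: (esym (Yat (AA k j))). Qed.
Lemma S2_DD k j : S2Y (DD k j) = Y (DD k j). Proof. exact: (esym (Yat (DD k j))). Qed.
Lemma S2_UU : S2Y UU = Y UU. Proof. exact: (esym (Yat UU)). Qed.
Lemma S2_EE k j : S2Y (EE k j) = Y (EE k j). Proof. exact: (esym (Yat (EE k j))). Qed.
Lemma S3_SS k : S3Y (SS k) = Y (SS k). Proof. exact: (esym (Yat (SS k))). Qed.
Lemma S3_V1 k : S3Y (V1 k) = Y (V1 k). Proof. exact: (esym (Yat (V1 k))). Qed.
Lemma S3_V2 k : S3Y (V2 k) = Y (V2 k). Proof. exact: (esym (Yat (V2 k))). Qed.

Lemma Y_AA k j : Y (AA k j) = sc (AhY k j [+] ssh (ssh (sW (Y (AA k j) [*] Y (AA k j)) (AhY k j)))).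
Proof. by rewrite [LHS]Yat [LHS]/=; rewrite {1}/Ah /zd /zhd /zh /Th !S1_YC S1_TT. Qed.
Lemma Y_UU : Y UU = Xu M Y [+] ssh (ssh (sW (Y UU [*] Y UU) (Xu M Y))).
Proof. by rewrite [LHS]Yat [LHS]/=; rewrite {1}/Xu S1_TT. Qed.
Lemma Y_V1 k : Y (V1 k) = ssh (V1hY k).
Proof. exact: Yat. Qed.

Lemma S2_K1 k j : K1 M z0 T0 S2Y k j = K1Y k j.
Proof. by rewrite /K1 /C1 /E1 /ee /eh S2_TT S2_UU S2_AA S2_DD S2_EE. Qed.

Lemma Y_V2 k : Y (V2 k) = V2a M z0 g0 T0 Y k [+] ssh (V2b M z0 c0 T0 Y k).
Proof.
rewrite [LHS]Yat [LHS]/=; congr (_ [+] _); rewrite /V2a; congr (stau _ _).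
elim: (idx M) => //= j l ->; congr (_ [+] _); congr (_ [:] (_ [*] slin _ _)); last exact: S2_K1.
by rewrite /gam /gh S2_YC.
Qed.
Lemma Y_MM k : Y (MM k) = MMa M Y k [+] ssh (MMb M z0 g0 T0 Y k).
Proof. by rewrite [LHS]Yat [LHS]/=; rewrite /MMa S3_SS S3_V2. Qed.
Lemma Y_NN k : Y (NN k) = NNa M Y k [+] ssh (NNb M c0 Y k).
Proof. by rewrite [LHS]Yat [LHS]/=; rewrite /NNa /vv S3_V1 S3_V2. Qed.
Lemma Y_QQ k : Y (QQ k) = ssh (QQa M z0 g0 T0 Y k).
Proof. exact: Yat. Qed.

Lemma supp_YC i : supp zero_exp (Y (YC i)). Proof. rewrite Y_YC; exact: supp_sc. Qed.
Lemma supp_TT : supp zero_exp (Y TT). Proof. rewrite Y_TT; exact: supp_sc. Qed.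
Lemma supp_SS k : supp zero_exp (Y (SS k)). Proof. rewrite Y_SS; exact: supp_sc. Qed.
Lemma supp_AA k j : supp zero_exp (Y (AA k j)). Proof. rewrite Y_AA; exact: supp_sc. Qed.
Lemma supp_DD k j : supp zero_exp (Y (DD k j)). Proof. rewrite Y_DD; exact: supp_sc. Qed.

Lemma supp_ee k j : supp zero_exp (eeY k j).
Proof.
apply: supp_sadd; first exact: supp_K.
by apply: supp_ssh; apply: supp_scal; apply: supp0_mul; [exact: supp_AA|exact: supp_DD].
Qed.

Lemma supp_gam k : supp zero_exp (gam M g0 Y k).
Proof. by apply: supp_sadd; [exact: supp_K|apply: supp_ssh; exact: supp_YC]. Qed.

Lemma supp_spd : supp zero_exp (spd M c0 Y).
Proof.
apply: supp_sadd; first exact: supp_K.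
by apply: supp_ssh; apply: supp_sadd; [|apply: supp_scal]; exact: supp_YC.
Qed.

Lemma supp_g4 k : supp zero_exp (g4 M g0 Y k).
Proof. by apply: supp_scal; apply: supp0_mul; exact: supp_gam. Qed.

Definition pos_exp (e : Z) : Prop := (1 <= e)%Z.

Lemma supp_Xu : supp pos_exp (Xu M Y).
Proof. by apply: supp_scal; apply: supp_slin supp_TT => x; rewrite /zero_exp /pos_exp /=; lia. Qed.

(** The series is known only through its equation, so the support is propagated by induction on the
    order; the quadratic term at order n involves orders up to n - 2. *)
Lemma supp_UU : supp pos_exp (Y UU).
Proof.
move=> n; move: n {-2}n (Nat.le_refl n); elim=> [|m IH] n Hn; rewrite Y_UU.
  by move=> x /in_app_iff [|]; [exact: supp_Xu|have -> : n = 0%nat by lia].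
move=> x /in_app_iff [|]; first exact: supp_Xu.
case: n Hn => [|[|n]] Hn // Hin.
suff : lsupp pos_exp (sW (Y UU [*] Y UU) (Xu M Y) n) by apply.
apply: (lsupp_sbil pos_exp pos_exp) => [a b|i Hi|i Hi]; rewrite /pos_exp /=; first lia.
  by apply: (lsupp_sbil pos_exp pos_exp) => [a b|p Hp|p Hp]; rewrite /pos_exp /=; [lia|apply: IH; lia|apply: IH; lia].
exact: supp_Xu.
Qed.

Lemma supp_pos_nonneg X : supp pos_exp X -> supp nonneg X.
Proof. by apply: supp_sub => e; rewrite /pos_exp /nonneg; lia. Qed.

Lemma supp_EE k j : supp nonneg (Y (EE k j)).
Proof.
move=> n; move: n {-2}n (Nat.le_refl n).
have S1' : supp nonneg (sK 1) by apply: supp_K; rewrite /nonneg; lia.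
elim=> [|m IH] n Hn; rewrite Y_EE => x /in_app_iff [|]; try exact: S1'.
  by have -> : n = 0%nat by lia.
case: n Hn => [|n] Hn // /in_map_iff [y [<- Hy]].
have : lsupp nonneg ((eeY k j [*] Y UU [*] Y (EE k j)) n); last by move/(_ y Hy).
apply: (lsupp_sbil nonneg nonneg) => [a b|i Hi|i Hi]; rewrite /nonneg /=; first lia.
  by apply: supp_nn_mul; [apply: supp0_nonneg; exact: supp_ee|apply: supp_pos_nonneg; exact: supp_UU].
by apply: IH; lia.
Qed.

Lemma supp_C1 : supp pos_exp (C1 M Y).
Proof. by apply: supp_slin supp_UU. Qed.

Lemma supp_pos_mul X W : supp pos_exp X -> supp nonneg W -> supp pos_exp (X [*] W).
Proof. by apply: supp_sbil => x y; rewrite /pos_exp /nonneg /=; lia. Qed.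

Lemma supp_nn_pos_mul X W : supp nonneg X -> supp pos_exp W -> supp pos_exp (X [*] W).
Proof. by apply: supp_sbil => x y; rewrite /pos_exp /nonneg /=; lia. Qed.

Lemma supp_E1 k j : supp pos_exp (E1Y k j).
Proof.
apply: supp_scal; apply: supp_nn_pos_mul.
  apply: supp0_nonneg; apply: supp_sadd; first exact: supp_K.
  by apply: supp0_mul; exact: supp_ee.
by apply: supp_pos_mul; [exact: supp_UU|exact: supp_EE].
Qed.

Lemma supp_K1 k j : supp pos_exp (K1Y k j).
Proof.
apply: supp_scal; apply: supp_nn_pos_mul; first by apply: supp0_nonneg; exact: supp_TT.
by case: (k == j); [exact: supp_C1|exact: supp_E1].
Qed.

Lemma supp_Kt k j : supp nonneg (KtY k j).
Proof.
rewrite /Kt; case: (k == j); first by apply: supp_ssh; apply: supp_pos_nonneg; exact: supp_K1.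
apply: supp_sadd; last by apply: supp_ssh; apply: supp_pos_nonneg; exact: supp_K1.
by apply: supp0_nonneg; apply: supp_scal; apply: supp0_mul; [exact: supp_TT|exact: supp_ee].
Qed.

Lemma supp_RM k : supp nonneg (RMY k).
Proof. by apply: supp_big => j; exact: supp_rop. Qed.
Lemma supp_RN k : supp nonneg (RNY k).
Proof. by apply: supp_big => j; exact: supp_rop. Qed.

Lemma supp_V1h k : supp pos_exp (V1hY k).
Proof.
apply: (supp_slin (fun e => e = -1)%Z) => [x|]; first by rewrite /pos_exp /= => ->; lia.
have F X : supp (fun e => e = -1)%Z (fm1 X).
  by apply: supp_sub (supp_sfil (fun=> True) _ _ _) => // e [_ /Z.eqb_eq]; lia.
apply: supp_scal; apply: (supp_sbil zero_exp (fun e => e = -1)%Z) => [x y||].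
- by rewrite /zero_exp /= => -> ->.
- exact: supp_SS.
apply: supp_sadd; first by apply: supp_ssh; exact: F.
apply: supp_scal; apply: (supp_sbil zero_exp (fun e => e = -1)%Z) => [x y||].
- by rewrite /zero_exp /= => -> ->.
- exact: supp_g4.
exact: F.
Qed.

Lemma supp_stau P Q e X : (forall a, P a -> Q (a + e)%Z) -> supp P X -> supp Q (stau e X).
Proof. by move=> H; apply: supp_slin => x; exact: H. Qed.

Lemma supp_fp1 X : supp pos_exp (fp1 X).
Proof. by apply: supp_sub (supp_sfil (fun=> True) _ _ _) => // e [_ /Z.leb_le]. Qed.

Lemma supp_V2 k : supp (fun e => 2 <= e)%Z (Y (V2 k)).
Proof.
have T X : supp pos_exp X -> supp (fun e => 2 <= e)%Z (stau 1 X).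
  by apply: supp_stau => a; rewrite /pos_exp; lia.
have P0 P X W : (forall a, P a -> P a) -> supp zero_exp X -> supp P W -> supp P (X [*] W).
  by move=> _; apply: supp_sbil => x y; rewrite /zero_exp /= => ->.
rewrite Y_V2; apply: supp_sadd.
  apply: T; apply: supp_big => j; apply: supp_scal; apply: P0 => //; first exact: supp_gam.
  by apply: supp_slin (supp_K1 k j).
apply: supp_ssh; apply: supp_sadd; first by apply: T; exact: supp_fp1.
apply: supp_scal; apply: P0 => //; first exact: supp_spd.
by apply: supp_ssh; apply: T; exact: supp_fp1.
Qed.

Definition ext_exp (e : Z) : Prop := (e <= -2)%Z.

Lemma supp_ext_mul X W : supp zero_exp X -> supp ext_exp W -> supp ext_exp (X [*] W).
Proof. by apply: supp_sbil => x y; rewrite /zero_exp /ext_exp /= => ->. Qed.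

Lemma supp_fm2 X : supp ext_exp (fm2 X).
Proof. by apply: supp_sub (supp_sfil (fun=> True) _ _ _) => // e [_ /Z.leb_le]. Qed.

(** With exponents at most -2 the data have an antiderivative in tau with negative exponents only:
    no residue, hence a single-valued potential, and no mode 0, hence a density of mean zero. *)
Lemma supp_MM k : supp ext_exp (Y (MM k)).
Proof.
rewrite Y_MM; apply: supp_sadd.
  apply: supp_scal; apply: supp_ext_mul; first exact: supp_SS.
  by apply: supp_slin (supp_V2 k) => x; rewrite /ext_exp /=; lia.
apply: supp_ssh; apply: supp_sadd; first exact: supp_fm2.
apply: supp_scal; apply: supp_ext_mul; first by apply: supp0_mul; exact: supp_SS.
by apply: supp_ssh; exact: supp_fm2.
Qed.

Lemma supp_NN k : supp ext_exp (Y (NN k)).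
Proof.
rewrite Y_NN; apply: supp_sadd.
  apply: (supp_stau (fun e => e <= -1)%Z) => [a|]; first by rewrite /ext_exp; lia.
  apply: (supp_slin pos_exp) => [x|]; first by rewrite /pos_exp /=; lia.
  apply: supp_sadd; first by rewrite Y_V1; apply: supp_ssh; exact: supp_V1h.
  by apply: supp_sub (supp_V2 k) => e; rewrite /pos_exp; lia.
by apply: supp_ssh; apply: supp_ext_mul; [exact: supp_spd|exact: supp_MM].
Qed.

Lemma supp_f0 X : supp zero_exp (f0 X).
Proof. by apply: supp_sub (supp_sfil (fun=> True) _ _ _) => // e [_ /Z.eqb_eq]. Qed.

Lemma supp_conj0 X : supp zero_exp X -> supp zero_exp (sconj X).
Proof. by apply: supp_slin => x; rewrite /zero_exp /= => ->. Qed.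

Lemma supp_QQ k : supp zero_exp (Y (QQ k)).
Proof.
have F X : supp zero_exp (f0 X [+] sconj (f0 X)).
  by apply: supp_sadd; [|apply: supp_conj0]; exact: supp_f0.
rewrite Y_QQ; apply: supp_ssh; apply: supp_sadd; last by apply: supp_ssh.
by apply: supp_scal; apply: supp0_mul; [exact: supp_g4|exact: F].
Qed.

Variable x : R.
Hypothesis Hx : (Rabs x < r)%R.

Lemma r_pos : (0 < r)%R.
Proof. by have := Rabs_pos x; lra. Qed.

(** The final v of this and the following names marks the value at x of the series of that name. *)
Definition sv (i : comp M) : C := val (Y i) x 1.
Definition yi (i : coord M) : C := sv (YC i).
Definition zhv k : C := yi (CenterRe k) + Ci * yi (CenterIm k).
Definition zhdv k j : C := zhv k + - (1) * zhv j.
Definition zdv k j : C := z0 k - z0 j + x * zhdv k j.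
Definition ghv k : C := yi (Circulation k).
Definition gamv k : C := g0 k + x * ghv k.
Definition chv : C := yi (SpeedRe M) + Ci * yi (SpeedIm M).
Definition spdv : C := c0 + x * chv.
Definition Thv : C := yi (Period M).
Definition tv : C := sv TT.
Definition thv : C := - / T0 * (Thv * tv).
Definition Ahv k j : C := PI / T0 * (zhdv k j + - (1) * (Thv * tv * zdv k j)).
Definition ehv k j : C := - (1 + e0 M z0 T0 k j * e0 M z0 T0 k j) * (sv (AA k j) * sv (DD k j)).
Definition eev k j : C := e0 M z0 T0 k j + x * ehv k j.
Definition g4v k : C := / (4 * PI * PI) * (gamv k * gamv k).

Section AtPoint.
Variable z : C.
Hypothesis Hz : (Cmod z <= 4)%R.

Ltac hv_step := lazymatch goal with
  | |- hv _ _ _ (sadd _ _) _ => apply: (hv_add r x z Hx)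
  | |- hv _ _ _ (smul _ _) _ => apply: (hv_mul r x z Hx)
  | |- hv _ _ _ (slin (mscal _) _) _ => apply: (hv_scal r x z Hx)
  | |- hv _ _ _ (ssh _) _ => apply: (hv_sh r x z Hx)
  | |- hv _ _ _ (sK _) _ => apply: (hv_cst r x z _ Hz)
  end.

Lemma hv0 i : supp zero_exp (Y i) -> hv r x z (Y i) (sv i).
Proof. by move=> H; exact: hv_supp0. Qed.

Lemma hv_YC i : hv r x z (Y (YC i)) (yi i).
Proof. by apply: hv0; exact: supp_YC. Qed.
Lemma hv_TT : hv r x z (Y TT) tv.
Proof. by apply: hv0; exact: supp_TT. Qed.
Lemma hv_zh k : hv r x z (zh M Y k) (zhv k).
Proof. by rewrite /zh; repeat hv_step; exact: hv_YC. Qed.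
Lemma hv_zhd k j : hv r x z (zhd M Y k j) (zhdv k j).
Proof. by rewrite /zhd; repeat hv_step; exact: hv_zh. Qed.
Lemma hv_zd k j : hv r x z (zd M z0 Y k j) (zdv k j).
Proof. by rewrite /zd; repeat hv_step; exact: hv_zhd. Qed.
Lemma hv_gam k : hv r x z (gam M g0 Y k) (gamv k).
Proof. by rewrite /gam /gh; repeat hv_step; exact: hv_YC. Qed.
Lemma hv_spd : hv r x z (spd M c0 Y) spdv.
Proof. by rewrite /spd /chh; repeat hv_step; exact: hv_YC. Qed.
Lemma hv_th : hv r x z (th M T0 Y) thv.
Proof. by rewrite /th /Th; repeat hv_step; [exact: hv_YC|exact: hv_TT]. Qed.
Lemma hv_Ah k j : hv r x z (AhY k j) (Ahv k j).
Proof. by rewrite /Ah /Th; repeat hv_step; [exact: hv_zhd|exact: hv_YC|exact: hv_TT|exact: hv_zd]. Qed.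
Lemma hv_eh k j : hv r x z (eh M z0 T0 Y k j) (ehv k j).
Proof. by rewrite /eh; repeat hv_step; apply: hv0; [exact: supp_AA|exact: supp_DD]. Qed.
Lemma hv_ee k j : hv r x z (eeY k j) (eev k j).
Proof. by rewrite /ee; repeat hv_step; exact: hv_eh. Qed.
Lemma hv_g4 k : hv r x z (g4 M g0 Y k) (g4v k).
Proof. by rewrite /g4; repeat hv_step; exact: hv_gam. Qed.

Definition uv : C := val (Y UU) x z.
Definition Dv k j : C := val (Y (EE k j)) x z.
Definition E1v k j : C := - (1) * ((1 + eev k j * eev k j) * (uv * Dv k j)).

Lemma hv_UU : hv r x z (Y UU) uv.
Proof. by apply: hv_self => //; right; split=> //; apply: supp_pos_nonneg; exact: supp_UU. Qed.
Lemma hv_EE k j : hv r x z (Y (EE k j)) (Dv k j).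
Proof. by apply: hv_self => //; right; split=> //; exact: supp_EE. Qed.
Lemma hv_E1 k j : hv r x z (E1Y k j) (E1v k j).
Proof. by rewrite /E1; repeat hv_step; [exact: hv_ee|exact: hv_ee|exact: hv_UU|exact: hv_EE]. Qed.
End AtPoint.


Hypothesis T0pos : (0 < T0)%R.
Hypothesis g0nz : forall k, g0 k <> 0%R.
Hypothesis sin0 : forall k j, k <> j -> Csin (PI * (z0 k - z0 j) / T0) <> 0.

Lemma T0C : RtoC T0 <> 0.
Proof. by apply: RtoC_neq0; lra. Qed.

Lemma hv_val X z v : hv r x z X v -> val X x z = v.
Proof. by case. Qed.

Lemma sv_sc i X v : Y i = sc X -> hv r x 1 X v -> sv i = v.
Proof. by rewrite /sv => -> /hv_val <-; apply: CS_ext => n; rewrite lev_sc. Qed.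

Lemma one_le4 : (Cmod 1 <= 4)%R.
Proof. by rewrite Cmod_1; lra. Qed.

Lemma t_eq : tv = / T0 + x * thv.
Proof.
apply: (sv_sc _ _ _ Y_TT); apply: (hv_add r x _ Hx); first exact: (hv_cst r x _ _ one_le4).
by apply: (hv_sh r x _ Hx); apply: hv_th; exact: one_le4.
Qed.

Lemma t_period : tv * (T0 + x * Thv) = 1.
Proof. by have H := t_eq; rewrite {1}/thv in H; transitivity (T0 * tv + x * Thv * tv); [ring|rewrite {1}H; field; exact: T0C]. Qed.

Lemma s_gam k : sv (SS k) * gamv k = 1.
Proof.
have H : sv (SS k) = / g0 k + x * (- / g0 k * (ghv k * sv (SS k))).
  apply: (sv_sc _ _ _ (Y_SS k)); apply: (hv_add r x _ Hx); first exact: (hv_cst r x _ _ one_le4).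
  apply: (hv_sh r x _ Hx); apply: (hv_scal r x _ Hx); apply: (hv_mul r x _ Hx).
    by apply: hv_YC; exact: one_le4.
  by apply: (hv0 _ one_le4); exact: supp_SS.
rewrite /gamv; transitivity (g0 k * sv (SS k) + x * ghv k * sv (SS k)); first by ring.
by rewrite {1}H; field; apply: RtoC_neq0.
Qed.

Lemma DD_eq k j : sv (DD k j) = 1 + x * (- e0 M z0 T0 k j * (sv (AA k j) * sv (DD k j))).
Proof.
apply: (sv_sc _ _ _ (Y_DD k j)); apply: (hv_add r x _ Hx); first exact: (hv_cst r x _ _ one_le4).
apply: (hv_sh r x _ Hx); apply: (hv_scal r x _ Hx).
by apply: (hv_mul r x _ Hx); apply: (hv0 _ one_le4); [exact: supp_AA|exact: supp_DD].
Qed.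

Definition wv k j : C := val (sW (Y (AA k j) [*] Y (AA k j)) (AhY k j)) x 1.

Lemma conv_mul X W : conv r X -> conv r W -> conv r (X [*] W).
Proof.
by move=> H1 H2; apply: conv_sbil H1 H2; [exact: r_pos|exact: mmul_bounded|exact: one_contracting].
Qed.

Lemma conv_W X W : conv r X -> conv r W -> conv r (sW X W).
Proof.
by move=> H1 H2; apply: conv_sbil H1 H2; [exact: r_pos|exact: mmul_bounded|exact: w2_contracting].
Qed.

Lemma conv_rop X W : conv r X -> conv r W -> conv r (rop X W).
Proof.
by move=> H1 H2; apply: conv_sbil H1 H2; [exact: r_pos|exact: rmono_bounded|exact: one_contracting].
Qed.

Lemma conv_big {J} (l : list J) F : (forall i, conv r (F i)) -> conv r (sbig l F).
Proof. by move=> H; elim: l => [|i l IH] /=; [exact: conv_scst|exact: conv_sadd]. Qed.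

Ltac cv_step := lazymatch goal with
  | |- conv _ (sadd _ _) => apply: conv_sadd
  | |- conv _ (smul _ _) => apply: conv_mul
  | |- conv _ (sW _ _) => apply: conv_W
  | |- conv _ (slin ?g _) => apply: conv_slin; [exact: r_pos|
      first [exact: bounded_mscal|exact: bounded_mexp|exact: bounded_mconj
      |exact: bounded_msc|exact: bounded_mhalf|exact: bounded_momega]|]
  | |- conv _ (sfil _ _) => apply: conv_sfil; first exact: r_pos
  | |- conv _ (ssh _) => apply: conv_ssh; first exact: r_pos
  | |- conv _ (scst _) => exact: conv_scst
  | |- conv _ (Y _) => exact: Yconv
  end.
Ltac cvs := rewrite /sc /sconj /stau /sK /f0 /fm1 /fm2 /fp1; repeat cv_step.

Lemma cv_zd k j : conv r (zd M z0 Y k j).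
Proof. by rewrite /zd /zhd /zh; cvs. Qed.
Lemma cv_ee k j : conv r (eeY k j).
Proof. by rewrite /ee /eh; cvs. Qed.
Lemma cv_Ah k j : conv r (AhY k j).
Proof. by rewrite /Ah /zd /zhd /zh /Th; cvs. Qed.
Lemma cv_K1 k j : conv r (K1Y k j).
Proof. by rewrite /K1 /C1 /E1; case: (k == j); cvs; exact: cv_ee. Qed.
Lemma cv_Kt k j : conv r (KtY k j).
Proof. by rewrite /Kt; case: (k == j); cvs; first [exact: cv_K1|exact: cv_ee]. Qed.
Lemma cv_RM k : conv r (RMY k).
Proof. by apply: conv_big => j; apply: conv_rop; [exact: cv_Kt|]. Qed.
Lemma cv_RN k : conv r (RNY k).
Proof. by apply: conv_big => j; apply: conv_rop; [exact: cv_Kt|]. Qed.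
Lemma cv_g4 k : conv r (g4 M g0 Y k).
Proof. by rewrite /g4 /gam /gh; cvs. Qed.
Lemma cv_spd : conv r (spd M c0 Y).
Proof. by rewrite /spd /chh; cvs. Qed.
Lemma cv_gg k : conv r (gg M z0 T0 Y k).
Proof. by rewrite /gg; cvs; exact: cv_RM. Qed.
Lemma cv_vv k : conv r (vv M Y k).
Proof. by rewrite /vv; cvs. Qed.
Lemma cv_Hh k : conv r (HhY k).
Proof. by rewrite /Hh /vi; cvs; first [exact: cv_gg|exact: cv_g4|exact: cv_vv]. Qed.
Lemma cv_Er k : conv r (ErY k).
Proof. by rewrite /Er; cvs; exact: cv_Hh. Qed.
Lemma cv_V1h k : conv r (V1hY k).
Proof. by rewrite /V1h; cvs; first [exact: cv_Er|exact: cv_g4|exact: cv_RM]. Qed.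
Lemma cv_Bv k : conv r (Bv M z0 g0 c0 T0 Y k).
Proof. by rewrite /Bv; cvs; first [exact: cv_V1h|exact: cv_RN|exact: cv_RM|exact: cv_spd]. Qed.
Lemma cv_rest1 k j : conv r (rest1 M z0 g0 T0 Y k j).
Proof. by rewrite /rest1 /te /th /gh /Th /eh /zhd /zh; cvs; first [exact: cv_ee|exact: cv_zd|exact: cv_Ah]. Qed.
Lemma cv_rest k : conv r (rest M z0 g0 T0 Y k).
Proof. by apply: conv_big => j; case: (j == k); cvs; exact: cv_rest1. Qed.
Lemma cv_yv i : conv r (yv M z0 g0 c0 T0 zm Y i).
Proof. by apply: conv_big => j; cvs; [exact: cv_Bv|exact: cv_rest]. Qed.

Lemma hv_wv k j : hv r x 1 (sW (Y (AA k j) [*] Y (AA k j)) (AhY k j)) (wv k j).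
Proof. by apply: hv_self; [apply: conv_W; [apply: conv_mul|exact: cv_Ah]|exact: OK1]. Qed.

Lemma AA_eq k j : sv (AA k j) = Ahv k j + x * (x * wv k j).
Proof.
apply: (sv_sc _ _ _ (Y_AA k j)); apply: (hv_add r x _ Hx); first by apply: hv_Ah; exact: one_le4.
by do 2 apply: (hv_sh r x _ Hx); exact: hv_wv.
Qed.

Lemma AA_tan k j : Csin (x * Ahv k j) = x * sv (AA k j) * Ccos (x * Ahv k j).
Proof.
have <- : val (AhY k j) x 1 = Ahv k j by apply: hv_val; apply: hv_Ah; exact: one_le4.
apply: (tan_series r 1 (AhY k j) (Y (AA k j))) => //; [exact: cv_Ah|exact: OK1|exact: OK1|].
by move=> n; rewrite {1}Y_AA lev_sc /sadd lev_app.
Qed.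

Lemma angle_eq k j : PI * tv * zdv k j = PI * (z0 k - z0 j) / T0 + x * Ahv k j.
Proof.
have H := t_period; have n0 := T0C.
have H' : x * Thv * tv = 1 - T0 * tv by rewrite -H; ring.
rewrite /Ahv; transitivity (PI / T0 * (z0 k - z0 j + x * zhdv k j - (x * Thv * tv) * zdv k j)).
  by rewrite H' /zdv; field.
by field.
Qed.

Lemma cot_ee k j : k <> j -> Csin (PI * tv * zdv k j) <> 0 /\ Ccot (PI * tv * zdv k j) = eev k j.
Proof.
move=> kj; rewrite angle_eq.
have Hd : sv (DD k j) * (1 + Ccot (PI * (z0 k - z0 j) / T0) * (x * sv (AA k j))) = 1.
  rewrite -/(e0 M z0 T0 k j); have H := DD_eq k j.
  transitivity (sv (DD k j) + x * e0 M z0 T0 k j * (sv (AA k j) * sv (DD k j))); first by ring.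
  by rewrite {1}H; ring.
have [H1 H2] := cot_add_tan _ _ (x * sv (AA k j)) (sv (DD k j)) (sin0 k j kj) (AA_tan k j) Hd.
by split=> //; rewrite H2 /eev /ehv -/(e0 M z0 T0 k j); ring.
Qed.

Lemma UU_tan z : (Cmod z <= 4)%R ->
  Csin (x * (2 * PI * (z * tv))) = x * uv z * Ccos (x * (2 * PI * (z * tv))).
Proof.
move=> Hz; have HX : hv r x z (Xu M Y) (2 * PI * (z * tv)).
  apply: (hv_scal r x _ Hx); apply: (hv_eq r x z _ (zpow z 1 * tv)); last by rewrite /= Cmult_1_r.
  by apply: (hv_exp_nonneg r x z Hx) => //; [apply: supp0_nonneg; exact: supp_TT|exact: hv_TT].
rewrite -(hv_val _ _ _ HX); case: HX => H1 H2 _.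
apply: (tan_series r z _ (Y UU)) => //; first by right; split=> //; apply: supp_pos_nonneg; exact: supp_UU.
by move=> n; rewrite {1}Y_UU /sadd lev_app.
Qed.

Lemma EE_eq z k j : (Cmod z <= 4)%R -> Dv z k j * (1 + eev k j * (x * uv z)) = 1.
Proof.
move=> Hz; have H : Dv z k j = 1 + x * (- (1) * (eev k j * uv z * Dv z k j)).
  rewrite {1}/Dv Y_EE; apply: hv_val; apply: (hv_add r x _ Hx); first exact: (hv_cst r x _ _ Hz).
  apply: (hv_sh r x _ Hx); apply: (hv_scal r x _ Hx); apply: (hv_mul r x _ Hx); last exact: hv_EE.
  by apply: (hv_mul r x _ Hx); [exact: hv_ee|exact: hv_UU].
transitivity (Dv z k j + x * (eev k j * uv z * Dv z k j)); first by ring.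
by rewrite {1}H; ring.
Qed.

Lemma cot_E1 z k j : (Cmod z <= 4)%R -> k <> j ->
  Csin (PI * tv * (zdv k j + 2 * x * z)) <> 0 /\
  Ccot (PI * tv * (zdv k j + 2 * x * z)) = eev k j + x * E1v z k j.
Proof.
move=> Hz kj; have [H1 H2] := cot_ee k j kj.
have -> : PI * tv * (zdv k j + 2 * x * z) = PI * tv * zdv k j + x * (2 * PI * (z * tv)) by ring.
have Hd := EE_eq z k j Hz; rewrite -{1}H2 in Hd.
have [H3 H4] := cot_add_tan _ _ _ _ H1 (UU_tan z Hz) Hd.
by split=> //; rewrite H4 H2 /E1v; ring.
Qed.

(** On tau^p this is omega (1 - 2^-(p+1)) = -2^-(p+1), the duplication formula read on one power. *)
Lemma lev_omega l z : lsupp nonneg l ->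
  lev (map momega l) z = / 2 * lev (map momega l) (z / 2) - / 2 * lev l (z / 2).
Proof.
move=> H; rewrite /lev !csumL_map; elim: l H => [|y l IH] H; first by rewrite /=; ring.
have Hl : lsupp nonneg l by move=> w Hw; apply: H; right.
have Hy : nonneg y.2 by apply: H; left.
rewrite [LHS]/= [csumL _ l](IH Hl) /=.
have E : RtoC (omega (Z.abs_nat y.2)) * zpow z y.2
  = / 2 * (RtoC (omega (Z.abs_nat y.2)) * zpow (z / 2) y.2) - / 2 * zpow (z / 2) y.2.
  rewrite !zpow_nonneg // (_ : Z.to_nat y.2 = Z.abs_nat y.2); last by rewrite /nonneg in Hy; lia.
  move: (Z.abs_nat y.2) => p; rewrite /Cdiv Cpow_mult_l Cpow_inv; last exact: C2_neq0.
  rewrite -RtoC_pow.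
  have p0 : (2 ^ p <> 0)%R by apply: pow_nonzero; lra.
  have h := half_pow_bound p.
  rewrite -(RtoC_inv (2 ^ p)) // /omega half_pow_S; move: (/ 2 ^ p)%R h => h Hh.
  have -> : RtoC (- (h / 2) / (1 - h / 2)) = RtoC (- (h / (2 - h))) by congr RtoC; field; lra.
  rewrite RtoC_opp RtoC_div; last lra.
  rewrite RtoC_minus; field.
  by rewrite -RtoC_minus; apply: RtoC_neq0; lra.
set A := csumL _ l; set B := csumL (fun x0 : C * Z => _) l.
transitivity (y.1 * (RtoC (omega (Z.abs_nat y.2)) * zpow z y.2) + (/ 2 * A - / 2 * B)); first by ring.
by rewrite E; ring.
Qed.

Definition C1v z : C := val (C1 M Y) x z.

Lemma hv_C1 z : (Cmod z <= 4)%R -> hv r x z (C1 M Y) (C1v z).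
Proof.
move=> Hz; apply: hv_self; first by rewrite /C1; cvs.
by right; split=> //; apply: supp_pos_nonneg; exact: supp_C1.
Qed.

Lemma half_le4 z : (Cmod z <= 4)%R -> (Cmod (z / 2) <= 4)%R.
Proof.
move=> Hz; rewrite Cmod_div; last exact: C2_neq0.
by rewrite Cmod_R Rabs_pos_eq; have := Cmod_ge_0 z; lra.
Qed.

Lemma C1_half z : (Cmod z <= 4)%R -> C1v z = / 2 * C1v (z / 2) - / 2 * uv (z / 2).
Proof.
move=> Hz; have Hz2 := half_le4 z Hz.
have H := hv_add r x _ Hx _ _ _ _ (hv_scal r x _ Hx (/ 2) _ _ (hv_C1 _ Hz2)) (hv_scal r x _ Hx (- / 2) _ _ (hv_UU _ Hz2)).
transitivity (/ 2 * C1v (z / 2) + - / 2 * uv (z / 2)); last by ring.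
rewrite -(hv_val _ _ _ H); apply: CS_ext => n.
rewrite /sadd lev_app /slin !lev_map_mscal lev_omega; last by apply: supp_pos_nonneg; exact: supp_UU.
by rewrite /C1 /slin; ring.
Qed.


Lemma val_bound X : conv r X -> exists b, forall z, OK z X -> (Cmod (val X x z) <= b)%R.
Proof.
move=> [b Hb]; exists b => z Hz; apply: bsum_CS => m.
by apply: Rle_trans (lev_dom z X r m x Hz _) (Hb m); lra.
Qed.

Lemma cot_half (w p : C) : Csin (w / 2) <> 0 -> Ccos (w / 2) <> 0 -> Csin (w / 2) = p * Ccos (w / 2) ->
  Ccot w = / 2 * Ccot (w / 2) - / 2 * p.
Proof.
move=> s0 c0' E; have -> : p = Csin (w / 2) / Ccos (w / 2) by rewrite E; field.
have {1}-> : w = w / 2 + w / 2 by field; exact: C2_neq0.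
rewrite /Ccot Csin_add Ccos_add; field; repeat split => //.
rewrite (_ : _ + _ = 2 * (Csin (w / 2) * Ccos (w / 2))); last by ring.
by apply: Cmult_neq_0; [exact: C2_neq0|exact: Cmult_neq_0].
Qed.

Lemma cot_sub_inv (w : C) : w <> 0 -> (Cmod w <= 1 / 8)%R ->
  Csin w <> 0 /\ Ccos w <> 0 /\ (Cmod (Ccot w - / w) <= 10)%R.
Proof.
move=> w0 Hw; have [H1 _ H3 H4] := small_trig w Hw; have wp := proj1 (Cmod_gt_0 w) w0.
have s0 : Csin w <> 0 by move=> E; move: H3; rewrite E Cmod_0; lra.
have c0' : Ccos w <> 0 by move=> E; move: H1; rewrite E Cmod_0; lra.
split=> //; split=> //.
have -> : Ccot w - / w = (w * Ccos w - Csin w) / (w * Csin w) by rewrite /Ccot; field.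
have ws0 : w * Csin w <> 0 by exact: Cmult_neq_0.
rewrite Cmod_div // (Cmod_mult w (Csin w)).
have P : (0 < Cmod w * Cmod (Csin w))%R by rewrite -(Cmod_mult w (Csin w)); apply/Cmod_gt_0.
apply: (Rmult_le_reg_r (Cmod w * Cmod (Csin w))) => //.
rewrite /Rdiv Rmult_assoc Rinv_l; last lra.
rewrite Rmult_1_r; apply: Rle_trans H4 _.
have := Rmult_le_compat_l (10 * Cmod w) _ _ _ H3; move: (Cmod (Csin w)) => s; nra.
Qed.

Definition ev z : C := x * (2 * PI * (z * tv)).

(** The defect D between the series and cot y - 1/y satisfies D(w) = D(w/2)/2 by the duplication
    formula. It is bounded, so iteration gives D = 0. *)
Lemma C1_cot z : (Cmod z <= 4)%R -> ev z <> 0 -> (Cmod (ev z) <= 1 / 8)%R ->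
  x * C1v z = Ccot (ev z) - / ev z.
Proof.
have [b Hb] := val_bound (C1 M Y) ltac:(rewrite /C1; cvs).
pose D w := x * C1v w - (Ccot (ev w) - / ev w).
have ev2 w : ev (w / 2) = ev w / 2 by rewrite /ev; field; exact: C2_neq0.
have H2 w : (Cmod w / 2 <= Cmod w)%R by have := Cmod_ge_0 w; lra.
have M2 w : Cmod (w / 2) = (Cmod w / 2)%R.
  by rewrite Cmod_div; [rewrite Cmod_R Rabs_pos_eq //; lra|exact: C2_neq0].
have half w : (Cmod w <= 4)%R -> ev w <> 0 -> (Cmod (ev w) <= 1 / 8)%R -> D w = / 2 * D (w / 2).
  move=> Hw w0 Hs; have Hw2 := half_le4 w Hw; rewrite /D C1_half // ev2.
  have h0 : ev w / 2 <> 0.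
    by move=> E; apply: w0; rewrite (_ : ev w = 2 * (ev w / 2)); [rewrite E; ring|field; exact: C2_neq0].
  have [|s0 [c0' _]] := cot_sub_inv (ev w / 2) h0.
    by rewrite M2; have := H2 (ev w); lra.
  rewrite (cot_half (ev w) (x * uv (w / 2))) //; last by have := UU_tan _ Hw2; rewrite -/(ev _) ev2.
  by field.
have bnd w : (Cmod w <= 4)%R -> ev w <> 0 -> (Cmod (ev w) <= 1 / 8)%R -> (Cmod (D w) <= Rabs x * b + 10)%R.
  move=> Hw w0 Hs; have [_ [_ H]] := cot_sub_inv _ w0 Hs.
  apply: Rle_trans (Cmod_sub_le _ _) _; apply: Rplus_le_compat => //.
  rewrite (Cmod_mult x) Cmod_R; apply: Rmult_le_compat_l; first exact: Rabs_pos.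
  by apply: Hb; right; split=> //; apply: supp_pos_nonneg; exact: supp_C1.
have it n : forall w, (Cmod w <= 4)%R -> ev w <> 0 -> (Cmod (ev w) <= 1 / 8)%R ->
    (Cmod (D w) <= (Rabs x * b + 10) * (/ 2) ^ n)%R.
  elim: n => [|n IH] w Hw w0 Hs; first by rewrite Rmult_1_r; exact: bnd.
  rewrite half // (Cmod_mult (/ 2)) Cmod_inv; last exact: C2_neq0.
  rewrite Cmod_R (Rabs_pos_eq 2); last lra.
  have h0 : ev (w / 2) <> 0.
    by rewrite ev2 => E; apply: w0; rewrite (_ : ev w = 2 * (ev w / 2)); [rewrite E; ring|field; exact: C2_neq0].
  have := IH (w / 2) (half_le4 w Hw) h0 ltac:(rewrite ev2 M2; have := H2 (ev w); lra).
  by rewrite [((/ 2) ^ S n)%R]/=; lra.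
move=> Hz z0' Hs; apply: Cminus_eq0; apply: Cmod_eq_0; apply: Rle_antisym; last exact: Cmod_ge_0.
have L : is_lim_seq (fun n => (Rabs x * b + 10) * (/ 2) ^ n)%R 0%R.
  rewrite (_ : 0%R = (Rabs x * b + 10) * 0)%R; last by ring.
  by apply: (is_lim_seq_scal_l _ _ 0%R); apply: is_lim_seq_geom; rewrite Rabs_pos_eq; lra.
apply: (is_lim_seq_le (fun _ => Cmod (D z)) _ (Cmod (D z)) 0%R) L => [n|]; [exact: it|exact: is_lim_seq_const].
Qed.


Lemma csumL_minus {A} (f g : A -> C) l : csumL (fun y => f y - g y) l = csumL f l - csumL g l.
Proof. by elim: l => [|y l IH] /=; [ring|rewrite IH; ring]. Qed.

Definition zvec (y : coord M -> C) k : C := y (CenterRe k) + Ci * y (CenterIm k).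
Definition Dterm (y : coord M -> C) k j : C :=
  y (Circulation j) / T0 * e0 M z0 T0 k j - g0 j / (T0 * T0) * y (Period M) * e0 M z0 T0 k j
  - g0 j / T0 * (1 + e0 M z0 T0 k j * e0 M z0 T0 k j) * (PI / T0)
    * (zvec y k - zvec y j - y (Period M) / T0 * (z0 k - z0 j)).
(* The differential of the velocity at [Lambda_0], in real coordinates. *)
Definition Dvel (y : coord M -> C) k : C :=
  csumL (fun j => if j == k then RtoC 0 else / (2 * Ci) * Dterm y k j) (idx M)
  - (y (SpeedRe M) + Ci * y (SpeedIm M)).

Lemma Dvel_scal (q : C) y k : Dvel (fun i => q * y i) k = q * Dvel y k.
Proof.
rewrite /Dvel; transitivity (q * csumL (fun j => if j == k then RtoC 0 else / (2 * Ci) * Dterm y k j) (idx M)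
  - q * (y (SpeedRe M) + Ci * y (SpeedIm M))); last by ring.
rewrite -csumL_scal; congr (_ - _); last by ring.
apply: csumL_ext => j _; case: (j == k); first by ring.
by rewrite /Dterm /zvec /Cdiv; ring.
Qed.

Hypothesis vel0 : forall k, csumL (fun j => if j == k then RtoC 0 else g0 j / (2 * Ci * T0) * e0 M z0 T0 k j) (idx M) - c0 = 0.
Hypothesis zm_spec : forall (v : 'I_M -> C) k,
  Dvel (fun i => csumL (fun j => zm i j * v j) (idx M) + Cconj (csumL (fun j => zm i j * v j) (idx M))) k = v k.

Definition Bval k : C := val (Bv M z0 g0 c0 T0 Y k) x 1.
Definition tev k j : C := thv * eev k j + / T0 * ehv k j.
Definition rest1v k j : C :=
  (ghv j + - (g0 j / T0) * Thv) * tev k j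
  + - (g0 j / T0 * (1 + e0 M z0 T0 k j * e0 M z0 T0 k j)) *
    (- (PI / T0) * (Thv * (thv * zdv k j + / T0 * zhdv k j))
      + x * wv k j + - e0 M z0 T0 k j * (sv (AA k j) * sv (AA k j) * sv (DD k j))).
Definition restv k : C := csumL (fun j => if j == k then RtoC 0 else / (2 * Ci) * rest1v k j) (idx M).

Ltac hstep1 := lazymatch goal with
  | |- hv _ _ _ (sadd _ _) _ => apply: (hv_add r x 1 Hx)
  | |- hv _ _ _ (smul _ _) _ => apply: (hv_mul r x 1 Hx)
  | |- hv _ _ _ (slin (mscal _) _) _ => apply: (hv_scal r x 1 Hx)
  | |- hv _ _ _ (ssh _) _ => apply: (hv_sh r x 1 Hx)
  | |- hv _ _ _ (sK _) _ => apply: (hv_cst r x 1 _ one_le4)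
  end.

Lemma hv_rest k : hv r x 1 (rest M z0 g0 T0 Y k) (restv k).
Proof.
apply: (hv_big r x 1 Hx _ _ (fun j => if j == k then RtoC 0 else / (2 * Ci) * rest1v k j) one_le4) => j.
case: (j == k).
  split; [exact: conv_scst|exact: OK1|].
  by rewrite /val -[RHS](CS_cst 0 x); apply: CS_ext => -[|n].
have one4 := one_le4; apply: (hv_scal r x 1 Hx); rewrite /rest1 /rest1v /tev /te /gh /Th.
repeat hstep1; first [exact: hv_wv|exact: hv_th|exact: hv_YC|exact: hv_ee|exact: hv_eh|exact: hv_zd|exact: hv_zhd|
  apply: (hv0 _ one4); first [exact: supp_AA|exact: supp_DD]].
Qed.

Lemma yi_eq i : yi i = x * (csumL (fun j => zm i j * (Bval j - restv j)) (idx M)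
   + Cconj (csumL (fun j => zm i j * (Bval j - restv j)) (idx M))).
Proof.
have one1 : Cmod 1 = 1%R by rewrite Cmod_1.
have H : hv r x 1 (yv M z0 g0 c0 T0 zm Y i) (csumL (fun j => zm i j * (Bval j - restv j)) (idx M)).
  rewrite (csumL_ext _ (fun j => zm i j * (Bval j + - (1) * restv j))); last by move=> j _; ring.
  apply: (hv_big r x 1 Hx _ _ (fun j => zm i j * (Bval j + - (1) * restv j)) one_le4) => j.
  by repeat hstep1; [apply: hv_self; [exact: cv_Bv|exact: OK1]|exact: hv_rest].
apply: (sv_sc _ _ _ (Y_YC i)); apply: (hv_sh r x 1 Hx); apply: (hv_add r x 1 Hx) => //.
exact: (hv_conj r x 1 Hx _ _ one1).
Qed.

(** The parameter equation: the differential of the velocity applied to the increments is rho (B -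
    rest), by the choice of [zm]. *)
Lemma Dvel_yi k : Dvel yi k = x * (Bval k - restv k).
Proof. by rewrite (functional_extensionality yi _ yi_eq) Dvel_scal zm_spec. Qed.

(** Each factor is expanded exactly about Lambda_0 by means of its own fixed-point equation; all
    that is not linear in the increments is [rest1v]. *)
Lemma term_eq k j : gamv j * tv * eev k j - g0 j / T0 * e0 M z0 T0 k j
  = x * (Dterm yi k j + x * rest1v k j).
Proof.
have n0 := T0C; have Ht := t_eq.
have H1 : tv * eev k j = e0 M z0 T0 k j / T0 + x * tev k j.
  by rewrite Ht /tev /eev; field.
have H2 : thv * eev k j = - / T0 * Thv * (e0 M z0 T0 k j / T0 + x * tev k j).
  by rewrite -H1 /thv; ring.
have H3 : tv * zdv k j = (z0 k - z0 j) / T0 + x * (thv * zdv k j + / T0 * zhdv k j).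
  by rewrite {1}Ht /zdv; field.
have H4 : Ahv k j = PI / T0 * (zhdv k j - Thv * ((z0 k - z0 j) / T0 + x * (thv * zdv k j + / T0 * zhdv k j))).
  by rewrite -H3 /Ahv; field.
have H5 : sv (AA k j) * sv (DD k j) = Ahv k j + x * (x * wv k j)
    - x * e0 M z0 T0 k j * (sv (AA k j) * sv (AA k j) * sv (DD k j)).
  rewrite -AA_eq; transitivity (sv (AA k j) * (1 + x * (- e0 M z0 T0 k j * (sv (AA k j) * sv (DD k j))))).
    by rewrite -DD_eq.
  by ring.
have H6 : tev k j = - / T0 * Thv * (e0 M z0 T0 k j / T0 + x * tev k j) + / T0 * ehv k j.
  by rewrite -H2.
have E : ehv k j = - (1 + e0 M z0 T0 k j * e0 M z0 T0 k j) * (sv (AA k j) * sv (DD k j)) by [].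
transitivity (x * (ghv j * (e0 M z0 T0 k j / T0 + x * tev k j) + g0 j * tev k j)).
  rewrite /gamv; transitivity (g0 j * (tv * eev k j) + x * ghv j * (tv * eev k j) - g0 j / T0 * e0 M z0 T0 k j); first by ring.
  by rewrite H1; field.
congr (_ * _); rewrite {2}H6 E H5 H4 /Dterm /rest1v -/(zhv _) -/(ghv j) -/Thv.
have -> : zvec yi k - zvec yi j = zhdv k j by rewrite /zhdv /zvec /zhv; ring.
by field.
Qed.

(** Order 0 vanishes because Lambda_0 is steady, the linear part is rho^2 (B - rest) by [Dvel_yi],
    and the remainder rho^2 rest cancels. *)
Lemma velocity_eq k : csumL (fun j => if j == k then RtoC 0 else gamv j * tv * eev k j / (2 * Ci)) (idx M) - spdv
  = x * x * Bval k.
Proof.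
have n0 := T0C; have i0 := Ci_neq0; have H := Dvel_yi k.
have E : csumL (fun j => if j == k then RtoC 0 else gamv j * tv * eev k j / (2 * Ci)) (idx M)
   = csumL (fun j => if j == k then RtoC 0 else g0 j / (2 * Ci * T0) * e0 M z0 T0 k j) (idx M)
   + x * csumL (fun j => if j == k then RtoC 0 else / (2 * Ci) * Dterm yi k j) (idx M) + x * x * restv k.
  rewrite /restv -!csumL_scal -!csumL_add; apply: csumL_ext => j _; case: (j == k); first by ring.
  have K := term_eq k j.
  transitivity ((gamv j * tv * eev k j - g0 j / T0 * e0 M z0 T0 k j) / (2 * Ci)
     + g0 j / T0 * e0 M z0 T0 k j / (2 * Ci)); first by field.
  by rewrite K; field.
rewrite E; have V := vel0 k; rewrite /Dvel in H.
transitivity ((csumL (fun j => if j == k then RtoC 0 else g0 j / (2 * Ci * T0) * e0 M z0 T0 k j) (idx M) - c0)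
  + x * (csumL (fun j => if j == k then RtoC 0 else / (2 * Ci) * Dterm yi k j) (idx M) - (yi (SpeedRe M) + Ci * yi (SpeedIm M)))
  + x * x * restv k); first by rewrite /spdv /chv; ring.
by rewrite V H; ring.
Qed.


Lemma yi_real i : Cconj (yi i) = yi i.
Proof.
have H : hv r x 1 (yv M z0 g0 c0 T0 zm Y i) (val (yv M z0 g0 c0 T0 zm Y i) x 1).
  by apply: hv_self; [exact: cv_yv|exact: OK1].
have E : yi i = x * (val (yv M z0 g0 c0 T0 zm Y i) x 1 + Cconj (val (yv M z0 g0 c0 T0 zm Y i) x 1)).
  apply: (sv_sc _ _ _ (Y_YC i)); apply: (hv_sh r x _ Hx); apply: (hv_add r x _ Hx) => //.
  by apply: (hv_conj r x _ Hx) => //; rewrite Cmod_1.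
by rewrite E; apply: Ceq; rewrite /Cconj /=; ring.
Qed.

Definition yr (i : coord M) : R := Re (yi i).

Lemma yi_yr i : yi i = RtoC (yr i).
Proof.
have := yi_real i; rewrite /yr; case: (yi i) => p q [H].
by apply: Ceq => //; rewrite /=; lra.
Qed.

Definition gamr k : R := (g0 k + x * yr (Circulation k))%R.
Definition Tr : R := (T0 + x * yr (Period M))%R.

Lemma gam_real k : gamv k = RtoC (gamr k).
Proof. by rewrite /gamv /ghv yi_yr /gamr RtoC_plus RtoC_mult. Qed.

Lemma t_Tr : tv * RtoC Tr = 1.
Proof. by have := t_period; rewrite /Thv yi_yr /Tr RtoC_plus RtoC_mult. Qed.

Lemma inv_real (a : C) (b : R) : a * RtoC b = 1 -> b <> 0%R /\ a = RtoC (/ b).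
Proof.
move=> H; have b0 : b <> 0%R by move=> E; have := f_equal Re H; rewrite E /=; lra.
split=> //; rewrite RtoC_inv //; transitivity (a * b * / b); first by field; exact: RtoC_neq0.
by rewrite H; ring.
Qed.

Lemma Tr_neq0 : Tr <> 0%R. Proof. exact: (proj1 (inv_real _ _ t_Tr)). Qed.
Lemma t_inv : tv = RtoC (/ Tr). Proof. exact: (proj2 (inv_real _ _ t_Tr)). Qed.
Lemma gamr_neq0 k : gamr k <> 0%R.
Proof. by apply: (proj1 (inv_real _ _ _)); rewrite -gam_real; exact: s_gam. Qed.
Lemma s_inv k : sv (SS k) = RtoC (/ gamr k).
Proof. by apply: (proj2 (inv_real _ _ _)); rewrite -gam_real; exact: s_gam. Qed.

Definition g4r k : R := (/ (4 * PI * PI) * (gamr k * gamr k))%R.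

Lemma g4_real k : g4v k = RtoC (g4r k).
Proof.
have P := PI_neq0; rewrite /g4v /g4r gam_real !RtoC_mult RtoC_inv; last by apply: Rmult_integral_contrapositive; split; [lra|].
by rewrite !RtoC_mult.
Qed.

Lemma supp_V1 k : supp (fun e => e = 1)%Z (V1hY k).
Proof.
apply: (supp_slin (fun e => e = -1)%Z) => [y|]; first by rewrite /= => ->.
have F X : supp (fun e => e = -1)%Z (fm1 X).
  by apply: supp_sub (supp_sfil (fun=> True) _ _ _) => // e [_ /Z.eqb_eq]; lia.
have G X W : supp zero_exp X -> supp (fun e => e = -1)%Z W -> supp (fun e => e = -1)%Z (X [*] W).
  by apply: supp_sbil => a b; rewrite /zero_exp /= => -> ->.
apply: supp_scal; apply: (G); first exact: supp_SS.
apply: supp_sadd; first by apply: supp_ssh; exact: F.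
by apply: supp_scal; apply: G; [exact: supp_g4|exact: F].
Qed.

Section OnCircle.
Variable z : C.
Hypothesis Hz : Cmod z = 1%R.

Lemma z_le4 : (Cmod z <= 4)%R. Proof. by rewrite Hz; lra. Qed.
Lemma z_ann : ann z. Proof. by rewrite /ann Hz; lra. Qed.
Lemma z_neq0 : z <> 0. Proof. by apply: ann_neq0; exact: z_ann. Qed.

Definition R_ k := val (RMY k) x z.
Definition S_ k := val (RNY k) x z.
Definition m_ k := val (Y (MM k)) x z.
Definition n_ k := val (Y (NN k)) x z.
Definition v_ k := val (Y (V1 k)) x z + val (Y (V2 k)) x z.
Definition g_ k := m_ k - x * R_ k.
Definition q_ k := sv (QQ k).

Lemma hvY i : hv r x z (Y i) (val (Y i) x z).
Proof. by apply: hv_self => //; left; exact: z_ann. Qed.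
Lemma hv_R k : hv r x z (RMY k) (R_ k).
Proof. by apply: hv_self; [exact: cv_RM|left; exact: z_ann]. Qed.
Lemma hv_S k : hv r x z (RNY k) (S_ k).
Proof. by apply: hv_self; [exact: cv_RN|left; exact: z_ann]. Qed.
Lemma hv_SS k : hv r x z (Y (SS k)) (RtoC (/ gamr k)).
Proof. by rewrite -s_inv; apply: (hv0 _ z_le4); exact: supp_SS. Qed.
Lemma hv_g4r k : hv r x z (g4 M g0 Y k) (RtoC (g4r k)).
Proof. by rewrite -g4_real; apply: hv_g4; exact: z_le4. Qed.
Lemma hv_Q k : hv r x z (Y (QQ k)) (q_ k).
Proof. by apply: (hv0 _ z_le4); exact: supp_QQ. Qed.

Ltac hstep := lazymatch goal with
  | |- hv _ _ _ (sadd _ _) _ => apply: (hv_add r x z Hx)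
  | |- hv _ _ _ (smul _ _) _ => apply: (hv_mul r x z Hx)
  | |- hv _ _ _ (slin (mscal _) _) _ => apply: (hv_scal r x z Hx)
  | |- hv _ _ _ (slin (mexp _) _) _ => apply: (hv_exp_ann r x z Hx _ _ _ z_ann)
  | |- hv _ _ _ (slin mconj _) _ => apply: (hv_conj r x z Hx _ _ Hz)
  | |- hv _ _ _ (ssh _) _ => apply: (hv_sh r x z Hx)
  | |- hv _ _ _ (sK _) _ => apply: (hv_cst r x z _ z_le4)
  end.

Lemma hv_gg k : hv r x z (gg M z0 T0 Y k) (m_ k + - (1) * (x * R_ k)).
Proof. by rewrite /gg; repeat hstep; [exact: hvY|exact: hv_R]. Qed.

Lemma hv_vv k : hv r x z (vv M Y k) (v_ k).
Proof. by rewrite /vv; hstep; exact: hvY. Qed.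

Lemma g_alt k : m_ k + - (1) * (x * R_ k) = g_ k.
Proof. by rewrite /g_; ring. Qed.

Definition H_ k := val (HhY k) x z.

Lemma hv_H k : hv r x z (HhY k) (H_ k).
Proof. by apply: hv_self; [exact: cv_Hh|left; exact: z_ann]. Qed.

Lemma H_eq k : H_ k = / 2 * (- (1) * ((v_ k + - (1) * Cconj (v_ k)) * (v_ k + - (1) * Cconj (v_ k)))
  + q_ k * (g_ k + Cconj (g_ k)) + - (1) * ((x * (x * q_ k) + g4r k) * (g_ k * Cconj (g_ k)))).
Proof.
apply: hv_val; rewrite /Hh /vi /sconj -g_alt.
by repeat hstep; first [exact: hv_vv|exact: hv_gg|exact: hv_Q|exact: hv_g4r].
Qed.

Definition E_ k := val (ErY k) x z.

Lemma hv_E k : hv r x z (ErY k) (E_ k).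
Proof. by apply: hv_self; [exact: cv_Er|left; exact: z_ann]. Qed.

Lemma conj_q k : Cconj (q_ k) = q_ k.
Proof.
have F X : conv r X -> hv r x 1 (f0 X) (val (f0 X) x 1).
  by move=> H; apply: hv_fil Hx _ _ _ (hv_self r x 1 X H (OK1 X)).
have one1 : Cmod 1 = 1%R by rewrite Cmod_1.
set a := val (f0 (RMY k)) x 1; set b := val (f0 (HhY k)) x 1.
have E : q_ k = x * (- (1) * (g4v k * (a + Cconj a)) + x * (b + Cconj b)).
  apply: hv_val; rewrite Y_QQ; apply: (hv_sh r x _ Hx); apply: (hv_add r x _ Hx).
    apply: (hv_scal r x _ Hx); apply: (hv_mul r x _ Hx); first by apply: hv_g4; exact: one_le4.
    by apply: (hv_add r x _ Hx); [|apply: (hv_conj r x _ Hx _ _ one1)]; apply: F; exact: cv_RM.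
  apply: (hv_sh r x _ Hx); apply: (hv_add r x _ Hx); [|apply: (hv_conj r x _ Hx _ _ one1)]; apply: F; exact: cv_Hh.
rewrite E g4_real; apply: Ceq; rewrite /Cconj /=; ring.
Qed.

Lemma conj_conj (u : C) : Cconj (Cconj u) = u.
Proof. by case: u => p q; rewrite /Cconj /= Ropp_involutive. Qed.
Lemma conj_real (p : R) : Cconj (RtoC p) = RtoC p.
Proof. by rewrite /Cconj /RtoC /= Ropp_0. Qed.
Lemma conj_plus (u v : C) : Cconj (u + v) = Cconj u + Cconj v.
Proof. by apply: Ceq; rewrite /Cconj /=; ring. Qed.
Lemma conj_opp (u : C) : Cconj (- u) = - Cconj u.
Proof. by apply: Ceq; rewrite /Cconj /=; ring. Qed.
Lemma conj_minus (u v : C) : Cconj (u - v) = Cconj u - Cconj v.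
Proof. by apply: Ceq; rewrite /Cconj /=; ring. Qed.
Lemma conj_Ci : Cconj Ci = - Ci.
Proof. by apply: Ceq; rewrite /Cconj /=; ring. Qed.

Lemma E_H k : E_ k = H_ k + Cconj (H_ k).
Proof. by apply: hv_val; rewrite /Er /sconj; repeat hstep; exact: hv_H. Qed.

(** The right-hand side is real on the unit circle and H is half of it, so H + conj H restores
    it. *)
Lemma E_eq k : E_ k = - ((v_ k - Cconj (v_ k)) * (v_ k - Cconj (v_ k))) + q_ k * (g_ k + Cconj (g_ k))
   - (x * x * q_ k + g4r k) * (g_ k * Cconj (g_ k)).
Proof.
rewrite E_H; set T := (X in _ = X).
have E1 : H_ k = / 2 * T by rewrite H_eq /T; ring.
have E2 : Cconj T = T.
  rewrite /T; do 4 rewrite ?conj_minus ?conj_plus ?conj_opp ?Cmult_conj ?conj_conj ?conj_q ?conj_real.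
  by rewrite /v_ /g_; ring.
rewrite E1 Cmult_conj E2 -RtoC_inv ?conj_real; last lra.
by rewrite RtoC_inv; [field; exact: C2_neq0|lra].
Qed.


Lemma cv_fil P X : conv r X -> conv r (sfil P X).
Proof. exact: conv_sfil r_pos. Qed.

Lemma OKc X : OK z X. Proof. by left; exact: z_ann. Qed.

Definition h_ k (P : Z -> bool) := val (sfil P (HhY k)) x z.
Definition r_ k (P : Z -> bool) := val (sfil P (RMY k)) x z.

Lemma E_fil k P Q : (forall e, P (- e)%Z = Q e) -> val (sfil P (ErY k)) x z = h_ k P + Cconj (h_ k Q).
Proof.
move=> HPQ; have A := hv_filP r x z Hx P (HhY k) (cv_Hh k) (OKc _).
have B := hv_filP r x z Hx P (sconj (HhY k)) ltac:(cvs; exact: cv_Hh) (OKc _).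
rewrite (val_fil_conj r x z Hx Hz P Q) // in B; last exact: cv_Hh.
rewrite -(hv_val _ _ _ (hv_add r x z Hx _ _ _ _ A B)); apply: CS_ext => n.
by rewrite /Er /sadd /sfil filter_app.
Qed.

Let e0' := Z.eqb 0.
Let em1 := Z.eqb (-1).
Let em2 := fun e : Z => Z.leb e (-2).
Let ep1 := Z.eqb 1.
Let ep2 := Z.leb 2.

Lemma flip0 e : e0' (- e) = e0' e.
Proof. by rewrite /e0'; case: Z.eqb_spec => H1; case: Z.eqb_spec => H2 //; lia. Qed.
Lemma flip1 e : em1 (- e) = ep1 e.
Proof. by rewrite /em1 /ep1; case: Z.eqb_spec => H1; case: Z.eqb_spec => H2 //; lia. Qed.
Lemma flip2 e : em2 (- e) = ep2 e.
Proof. by rewrite /em2 /ep2; case: Z.leb_spec => H1; case: Z.leb_spec => H2 //; lia. Qed.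

Lemma H_split k : H_ k = h_ k e0' + h_ k em1 + h_ k em2 + h_ k ep1 + h_ k ep2.
Proof. by rewrite /H_ (val_split5 r x z Hx) //; [exact: cv_Hh|exact: OKc]. Qed.

Lemma R_split k : R_ k = r_ k e0' + r_ k ep1 + r_ k ep2.
Proof.
rewrite /R_ (val_split5 r x z Hx); [|exact: cv_RM|exact: OKc].
rewrite (val_fil_empty em1 _ x z _ (supp_RM k)); last by move=> e He; rewrite /nonneg in He; rewrite /em1; case: Z.eqb_spec => H1 //; lia.
rewrite (val_fil_empty em2 _ x z _ (supp_RM k)); last by move=> e He; rewrite /nonneg in He; rewrite /em2; case: Z.leb_spec => H1 //; lia.
by rewrite /r_ /f0 /fp1e /fp2 /e0' /ep1 /ep2; ring.
Qed.

Lemma PI_Ci : RtoC PI / Ci = - (PI * Ci).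
Proof.
have C0 := Ci_neq0; rewrite (_ : - (PI * Ci) = PI * - (Ci * Ci) / Ci); first by rewrite Ci_sqr; field.
by field.
Qed.

Lemma V1_val k : val (Y (V1 k)) x z = x * (PI * Ci *
   (/ gamr k * (x * (Cconj (h_ k em1) + h_ k ep1) - g4r k * r_ k ep1))).
Proof.
rewrite Y_V1; apply: hv_val; apply: (hv_sh r x z Hx); rewrite /V1h /sconj.
have Em := hv_filP r x z Hx em1 (ErY k) (cv_Er k) (OKc _); rewrite (E_fil k em1 ep1 flip1) in Em.
have Rm := hv_filP r x z Hx em1 (sconj (RMY k)) ltac:(cvs; exact: cv_RM) (OKc _).
rewrite (val_fil_conj r x z Hx Hz em1 ep1 (RMY k) (cv_RM k) flip1) in Rm.
apply: hv_eq; first by repeat hstep; first [exact: hv_SS|exact: Em|exact: hv_g4r|exact: Rm].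
rewrite PI_Ci; have g0' := gamr_neq0 k.
rewrite RtoC_inv //.
do 6 rewrite ?conj_minus ?conj_plus ?conj_opp ?Cmult_conj ?conj_conj ?conj_real ?conj_Ci ?Cconj_inv.
rewrite -?RtoC_inv // ?conj_real /r_; ring.
Qed.

Lemma M_val k : m_ k = 4 * PI * Ci * (/ gamr k * Cconj (val (Y (V2 k)) x z))
   + x * (Cconj (r_ k ep2) - 4 * PI * PI * (/ gamr k * / gamr k * (x * (h_ k em2 + Cconj (h_ k ep2))))).
Proof.
have g0' := gamr_neq0 k.
rewrite /m_ Y_MM; apply: hv_val; rewrite /MMa /MMb /sconj.
have Em := hv_filP r x z Hx em2 (ErY k) (cv_Er k) (OKc _); rewrite (E_fil k em2 ep2 flip2) in Em.
have Rm := hv_filP r x z Hx em2 (sconj (RMY k)) ltac:(cvs; exact: cv_RM) (OKc _).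
rewrite (val_fil_conj r x z Hx Hz em2 ep2 (RMY k) (cv_RM k) flip2) in Rm.
apply: hv_eq; first by repeat hstep; first [exact: hv_SS|exact: Em|exact: hvY|exact: Rm].
by rewrite RtoC_inv // /r_; ring.
Qed.

Lemma Q_val k : q_ k = x * (- (g4r k * (r_ k e0' + Cconj (r_ k e0'))) + x * (h_ k e0' + Cconj (h_ k e0'))).
Proof.
rewrite -(hv_val _ _ _ (hv_Q k)) Y_QQ; apply: hv_val; rewrite /QQa /sconj.
have Rm := hv_filP r x z Hx e0' (RMY k) (cv_RM k) (OKc _).
have Hm := hv_filP r x z Hx e0' (HhY k) (cv_Hh k) (OKc _).
apply: hv_eq; first by repeat hstep; first [exact: hv_g4r|exact: Rm|exact: Hm].
by rewrite /r_ /h_; ring.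
Qed.

(** The sum over the frequency bands of the equations for [QQ] (frequency 0), [V1] (frequencies 1
    and -1) and [MM] (modulus at least 2), together with the splittings of H and R. *)
Lemma bernoulli_quad k : q_ k - g4r k * (g_ k + Cconj (g_ k))
  = Ci * gamr k / PI * (v_ k - Cconj (v_ k)) + x * x * E_ k.
Proof.
have g0' := RtoC_neq0 _ (gamr_neq0 k); have P0 := CPI_neq0.
have G4 : RtoC (g4r k) = gamr k * gamr k / (4 * PI * PI) by rewrite -g4_real /g4v gam_real; field.
set V2v := val (Y (V2 k)) x z; set V1v := val (Y (V1 k)) x z.
(* The frequencies 1 and -1. *)
have L1 : Ci * gamr k / PI * (V1v - Cconj V1v)
   = - (x * (x * (h_ k em1 + Cconj (h_ k ep1) + Cconj (h_ k em1) + h_ k ep1) - g4r k * (r_ k ep1 + Cconj (r_ k ep1)))).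
  rewrite /V1v V1_val -RtoC_inv; last exact: gamr_neq0.
  do 7 rewrite ?conj_minus ?conj_plus ?conj_opp ?Cmult_conj ?conj_conj ?conj_real ?conj_Ci.
  rewrite RtoC_inv; last exact: gamr_neq0.
  set w := x * (Cconj (h_ k em1) + h_ k ep1) - _; set w' := x * (h_ k em1 + Cconj (h_ k ep1)) - _.
  transitivity ((Ci * Ci) * (x * (w + w'))); first by field.
  by rewrite Ci_sqr /w /w'; ring.
(* The frequencies of modulus at least 2. *)
have L2 : g4r k * (m_ k + Cconj (m_ k)) = Ci * gamr k / PI * (Cconj V2v - V2v)
   + x * g4r k * (r_ k ep2 + Cconj (r_ k ep2)) - x * x * (h_ k em2 + Cconj (h_ k ep2) + Cconj (h_ k em2) + h_ k ep2).
  rewrite M_val -/V2v -RtoC_inv; last exact: gamr_neq0.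
  do 9 rewrite ?conj_minus ?conj_plus ?conj_opp ?Cmult_conj ?conj_conj ?conj_real ?conj_Ci.
  rewrite RtoC_inv; last exact: gamr_neq0.
  by rewrite G4; field.
have -> : g4r k * (g_ k + Cconj (g_ k)) = g4r k * (m_ k + Cconj (m_ k))
   - x * g4r k * (R_ k + Cconj (R_ k)).
  by rewrite /g_ conj_minus Cmult_conj conj_real; ring.
have -> : v_ k - Cconj (v_ k) = (V1v - Cconj V1v) + (V2v - Cconj V2v).
  by rewrite /v_ conj_plus -/V1v -/V2v; ring.
rewrite L2 (Cmult_plus_distr_l (Ci * gamr k / PI) (V1v - Cconj V1v)) L1 E_H H_split R_split Q_val !conj_plus.
by field.
Qed.

Definition P_ k : C := gamr k / (2 * PI) + Ci * (x * x) * (v_ k - Cconj (v_ k)).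

(** Expanding both sides, the constants agree and the rest is rho^2 times [bernoulli_quad]. *)
Lemma bernoulli k : P_ k * P_ k = (g4r k + x * x * q_ k) * (1 - x * x * g_ k) * Cconj (1 - x * x * g_ k).
Proof.
have P0 := CPI_neq0.
have G4 : RtoC (g4r k) = gamr k * gamr k / (4 * PI * PI) by rewrite -g4_real /g4v gam_real; field.
rewrite !conj_minus !Cmult_conj !conj_real.
transitivity (g4r k + x * x * (Ci * gamr k / PI * (v_ k - Cconj (v_ k)))
  + (Ci * Ci) * (x * x * x * x) * ((v_ k - Cconj (v_ k)) * (v_ k - Cconj (v_ k)))).
  by rewrite /P_ G4; field.
have K := bernoulli_quad k.
have -> : Ci * gamr k / PI * (v_ k - Cconj (v_ k)) = q_ k - g4r k * (g_ k + Cconj (g_ k)) - x * x * E_ k.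
  by rewrite K; ring.
by rewrite Ci_sqr E_eq; ring.
Qed.

Lemma P_real k : Cconj (P_ k) = P_ k.
Proof.
have P := PI_neq0.
have E : gamr k / (2 * PI) = RtoC (gamr k / (2 * PI)) by rewrite RtoC_div ?RtoC_mult //; lra.
rewrite /P_ E conj_plus (Cmult_conj (Ci * (x * x))) conj_minus conj_conj (Cmult_conj Ci) (Cmult_conj x) !conj_real conj_Ci.
ring.
Qed.


Lemma val_fp0 X : conv r X -> supp nonneg X -> val X x z = val (f0 X) x z + val (fp1 X) x z.
Proof.
move=> CX SX; rewrite (val_fp1 r x z Hx X CX (OKc X)) (val_split5 r x z Hx X CX (OKc X)).
rewrite (val_fil_empty em1 _ x z _ SX); last by move=> e He; rewrite /nonneg in He; rewrite /em1; case: Z.eqb_spec => H1 //; lia.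
rewrite (val_fil_empty em2 _ x z _ SX); last by move=> e He; rewrite /nonneg in He; rewrite /em2; case: Z.leb_spec => H1 //; lia.
by ring.
Qed.

Definition K1v k j : C := val (K1Y k j) x (z / 2).

Lemma half_le : (Cmod (z / 2) <= 4)%R. Proof. exact: half_le4 z_le4. Qed.

Lemma Kt_half k j : val (KtY k j) x (z / 2) = if k == j then x * K1v k j else PI * (tv * eev k j) + x * K1v k j.
Proof.
have O1 : hv r x (z / 2) (K1Y k j) (K1v k j).
  by apply: hv_self; [exact: cv_K1|right; split; [exact: half_le|apply: supp_pos_nonneg; exact: supp_K1]].
apply: hv_val; move: O1; rewrite /Kt; case: (k == j) => O1; first exact: (hv_sh r x _ Hx).
apply: (hv_add r x _ Hx); last exact: (hv_sh r x _ Hx).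
by apply: (hv_scal r x _ Hx); apply: (hv_mul r x _ Hx); [apply: hv_TT|apply: hv_ee]; exact: half_le.
Qed.

Definition p0_ (X : ser) := val (f0 X) x z.
Definition p1_ (X : ser) := val (fp1 X) x z.

Lemma V2_val k : val (Y (V2 k)) x z
  = z * csumL (fun j => / (2 * PI * Ci) * (gamv j * K1v k j)) (idx M)
    + x * (z * p1_ (RNY k) - spdv * (x * (z * p1_ (RMY k)))).
Proof.
have z1 : zpow z 1 = z by rewrite /= Cmult_1_r.
rewrite Y_V2; apply: hv_val; apply: (hv_add r x z Hx).
  rewrite -{2}z1; apply: (hv_exp_ann r x z Hx _ _ _ z_ann).
  apply: (hv_big r x z Hx _ _ (fun j => / (2 * PI * Ci) * (gamv j * K1v k j)) z_le4) => j.
  apply: (hv_scal r x z Hx); apply: (hv_mul r x z Hx); first by apply: hv_gam; exact: z_le4.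
  rewrite /K1v -val_half; last by apply: supp_pos_nonneg; exact: supp_K1.
  by apply: hv_self; [cvs; exact: cv_K1|exact: OKc].
have FN := hv_filP r x z Hx (Z.leb 1) _ (cv_RN k) (OKc _).
have FM := hv_filP r x z Hx (Z.leb 1) _ (cv_RM k) (OKc _).
rewrite /V2b /stau; apply: hv_eq; first by repeat hstep; first [exact: FN|exact: FM|apply: hv_spd; exact: z_le4].
by rewrite z1 /p1_ /fp1; ring.
Qed.

Lemma supp_Bv k : supp zero_exp (Bv M z0 g0 c0 T0 Y k).
Proof.
apply: supp_sadd; [apply: supp_sadd|].
- by apply: (supp_stau (fun e => e = 1)%Z) => [a ->|]; [|exact: supp_V1].
- by apply: supp_scal; exact: supp_f0.
by apply: supp0_mul; [exact: supp_spd|apply: supp_ssh; exact: supp_f0].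
Qed.

(** The definition of [Bv] multiplied out: frequency 1 of the interior equation, with the velocity
    isolated on the left. *)
Lemma B_val k : z * (x * x * Bval k) = x * val (Y (V1 k)) x z - x * x * z * p0_ (RNY k) + x * x * x * spdv * z * p0_ (RMY k).
Proof.
have z0' := z_neq0.
have zi : zpow z (-1) = / z by rewrite /= Cmult_1_r.
have V1e : val (Y (V1 k)) x z = x * val (V1hY k) x z.
  by rewrite Y_V1; apply: hv_val; apply: (hv_sh r x z Hx); apply: hv_self; [exact: cv_V1h|exact: OKc].
have FN := hv_filP r x z Hx (Z.eqb 0) _ (cv_RN k) (OKc _).
have FM := hv_filP r x z Hx (Z.eqb 0) _ (cv_RM k) (OKc _).
have VH : hv r x z (V1hY k) (val (V1hY k) x z) by apply: hv_self; [exact: cv_V1h|exact: OKc].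
have -> : Bval k = / z * val (V1hY k) x z + - (1) * p0_ (RNY k) + spdv * (x * p0_ (RMY k)).
  rewrite /Bval -(val_supp0 _ x z); last exact: supp_Bv.
  apply: hv_val; rewrite -zi /Bv /stau; repeat hstep; first [exact: FN|exact: FM|exact: VH|apply: hv_spd; exact: z_le4].
by rewrite V1e; field.
Qed.

(** The part of tau (w' - c f') that is regular inside the disk. Its mode of frequency 1 is [B_val]
    combined with [velocity_eq]; the higher ones are the equation of [V2]. *)
Lemma interior_eq k : z * (csumL (fun j => gamv j / (2 * PI * Ci) * val (KtY k j) x (z / 2)) (idx M) - spdv)
  + x * x * z * S_ k - spdv * (x * x * x) * z * R_ k = x * v_ k.
Proof.
have i0 := Ci_neq0; have P0 := CPI_neq0.
have -> : csumL (fun j => gamv j / (2 * PI * Ci) * val (KtY k j) x (z / 2)) (idx M)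
  = csumL (fun j => if j == k then RtoC 0 else gamv j * tv * eev k j / (2 * Ci)) (idx M)
    + x * csumL (fun j => / (2 * PI * Ci) * (gamv j * K1v k j)) (idx M).
  rewrite -csumL_scal -csumL_add; apply: csumL_ext => j _; rewrite Kt_half eq_sym.
  by case: (j == k); field.
rewrite /v_ V2_val /S_ /R_ (val_fp0 _ (cv_RN k) (supp_RN k)) (val_fp0 _ (cv_RM k) (supp_RM k)).
rewrite -/(p0_ _) -/(p1_ _) -/(p0_ _) -/(p1_ _).
have B := B_val k; rewrite -velocity_eq in B.
transitivity (z * (csumL (fun j => if j == k then RtoC 0 else gamv j * tv * eev k j / (2 * Ci)) (idx M) - spdv)
   + x * z * csumL (fun j => / (2 * PI * Ci) * (gamv j * K1v k j)) (idx M)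
   + x * x * z * (p0_ (RNY k) + p1_ (RNY k)) - spdv * (x * x * x) * z * (p0_ (RMY k) + p1_ (RMY k))); first by ring.
by rewrite B; ring.
Qed.

Lemma exterior_eq k : z * n_ k = Cconj (v_ k) + x * spdv * (z * m_ k).
Proof.
have z0' := z_neq0.
have zi : zpow z (-1) = / z by rewrite /= Cmult_1_r.
have -> : n_ k = / z * Cconj (v_ k) + x * (spdv * m_ k).
  rewrite /n_ Y_NN; apply: hv_val; rewrite -zi /NNa /NNb /stau /sconj.
  by repeat hstep; first [exact: hv_vv|exact: hvY|apply: hv_spd; exact: z_le4].
by field.
Qed.

Lemma P_alt k : P_ k = gamr k / (2 * PI) + Ci * x * z * (csumL (fun j => gamv j / (2 * PI * Ci) * val (KtY k j) x (z / 2)) (idx M)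
   + x * (x * S_ k - n_ k) - spdv * (1 - x * x * g_ k)).
Proof.
have E1 := interior_eq k; have E2 := exterior_eq k.
rewrite /P_; transitivity (gamr k / (2 * PI) + Ci * x * (x * v_ k) - Ci * x * x * Cconj (v_ k)); first by ring.
have -> : Cconj (v_ k) = z * n_ k - x * spdv * (z * m_ k) by rewrite E2; ring.
by rewrite -E1 /g_; ring.
Qed.

End OnCircle.


Definition Lx : params M := (((fun k => z0 k + x * zhv k), gamr), spdv, Tr).

Hypothesis xnz : x <> 0%R.
Hypothesis xsmall : (Rabs x * (8 * PI * / Rabs Tr) <= 1 / 8)%R.

Lemma kap_t : RtoC (kap Lx) = PI * tv.
Proof. by rewrite /kap t_inv RtoC_mult. Qed.

Lemma ev_bound ze : (Cmod ze <= 4)%R -> (Cmod (ev ze) <= 1 / 8)%R.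
Proof.
move=> H; have P := PI_RGT_0; have T0' := Rinv_0_lt_compat _ (Rabs_pos_lt _ Tr_neq0).
apply: Rle_trans xsmall; rewrite /ev t_inv.
rewrite (_ : x * (2 * PI * (ze * (/ Tr)%R)) = RtoC (x * (2 * PI * / Tr)) * ze); last by rewrite !RtoC_mult; ring.
rewrite (Cmod_mult (RtoC (x * (2 * PI * / Tr)))) Cmod_R Rabs_mult (Rabs_mult (2 * PI)) Rabs_inv (Rabs_pos_eq (2 * PI)); last lra.
rewrite (_ : Rabs x * (8 * PI * / Rabs Tr) = Rabs x * (2 * PI * / Rabs Tr) * 4)%R; last by ring.
apply: Rmult_le_compat_l => //; apply: Rmult_le_pos; first exact: Rabs_pos.
by apply: Rmult_le_pos; [lra|apply: Rlt_le].
Qed.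

Lemma sep_sin ze k j : (Cmod ze <= 4)%R -> k <> j ->
  Csin (kap Lx * (center Lx k - center Lx j + 2 * x * ze)) <> 0.
Proof.
move=> H kj; have [K _] := cot_E1 ze k j H kj; rewrite kap_t; move: K; congr (Csin _ <> 0).
by rewrite /zdv /zhdv /Lx /center /=; ring.
Qed.

Lemma Kt_val k j ze : (Cmod ze <= 4)%R -> ze <> 0 -> val (KtY k j) x ze = Kern Lx k j (x * (2 * ze)).
Proof.
move=> H h0; have n0 := RtoC_neq0 _ Tr_neq0; have P0 := CPI_neq0; have x0 := RtoC_neq0 _ xnz.
rewrite /Kern /Kt kap_t; case: eqP => [<-|kj].
  have E := ev_bound ze H.
  have e0' : ev ze <> 0.
    rewrite /ev; apply: Cmult_neq_0 => //; apply: Cmult_neq_0; first by apply: Cmult_neq_0 => //; exact: C2_neq0.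
    by apply: Cmult_neq_0 => //; rewrite t_inv; apply: RtoC_neq0; apply: Rinv_neq_0_compat; exact: Tr_neq0.
  have Ec := C1_cot ze H e0' E.
  have -> : val (ssh (K1Y k k)) x ze = x * (PI * (tv * C1v ze)).
    apply: hv_val; apply: (hv_sh r x ze Hx); rewrite /K1 eqxx; apply: (hv_scal r x ze Hx).
    by apply: (hv_mul r x ze Hx); [exact: hv_TT|exact: hv_C1].
  transitivity (PI * tv * (x * C1v ze)); first by ring.
  rewrite Ec (_ : PI * tv * (x * (2 * ze)) = ev ze); last by rewrite /ev; ring.
  have t0 : tv <> 0 by rewrite t_inv; apply: RtoC_neq0; apply: Rinv_neq_0_compat; exact: Tr_neq0.
  have -> : / ev ze = / (2 * PI * tv) * / (x * ze) by rewrite /ev; field; repeat split => //; exact: C2_neq0.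
  by field; repeat split => //; exact: C2_neq0.
have [_ K] := cot_E1 ze k j H kj.
have -> : val (PI [:] (Y TT [*] eeY k j) [+] ssh (K1Y k j)) x ze = PI * (tv * eev k j) + x * (PI * (tv * E1v ze k j)).
  apply: hv_val; apply: (hv_add r x ze Hx).
    by apply: (hv_scal r x ze Hx); apply: (hv_mul r x ze Hx); [exact: hv_TT|exact: hv_ee].
  apply: (hv_sh r x ze Hx); rewrite /K1; case: eqP => // _; apply: (hv_scal r x ze Hx).
  by apply: (hv_mul r x ze Hx); [exact: hv_TT|exact: hv_E1].
rewrite (_ : center Lx k - center Lx j + x * (2 * ze) = zdv k j + 2 * x * ze); last by rewrite /zdv /zhdv /Lx /center /=; ring.
by rewrite K; ring.
Qed.

(** The residue operator with kernel series [Kt] is the integral with the actual periodic kernel,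
    evaluated at u = (w - z)/2 where 2 rho u = rho (w - z). *)
Lemma potl_val (X : 'I_M -> ser) k z : (forall j, conv r (X j)) -> Cmod z = 1%R ->
  val (Rr M z0 T0 Y X k) x z = potl Lx x X k z.
Proof.
move=> HX Hz; have i0 := Ci_neq0; have P0 := CPI_neq0.
have z4 : (Cmod z <= 4)%R by rewrite Hz; lra.
rewrite /potl -csumL_scal.
apply: hv_val; apply: (hv_big r x z Hx _ _ (fun j => / (2 * PI * Ci) * cint _) z4) => j.
apply: (hv_eq r x z _ (val (rop (KtY j k) (X j)) x z)).
  apply: hv_self; first by apply: conv_rop => //; exact: cv_Kt.
  by right; split=> //; apply: supp_rop; exact: supp_Kt.
transitivity (/ (2 * PI * Ci) * (2 * PI * Ci * val (rop (KtY j k) (X j)) x z)); first by field.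
congr (_ * _); rewrite (rop_val r x z (KtY j k) (X j) Hx (cv_Kt j k) (HX j) (supp_Kt j k)); last lra.
apply: cint_ext => t; congr (_ * _ * _).
have hz : hc t - z <> 0.
  move=> E; have E' : hc t = z by exact: Cminus_eq0.
  by have := Cmod_hc t; rewrite E' Hz; lra.
rewrite Kt_val; first by congr Kern; field.
  rewrite Cmod_div; last exact: C2_neq0.
  by rewrite Cmod_R Rabs_pos_eq; [have := Cmod_sub_le (hc t) z; rewrite Cmod_hc Hz; lra|lra].
by move=> E; apply: hz; rewrite (_ : hc t - z = 2 * ((hc t - z) / 2)); [rewrite E; ring|field].
Qed.

Definition qr k : R := Re (sv (QQ k)).

Lemma bdry_eq k z : Cmod z = 1%R ->
  let P := bdry Lx x (fun k => Y (MM k)) (fun k => Y (NN k)) k z in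
  let F := 1 - x * x * (val (Y (MM k)) x z - x * potl Lx x (fun k => Y (MM k)) k z) in
  Cconj P = P /\ P * P = RtoC (gamr k ^ 2 / (4 * PI ^ 2) + x * (x * qr k)) * F * Cconj F.
Proof.
move=> Hz P F; have z0' := z_neq0 z Hz.
have E : P = P_ z k.
  rewrite (P_alt z Hz k) /P /bdry; congr (_ + _ * _).
  have -> : csumL (fun j => Defs.circ Lx j / (2 * PI * Ci) * Kern Lx k j (x * z)) (idx M)
    = csumL (fun j => gamv j / (2 * PI * Ci) * val (KtY k j) x (z / 2)) (idx M).
    apply: csumL_ext => j _; rewrite gam_real Kt_val; [|exact: half_le|].
      by congr (_ * Kern _ _ _ (_ * _)); field.
    by move=> H; apply: z0'; rewrite (_ : z = 2 * (z / 2)); [rewrite H; ring|field].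
  rewrite /S_ /g_ /R_ /m_ /n_ /RM /RN.
  rewrite (potl_val (fun j => Y (MM j)) k z) // (potl_val (fun j => Y (NN j)) k z) //.
have EF : F = 1 - x * x * g_ z k.
  by rewrite /F /g_ /R_ /m_ /RM (potl_val _ k z).
split; first by rewrite E P_real.
rewrite E (bernoulli z Hz) EF; congr (_ * _ * _).
have Q : q_ k = RtoC (qr k).
  have := conj_q k; rewrite /q_ /qr; case: (sv (QQ k)) => a b [H].
  by apply: Ceq => //; rewrite /=; lra.
rewrite Q -(RtoC_mult x x) -(RtoC_mult (x * x)) -RtoC_plus; congr RtoC.
rewrite /g4r; field; exact: PI_neq0.
Qed.

End Solution.

(** * A common radius for the properties of the solution *)

Lemma val_uniform r X : (0 < r)%R -> conv r X ->
  exists b, (0 <= b)%R /\ forall x z, (Rabs x <= r)%R -> OK z X -> (Cmod (val X x z) <= b)%R.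
Proof.
move=> r0 [b Hb]; exists b; split.
  by apply: Rle_trans (Hb 0%nat); exact: Rle_refl.
move=> x z Hx Hz; apply: bsum_CS => m.
by apply: Rle_trans (lev_dom z X r m x Hz Hx) (Hb m).
Qed.

Lemma common_bound {J : Type} (l : list J) (P : J -> R -> Prop) :
  (forall j b b', P j b -> (b <= b')%R -> P j b') -> (forall j, exists b, P j b) ->
  exists b, (0 <= b)%R /\ forall j, In j l -> P j b.
Proof.
move=> mono H; elim: l => [|j l [b [b0 IH]]]; first by exists 0%R; split; [lra|].
have [a Ha] := H j; exists (Rmax a b); split; first by apply: Rle_trans b0 (Rmax_r _ _).
move=> i [<-|Hi]; first by apply: mono Ha (Rmax_l _ _).
by apply: mono (IH i Hi) (Rmax_r _ _).
Qed.

(** All that the construction of the flow uses of the series. The condition on the sine says that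
    centers of different vortices stay apart at the scale of rho, up to periods. *)
Lemma vortex_series M z0 g0 c0 T0 zm : (0 < T0)%R -> (forall k, g0 k <> 0%R) ->
  (forall k j : 'I_M, k <> j -> Csin (PI * (z0 k - z0 j) / T0) <> 0) ->
  (forall k, csumL (fun j => if j == k then RtoC 0 else g0 j / (2 * Ci * T0) * e0 M z0 T0 k j) (idx M) - c0 = 0) ->
  (forall (v : 'I_M -> C) k, Dvel M z0 g0 T0
     (fun i => csumL (fun j => zm i j * v j) (idx M) + Cconj (csumL (fun j => zm i j * v j) (idx M))) k = v k) ->
  exists (Y : comp M -> ser) (r b : R), [/\ (0 < r)%R, (0 <= b)%R, forall i, conv r (Y i),
    forall k, supp ext_exp (Y (MM k)) /\ supp ext_exp (Y (NN k)) &
    forall x, (Rabs x < r)%R -> let L := Lx M z0 g0 c0 T0 Y x in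
      [/\ (T0 / 2 <= period L <= 2 * T0)%R, (Rabs x * (128 * PI) <= period L)%R,
        forall k, Defs.circ L k <> 0%R,
        forall i, yi M Y x i = RtoC (yr M Y x i) /\ ((forall j, zm i j = 0) -> yr M Y x i = 0%R) &
      x <> 0%R ->
      (forall ze k j, (Cmod ze <= 4)%R -> k <> j ->
         Csin (kap L * (center L k - center L j + 2 * x * ze)) <> 0) /\
      (forall k z, Cmod z = 1%R ->
        let P := bdry L x (fun k => Y (MM k)) (fun k => Y (NN k)) k z in
        let F := 1 - x * x * (val (Y (MM k)) x z - x * potl L x (fun k => Y (MM k)) k z) in
        Cconj P = P /\ P * P = RtoC (Defs.circ L k ^ 2 / (4 * PI ^ 2) + x * (x * qr M Y x k)) * F * Cconj F)]].
Proof.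
move=> T0pos g0nz sin0 vel0 zms; have Pp := PI_RGT_0.
have [Y [r [r0 Yfix Yconv]]] := system_solution M z0 g0 c0 T0 zm.
have [b [b0 Hb]] := val_uniform r (Y (YC (Period M))) r0 (Yconv _).
(* The second entry keeps the change of the period below T0/2; the third makes 128 pi |x| at most
   T0/2, hence at most the period. *)
pose r1 := Rmin r (Rmin (T0 / (2 * (b + 1))) (T0 / (256 * PI))).
have q1 : (0 < T0 / (2 * (b + 1)))%R by apply: Rdiv_lt_0_compat; lra.
have q2 : (0 < T0 / (256 * PI))%R by apply: Rdiv_lt_0_compat; lra.
have r1p : (0 < r1)%R by rewrite /r1; do 2 apply: Rmin_glb_lt => //.
exists Y, r1, b; split=> //.
- move=> i; have [B HB] := Yconv i; exists B => m; apply: Rle_trans (HB m).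
  apply: rs_le => n _; apply: Rmult_le_compat_l; first exact: lnorm_ge0.
  by apply: pow_incr; split; [lra|exact: Rmin_l].
- by move=> k; split; [exact: (supp_MM M z0 g0 c0 T0 zm)|exact: (supp_NN M z0 g0 c0 T0 zm)].
move=> x Hx1 L.
have Hx : (Rabs x < r)%R by apply: Rlt_le_trans Hx1 (Rmin_l _ _).
have Hx2 : (Rabs x < T0 / (2 * (b + 1)))%R.
  by apply: Rlt_le_trans Hx1 _; apply: Rle_trans (Rmin_r _ _) (Rmin_l _ _).
have Hx3 : (Rabs x < T0 / (256 * PI))%R.
  by apply: Rlt_le_trans Hx1 _; apply: Rle_trans (Rmin_r _ _) (Rmin_r _ _).
have yb : (Rabs (yr M Y x (Period M)) <= b)%R.
  apply: Rle_trans (Hb x 1 ltac:(lra) (OK1 _)); rewrite /yr /yi /sv; move: (val _ _ _) => w.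
  by rewrite -(Rabs_pos_eq (Cmod w)); [apply: Rsqr_le_abs_0; have := Cmod_sqr w; rewrite /Rsqr; nra|exact: Cmod_ge_0].
have xb : (Rabs (x * yr M Y x (Period M)) <= T0 / 2)%R.
  rewrite Rabs_mult; apply: Rle_trans (_ : T0 / (2 * (b + 1)) * b <= _)%R.
    by apply: Rmult_le_compat; try exact: Rabs_pos; lra.
  rewrite (_ : T0 / 2 = T0 / (2 * (b + 1)) * (b + 1))%R; last by field; lra.
  by apply: Rmult_le_compat_l; lra.
have HT : (T0 / 2 <= period L <= 2 * T0)%R.
  rewrite /L /Lx /period /= /Tr; have := Rabs_le_between (x * yr M Y x (Period M)) (T0 / 2); move=> [H _].
  by have := H xb; lra.
have xs : (Rabs x * (128 * PI) <= period L)%R.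
  apply: Rle_trans (_ : T0 / 2 <= _)%R; last lra.
  rewrite (_ : T0 / 2 = T0 / (256 * PI) * (128 * PI))%R; last by field; lra.
  by apply: Rmult_le_compat_r; lra.
split=> //.
- by move=> k; exact: (gamr_neq0 M z0 g0 c0 T0 zm Y r Yfix Yconv x Hx g0nz k).
- move=> i; split; first exact: (yi_yr M z0 g0 c0 T0 zm Y r Yfix Yconv x Hx i).
  move=> Hi; rewrite /yr (yi_eq M z0 g0 c0 T0 zm Y r Yfix Yconv x Hx).
  rewrite (csumL_ext _ (fun _ => 0 * 0)); last by move=> j _; rewrite Hi; ring.
  by rewrite csumL_scal /Cconj /=; ring.
move=> xnz; have xsm : (Rabs x * (8 * PI * / Rabs (Tr M T0 Y x)) <= 1 / 8)%R.
  have TL : Tr M T0 Y x = period L by [].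
  rewrite TL (Rabs_pos_eq (period L)); last lra.
  rewrite (_ : 1 / 8 = period L / 16 * (2 * / period L))%R; last by field; lra.
  rewrite (_ : Rabs x * (8 * PI * / period L) = (Rabs x * (128 * PI)) / 16 * / period L)%R; last by field; lra.
  have ip : (0 < / period L)%R by apply: Rinv_0_lt_compat; lra.
  by apply: Rmult_le_compat; [|lra|lra|lra]; have := Rabs_pos x; nra.
split.
  by move=> ze k j; exact: (sep_sin M z0 g0 c0 T0 zm Y r Yfix Yconv x Hx T0pos sin0).
by move=> k z Hz; exact: (bdry_eq M z0 g0 c0 T0 zm Y r Yfix Yconv x Hx T0pos g0nz sin0 vel0 zms xnz xsm k z Hz).
Qed.

(** * The differential of the velocity and its right inverse *)

Lemma cder_unique f t l m : cder f t l -> cder f t m -> l = m.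
Proof.
move=> [A1 A2] [B1 B2]; apply: Ceq.
  by rewrite -(is_derive_unique _ _ _ A1) -(is_derive_unique _ _ _ B1).
by rewrite -(is_derive_unique _ _ _ A2) -(is_derive_unique _ _ _ B2).
Qed.

Lemma cder_inv (f : R -> C) t (l : C) : f t <> 0 -> cder f t l -> cder (fun s => / f s) t (- (l / (f t * f t))).
Proof.
move=> f0 [A B].
have n0 : (Re (f t) ^ 2 + Im (f t) ^ 2 <> 0)%R.
  by rewrite -Cmod_sqr; apply: pow_nonzero => E; apply: f0; exact: Cmod_eq_0.
have N : is_derive (fun s => Re (f s) ^ 2 + Im (f s) ^ 2)%R t (2 * Re (f t) * Re l + 2 * Im (f t) * Im l)%R.
  apply: is_derive_Rplus.
    apply: (is_derive_ext (fun s => Re (f s) * Re (f s))%R) => [s|]; first by rewrite /=; ring.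
    by apply: is_derive_eq (is_derive_Rmult _ _ _ _ _ A A); ring.
  apply: (is_derive_ext (fun s => Im (f s) * Im (f s))%R) => [s|]; first by rewrite /=; ring.
  by apply: is_derive_eq (is_derive_Rmult _ _ _ _ _ B B); ring.
have fn : f t * f t <> 0 by exact: Cmult_neq_0.
have R1 : - (l / (f t * f t)) = - (l * (/ f t * / f t)) by field.
rewrite R1; split.
  apply: (is_derive_ext (fun s => Re (f s) / (Re (f s) ^ 2 + Im (f s) ^ 2))%R) => [s|] //.
  apply: is_derive_eq (is_derive_div _ _ _ _ _ A N n0).
  by move: n0; case: (f t) => p q; case: l {A B N R1} => u v; rewrite /Re /Im /=; move=> n0; field; move=> E; apply: n0; rewrite -E; ring.
apply: (is_derive_ext (fun s => - Im (f s) / (Re (f s) ^ 2 + Im (f s) ^ 2))%R) => [s|] //.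
apply: is_derive_eq (is_derive_div _ _ _ _ _ (is_derive_opp _ _ _ B) N n0).
by move: n0; case: (f t) => p q; case: l {A B N R1} => u v; rewrite /Re /Im /= /opp /=; move=> n0; field; move=> E; apply: n0; rewrite -E; ring.
Qed.

Lemma cder_Ccot (z : R -> C) t (l : C) : Csin (z t) <> 0 -> cder z t l ->
  cder (fun s => Ccot (z s)) t (- ((1 + Ccot (z t) * Ccot (z t)) * l)).
Proof.
move=> s0 H; have H1 := cder_mult _ _ _ _ _ (cder_Ccos _ _ _ H) (cder_inv (fun s => Csin (z s)) _ _ s0 (cder_Csin _ _ _ H)).
apply: cder_eq H1; rewrite Ccot_sqr //; set S := Csin (z t) in s0 *; set K := Ccos (z t).
have E := Csin2_Ccos2 (z t); rewrite -/S -/K in E.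
transitivity (- ((S * S + K * K) * / (S * S) * l)); first by field.
by rewrite E; field.
Qed.

Lemma cder_csumL {A} (F : A -> R -> C) (F' : A -> C) t (l : list A) : (forall j, In j l -> cder (F j) t (F' j)) ->
  cder (fun s => csumL (fun j => F j s) l) t (csumL F' l).
Proof.
elim: l => [|j l IH] H; first exact: cder_const.
by apply: (cder_plus (F j)); [apply: H; left|apply: IH => i Hi; apply: H; right].
Qed.

Lemma big_csumL M (P : pred 'I_M) (F : 'I_M -> C) :
  \big[Cplus/RtoC 0]_(j < M | P j) F j = csumL (fun j => if P j then F j else RtoC 0) (idx M).
Proof.
rewrite unlock /idx /reducebig /csumL; elim: (index_enum _) => //= j l ->.
by case: (P j) => //; ring.
Qed.

Section Velocity.
Variables (M : nat) (L0 : params M).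
Hypothesis Tpos : (0 < period L0)%R.
Hypothesis sin0 : forall k j : 'I_M, k <> j -> Csin (PI * (center L0 k - center L0 j) / period L0) <> 0.
Notation P := (params_NormedModule M).
Notation Vn := (velocity_NormedModule M).

Definition line (h : params M) (t : R) : params M := plus (L0 : P) (scal t (h : P)).

Lemma scal_C (t : R) (z : C) : scal t (z : C_R_NormedModule) = RtoC t * z.
Proof. by apply: Ceq; [change (t * Re z = t * Re z - 0 * Im z)%R|change (t * Im z = t * Im z + 0 * Re z)%R]; ring. Qed.

Lemma center_line h t k : center (line h t) k = center L0 k + t * center h k.
Proof. by rewrite /line -scal_C. Qed.
Lemma circ_line h t k : Defs.circ (line h t) k = (Defs.circ L0 k + t * Defs.circ h k)%R.
Proof. by []. Qed.
Lemma speed_line h t : speed (line h t) = speed L0 + t * speed h.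
Proof. by rewrite /line -scal_C. Qed.
Lemma period_line h t : period (line h t) = (period L0 + t * period h)%R.
Proof. by []. Qed.

Definition cv (h : params M) (i : coord M) : C := RtoC (coord_val i h).

(** The derivative along a line through Lambda_0, computed explicitly; any differential of the
    velocity must agree with it, which turns the abstract splitting into a statement on [Dvel]. *)
Lemma velocity_cder h k : cder (fun t => velocity (line h t) k) 0%R
  (Dvel M (center L0) (Defs.circ L0) (period L0) (cv h) k).
Proof.
have T0 : RtoC (period L0) <> 0 by apply: RtoC_neq0; lra.
have i0 := Ci_neq0.
have C12 (c : C) : (RtoC (Re c) + Ci * RtoC (Im c)) = c by apply: Ceq; rewrite /=; ring.
have line0 (u v : C) : cder (fun t => u + t * v) 0%R v.
  apply: (cder_eq _ _ (0 + (1 * v + 0%R * 0))); first by ring.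
  by apply: cder_plus; [exact: cder_const|apply: cder_mult; [apply: cder_RtoC; exact: is_derive_id|exact: cder_const]].
have lineR (u v : R) : cder (fun t => RtoC (u + t * v)%R) 0%R v.
  apply: (cder_ext (fun t => u + t * v)); first by move=> s; rewrite RtoC_plus RtoC_mult.
  exact: line0.
apply: (cder_ext (fun t => csumL (fun j => if j == k then RtoC 0 else
    (Defs.circ L0 j + t * Defs.circ h j)%R * / (2 * Ci * (period L0 + t * period h)%R)
    * Ccot (PI * ((center L0 k + t * center h k) - (center L0 j + t * center h j)) * / (period L0 + t * period h)%R)) (idx M)
   - (speed L0 + t * speed h))).
  move=> s; rewrite /velocity big_csumL speed_line; congr (_ - _); apply: csumL_ext => j _.
  by rewrite !center_line circ_line period_line; case: (j == k).
rewrite /Dvel; apply: cder_minus; last first.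
  by apply: cder_eq (line0 _ (speed h)); rewrite /cv /= C12.
apply: cder_csumL => j _; case: eqP => [_|jk]; first exact: cder_const.
have I0 : cder (fun t => / RtoC (period L0 + t * period h)%R) 0%R (- (period h / (period L0 * period L0))).
  have := cder_inv (fun t => RtoC (period L0 + t * period h)%R) 0%R (period h) _ (lineR _ _).
  by rewrite Rmult_0_l Rplus_0_r => H; exact: H.
have A0 := cder_mult _ _ _ _ _ (cder_scal PI _ _ _ (cder_minus _ _ _ _ _ (line0 (center L0 k) (center h k)) (line0 (center L0 j) (center h j)))) I0.
have E0 : PI * (center L0 k + 0%R * center h k - (center L0 j + 0%R * center h j)) * / RtoC (period L0 + 0 * period h)%R
  = PI * (center L0 k - center L0 j) / period L0.
  by rewrite Rmult_0_l Rplus_0_r; field.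
have K0 := cder_Ccot _ _ _ _ A0; rewrite E0 in K0; have kj : k <> j by move=> E; apply: jk.
have K1 := cder_mult _ _ _ _ _ (cder_mult _ _ _ _ _ (lineR (Defs.circ L0 j) (Defs.circ h j)) (cder_scal (/ (2 * Ci)) _ _ _ I0)) (K0 (sin0 k j kj)).
apply: (cder_ext _ _ _ _ _ (cder_eq _ _ _ _ _ K1)).
  move=> s; congr (_ * _ * _).
  (* Where the period vanishes along the line both sides are 0, because the inverse of 0 is 0; so
     the two functions agree everywhere. *)
  case: (Req_dec (period L0 + s * period h) 0) => [->|n].
    rewrite Cmult_0_r; have -> : / RtoC 0 = 0 by apply: Ceq; rewrite /= /Rdiv; rewrite ?Ropp_0; ring.
    by ring.
  by field; split=> //; exact: RtoC_neq0.
rewrite E0 !Rmult_0_l !Rplus_0_r /Dterm /zvec /cv /= !C12 /e0.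
by field.
Qed.

(** The chain rule applied to the line, the velocity and a coordinate projection, the latter being
    linear and bounded by the maximum norm. *)
Lemma velocity_diff_line D h k : velocity_diff L0 D -> cder (fun t => velocity (line h t) k) 0%R (D h k).
Proof.
move=> [HD1 HD2].
have l0 : line h 0%R = L0 by rewrite /line scal_zero_l plus_zero_r.
have Dl : is_derive (V := P) (line h) 0%R (h : P).
  rewrite -[X in is_derive _ _ X](plus_zero_l (h : P)).
  apply: (is_derive_plus (V := P) (fun _ => (L0 : P)) (fun t => scal t (h : P))); first exact: is_derive_const.
  exact: filterdiff_linear (is_linear_scal_l (h : P)).
have Dv : filterdiff (K := R_AbsRing) (U := P) (V := Vn) (@velocity M) (locally (T := P) (line h 0%R)) D.
  by rewrite l0; split.
have C1' := filterdiff_comp' (K := R_AbsRing) (U := R_NormedModule) (V := P) (W := Vn) _ _ _ _ _ Dl Dv.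
have Pl : is_linear (K := R_AbsRing) (U := Vn) (V := C_R_NormedModule) (fun f => f k).
  split=> //; exists 1%R; split; first lra; move=> f; rewrite Rmult_1_l.
  exact: (le_fin_norm (K := R_AbsRing) (V := C_R_NormedModule)).
have C2' := filterdiff_comp' (K := R_AbsRing) (U := R_NormedModule) (V := Vn) (W := C_R_NormedModule) _ _ _ _ _ C1' (filterdiff_linear _ Pl).
apply: is_derive_cder; apply: filterdiff_ext_lin C2' _ => y /=.
by rewrite (linear_scal _ HD1).
Qed.

Lemma velocity_diff_Dvel D h k : velocity_diff L0 D ->
  D h k = Dvel M (center L0) (Defs.circ L0) (period L0) (cv h) k.
Proof. by move=> H; apply: cder_unique (velocity_diff_line D h k H) (velocity_cder h k). Qed.
End Velocity.


HB.instance Definition _ := Monoid.isComLaw.Build C (RtoC 0) Cplus Cplus_assoc Cplus_comm Cplus_0_l.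

Section Steady.
Variables (M : nat) (L0 : params M).
Hypothesis HL : steady_point_vortex L0.

Lemma steady_sin (k j : 'I_M) : k <> j -> Csin (PI * (center L0 k - center L0 j) / period L0) <> 0.
Proof.
case: HL => [_ [Tp [_ Hs]]] kj /Csin_eq0 [n Hn]; apply: (Hs k j kj n).
have T0 : RtoC (period L0) <> 0 by apply: RtoC_neq0; lra.
have P0 := CPI_neq0.
transitivity (period L0 / PI * (PI * (center L0 k - center L0 j) / period L0)); first by field.
by rewrite Hn (RtoC_mult (IZR n)) (RtoC_mult (period L0)); field.
Qed.

Lemma steady_vel (k : 'I_M) : csumL (fun j => if j == k then RtoC 0 else
   Defs.circ L0 j / (2 * Ci * period L0) * e0 M (center L0) (period L0) k j) (idx M) - speed L0 = 0.
Proof.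
case: HL => [Hv _]; rewrite -[RHS](Hv k) /velocity big_csumL; congr (_ - _); apply: csumL_ext => j _.
by case: (j == k).
Qed.

Lemma Dvel_lin (A : Type) (y : A -> coord M -> C) (q : A -> C) z0 g0 T0 l k :
  csumL (fun a => q a * Dvel M z0 g0 T0 (y a) k) l
  = Dvel M z0 g0 T0 (fun i => csumL (fun a => q a * y a i) l) k.
Proof.
have add (u v : coord M -> C) : Dvel M z0 g0 T0 (fun i => u i + v i) k = Dvel M z0 g0 T0 u k + Dvel M z0 g0 T0 v k.
  have E : csumL (fun j : 'I_M => if j == k then RtoC 0 else / (2 * Ci) * Dterm M z0 g0 T0 (fun i => u i + v i) k j) (idx M)
    = csumL (fun j : 'I_M => if j == k then RtoC 0 else / (2 * Ci) * Dterm M z0 g0 T0 u k j) (idx M)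
    + csumL (fun j : 'I_M => if j == k then RtoC 0 else / (2 * Ci) * Dterm M z0 g0 T0 v k j) (idx M).
    rewrite -csumL_add; apply: csumL_ext => j _; case: (j == k); first by ring.
    by rewrite /Dterm /zvec /Cdiv; ring.
  rewrite /Dvel E; cbv beta; ring.
elim: l => [|a l IH].
  rewrite [LHS]/=; have := Dvel_scal M z0 g0 T0 0 (fun _ => RtoC 0) k; rewrite [X in _ = X]Cmult_0_l => H.
  transitivity (Dvel M z0 g0 T0 (fun _ : coord M => 0 * RtoC 0) k); first by symmetry.
  by congr (Dvel M z0 g0 T0 _ k); apply: functional_extensionality => i; rewrite /=; ring.
by rewrite [LHS]/= -/(csumL _ l) IH -Dvel_scal -add.
Qed.

(** Let a_j and b_j be preimages of e_j and i e_j among the selected directions. A preimage of v is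
    the sum of Re(v_j) a_j + Im(v_j) b_j, that is, twice the real part of the sum of (a_j - i b_j)
    v_j / 2. Rows of unselected coordinates vanish with those of a_j and b_j. *)
Lemma velocity_matrix (sel : coord M -> bool) : splitting sel L0 ->
  exists zm : coord M -> 'I_M -> C, (forall i, sel i = false -> forall j, zm i j = 0) /\
  forall (v : 'I_M -> C) k, Dvel M (center L0) (Defs.circ L0) (period L0)
     (fun i => csumL (fun j => zm i j * v j) (idx M) + Cconj (csumL (fun j => zm i j * v j) (idx M))) k = v k.
Proof.
move=> [D [HD Hinv]]; case: HL => [_ [Tp _]].
have HDv h k : D h k = Dvel M (center L0) (Defs.circ L0) (period L0) (cv M h) k.
  by apply: velocity_diff_Dvel => //; exact: steady_sin.
have ex (v : 'I_M -> C) : exists h, (forall i, sel i = false -> coord_val i h = 0%R) /\ D h = v.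
  by have [h [H _]] := Hinv v; exists h.
pose hv v := proj1_sig (constructive_indefinite_description _ (ex v)).
have Hh v : (forall i, sel i = false -> coord_val i (hv v) = 0%R) /\ D (hv v) = v.
  by rewrite /hv; case: (constructive_indefinite_description _ _).
pose bas (c : C) j : 'I_M -> C := fun k => if j == k then c else RtoC 0.
pose a j := hv (bas 1 j); pose b j := hv (bas Ci j).
exists (fun i j => / 2 * (coord_val i (a j) - Ci * coord_val i (b j))); split.
  by move=> i Hi j; rewrite (proj1 (Hh _) i Hi) (proj1 (Hh _) i Hi); ring.
move=> v k.
have E i : csumL (fun j => / 2 * (coord_val i (a j) - Ci * coord_val i (b j)) * v j) (idx M)
   + Cconj (csumL (fun j => / 2 * (coord_val i (a j) - Ci * coord_val i (b j)) * v j) (idx M))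
   = csumL (fun j => Re (v j) * cv M (a j) i) (idx M) + csumL (fun j => Im (v j) * cv M (b j) i) (idx M).
  rewrite csumL_conj -!csumL_add; apply: csumL_ext => j _; rewrite /cv.
  have h2 : / RtoC 2 = RtoC (/ 2) by rewrite RtoC_inv //; lra.
  by rewrite h2; case: (v j) => p q; apply: Ceq; rewrite /Cconj /Re /Im /=; field.
rewrite (functional_extensionality _ _ E).
have E2 i : csumL (fun j => Re (v j) * cv M (a j) i) (idx M) + csumL (fun j => Im (v j) * cv M (b j) i) (idx M)
   = csumL (fun a => a.1 * a.2 i) (map (fun j => (RtoC (Re (v j)), cv M (a j))) (idx M) ++ map (fun j => (RtoC (Im (v j)), cv M (b j))) (idx M)).
  by rewrite csumL_app !csumL_map.
rewrite (functional_extensionality _ _ E2) -(Dvel_lin _ (fun a : C * (coord M -> C) => a.2) (fun a => a.1)).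
rewrite csumL_app !csumL_map /=.
have -> : csumL (fun j => Re (v j) * Dvel M (center L0) (Defs.circ L0) (period L0) (cv M (a j)) k) (idx M)
   = csumL (fun j => if j == k then RtoC (Re (v k)) else RtoC 0) (idx M).
  apply: csumL_ext => j _; rewrite -HDv (proj2 (Hh _)) /bas; case: eqP => [->|_]; ring.
have -> : csumL (fun j => Im (v j) * Dvel M (center L0) (Defs.circ L0) (period L0) (cv M (b j)) k) (idx M)
   = csumL (fun j => if j == k then Im (v k) * Ci else RtoC 0) (idx M).
  apply: csumL_ext => j _; rewrite -HDv (proj2 (Hh _)) /bas; case: eqP => [->|_]; ring.
rewrite -!(big_csumL M (fun j => j == k)) !big_pred1_eq.
by apply: Ceq; rewrite /=; ring.
Qed.
End Steady.

(** * Local logarithms and integrals of series against regular functions *)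

Lemma unit_pt_onto (s : C) : Cmod s = 1%R -> exists t, s = unit_pt t.
Proof.
move=> H; have Q := Cmod_sqr s; rewrite H pow1 in Q.
have R1 : (-1 <= Re s <= 1)%R by split; nra.
have S2 : (Rsqr (sqrt (1 - Rsqr (Re s))) = Rsqr (Im s))%R by rewrite Rsqr_sqrt /Rsqr; nra.
case: (Rle_lt_dec 0 (Im s)) => Hi.
  exists (acos (Re s)); apply: Ceq; rewrite /unit_pt /=; first by rewrite cos_acos.
  by rewrite sin_acos //; apply: Rsqr_inj => //; exact: sqrt_pos.
exists (- acos (Re s))%R; apply: Ceq; rewrite /unit_pt /=; first by rewrite cos_neg cos_acos.
have E : (- Im s = sqrt (1 - Rsqr (Re s)))%R by apply: Rsqr_inj; [lra|exact: sqrt_pos|rewrite S2 /Rsqr; ring].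
by rewrite sin_neg sin_acos // -E; ring.
Qed.

Lemma rder0_const (f : R -> R) : (forall t, is_derive f t 0%R) -> forall s t, f s = f t.
Proof.
move=> H s t; have [||c [_ Hc]] := MVT_gen f s t (fun=> 0%R).
- by move=> u _; exact: H.
- by move=> u _; apply: derivable_continuous_pt; apply/ex_derive_Reals_0; exists 0%R.
by lra.
Qed.

Lemma is_derive_ln_Cmod (S : R -> C) t l : S t <> 0 -> cder S t l ->
  is_derive (fun s => ln (Cmod (S s))) t (Re (l / S t)).
Proof.
move=> S0 [A B].
have P : (0 < Re (S t) ^ 2 + Im (S t) ^ 2)%R by rewrite -Cmod_sqr; apply: pow_lt; apply/Cmod_gt_0.
have E s : (/ 2 * ln (Re (S s) ^ 2 + Im (S s) ^ 2) = ln (Cmod (S s)))%R.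
  rewrite -Cmod_sqr; case: (Req_dec (Cmod (S s)) 0) => [->|n].
    (* At zeros of S both sides are 0, since [ln 0] is 0 by convention; the identity is needed at
       all points to rewrite the function. *)
    have l0 : ln 0 = 0%R by unfold ln; destruct (Rlt_dec 0 0) as [h|h]; [exfalso; lra|].
    by rewrite pow_i ?l0; [ring|lia].
  have p : (0 < Cmod (S s))%R by have := Cmod_ge_0 (S s); lra.
  by rewrite /= Rmult_1_r ln_mult //; lra.
apply: (is_derive_ext _ _ _ _ E).
have D : is_derive (fun s => Re (S s) ^ 2 + Im (S s) ^ 2)%R t (2 * (Re (S t) * Re l + Im (S t) * Im l))%R.
  apply: (is_derive_ext (fun s => Re (S s) * Re (S s) + Im (S s) * Im (S s))%R) => [s|]; first by rewrite /=; ring.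
  by apply: is_derive_eq (is_derive_Rplus _ _ _ _ _ (is_derive_Rmult _ _ _ _ _ A A) (is_derive_Rmult _ _ _ _ _ B B)); ring.
have Hl := is_derive_comp ln _ t _ _ (is_derive_ln _ P) D.
apply: is_derive_eq (is_derive_scal _ t (/ 2)%R _ Hl); rewrite /scal /= /mult /=.
by move: P; case: (S t) => p q; case: l {A B D Hl} => u v; rewrite /Re /Im /= => P; field; lra.
Qed.

Lemma MVT_Re (g : R -> C) (g' : R -> C) : (forall t, (0 <= t <= 1)%R -> cder g t (g' t)) ->
  exists t1 t2, [/\ (0 <= t1 <= 1)%R, (0 <= t2 <= 1)%R, Re (g 1%R - g 0%R) = Re (g' t1) & Im (g 1%R - g 0%R) = Im (g' t2)].
Proof.
move=> H.
have A (f f' : R -> R) : (forall t, (0 <= t <= 1)%R -> is_derive f t (f' t)) -> exists t, (0 <= t <= 1)%R /\ (f 1 - f 0 = f' t)%R.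
  move=> D; have [||c [Hc1 Hc2]] := MVT_gen f 0%R 1%R f'.
  - by rewrite Rmin_left ?Rmax_right; try lra; move=> u Hu; apply: D; lra.
  - rewrite Rmin_left ?Rmax_right; try lra; move=> u Hu; apply: derivable_continuous_pt; apply/ex_derive_Reals_0.
    by exists (f' u); apply: D.
  exists c; move: Hc1; rewrite Rmin_left ?Rmax_right; try lra; move=> Hc1; split=> //; rewrite Hc2; ring.
have [t1 [T1 E1]] := A _ (fun t => Re (g' t)) (fun t Ht => proj1 (H t Ht)).
have [t2 [T2 E2]] := A _ (fun t => Im (g' t)) (fun t Ht => proj2 (H t Ht)).
by exists t1, t2; split.
Qed.

(** Segments stay in a ball, so the mean value theorem applied to real and imaginary parts
    separately gives the two-point bounds, at the cost of a factor 2. *)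
Lemma SD_ball (c : C) (d B : R) (g g' : C -> C) : (0 <= B)%R ->
  (forall u v t, (Cmod (u - c) < d)%R -> (Cmod (v - c) < d)%R -> (0 <= t <= 1)%R ->
     cder (fun s => g (u + s * (v - u))) t (g' (u + t * (v - u)) * (v - u))) ->
  (forall u, (Cmod (u - c) < d)%R -> (Cmod (g' u) <= B)%R) ->
  (forall u v, (Cmod (u - c) < d)%R -> (Cmod (v - c) < d)%R -> (Cmod (g' v - g' u) <= B * Cmod (v - u))%R) ->
  SD (fun u => (Cmod (u - c) < d)%R) g g'.
Proof.
move=> B0 Hd Hb Hl; pose O u := (Cmod (u - c) < d)%R.
have seg u v t : O u -> O v -> (0 <= t <= 1)%R -> O (u + t * (v - u)).
  move=> Hu Hv Ht; rewrite /O (_ : u + t * (v - u) - c = RtoC (1 - t) * (u - c) + t * (v - c)); last by rewrite RtoC_minus; ring.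
  apply: Rle_lt_trans (Cmod_triangle _ _) _; rewrite (Cmod_mult (RtoC (1 - t))) (Cmod_mult t) !Cmod_R !Rabs_pos_eq; try lra.
  rewrite /O in Hu Hv; case: (Req_dec t 0) => [->|t0]; first lra.
  have := Rmult_lt_compat_l t _ _ ltac:(lra) Hv; have := Rmult_le_compat_l (1 - t) _ _ ltac:(lra) (Rlt_le _ _ Hu); lra.
have two (w : C) (b : R) : (Rabs (Re w) <= b)%R -> (Rabs (Im w) <= b)%R -> (Cmod w <= 2 * b)%R.
  by move=> H1 H2; apply: Rle_trans (Cmod_le_abs w) _; lra.
have lip u v : O u -> O v -> (Cmod (g v - g u) <= 2 * (B * Cmod (v - u)))%R.
  move=> Hu Hv; have [t1 [t2 [T1 T2 E1 E2]]] := MVT_Re _ (fun t => g' (u + t * (v - u)) * (v - u)) (fun t Ht => Hd u v t Hu Hv Ht).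
  have e1 : u + 1%R * (v - u) = v by ring.
  have e0 : u + 0%R * (v - u) = u by ring.
  rewrite e1 e0 in E1 E2.
  apply: two; rewrite ?E1 ?E2; [apply: Rle_trans (re_le_Cmod _) _|apply: Rle_trans (im_le_Cmod _) _];
    rewrite (Cmod_mult (g' _)); apply: Rmult_le_compat_r; try exact: Cmod_ge_0; apply: Hb; exact: seg.
have quad u v : O u -> O v -> (Cmod (g v - g u - (v - u) * g' u) <= 2 * (B * Cmod (v - u) ^ 2))%R.
  move=> Hu Hv; have [t1 [t2 [T1 T2 E1 E2]]] := MVT_Re _ (fun t => g' (u + t * (v - u)) * (v - u)) (fun t Ht => Hd u v t Hu Hv Ht).
  have e1 : u + 1%R * (v - u) = v by ring.
  have e0 : u + 0%R * (v - u) = u by ring.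
  rewrite e1 e0 in E1 E2.
  have K t : (0 <= t <= 1)%R -> (Cmod (g' (u + t * (v - u)) * (v - u) - (v - u) * g' u)%C <= B * Cmod (v - u) ^ 2)%R.
    move=> Ht; rewrite (_ : _ - _ = (g' (u + t * (v - u)) - g' u) * (v - u)); last by ring.
    rewrite (Cmod_mult (_ - _)).
    have := Hl u _ Hu (seg u v t Hu Hv Ht); rewrite (_ : u + t * (v - u) - u = t * (v - u)); last by ring.
    rewrite (Cmod_mult t) Cmod_R Rabs_pos_eq; last lra.
    have h0 := Cmod_ge_0 (v - u); move: (Cmod (v - u)) h0 => h h0 H1.
    apply: Rle_trans (_ : B * (t * h) * h <= _)%R; first exact: Rmult_le_compat_r.
    rewrite (_ : B * (t * h) * h = t * (B * h ^ 2))%R; last by ring.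
    have : (0 <= B * h ^ 2)%R by apply: Rmult_le_pos => //; exact: pow2_ge_0.
    nra.
  apply: two.
    rewrite Re_minus E1 -Re_minus; exact: Rle_trans (re_le_Cmod _) (K t1 T1).
  by rewrite Im_minus E2 -Im_minus; exact: Rle_trans (im_le_Cmod _) (K t2 T2).
have d0 u : O u -> (0 < d)%R by move=> Hu; apply: Rle_lt_trans Hu; exact: Cmod_ge_0.
have Oc u : O u -> O c by move=> /d0 Hd0; rewrite /O (_ : c - c = 0) ?Cmod_0 //; ring.
pose G := (2 * B + Cmod (g c) + 2 * (B * Rabs d))%R.
have Bd : (0 <= B * Rabs d)%R by apply: Rmult_le_pos => //; exact: Rabs_pos.
have gc := Cmod_ge_0 (g c).
exists G; split; first by rewrite /G; lra.
split=> [u Hu|u v Hu Hv].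
  split; last by apply: Rle_trans (Hb u Hu) _; rewrite /G; lra.
  rewrite (_ : g u = g c + (g u - g c)); last by ring.
  apply: Rle_trans (Cmod_triangle _ _) _.
  have := lip c u (Oc u Hu) Hu.
  have : (B * Cmod (u - c) <= B * Rabs d)%R.
    by apply: Rmult_le_compat_l => //; rewrite Rabs_pos_eq; have := d0 u Hu; rewrite /O in Hu; lra.
  rewrite /G; lra.
have h0 := Cmod_ge_0 (v - u).
have GB : (2 * B <= G)%R by rewrite /G; lra.
split.
- apply: Rle_trans (lip u v Hu Hv) _; rewrite -Rmult_assoc; exact: Rmult_le_compat_r.
- apply: Rle_trans (Hl u v Hu Hv) _; apply: Rmult_le_compat_r => //; lra.
apply: Rle_trans (quad u v Hu Hv) _; rewrite -Rmult_assoc; apply: Rmult_le_compat_r => //; exact: pow2_ge_0.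
Qed.

Definition Clog (u : C) : C := (ln (Cmod u), atan (Im u / Re u)).

Lemma Cexp_Clog (u : C) : (0 < Re u)%R -> Cexp (Clog u) = u.
Proof.
move=> H; have m0 : (0 < Cmod u)%R by apply/Cmod_gt_0 => E; move: H; rewrite E /=; lra.
rewrite /Cexp [Re (Clog u)]/= [Im (Clog u)]/= exp_ln // cos_atan sin_atan.
have E : (sqrt (1 + Rsqr (Im u / Re u)) = Cmod u / Re u)%R.
  apply: sqrt_lem_1.
  - by have := Rle_0_sqr (Im u / Re u); lra.
  - by apply: Rlt_le; exact: Rdiv_lt_0_compat.
  rewrite (_ : Cmod u / Re u * (Cmod u / Re u) = Cmod u ^ 2 / Re u ^ 2)%R; last by field; lra.
  by rewrite Cmod_sqr /Rsqr; field; lra.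
rewrite E; apply: Ceq; rewrite ?Re_mult ?Im_mult [Re (RtoC _)]/= [Im (RtoC _)]/= [Re (_, _)]/= [Im (_, _)]/=; field; lra.
Qed.

Lemma cder_Clog (f : R -> C) t l : (0 < Re (f t))%R -> cder f t l -> cder (fun s => Clog (f s)) t (l / f t).
Proof.
move=> H D; have f0 : f t <> 0 by move=> E; move: H; rewrite E /=; lra.
split; first exact: is_derive_ln_Cmod.
case: D => A B; have r0 : Re (f t) <> 0%R by lra.
have Q := is_derive_div _ _ _ _ _ B A r0.
have At : is_derive atan (Im (f t) / Re (f t))%R (/ (1 + (Im (f t) / Re (f t))²))%R.
  by apply/is_derive_Reals; have := derivable_pt_lim_atan (Im (f t) / Re (f t))%R; rewrite Rsqr_pow2.
apply: is_derive_eq (is_derive_comp atan _ t _ _ At Q); rewrite /scal /= /mult /=.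
move: H; case: (f t) => p q; case: l {A B Q} => u v; rewrite /Re /Im /Rsqr /= => H; field.
have P : (0 < p * p)%R by nra.
by repeat split; nra.
Qed.

Lemma Clog_exists (u : C) : u <> 0 -> exists s, Cexp s = u.
Proof.
move=> u0; have m0 : (0 < Cmod u)%R by apply/Cmod_gt_0.
have [t Ht] : exists t, u / Cmod u = unit_pt t.
  by apply: unit_pt_onto; rewrite Cmod_div ?Cmod_R ?Rabs_pos_eq; [field; lra|lra|apply: RtoC_neq0; lra].
exists (ln (Cmod u), t); rewrite /Cexp [Re (_, _)]/= [Im (_, _)]/= exp_ln // -/(unit_pt t) -Ht.
by field; apply: RtoC_neq0; lra.
Qed.

(** Algebraic identities for the differences replace the mean value theorem, since the exterior of a
    disk is not convex. *)
Lemma SD_inv (a : R) : (0 < a)%R -> SD (fun z => (a <= Cmod z)%R) (fun z => / z) (fun z => - (/ z * / z)).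
Proof.
move=> a0; set i := (/ a)%R; have i0 : (0 < i)%R by exact: Rinv_0_lt_compat.
have I (z : C) : (a <= Cmod z)%R -> z <> 0 /\ (Cmod (/ z) <= i)%R.
  move=> H; have z0 : z <> 0 by move=> E; move: H; rewrite E Cmod_0; lra.
  by split=> //; rewrite Cmod_inv //; apply: Rinv_le_contravar.
have I2 (z w : C) : (a <= Cmod z)%R -> (a <= Cmod w)%R -> (Cmod (/ z * / w) <= i ^ 2)%R.
  move=> /I [_ H1] /I [_ H2]; rewrite /= Rmult_1_r; exact: Cmod_mult_le.
have I3 (z w : C) : (a <= Cmod z)%R -> (a <= Cmod w)%R -> (Cmod (/ z * / z * / w) <= i ^ 3)%R.
  move=> H1 H2; have [_ H] := I w H2; rewrite (_ : i ^ 3 = i ^ 2 * i)%R; last by rewrite /=; ring.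
  by apply: Cmod_mult_le => //; exact: I2.
exists (i + i ^ 2 + 2 * i ^ 3)%R; have p2 : (0 < i ^ 2)%R by exact: pow_lt.
have p3 : (0 < i ^ 3)%R by exact: pow_lt.
split; first lra.
split=> [x Hx|x y Hx Hy].
  have [x0 H1] := I x Hx; have := I2 x x Hx Hx; rewrite Cmod_opp; split; lra.
have [x0 _] := I x Hx; have [y0 _] := I y Hy; have h0 := Cmod_ge_0 (y - x).
have A := I2 x y Hx Hy; have B1 := I3 x y Hx Hy; have B2 := I3 y x Hy Hx.
have h2 := pow2_ge_0 (Cmod (y - x)).
split.
- rewrite (_ : / y - / x = - (/ x * / y) * (y - x)); last by field.
  rewrite (Cmod_mult (- (/ x * / y))) Cmod_opp; apply: Rmult_le_compat_r => //; lra.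
- rewrite (_ : - (/ y * / y) - - (/ x * / x) = (/ x * / x * / y + / y * / y * / x) * (y - x)); last by field.
  rewrite (Cmod_mult (_ + _)); apply: Rmult_le_compat_r => //.
  by apply: Rle_trans (Cmod_triangle _ _) _; lra.
rewrite (_ : / y - / x - (y - x) * - (/ x * / x) = (/ x * / x * / y) * ((y - x) * (y - x))); last by field.
rewrite (Cmod_mult (/ x * / x * / y)) (Cmod_mult (y - x)) (_ : Cmod (y - x) * Cmod (y - x) = Cmod (y - x) ^ 2)%R; last by rewrite /=; ring.
by apply: Rmult_le_compat_r => //; lra.
Qed.

Lemma SD_pow (b : R) n : exists g', SD (annulus 0 b) (fun z => Cpow z n) g'.
Proof.
elim: n => [|n [g' IH]]; first by exists (fun=> 0); exact: SD_const.
eexists; apply: (SD_mult _ id (fun=> 1) _ g' _ IH); by apply: (SD_id _ b) => z [].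
Qed.

Lemma SD_zpow (a b : R) e : (0 < a)%R -> exists g', SD (annulus a b) (fun z => zpow z e) g'.
Proof.
move=> a0; have S n : exists g', SD (annulus a b) (fun z => Cpow z n) g'.
  by have [g' H] := SD_pow b n; exists g'; apply: SD_sub H => z [H1 H2]; split=> //; lra.
have Sinv n : exists g', SD (annulus a b) (fun z => / Cpow z n) g'.
  have [g' H] := S n.
  elim: n {g' H} => [|n [g' IH]].
    by exists (fun=> 0); apply: SD_ext (SD_const _ 1) => // z _; rewrite /=; apply: Ceq; rewrite /=; field.
  have Hi : SD (annulus a b) (fun z => / z) (fun z => - (/ z * / z)) by apply: SD_sub (SD_inv a a0) => z [].
  eexists; apply: SD_ext (SD_mult _ _ _ _ _ Hi IH) => // z [Hz _].
  have z0 : z <> 0 by move=> E; move: Hz; rewrite E Cmod_0; lra.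
  by rewrite /=; field; split=> //; exact: Cpow_nz.
case: e => [|p|p]; [exact: (S 0%nat)|exact: (S (Pos.to_nat p))|exact: (Sinv (Pos.to_nat p))].
Qed.

Lemma ccont_zpow_circle (s : R) e : (0 < s)%R -> ccont (fun t => zpow (s * unit_pt t) e).
Proof.
move=> s0; have [g' H] := SD_zpow s s e s0.
apply: (proj1 (SD_ccont _ _ _ (fun t => s * unit_pt t) H _ (ccont_circle s))) => t.
by rewrite /annulus Cmod_circle; lra.
Qed.

Section SeriesIntegral.
Variables (r x s : R) (X : ser) (A : R -> C) (K : R).
Hypotheses (Hx : (Rabs x < r)%R) (HX : conv r X) (Hs : (/ 4 <= s <= 4)%R).
Hypotheses (CA : ccont A) (KA : forall t, (Cmod (A t) <= K)%R).

Lemma ann_circle t : ann (s * unit_pt t).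
Proof. by rewrite /ann Cmod_circle; lra. Qed.

Let c t n := A t * lev (X n) (s * unit_pt t).
Let y n := (K * (lnorm (X n) * Rabs x ^ n))%R.

Let K0 : (0 <= K)%R.
Proof. by apply: Rle_trans (KA 0); exact: Cmod_ge_0. Qed.
Let Cl l : ccont (fun t => lev l (s * unit_pt t)).
Proof.
apply: (proj1 (cint_csumL (fun y t => y.1 * zpow (s * unit_pt t) y.2) l _)) => a.
by apply: ccont_scal; apply: ccont_zpow_circle; lra.
Qed.
Let Cc n : ccont (fun t => c t n).
Proof. by apply: ccont_mult. Qed.
Let Hy t n : (Cmod (c t n) * Rabs x ^ n <= y n)%R.
Proof.
rewrite /c /y -Rmult_assoc; apply: Rmult_le_compat_r; first by apply: pow_le; exact: Rabs_pos.
by apply: Cmod_mult_le => //; apply: OK_lev; left; exact: ann_circle.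
Qed.
Let y0 n : (0 <= y n)%R.
Proof.
by apply: Rmult_le_pos => //; apply: Rmult_le_pos; [exact: lnorm_ge0|apply: pow_le; exact: Rabs_pos].
Qed.
Let Hb : exists b, forall m, (rs m y <= b)%R.
Proof.
have [b Hb] := HX; exists (K * b)%R => m; rewrite /y rs_scal; apply: Rmult_le_compat_l => //.
apply: Rle_trans (Hb m); apply: rs_le => i _; apply: Rmult_le_compat_l; first exact: lnorm_ge0.
by apply: pow_incr; split; [exact: Rabs_pos|lra].
Qed.
Let Ev t : CS (c t) x = A t * val X x (s * unit_pt t).
Proof. by rewrite /val -CS_scal //; apply: (conv_asum _ X r) => //; [left; exact: ann_circle|lra]. Qed.

Lemma ccont_val : ccont (fun t => val X x (s * unit_pt t) * A t).
Proof.
have [b B] := Hb; apply: (ccont_ext (fun t => CS (c t) x)); last exact: CS_ccont Hy y0 B.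
by move=> t; rewrite Ev; ring.
Qed.

Lemma cint_val : cint (fun t => val X x (s * unit_pt t) * A t)
  = CS (fun n => csumL (fun m => m.1 * cint (fun t => zpow (s * unit_pt t) m.2 * A t)) (X n)) x.
Proof.
have [b B] := Hb; rewrite (cint_ext _ (fun t => CS (c t) x)); last by move=> t; rewrite Ev; ring.
rewrite (cint_CS c x y b Cc Hy y0 B); apply: CS_ext => n; rewrite /c.
have Cm (m : mono) : ccont (fun t => zpow (s * unit_pt t) m.2 * A t).
  by apply: ccont_mult => //; apply: ccont_zpow_circle; lra.
rewrite (cint_ext _ (fun t => csumL (fun m => m.1 * (zpow (s * unit_pt t) m.2 * A t)) (X n))); last first.
  by move=> t; rewrite /lev -csumL_scal; apply: csumL_ext => m _; ring.
rewrite (proj2 (cint_csumL (fun (m : mono) t => m.1 * (zpow (s * unit_pt t) m.2 * A t)) (X n) _)); last first.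
  by move=> m; exact: ccont_scal.
by apply: csumL_ext => m _; rewrite cint_scal.
Qed.
End SeriesIntegral.

Lemma hc_circle t : hc t = RtoC (/ 2) * unit_pt t. Proof. by []. Qed.

Lemma unit_circle t : unit_pt t = RtoC 1 * unit_pt t. Proof. by ring. Qed.

(* The nonnegative modes of a real density do not contribute and the negative
   ones may be integrated over a smaller circle. *)
Lemma density_int (r x : R) X (G G' : C -> C) : (Rabs x < r)%R -> conv r X ->
  supp (fun e => e <= -1)%Z X -> SD (annulus 0 1) G G' ->
  ccont (fun t => RtoC (2 * Re (val X x (unit_pt t)))%R * (G (unit_pt t) * (Ci * unit_pt t))) /\
  cint (fun t => RtoC (2 * Re (val X x (unit_pt t)))%R * (G (unit_pt t) * (Ci * unit_pt t)))
  = cint (fun t => val X x (hc t) * (G (hc t) * (Ci * hc t))).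
Proof.
move=> Hx HX SX HG.
have [B [B0 [B1 _]]] := HG.
have Ht s t : (0 <= s <= 1)%R -> annulus 0 1 (s * unit_pt t) by move=> H; rewrite /annulus Cmod_circle; lra.
have CG s : (0 <= s <= 1)%R -> ccont (fun t => G (s * unit_pt t) * (Ci * (s * unit_pt t))).
  move=> H; apply: ccont_mult; last by apply: ccont_scal; exact: ccont_circle.
  by apply: (proj1 (SD_ccont _ _ _ (fun t => s * unit_pt t) HG _ (ccont_circle s))) => t; exact: Ht.
have KG s t : (0 <= s <= 1)%R -> (Cmod (G (s * unit_pt t) * (Ci * (s * unit_pt t)))%C <= B * 1)%R.
  move=> H; apply: Cmod_mult_le; first by have [] := B1 _ (Ht s t H).
  by rewrite Cmod_mult Cmod_Ci Cmod_circle; lra.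
have r0 : (0 < r)%R by have := Rabs_pos x; lra.
have HXc : conv r (sconj X) by apply: conv_slin => //; exact: bounded_mconj.
have S1 : (/ 4 <= 1 <= 4)%R by lra.
have S2 : (/ 4 <= / 2 <= 4)%R by lra.
have o1 : (0 <= 1 <= 1)%R by lra.
have o2 : (0 <= / 2 <= 1)%R by lra.
pose A s t := G (s * unit_pt t) * (Ci * (s * unit_pt t)).
have E t : val X x (RtoC 1 * unit_pt t) * A 1%R t + val (sconj X) x (RtoC 1 * unit_pt t) * A 1%R t
   = RtoC (2 * Re (val X x (unit_pt t)))%R * (G (unit_pt t) * (Ci * unit_pt t)).
  rewrite /A -unit_circle (val_conj r x _ Hx (Cmod_unit t) X HX) -Cmult_plus_distr_r; congr (_ * _).
  by move: (val _ _ _) => [p q]; apply: Ceq; rewrite /Cconj /=; ring.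
have CX1 := ccont_val r x 1%R X (A 1%R) _ Hx HX S1 (CG _ o1) (fun t => KG _ t o1).
have CX2 := ccont_val r x 1%R (sconj X) (A 1%R) _ Hx HXc S1 (CG _ o1) (fun t => KG _ t o1).
split; first by apply: ccont_ext E _; exact: ccont_plus.
rewrite -(cint_ext _ _ E) cint_plus //.
rewrite (cint_val r x 1%R X (A 1%R) _ Hx HX S1 (CG _ o1) (fun t => KG _ t o1)).
rewrite (cint_val r x 1%R (sconj X) (A 1%R) _ Hx HXc S1 (CG _ o1) (fun t => KG _ t o1)).
rewrite [RHS](cint_val r x (/ 2)%R X (A (/ 2)%R) _ Hx HX S2 (CG _ o2) (fun t => KG _ t o2)).
(* The conjugate series has positive exponents, so every monomial times G is regular in the whole
   disk and its contour shrinks to a point. *)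
have -> : CS (fun n => csumL (fun m => m.1 * cint (fun t => zpow (RtoC 1 * unit_pt t) m.2 * A 1%R t)) (sconj X n)) x = 0.
  transitivity (CS (fun n => match n with O => RtoC 0 | S _ => 0 end) x); last by rewrite CS_cst.
  apply: CS_ext => n; transitivity (RtoC 0); last by case: n.
  rewrite /sconj /slin csumL_map.
  rewrite (csumL_ext _ (fun _ => 0 * 0)); first by rewrite csumL_scal; ring.
  move=> m Hm; have He : (m.2 <= -1)%Z := SX n m Hm.
  have -> : cint (fun t => zpow (RtoC 1 * unit_pt t) (mconj m).2 * A 1%R t) = 0; last by ring.
  have [g' Hp] := SD_pow 1 (Z.to_nat (- m.2)).
  have Hc := circ_const 0 1 _ _ ltac:(lra) (SD_mult _ _ _ _ _ Hp HG).
  transitivity (circ 1 (fun z => Cpow z (Z.to_nat (- m.2)) * G z)).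
    apply: cint_ext => t; rewrite /A [(mconj m).2]/= zpow_nonneg; last by lia.
    by ring.
  rewrite -Hc /circ (cint_ext _ (fun t => 0)) ?cint_const; first by ring.
  by move=> t; ring.
(* The negative modes: monomial by monomial, the contour moves from radius 1 to radius 1/2. *)
rewrite Cplus_0_r; apply: CS_ext => n; apply: csumL_ext => m Hm; congr (_ * _).
have [g' Hp] := SD_zpow (/ 2) 1 m.2 ltac:(lra).
have HG' : SD (annulus (/ 2) 1) G G' by apply: SD_sub HG => z [H1 H2]; split; lra.
have Hc := circ_const (/ 2) 1 _ _ ltac:(lra) (SD_mult _ _ _ _ _ Hp HG').
transitivity (circ 1 (fun z => zpow z m.2 * G z)); first by apply: cint_ext => t; rewrite /A; ring.
by rewrite -Hc; apply: cint_ext => t; rewrite /A; ring.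
Qed.

Lemma Cmult_minus_distr_l (a b c : C) : a * (b - c) = a * b - a * c.
Proof. by ring. Qed.

Lemma SD_csumL {A} (O : C -> Prop) (F F' : A -> C -> C) (l : list A) : (forall j, SD O (F j) (F' j)) ->
  SD O (fun z => csumL (fun j => F j z) l) (fun z => csumL (fun j => F' j z) l).
Proof. by move=> H; elim: l => [|j l IH]; [exact: SD_const|exact: (SD_plus _ (F j) (F' j))]. Qed.

(** Differentiation under the integral sign: the bounds on f hold with one constant for all t and
    are integrated, the affine argument contributing powers of |p|. *)
Lemma SD_cint (O O' : C -> Prop) f f' (p : C) (q a : R -> C) (K : R) : SD O f f' ->
  (forall t z, O' z -> O (p * z + q t)) -> ccont q -> ccont a -> (forall t, (Cmod (a t) <= K)%R) ->
  SD O' (fun z => cint (fun t => a t * f (p * z + q t))) (fun z => p * cint (fun t => a t * f' (p * z + q t))).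
Proof.
move=> HS HO Cq Ca HK; have [B [B0 [B1 B2]]] := HS.
set m := Cmod p; have m0 : (0 <= m)%R := Cmod_ge_0 p.
have K0 : (0 <= K)%R by apply: Rle_trans (HK 0%R); exact: Cmod_ge_0.
have TP := two_PI_pos.
have CF z : O' z -> ccont (fun t => a t * f (p * z + q t)) /\ ccont (fun t => a t * f' (p * z + q t)).
  move=> Hz; have [H1 H2] := SD_ccont O f f' (fun t => p * z + q t) HS (fun t => HO t z Hz)
    (ccont_plus _ _ (ccont_const _) Cq).
  by split; exact: ccont_mult.
have KB : (0 <= 2 * PI * (K * B))%R by apply: Rmult_le_pos; [lra|exact: Rmult_le_pos].
exists (2 * PI * (K * B) * (1 + m) ^ 2)%R.
have K1 : (1 <= (1 + m) ^ 2)%R by nra.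
have K2 : (m <= (1 + m) ^ 2)%R by nra.
have K3 : (m ^ 2 <= (1 + m) ^ 2)%R by nra.
have mono u v : (0 <= u)%R -> (v <= (1 + m) ^ 2)%R -> (2 * PI * (K * B) * v * u <= 2 * PI * (K * B) * (1 + m) ^ 2 * u)%R.
  by move=> Hu Hv; apply: Rmult_le_compat_r => //; apply: Rmult_le_compat_l.
split; first by apply: Rmult_le_pos => //; lra.
split=> [z Hz|z w Hz Hw].
  have [C1 C2] := CF z Hz.
  have E1 : (Cmod (cint (fun t => a t * f (p * z + q t))%C) <= 2 * PI * (K * B))%R.
    by apply: cint_bound => // t; apply: Cmod_mult_le => //; have [] := B1 _ (HO t z Hz).
  have E2 : (Cmod (cint (fun t => a t * f' (p * z + q t))%C) <= 2 * PI * (K * B))%R.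
    by apply: cint_bound => // t; apply: Cmod_mult_le => //; have [] := B1 _ (HO t z Hz).
  split; first by have := mono 1%R 1%R ltac:(lra) K1; lra.
  rewrite (Cmod_mult p) -/m; apply: Rle_trans (_ : m * (2 * PI * (K * B)) <= _)%R.
    exact: Rmult_le_compat_l.
  by have := mono 1%R m ltac:(lra) K2; lra.
have [C1 C2] := CF z Hz; have [C3 C4] := CF w Hw.
set h := Cmod (w - z); have h0 : (0 <= h)%R := Cmod_ge_0 _.
have Eh t : p * w + q t - (p * z + q t) = p * (w - z) by ring.
have D t := B2 _ _ (HO t z Hz) (HO t w Hw).
have hp : Cmod (p * (w - z)) = (m * h)%R by rewrite (Cmod_mult p).
split.
- rewrite -cint_minus //; apply: Rle_trans (_ : 2 * PI * (K * (B * (m * h))) <= _)%R; last first.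
    by have := mono h m h0 K2; lra.
  apply: cint_bound => [|t].
    by apply: ccont_ext (ccont_plus _ _ C3 (ccont_scal (- (1)) _ C1)) => t; ring.
  rewrite -Cmult_minus_distr_l; apply: Cmod_mult_le => //.
  by have [+ _ _] := D t; rewrite Eh hp.
- rewrite -Cmult_minus_distr_l -cint_minus // (Cmod_mult p) -/m.
  apply: Rle_trans (_ : m * (2 * PI * (K * (B * (m * h)))) <= _)%R; last first.
    by have := mono h (m ^ 2)%R h0 K3; lra.
  apply: Rmult_le_compat_l => //; apply: cint_bound => [|t].
    by apply: ccont_ext (ccont_plus _ _ C4 (ccont_scal (- (1)) _ C2)) => t; ring.
  rewrite -Cmult_minus_distr_l; apply: Cmod_mult_le => //.
  by have [_ + _] := D t; rewrite Eh hp.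
have E : ccont (fun t => a t * f (p * w + q t) - a t * f (p * z + q t)).
  by apply: ccont_ext (ccont_plus _ _ C3 (ccont_scal (- (1)) _ C1)) => t; ring.
rewrite Cmult_assoc -(cint_scal ((w - z) * p)) // -cint_minus // -cint_minus; [|exact: E|exact: ccont_scal].
apply: Rle_trans (_ : 2 * PI * (K * (B * (m * h) ^ 2)) <= _)%R; last first.
  by have := mono (h ^ 2)%R (m ^ 2)%R (pow2_ge_0 _) K3; nra.
apply: cint_bound => [|t].
  by apply: ccont_ext (ccont_plus _ _ E (ccont_scal (- ((w - z) * p)) _ C2)) => t; ring.
rewrite (_ : _ - _ = a t * (f (p * w + q t) - f (p * z + q t) - (p * (w - z)) * f' (p * z + q t))); last by ring.
apply: Cmod_mult_le => //.
by have [_ _ +] := D t; rewrite Eh hp.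
Qed.

(** * Derivatives of the cotangent, integration by parts and Cauchy's formula *)

(** Derivatives of cot of every order are polynomials in cot. Keeping them as syntax turns repeated
    differentiation into iteration of [cde], and one structural induction bounds them all. *)
Inductive cexp : Type := Ck of C | Ct | Ad of cexp & cexp | Ml of cexp & cexp.
Fixpoint cev (e : cexp) (w : C) : C :=
  match e with
  | Ck c => c
  | Ct => Ccot w
  | Ad e1 e2 => cev e1 w + cev e2 w
  | Ml e1 e2 => cev e1 w * cev e2 w
  end.
Fixpoint cde (e : cexp) : cexp :=
  match e with
  | Ck _ => Ck 0
  | Ct => Ml (Ck (- (1))) (Ad (Ck 1) (Ml Ct Ct))
  | Ad e1 e2 => Ad (cde e1) (cde e2)
  | Ml e1 e2 => Ad (Ml (cde e1) e2) (Ml e1 (cde e2))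
  end.

Lemma SD_cexp d e : (0 < d)%R -> SD (away d) (cev e) (cev (cde e)).
Proof.
move=> Hd; elim: e => [c||e1 H1 e2 H2|e1 H1 e2 H2] /=.
- exact: SD_const.
- by apply: SD_ext (SD_cot d Hd) => // w _ /=; ring.
- exact: SD_plus.
- exact: SD_mult.
Qed.

(** The antiderivative in tau, for exponents other than -1. *)
Definition mint (y : mono) : mono := (RtoC (/ IZR (y.2 + 1)) * y.1, (y.2 + 1)%Z).

Lemma inv_IZR_le1 (k : Z) : (Rabs (/ IZR k) <= 1)%R.
Proof.
case: (Z.eq_dec k 0) => [->|k0]; first by rewrite Rinv_0 Rabs_R0; lra.
rewrite Rabs_inv -Rinv_1; apply: Rinv_le_contravar; first lra.
by rewrite -abs_IZR; apply: IZR_le; lia.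
Qed.

Lemma bounded_mint : bounded_mono mint.
Proof.
exists (wt 1); split; first by have := wt_ge1 1; lra.
move=> y; rewrite /wn /mint /= Cmod_mult Cmod_R.
have H := wt_add y.2 1; have I := inv_IZR_le1 (y.2 + 1).
have W := wt_ge1 (y.2 + 1); have C0 := Cmod_ge_0 y.1; have Ip := Rabs_pos (/ IZR (y.2 + 1)).
apply: Rle_trans (_ : 1 * Cmod y.1 * (wt y.2 * wt 1) <= _)%R; last by apply: Req_le; ring.
apply: Rmult_le_compat => //; first by apply: Rmult_le_pos.
  lra.
exact: Rmult_le_compat_r.
Qed.

Lemma cder_zpow_hc e t : cder (fun t => zpow (hc t) e) t (IZR e * (Ci * zpow (hc t) e)).
Proof.
apply: (cder_ext (fun t => zpow (RtoC (/ 2)) e * unit_pt (IZR e * t))); first by move=> s; rewrite zpow_hc.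
rewrite zpow_hc; apply: cder_eq (cder_scal _ _ _ (IZR e * (Ci * unit_pt (IZR e * t))) _); first by ring.
by split; rewrite ?Re_mult ?Im_mult /=; auto_derive => //; ring.
Qed.

Lemma hc_period e : zpow (hc (2 * PI)) e = zpow (hc 0) e.
Proof. by rewrite /hc unit_pt_2PI. Qed.

Section ByParts.
Variables (r x : R) (X : ser) (O : C -> Prop) (g g' : C -> C) (p q : C).
Hypotheses (Hx : (Rabs x < r)%R) (HX : conv r X) (SX : supp ext_exp X) (HS : SD O g g').
Hypothesis HO : forall t, O (p * hc t + q).

Let W t := p * hc t + q.
Let CW : ccont W.
Proof. by apply: ccont_plus; [apply: ccont_scal; exact: ccont_hc|exact: ccont_const]. Qed.

(** Proved monomial by monomial: tau^(e+1) g(p tau + q) takes the same value at both ends of the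
    period. Exponents at most -2 keep e + 1 nonzero. *)
Lemma by_parts : cint (fun t => val (slin mint X) x (hc t) * (p * g' (W t) * (Ci * hc t)))
  = - cint (fun t => val X x (hc t) * (g (W t) * (Ci * hc t))).
Proof.
have r0 : (0 < r)%R by have := Rabs_pos x; lra.
have [B [B0 [B1 _]]] := HS.
have [Cg Cg'] := SD_ccont O g g' W HS HO CW.
have Ch := ccont_scal Ci _ ccont_hc.
have C1 : ccont (fun t => g (W t) * (Ci * hc t)) by exact: ccont_mult.
have C2 : ccont (fun t => p * g' (W t) * (Ci * hc t)) by apply: ccont_mult => //; exact: ccont_scal.
have hb t : (Cmod (Ci * hc t) <= 1)%R by rewrite Cmod_mult Cmod_Ci Cmod_hc; lra.
have K1 t : (Cmod (g (W t) * (Ci * hc t))%C <= B * 1)%R.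
  by apply: Cmod_mult_le => //; have [] := B1 _ (HO t).
have K2 t : (Cmod (p * g' (W t) * (Ci * hc t))%C <= Cmod p * B * 1)%R.
  apply: Cmod_mult_le => //; apply: Cmod_mult_le; first exact: Rle_refl.
  by have [] := B1 _ (HO t).
have S2 : (/ 4 <= / 2 <= 4)%R by lra.
have HX' : conv r (slin mint X) by apply: conv_slin => //; exact: bounded_mint.
rewrite (cint_val r x (/ 2)%R (slin mint X) _ _ Hx HX' S2 C2 K2).
rewrite (cint_val r x (/ 2)%R X _ _ Hx HX S2 C1 K1).
set cc := fun n => csumL _ (X n).
have As : asum cc x.
  have [b Hb] := HX; apply: (bsum_asum _ _ (2 * PI * (B * 1) * b)) => m.
  apply: Rle_trans (_ : rs m (fun n => 2 * PI * (B * 1) * (lnorm (X n) * r ^ n)) <= _)%R; last first.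
    rewrite rs_scal; apply: Rmult_le_compat_l; last exact: Hb.
    by have := two_PI_pos; nra.
  apply: rs_le => n _; rewrite -Rmult_assoc; apply: Rmult_le_compat.
  - exact: Cmod_ge_0.
  - by apply: pow_le; exact: Rabs_pos.
  - rewrite /cc /lnorm -rsumL_scal; apply: csumL_bound => y _.
    have Z t : (Cmod (zpow (RtoC (/ 2) * unit_pt t) y.2 * (g (W t) * (Ci * hc t)))%C <= wt y.2 * (B * 1))%R.
      by apply: Cmod_mult_le => //; apply: zpow_le_wt; exact: ann_hc.
    rewrite /wn (_ : 2 * PI * (B * 1) * (Cmod y.1 * wt y.2) = Cmod y.1 * (2 * PI * (wt y.2 * (B * 1))))%R; last by ring.
    apply: Cmod_mult_le; first exact: Rle_refl.
    by apply: cint_bound Z; apply: ccont_mult => //; apply: ccont_zpow_circle; lra.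
  by apply: pow_incr; split; [exact: Rabs_pos|lra].
rewrite (_ : - CS cc x = - (1) * CS cc x); last by ring.
rewrite -CS_scal //; apply: CS_ext => n; rewrite /cc /slin csumL_map -csumL_scal; apply: csumL_ext => y Hy.
have He : (y.2 <= -2)%Z := SX n y Hy.
rewrite -/hc /mint [fst _]/= [snd _]/=.
have e1 : IZR (y.2 + 1) <> 0%R by apply: not_0_IZR; lia.
(* The integrand is the angular derivative of tau^(e+1) g(p tau + q). *)
have I : cint (fun t => IZR (y.2 + 1) * (zpow (hc t) y.2 * (g (W t) * (Ci * hc t)))
   + zpow (hc t) (y.2 + 1) * (p * g' (W t) * (Ci * hc t))) = 0.
  rewrite (cint_derive (fun t => zpow (hc t) (y.2 + 1) * g (W t))).
  - by rewrite hc_period /W /hc unit_pt_2PI; ring.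
  - move=> t.
    have Dh : cder hc t (Ci * hc t) by exact: cder_circle.
    have DW : cder W t (p * (Ci * hc t)).
      by apply: cder_eq (cder_plus _ _ _ _ _ (cder_scal p _ _ _ Dh) (cder_const q t)); ring.
    have := cder_mult _ _ _ _ _ (cder_zpow_hc (y.2 + 1) t) (SD_cder O g g' W t _ HS HO DW).
    apply: cder_eq; rewrite (zpow_add (hc t) y.2 1); last exact: hc_neq0.
    by rewrite [zpow (hc t) 1]/= Cmult_1_r; ring.
  apply: ccont_plus; first by apply: ccont_scal; apply: ccont_mult => //; exact: ccont_zpow_hc.
  by apply: ccont_mult => //; exact: ccont_zpow_hc.
rewrite cint_plus in I; first last.
- by apply: ccont_mult => //; exact: ccont_zpow_hc.
- by apply: ccont_scal; apply: ccont_mult => //; exact: ccont_zpow_hc.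
rewrite cint_scal in I; last by apply: ccont_mult => //; exact: ccont_zpow_hc.
rewrite RtoC_inv //; have e1' := RtoC_neq0 _ e1.
set J1 := cint _ in I; set J2 := cint _ in I.
rewrite -/J1 -/J2 (_ : J2 = - (IZR (y.2 + 1) * J1)); first by field.
by apply: Cminus_eq0; rewrite -I; ring.
Qed.
End ByParts.

Lemma zpow_pred (z : C) e : z <> 0 -> z * zpow z (e - 1) = zpow z e.
Proof.
move=> z0; have := zpow_add z (e - 1) 1 z0; rewrite (_ : e - 1 + 1 = e)%Z; last by lia.
by rewrite [zpow z 1]/= => ->; ring.
Qed.

Lemma cint_zpow_hc e : cint (fun t => zpow (hc t) e * (Ci * hc t)) = if Z.eqb e (-1) then 2 * PI * Ci else 0.
Proof.
have -> : cint (fun t => zpow (hc t) e * (Ci * hc t)) = Ci * zpow (RtoC (/ 2)) (e + 1) * cint (fun t => unit_pt (IZR (e + 1) * t)).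
  rewrite -cint_scal.
    apply: cint_ext => t; rewrite -[RHS]Cmult_assoc -zpow_hc zpow_add; last exact: hc_neq0.
    by rewrite [zpow (hc t) 1]/=; ring.
  apply: (cder_ccont _ (fun t => IZR (e + 1) * (Ci * unit_pt (IZR (e + 1) * t)))) => t.
  by split; rewrite ?Re_mult ?Im_mult /=; auto_derive => //; ring.
rewrite cint_unit_int; case: Z.eqb_spec => E; case: Z.eqb_spec => E' //; try lia; last by ring.
by rewrite E; rewrite /=; ring.
Qed.

(** By descending recursion in e: z J(e-1) = J(e) minus the integral of w^(e-1), starting from J(0)
    = 0 because 1/(w - z) is regular for |w| <= 1/2. *)
Lemma cauchy_exterior e (z : C) : (e <= -1)%Z -> Cmod z = 1%R ->
  cint (fun t => zpow (hc t) e * (/ (hc t - z) * (Ci * hc t))) = - (2 * PI * Ci * zpow z e).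
Proof.
move=> He Hz; have z0 : z <> 0 by move=> E; move: Hz; rewrite E Cmod_0; lra.
have hz t : hc t - z <> 0.
  by move=> E; have := Cmod_hc t; rewrite (Cminus_eq0 _ _ E) Hz; lra.
have SI : SD (annulus 0 (/ 2)) (fun w => / (1 * w + - z)) (fun w => 1 * - (/ (1 * w + - z) * / (1 * w + - z))).
  apply: (SD_affine _ _ _ _ _ _ _ (SD_inv (/ 2) ltac:(lra))) => w [_ Hw].
  rewrite (_ : 1 * w + - z = w - z); last by ring.
  by rewrite Cmod_subC; have := Cmod_sub_ge z w; rewrite Hz; lra.
have Hh t : annulus 0 (/ 2) (hc t) by rewrite /annulus Cmod_hc; lra.
have CI : ccont (fun t => / (hc t - z)).
  by apply: ccont_ext (proj1 (SD_ccont _ _ _ hc SI Hh ccont_hc)) => t; congr Cinv; ring.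
have Ch := ccont_scal Ci _ ccont_hc.
have CJ e' : ccont (fun t => zpow (hc t) e' * (/ (hc t - z) * (Ci * hc t))).
  by apply: ccont_mult; [exact: ccont_zpow_hc|exact: ccont_mult].
have CZ e' : ccont (fun t => zpow (hc t) e' * (Ci * hc t)) by apply: ccont_mult; [exact: ccont_zpow_hc|].
pose J e' := cint (fun t => zpow (hc t) e' * (/ (hc t - z) * (Ci * hc t))).
have rec e' : z * J (e' - 1)%Z = J e' - (if Z.eqb e' 0 then 2 * PI * Ci else 0).
  have -> : (if Z.eqb e' 0 then 2 * PI * Ci else 0) = cint (fun t => zpow (hc t) (e' - 1) * (Ci * hc t)).
    by rewrite cint_zpow_hc; case: Z.eqb_spec => E1; case: Z.eqb_spec => E2 //; lia.
  rewrite /J -cint_scal // -cint_minus //; apply: cint_ext => t.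
  by rewrite -(zpow_pred (hc t) e'); [field|exact: hc_neq0].
have J0 : J 0%Z = 0.
  have := circ_const 0 (/ 2) _ _ ltac:(lra) SI; rewrite /circ => H.
  rewrite /J (cint_ext _ (fun t => / (1 * (RtoC (/ 2) * unit_pt t) + - z) * (Ci * (RtoC (/ 2) * unit_pt t)))).
    rewrite -H (cint_ext _ (fun=> 0)) ?cint_const; first by ring.
    by move=> t; ring.
  move=> t; rewrite -/(hc t) (_ : 1 * hc t + - z = hc t - z); last by ring.
  by rewrite [zpow _ 0]/=; ring.
have K n : J (- 1 - Z.of_nat n)%Z = - (2 * PI * Ci * zpow z (- 1 - Z.of_nat n)).
  have canc (u v : C) : z * u = z * v -> u = v.
    by move=> H; apply: Cminus_eq0; apply: (Cmult_eq0_r z) => //; rewrite Cmult_minus_distr_l H; ring.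
  elim: n => [|n IH].
    apply: canc; rewrite (_ : (- 1 - Z.of_nat 0 = 0 - 1)%Z) // rec J0 (_ : zpow z (0 - 1) = / z); last by rewrite /= Cmult_1_r.
    by rewrite Z.eqb_refl; field.
  apply: canc; rewrite (_ : - 1 - Z.of_nat (S n) = (- 1 - Z.of_nat n) - 1)%Z; last by lia.
  rewrite rec IH; case: Z.eqb_spec => E; first by lia.
  by rewrite -{1}(zpow_pred z (- 1 - Z.of_nat n)) //; ring.
by have := K (Z.to_nat (- 1 - e)); rewrite (_ : - 1 - Z.of_nat (Z.to_nat (- 1 - e)) = e)%Z //; lia.
Qed.

Lemma val_cauchy (r x : R) X (z : C) : (Rabs x < r)%R -> conv r X -> supp ext_exp X -> Cmod z = 1%R ->
  cint (fun t => val X x (hc t) * (/ (hc t - z) * (Ci * hc t))) = - (2 * PI * Ci * val X x z).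
Proof.
move=> Hx HX SX Hz.
have hz t : (/ 2 <= Cmod (hc t - z))%R by rewrite Cmod_subC; have := Cmod_sub_ge z (hc t); rewrite Hz Cmod_hc; lra.
have hz0 t : hc t - z <> 0 by move=> E; have := hz t; rewrite E Cmod_0; lra.
have SI := SD_affine _ (fun w => (/ 2 <= Cmod (1 * w + - z))%R) 1 (- z) _ _ (fun w H => H) (SD_inv (/ 2) ltac:(lra)).
have Eh t : 1 * hc t + - z = hc t - z by ring.
have Hh t : (/ 2 <= Cmod (1 * hc t + - z))%R by rewrite Eh.
have CI : ccont (fun t => / (hc t - z)).
  by apply: ccont_ext (proj1 (SD_ccont _ _ _ hc SI Hh ccont_hc)) => t; rewrite Eh.
have CA : ccont (fun t => / (hc t - z) * (Ci * hc t)) by apply: ccont_mult => //; exact: ccont_scal ccont_hc.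
have KA t : (Cmod (/ (hc t - z) * (Ci * hc t))%C <= 2 * 1)%R.
  apply: Cmod_mult_le; last by rewrite Cmod_mult Cmod_Ci Cmod_hc; lra.
  by rewrite Cmod_inv // -(Rinv_inv 2); apply: Rinv_le_contravar => //; lra.
rewrite [LHS](cint_val r x (/ 2)%R X _ _ Hx HX ltac:(lra) CA KA).
rewrite (_ : - (2 * PI * Ci * val X x z) = (- (2 * PI * Ci)) * val X x z); last by ring.
rewrite /val -CS_scal; last by apply: (conv_asum z X r) => //; [left; rewrite /ann Hz; lra|lra].
apply: CS_ext => n; rewrite /lev -csumL_scal; apply: csumL_ext => y Hy.
have He : (y.2 <= -2)%Z := SX n y Hy.
by rewrite -/hc cauchy_exterior //; [ring|lia].
Qed.

(** * From two-point bounds to holomorphy and Hoelder classes *)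

Lemma SD_is_derive O g g' z d : SD O g g' -> (0 < d)%R -> (forall y, (Cmod (y - z) < d)%R -> O y) ->
  is_derive (K := C_AbsRing) (V := C_NormedModule) g z (g' z).
Proof.
move=> [B [B0 [B1 B2]]] d0 HO; split; first exact: (is_linear_scal_l (K := C_AbsRing) (V := C_NormedModule) (g' z)).
move=> w /is_filter_lim_locally_unique <- eps.
have e0 : (0 < eps / (B + 1))%R by apply: Rdiv_lt_0_compat; [exact: cond_pos|lra].
exists (mkposreal _ (Rmin_pos _ _ d0 e0)) => y Hy.
have {Hy} Hy : (Cmod (y - z) < Rmin d (eps / (B + 1)))%R by exact: Hy.
have Hyd := Rlt_le_trans _ _ _ Hy (Rmin_l _ _); have Hye := Rlt_le_trans _ _ _ Hy (Rmin_r _ _).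
have z0 : O z by apply: HO; rewrite (_ : z - z = 0) ?Cmod_0 //; ring.
have [_ _ H] := B2 z y z0 (HO y Hyd).
change (Cmod (g y - g z - (y - z) * g' z) <= eps * Cmod (y - z))%R.
apply: Rle_trans H _; rewrite /= Rmult_1_r -Rmult_assoc; apply: Rmult_le_compat_r; first exact: Cmod_ge_0.
apply: Rle_trans (_ : (B + 1) * (eps / (B + 1)) <= _)%R; last by apply: Req_le; field; lra.
by apply: Rmult_le_compat; [|exact: Cmod_ge_0|lra|lra].
Qed.

Lemma locally_Cmod (z : C) (P : C -> Prop) :
  locally (T := C_UniformSpace) z P <-> exists d : R, (0 < d)%R /\ forall y, (Cmod (y - z) < d)%R -> P y.
Proof.
split=> [/locally_C [d Hd]|[d [d0 Hd]]].
  by exists d; split=> [|y Hy]; [exact: cond_pos|exact: Hd].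
by apply/locally_C; exists (mkposreal d d0) => y Hy; exact: Hd.
Qed.

Lemma SD_continuous_within (O A : C -> Prop) g g' : (forall z, A z -> O z) -> SD O g g' ->
  continuous_within A g /\ continuous_within A g'.
Proof.
move=> HA [B [B0 [B1 B2]]].
have K (f : C -> C) : (forall x y, O x -> O y -> (Cmod (f y - f x) <= B * Cmod (y - x))%R) -> continuous_within A f.
  move=> Hf z Az P /locally_Cmod [d [d0 Hd]]; apply/locally_Cmod.
  exists (d / (B + 1))%R; split=> [|y Hy Ay]; first by apply: Rdiv_lt_0_compat; lra.
  apply: Hd; apply: Rle_lt_trans (Hf _ _ (HA _ Az) (HA _ Ay)) _.
  rewrite (_ : d = (B + 1) * (d / (B + 1)))%R; last by field; lra.
  move: (d / (B + 1))%R Hy (Cmod_ge_0 (y - z)) => e; move: (Cmod _) => h *; nra.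
by split; apply: K => x y Hx Hy; have [] := B2 x y Hx Hy.
Qed.

Lemma Cclosure_sub (D O : C -> Prop) : (forall z, D z -> O z) ->
  (forall z, (forall eps : posreal, exists y, O y /\ (Cmod (y - z) < eps)%R) -> O z) ->
  forall z, Cclosure D z -> O z.
Proof.
by move=> H1 H2 z Hz; apply: H2 => eps; have [y [Dy Hy]] := Hz eps; exists y; split=> //; exact: H1.
Qed.

(** A bounded Lipschitz function is Hoelder: at distance at most 1 one has |x - y| <= |x - y|^a, and
    beyond that the supremum bound is enough. *)
Lemma holder_of_SD (D O : C -> Prop) (l : nat) (a : R) (G : nat -> C -> C) :
  (0 < a < 1)%R -> (forall z, Cclosure D z -> O z) ->
  (forall z, D z -> exists d : R, (0 < d)%R /\ forall y, (Cmod (y - z) < d)%R -> O y) ->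
  (forall j, SD O (G j) (G (S j))) -> holder_holomorphic D l a (G 0%nat).
Proof.
move=> Ha HC HD HS; exists G; split=> //; split.
  by move=> j _ z Dz; have [d [d0 Hd]] := HD z Dz; exact: SD_is_derive (HS j) d0 Hd.
split; first by move=> j _; exact: (proj1 (SD_continuous_within O (Cclosure D) _ _ HC (HS j))).
split.
  have E j : exists b, forall z, O z -> (Cmod (G j z) <= b)%R.
    by have [B [_ [B1 _]]] := HS j; exists B => z /B1 [].
  have [b Hb] : exists b, forall j z, (j <= l)%nat -> O z -> (Cmod (G j z) <= b)%R.
    elim: l => [|m [b Hb]].
      by have [b Hb] := E 0%nat; exists b => j z Hj; rewrite (_ : j = 0%nat); [exact: Hb|lia].
    have [b' Hb'] := E (S m); exists (Rmax b b') => j z Hj Oz.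
    case: (Nat.eq_dec j (S m)) => [->|n]; first by apply: Rle_trans (Hb' z Oz) (Rmax_r _ _).
    by apply: Rle_trans (Hb j z ltac:(lia) Oz) (Rmax_l _ _).
  by exists b => j z Hj /HC; exact: Hb.
have [B [B0 [B1 B2]]] := HS l; exists (2 * B)%R => x y /HC Ox /HC Oy nxy.
have h0 : (0 < Cmod (x - y))%R by apply/Cmod_gt_0 => E; apply: nxy; exact: Cminus_eq0.
have [H1 _ _] := B2 y x Oy Ox.
have H2 : (Cmod (G l x - G l y) <= 2 * B)%R.
  by apply: Rle_trans (Cmod_sub_le _ _) _; have [] := B1 x Ox; have [] := B1 y Oy; lra.
case: (Rle_lt_dec 1 (Cmod (x - y))) => Hh.
  apply: Rle_trans H2 _; rewrite -{1}(Rmult_1_r (2 * B)); apply: Rmult_le_compat_l; first lra.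
  rewrite -(Rpower_O (Cmod (x - y))) //; apply: Rle_Rpower; lra.
apply: Rle_trans H1 _; apply: Rmult_le_compat; [lra|lra|lra|].
rewrite -{1}(Rpower_1 (Cmod (x - y))) // /Rpower; apply: Rnot_lt_le => /exp_lt_inv.
have L : (ln (Cmod (x - y)) <= 0)%R by rewrite -ln_1; apply: ln_le; lra.
nra.
Qed.

(** * The hollow vortex flow built from a solution of the boundary equations *)

Section Hollow.
Variables (M : nat) (L : params M) (x r : R).
Implicit Types (k j : 'I_M) (n : Z) (X : 'I_M -> ser).
Hypotheses (Hx : (Rabs x < r)%R) (xnz : x <> 0%R) (Tp : (0 < period L)%R).
Hypothesis xs : (Rabs x * (128 * PI) <= period L)%R.
Local Notation T := (period L).
Local Notation K := (kap L).

Lemma kap_pos : (0 < K)%R.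
Proof. by apply: Rdiv_lt_0_compat => //; exact: PI_RGT_0. Qed.
Lemma kap_T : (K * T = PI)%R.
Proof. by rewrite /kap; field; lra. Qed.
Lemma x_pos : (0 < Rabs x)%R.
Proof. exact: Rabs_pos_lt. Qed.
Lemma kap_x : (K * Rabs x <= 1 / 128)%R.
Proof.
rewrite (_ : K * Rabs x = Rabs x * (128 * PI) / 128 * / T)%R; last by rewrite /kap; field; lra.
apply: (Rmult_le_reg_r T) => //; rewrite Rmult_assoc Rinv_l; lra.
Qed.

Definition pole k n : C := center L k + RtoC (IZR n * T).
(** A set containing the closure of the conformal domain, on which all estimates are made; closures
    enter only through [Om_closure]. *)
Definition Om (z : C) : Prop := forall k n, (Rabs x <= Cmod (z - pole k n))%R.

Lemma Om_domain z : conf_domain L x z -> Om z.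
Proof. by move=> H k n; have := H k n; rewrite /closed_disk -/(pole k n); lra. Qed.

Lemma Om_closure z : Cclosure (conf_domain L x) z -> Om z.
Proof.
apply: (Cclosure_sub _ _ Om_domain) => {}z H k n; apply: Rnot_lt_le => Hlt.
have e0 : (0 < Rabs x - Cmod (z - pole k n))%R by lra.
have [y [Oy Hy]] := H (mkposreal _ e0); have := Oy k n; rewrite /= in Hy.
have := Cmod_triangle (y - z) (z - pole k n).
rewrite (_ : y - z + (z - pole k n) = y - pole k n); last by ring.
lra.
Qed.

Lemma angle_pole (s z : C) k n : K * (x * s + center L k - z) - RtoC (IZR n * PI) = K * (x * s - (z - pole k (- n))).
Proof.
rewrite /pole opp_IZR -kap_T; rewrite !RtoC_mult RtoC_opp; ring.
Qed.

Lemma away_kap (d : R) (s z : C) k : (forall n, (d <= Cmod (x * s - (z - pole k n)))%R) ->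
  away (K * d) (K * (x * s + center L k - z)).
Proof.
move=> H n; rewrite angle_pole (Cmod_mult K) Cmod_R Rabs_pos_eq; last by have := kap_pos; lra.
by apply: Rmult_le_compat_l => //; have := kap_pos; lra.
Qed.

Lemma away_Om z k t : Om z -> away (K * (Rabs x / 2)) (- K * z + K * (x * hc t + center L k)).
Proof.
move=> Hz; rewrite (_ : _ + _ = K * (x * hc t + center L k - z)); last by ring.
apply: away_kap => n; have := Hz k n; rewrite (Cmod_subC (x * hc t)); have := Cmod_sub_ge (z - pole k n) (x * hc t).
rewrite (Cmod_mult x) Cmod_R Cmod_hc; lra.
Qed.

(* In the open domain the poles keep a positive distance from the closed disks:
   only the nearest translate of a center matters, the others being far away. *)
Lemma margin z k : conf_domain L x z -> exists d : R, (0 < d)%R /\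
  forall n, (Rabs x + d <= Cmod (z - pole k n))%R.
Proof.
move=> H; have kp := kap_pos; have xp := x_pos; have Pp := PI_RGT_0.
have [n0 Hn0] := nearest_PI (K * Re (z - center L k)).
have D n : (K * Rabs (Re (z - pole k n)) = Rabs (K * Re (z - center L k) - IZR n * PI))%R.
  rewrite -{1}(Rabs_pos_eq K); last lra.
  by rewrite -Rabs_mult; congr Rabs; rewrite /pole -kap_T /=; ring.
have far n : n <> n0 -> (2 * Rabs x <= Cmod (z - pole k n))%R.
  move=> nn; apply: Rle_trans (re_le_Cmod _).
  apply: (Rmult_le_reg_l K) => //; rewrite D.
  have A : (1 <= Rabs (IZR (n - n0)))%R by rewrite -abs_IZR; apply: IZR_le; lia.
  have B := Rabs_triang_inv (IZR (n - n0) * PI) (K * Re (z - center L k) - IZR n0 * PI).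
  have E : (IZR (n - n0) * PI - (K * Re (z - center L k) - IZR n0 * PI) = - (K * Re (z - center L k) - IZR n * PI))%R.
    by rewrite minus_IZR; ring.
  rewrite E Rabs_Ropp Rabs_mult (Rabs_pos_eq PI) in B; last lra.
  have C : (1 * PI <= Rabs (IZR (n - n0)) * PI)%R by apply: Rmult_le_compat_r; lra.
  by have := kap_x; have := PI_4; have := PI2_1; rewrite /PI2; lra.
have h0 : (Rabs x < Cmod (z - pole k n0))%R by have := H k n0; rewrite /closed_disk -/(pole k n0); lra.
exists (Rmin (Cmod (z - pole k n0) - Rabs x) (Rabs x)); split; first by apply: Rmin_pos; lra.
move=> n; case: (Z.eq_dec n n0) => [->|/far Hn].
  by have := Rmin_l (Cmod (z - pole k n0) - Rabs x) (Rabs x); lra.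
by have := Rmin_r (Cmod (z - pole k n0) - Rabs x) (Rabs x); lra.
Qed.

Lemma open_domain z : conf_domain L x z -> exists d : R, (0 < d)%R /\ forall y, (Cmod (y - z) < d)%R -> Om y.
Proof.
(* The bound is the reciprocal of the margin, so that enlarging it weakens the property, as
   [common_bound] requires. *)
move=> H; pose P k b := (0 < b)%R /\ forall n, (Rabs x + / b <= Cmod (z - pole k n))%R.
have [||b [b0 Hb]] := common_bound (idx M) P.
- move=> k b b' [b0 Hb] le; split=> [|n]; first lra.
  by apply: Rle_trans (Hb n); apply: Rplus_le_compat_l; apply: Rinv_le_contravar.
- move=> k; have [d [d0 Hd]] := margin z k H; exists (/ d)%R; split; first exact: Rinv_0_lt_compat.
  by move=> n; rewrite Rinv_inv.
exists (/ (b + 1))%R; split=> [|y Hy k n]; first by apply: Rinv_0_lt_compat; lra.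
have [b1 Hn] := Hb k (In_idx M k); have {}Hn := Hn n.
have : (/ (b + 1) <= / b)%R by apply: Rinv_le_contravar; lra.
have := Cmod_sub_ge (z - pole k n) (z - y).
rewrite (_ : z - pole k n - (z - y) = y - pole k n); last by ring.
rewrite (Cmod_subC z y); lra.
Qed.


(** The negative part of the density. The factor rho compensates the 1/rho that arises when a
    derivative in zeta is turned into one in tau. *)
Definition muS X k : ser := ssh (slin mint (X k)).

(** The layer potential over the inner contour, with cot replaced by an expression in cot. A
    derivative in z multiplies by -pi/T and differentiates the expression, so the whole jet has this
    form. *)
Definition Phi X (e : cexp) (z : C) : C :=
  csumL (fun k => / (2 * Ci * T) * cint (fun t => val (muS X k) x (hc t) * (x * (Ci * hc t))
     * cev e (- K * z + K * (x * hc t + center L k)))) (idx M).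

Definition jet X (j : nat) (z : C) : C := Cpow (- K) j * Phi X (Nat.iter j cde Ct) z.

Definition dens X k (t : R) : R := (2 * Re (val (muS X k) x (unit_pt t)))%R.

Lemma r_pos' : (0 < r)%R. Proof. by have := Rabs_pos x; lra. Qed.

Lemma Kx_pos : (0 < K * (Rabs x / 2))%R.
Proof. by apply: Rmult_lt_0_compat; [exact: kap_pos|have := x_pos; lra]. Qed.

Lemma conv_muS X k : conv r (X k) -> conv r (muS X k).
Proof.
by move=> H; apply: conv_ssh; [exact: r_pos'|apply: conv_slin => //; [exact: r_pos'|exact: bounded_mint]].
Qed.

Lemma supp_muS X k : supp ext_exp (X k) -> supp (fun e => e <= -1)%Z (muS X k).
Proof. by move=> H; apply: supp_ssh; apply: supp_slin H => y; rewrite /ext_exp /=; lia. Qed.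

Section Potential.
Variable X : 'I_M -> ser.
Hypotheses (CX : forall k, conv r (X k)) (SX : forall k, supp ext_exp (X k)).

Lemma val_hc_bound W : conv r W -> exists b, forall t, (Cmod (val W x (hc t)) <= b)%R.
Proof.
by move=> H; have [b [_ Hb]] := val_uniform r W r_pos' H; exists b => t; apply: Hb; [lra|left; exact: ann_hc].
Qed.

Lemma cone : ccont (fun t => x * (Ci * hc t)) /\ forall t, (Cmod (x * (Ci * hc t))%C <= Rabs x * 1)%R.
Proof.
split; first by do 2 apply: ccont_scal; exact: ccont_hc.
move=> t; apply: Cmod_mult_le; first by rewrite Cmod_R; lra.
by rewrite Cmod_mult Cmod_Ci Cmod_hc; lra.
Qed.

Lemma ccont_muS k : ccont (fun t => val (muS X k) x (hc t) * (x * (Ci * hc t))).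
Proof.
have [C1 C2] := cone.
exact: (ccont_val r x (/ 2)%R (muS X k) _ _ Hx (conv_muS _ _ (CX k)) ltac:(lra) C1 C2).
Qed.

Lemma SD_Phi e : SD Om (Phi X e) (fun z => - K * Phi X (cde e) z).
Proof.
have H k : SD Om (fun z => / (2 * Ci * T) * cint (fun t => val (muS X k) x (hc t) * (x * (Ci * hc t))
     * cev e (- K * z + K * (x * hc t + center L k))))
   (fun z => / (2 * Ci * T) * (- K * cint (fun t => val (muS X k) x (hc t) * (x * (Ci * hc t))
     * cev (cde e) (- K * z + K * (x * hc t + center L k))))).
  apply: SD_scal; have [b Hb] := val_hc_bound _ (conv_muS _ _ (CX k)); have [_ C2] := cone.
  apply: (SD_cint _ _ _ _ _ _ _ (b * (Rabs x * 1))%R (SD_cexp _ e Kx_pos)).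
  - by move=> t z; exact: away_Om.
  - apply: ccont_scal; apply: ccont_plus; last exact: ccont_const.
    by apply: ccont_scal; exact: ccont_hc.
  - exact: ccont_muS.
  by move=> t; exact: Cmod_mult_le.
apply: SD_ext (SD_csumL _ _ _ (idx M) H) => // z _.
by rewrite /Phi -csumL_scal; apply: csumL_ext => k _; ring.
Qed.

Lemma SD_jet p : SD Om (jet X p) (jet X (S p)).
Proof. by apply: SD_ext (SD_scal _ (Cpow (- K) p) _ _ (SD_Phi (Nat.iter p cde Ct))) => // z _; rewrite /jet /=; ring. Qed.

Lemma jet0 z : jet X 0 z = Phi X Ct z. Proof. by rewrite /jet /=; ring. Qed.

Lemma holder_Phi (l : nat) (a : R) (c : C) : (0 < a < 1)%R ->
  holder_holomorphic (conf_domain L x) l a (fun z => c * Phi X Ct z).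
Proof.
move=> Ha; have H := holder_of_SD (conf_domain L x) Om l a (fun p z => c * jet X p z) Ha Om_closure open_domain
  (fun p => SD_scal _ c _ _ (SD_jet p)).
by move: H; congr (holder_holomorphic _ _ _ _); apply: functional_extensionality => z; rewrite jet0.
Qed.

Lemma cot_period (w : C) : Ccot (w - RtoC PI) = Ccot w.
Proof.
have s0 : Csin (RtoC PI) = 0 by have := Csin_PI 1; rewrite Rmult_1_l.
have c1 : Ccos (RtoC PI) = - (1).
  by rewrite Ccos_comp (_ : Re (RtoC PI) = PI) // (_ : Im (RtoC PI) = 0%R) // cos_PI sin_PI cosh_0 sinh_0; apply: Ceq; rewrite /=; ring.
rewrite /Ccot; have -> : w - RtoC PI = w + - RtoC PI by [].
rewrite Csin_add Ccos_add Csin_opp Ccos_opp s0 c1.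
(* At a pole both sides are 0, the inverse of 0 being 0; periodicity thus holds at every point. *)
case: (excluded_middle_informative (Csin w = 0)) => [E|n]; last by field.
have i0 : / RtoC 0 = 0 by apply: Ceq; rewrite /= /Rdiv; ring.
by rewrite E (_ : 0 * - (1) + Ccos w * - (0) = 0); [rewrite /Cdiv i0; ring|ring].
Qed.

Lemma cev_period e w : cev e (w - RtoC PI) = cev e w.
Proof. by elim: e => //= [|e1 -> e2 -> //|e1 -> e2 -> //]; exact: cot_period. Qed.

Lemma Phi_period e z : Phi X e (z + T) = Phi X e z.
Proof.
apply: csumL_ext => k _; congr (_ * _); apply: cint_ext => t; congr (_ * _).
rewrite -[RHS]cev_period -kap_T RtoC_mult; congr cev; ring.
Qed.

(** Integration by parts moves the derivative from the kernel to the density, where it undoes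
    [mint]; the factor x left over is that of [muS]. *)
Lemma jet1 z : Om z -> jet X 1 z = x * csumL (fun k => / (2 * PI * Ci) *
   cint (fun t => K * Ccot (K * (x * hc t + center L k - z)) * val (X k) x (hc t) * (Ci * hc t))) (idx M).
Proof.
move=> Hz; rewrite /jet /Phi [Cpow _ _]/= -!csumL_scal; apply: csumL_ext => k _.
have P0 := CPI_neq0; have i0 := Ci_neq0.
have T0 : RtoC T <> 0 by apply: RtoC_neq0; lra.
have EK : RtoC K = PI / T by rewrite /kap RtoC_div //; lra.
have arg t : K * x * hc t + K * (center L k - z) = - K * z + K * (x * hc t + center L k) by ring.
have HO t : away (K * (Rabs x / 2)) (K * x * hc t + K * (center L k - z)).
  by rewrite arg; exact: away_Om.
have H := by_parts r x (X k) _ _ _ (K * x) (K * (center L k - z)) Hx (CX k) (SX k) (SD_cexp _ Ct Kx_pos) HO.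
have [CW1 CW2] := SD_ccont _ _ _ (fun t => K * x * hc t + K * (center L k - z)) (SD_cexp _ Ct Kx_pos) HO
   (ccont_plus _ _ (ccont_scal _ _ ccont_hc) (ccont_const _)).
have Vs t : val (muS X k) x (hc t) = x * val (slin mint (X k)) x (hc t).
  have [_ _ //] : hv r x (hc t) (muS X k) (x * val (slin mint (X k)) x (hc t)).
  apply: (hv_sh r x _ Hx); apply: hv_self; last by left; exact: ann_hc.
  by apply: conv_slin => //; [exact: r_pos'|exact: bounded_mint].
have [b0 [B0 [B1 _]]] := SD_cexp _ Ct Kx_pos.
have Ch := ccont_scal Ci _ ccont_hc.
have CV W (A : R -> C) (b : R) : conv r W -> ccont A -> (forall t, (Cmod (A t) <= b)%R) -> ccont (fun t => val W x (hc t) * A t).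
  by move=> H1 H2 H3; exact: (ccont_val r x (/ 2)%R W A b Hx H1 ltac:(lra) H2 H3).
have CI : conv r (slin mint (X k)) by apply: conv_slin => //; [exact: r_pos'|exact: bounded_mint].
have hb t : (Cmod (Ci * hc t) <= 1)%R by rewrite Cmod_mult Cmod_Ci Cmod_hc; lra.
have C1 : ccont (fun t => val (slin mint (X k)) x (hc t) * (K * x * cev (cde Ct) (K * x * hc t + K * (center L k - z)) * (Ci * hc t))).
  apply: (CV _ _ (Cmod (K * x) * b0 * 1)%R CI); first by apply: ccont_mult => //; exact: ccont_scal.
  move=> t; apply: Cmod_mult_le => //; apply: Cmod_mult_le; first exact: Rle_refl.
  by have [] := B1 _ (HO t).
have C2 : ccont (fun t => val (X k) x (hc t) * (cev Ct (K * x * hc t + K * (center L k - z)) * (Ci * hc t))).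
  apply: (CV _ _ (b0 * 1)%R (CX k)); first by apply: ccont_mult.
  by move=> t; apply: Cmod_mult_le => //; have [] := B1 _ (HO t).
transitivity (/ (2 * Ci * T) * x * - cint (fun t => val (slin mint (X k)) x (hc t) * (K * x * cev (cde Ct) (K * x * hc t + K * (center L k - z)) * (Ci * hc t)))).
  transitivity (/ (2 * Ci * T) * cint (fun t => - x * (val (slin mint (X k)) x (hc t) * (K * x * cev (cde Ct) (K * x * hc t + K * (center L k - z)) * (Ci * hc t))))); last first.
    by rewrite (cint_scal (- x)) //; ring.
  rewrite Cmult_1_r Cmult_assoc (Cmult_comm (- K)) -Cmult_assoc; congr (_ * _).
  rewrite -cint_scal; first by apply: cint_ext => t; rewrite Vs arg (_ : Nat.iter 1 cde Ct = cde Ct) //; ring.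
  apply: (ccont_ext (fun t => / K * (val (slin mint (X k)) x (hc t) * (K * x * cev (cde Ct) (K * x * hc t + K * (center L k - z)) * (Ci * hc t)) * x))).
    by move=> t; rewrite Vs arg (_ : Nat.iter 1 cde Ct = cde Ct) //; field; apply: RtoC_neq0; have := kap_pos; lra.
  by apply: ccont_scal; apply: ccont_mult => //; exact: ccont_const.
rewrite H.
transitivity (x * (/ (2 * PI * Ci) * cint (fun t => K * (val (X k) x (hc t) * (cev Ct (K * x * hc t + K * (center L k - z)) * (Ci * hc t)))))).
  by rewrite (cint_scal K) // EK; field.
do 2 congr (_ * _); apply: cint_ext => t; rewrite arg [cev Ct _]/= (_ : - K * z + K * (x * hc t + center L k) = K * (x * hc t + center L k - z)); ring.
Qed.
End Potential.


(** For a point of the open domain the kernel is regular on the whole closed unit disk in tau, by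
    [margin], so [density_int] replaces the unit circle by the inner one. *)
Lemma layer_Phi X z : (forall k, conv r (X k)) -> (forall k, supp ext_exp (X k)) -> conf_domain L x z ->
  layer L x (dens X) z = Phi X Ct z.
Proof.
move=> CX SX Hz; rewrite /layer big_csumL; apply: csumL_ext => k _; congr (_ * _).
have P0 := CPI_neq0; have T0 : RtoC T <> 0 by apply: RtoC_neq0; lra.
have EK : RtoC K = PI / T by rewrite /kap RtoC_div //; lra.
have [d [d0 Hd]] := margin z k Hz; have kp := kap_pos.
have HO s : annulus 0 1 s -> away (K * d) (K * x * s + K * (center L k - z)).
  move=> [_ Hs]; rewrite (_ : K * x * s + _ = K * (x * s + center L k - z)); last by ring.
  apply: away_kap => n; have := Hd n; rewrite (Cmod_subC (x * s)).
  have := Cmod_sub_ge (z - pole k n) (x * s); rewrite (Cmod_mult x) Cmod_R.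
  by have := x_pos; have := Cmod_ge_0 s; move: (Cmod s) Hs => u; nra.
have Kd : (0 < K * d)%R by exact: Rmult_lt_0_compat.
have SG := SD_scal _ x _ _ (SD_affine _ _ _ _ _ _ HO (SD_cot _ Kd)).
have [D1' D2'] := density_int r x (muS X k) _ _ Hx (conv_muS _ _ (CX k)) (supp_muS _ _ (SX k)) SG.
transitivity (cint (fun t => RtoC (dens X k t) * (x * Ccot (K * x * unit_pt t + K * (center L k - z)) * (Ci * unit_pt t)))).
  rewrite -cint_RInt //; apply: (RInt_ext (V := C_R_CompleteNormedModule)) => t _; rewrite EK.
  rewrite (_ : PI / T * (x * unit_pt t + center L k - z) = PI / T * x * unit_pt t + PI / T * (center L k - z)); last by ring.
  by match goal with |- @eq _ ?a ?b => change (@eq C a b) end; ring.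
rewrite D2'; apply: cint_ext => t /=.
rewrite (_ : - K * z + K * (x * hc t + center L k) = K * x * hc t + K * (center L k - z)); ring.
Qed.

Hypothesis sep : forall ze k j, (Cmod ze <= 4)%R -> k <> j -> Csin (K * (center L k - center L j + 2 * x * ze)) <> 0.

(** A pole of another vortex within 8 |rho| of the center would be reached as 2 rho ze with |ze| <=
    4, and there the sine in [sep] vanishes. *)
Lemma sep_dist k j n : k <> j -> (8 * Rabs x < Cmod (center L k - pole j n))%R.
Proof.
move=> kj; apply: Rnot_le_lt => H; have x0 := RtoC_neq0 _ xnz; have xp := x_pos.
have hz : (Cmod (- (center L k - pole j n) / (2 * x)) <= 4)%R.
  have n2 : 2 * x <> 0 by apply: Cmult_neq_0 => //; exact: C2_neq0.
  rewrite Cmod_div // Cmod_opp (Cmod_mult 2) !Cmod_R (Rabs_pos_eq 2); last lra.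
  apply: (Rmult_le_reg_r (2 * Rabs x)); first lra.
  rewrite /Rdiv Rmult_assoc Rinv_l; lra.
apply: (sep _ k j hz kj).
rewrite (_ : _ - _ + _ = RtoC (IZR n * T)); last by rewrite /pole; field.
by rewrite -RtoC_mult (_ : K * (IZR n * T) = IZR n * PI)%R ?Csin_PI //; rewrite -kap_T; ring.
Qed.

Lemma own_dist k n : n <> 0%Z -> (100 * Rabs x <= Cmod (center L k - pole k n))%R.
Proof.
move=> n0; rewrite (_ : center L k - pole k n = RtoC (- (IZR n * T))); last by rewrite /pole RtoC_opp; ring.
rewrite Cmod_R Rabs_Ropp Rabs_mult (Rabs_pos_eq T); last lra.
have A : (1 <= Rabs (IZR n))%R by rewrite -abs_IZR; apply: IZR_le; lia.
have P1 : (1 <= PI)%R by have := PI2_1; rewrite /PI2; lra.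
have xp := x_pos.
apply: Rle_trans (_ : 1 * T <= _)%R; last by apply: Rmult_le_compat_r; lra.
nra.
Qed.

Lemma pole_shift k n m z : z - pole k (n + m) = z - RtoC (IZR n * T) - pole k m.
Proof. rewrite /pole plus_IZR Rmult_plus_distr_r RtoC_plus; ring. Qed.

Lemma disks_disjoint : disjoint_disks L x.
Proof.
move=> k n k' n' z H1 H2; rewrite /closed_disk -/(pole k n) -/(pole k' n') in H1 H2.
have D : (Cmod (center L k - pole k' (n' - n)) <= 2 * Rabs x)%R.
  rewrite (_ : center L k - pole k' (n' - n) = (z - pole k' n') - (z - pole k n)); last first.
    by rewrite /pole minus_IZR Rmult_minus_distr_r RtoC_minus; ring.
  by apply: Rle_trans (Cmod_sub_le _ _) _; lra.
have xp := x_pos.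
case: (eqVneq k k') => [E|/eqP ne]; last by have := sep_dist k k' (n' - n) ne; lra.
split=> //; subst k'; case: (Z.eq_dec (n' - n) 0) => [|ne]; first by lia.
by have := own_dist k _ ne; lra.
Qed.

Lemma Om_boundary k (s : C) : Cmod s = 1%R -> Om (center L k + x * s).
Proof.
move=> Hs j n; have xp := x_pos; have xs1 : Cmod (x * s) = Rabs x by rewrite (Cmod_mult x) Cmod_R Hs Rmult_1_r.
have far : (8 * Rabs x < Cmod (center L k - pole j n))%R -> (Rabs x <= Cmod (center L k + x * s - pole j n))%R.
  move=> H; have := Cmod_sub_ge (center L k - pole j n) (- (x * s)); rewrite Cmod_opp xs1.
  rewrite (_ : _ - - (x * s) = center L k + x * s - pole j n); last by ring.
  lra.
case: (eqVneq k j) => [E|/eqP ne]; last by exact (far (sep_dist k j n ne)).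
subst j.
case: (Z.eq_dec n 0) => [->|ne]; last by refine (far _); have := own_dist k n ne; lra.
rewrite (_ : _ - _ = x * s) ?xs1; first by exact: Rle_refl.
by rewrite /pole Rmult_0_l; ring.
Qed.

(** On the own circle the kernel is its pole 1/(rho (w - s)) plus [Kern]. The pole contributes
    -X_k(s)/rho by the exterior Cauchy formula; all other terms form [potl]. *)
Lemma jet1_boundary X k (s : C) : (forall j, conv r (X j)) -> (forall j, supp ext_exp (X j)) -> Cmod s = 1%R ->
  jet X 1 (center L k + x * s) = x * potl L x X k s - val (X k) x s.
Proof.
move=> CX SX Hs; have x0 := RtoC_neq0 _ xnz; have P0 := CPI_neq0; have i0 := Ci_neq0.
have HOm := Om_boundary k s Hs; rewrite (jet1 X CX SX _ HOm).
have hs t : hc t - s <> 0.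
  by move=> E; have := Cmod_hc t; rewrite (Cminus_eq0 _ _ E) Hs; lra.
have arg j t : - K * (center L k + x * s) + K * (x * hc t + center L j) = K * (x * hc t + center L j - (center L k + x * s)) by ring.
have Ch := ccont_scal Ci _ ccont_hc.
have CC j : ccont (fun t => K * Ccot (K * (x * hc t + center L j - (center L k + x * s))) * val (X j) x (hc t) * (Ci * hc t)).
  have [Cw _] := SD_ccont _ _ _ (fun t => - K * (center L k + x * s) + K * (x * hc t + center L j)) (SD_cot _ Kx_pos)
    (fun t => away_Om _ j t HOm) (ccont_plus _ _ (ccont_const _) (ccont_scal _ _ (ccont_plus _ _ (ccont_scal _ _ ccont_hc) (ccont_const _)))).
  have [b [b0 [B1 _]]] := SD_cot _ Kx_pos.
  apply: (ccont_ext (fun t => K * (val (X j) x (hc t) * (Ccot (- K * (center L k + x * s) + K * (x * hc t + center L j)) * (Ci * hc t))))).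
    by move=> t; rewrite arg; ring.
  apply: ccont_scal; apply: (ccont_val r x (/ 2)%R (X j) _ (b * 1)%R Hx (CX j) ltac:(lra)); first by apply: ccont_mult.
  move=> t; apply: Cmod_mult_le; first by have [] := B1 _ (away_Om _ j t HOm).
  by rewrite Cmod_mult Cmod_Ci Cmod_hc; lra.
have VC := val_cauchy r x (X k) s Hx (CX k) (SX k) Hs.
have CV : ccont (fun t => val (X k) x (hc t) * (/ (hc t - s) * (Ci * hc t))).
  have hz t : (/ 2 <= Cmod (1 * hc t + - s))%R.
    rewrite (_ : 1 * hc t + - s = hc t - s); last by ring.
    by rewrite Cmod_subC; have := Cmod_sub_ge s (hc t); rewrite Hs Cmod_hc; lra.
  have SI := SD_affine _ (fun w => (/ 2 <= Cmod (1 * w + - s))%R) 1 (- s) _ _ (fun w H => H) (SD_inv (/ 2) ltac:(lra)).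
  have [b [b0 [B1 _]]] := SI.
  have [CI _] := SD_ccont _ _ _ hc SI hz ccont_hc.
  apply: (ccont_ext (fun t => val (X k) x (hc t) * (/ (1 * hc t + - s) * (Ci * hc t)))).
    by move=> t; congr (_ * (/ _ * _)); ring.
  apply: (ccont_val r x (/ 2)%R (X k) _ (b * 1)%R Hx (CX k) ltac:(lra)); first by apply: ccont_mult.
  by move=> t; apply: Cmod_mult_le; [have [] := B1 _ (hz t)|rewrite Cmod_mult Cmod_Ci Cmod_hc; lra].
have E : csumL (fun j => / (2 * PI * Ci) * cint (fun t => K * Ccot (K * (x * hc t + center L j - (center L k + x * s))) * val (X j) x (hc t) * (Ci * hc t))) (idx M)
  = potl L x X k s + csumL (fun j => if j == k then / x * - val (X k) x s else RtoC 0) (idx M).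
  rewrite /potl -csumL_scal -csumL_add; apply: csumL_ext => j _; rewrite /Kern.
  case: eqP => [->|ne].
    transitivity (/ (2 * PI * Ci) * (cint (fun t => K * Ccot (K * (x * hc t + center L k - (center L k + x * s))) * val (X k) x (hc t) * (Ci * hc t))
       - / x * cint (fun t => val (X k) x (hc t) * (/ (hc t - s) * (Ci * hc t)))) + / x * - val (X k) x s).
      by rewrite VC; field.
    congr (_ * _ + _); rewrite -cint_scal // -cint_minus //; last exact: ccont_scal.
    apply: cint_ext => t; rewrite (_ : x * hc t + center L k - (center L k + x * s) = x * (hc t - s)); last by ring.
    by field; split.
  rewrite Cplus_0_r; congr (_ * _); apply: cint_ext => t; congr (_ * Ccot (_ * _) * _ * _); ring.
rewrite E -(big_csumL M (fun j => j == k)) big_pred1_eq; field.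
exact: x0.
Qed.


Definition w0' (z : C) : C := csumL (fun j => Defs.circ L j / (2 * PI * Ci) * (K * Ccot (K * (z - center L j)))) (idx M).

Lemma away_center z j : Om z -> away (K * Rabs x) (K * z + - (K * center L j)).
Proof.
move=> Hz n; have H := Hz j n; have kp := kap_pos.
rewrite (_ : K * z + - (K * center L j) - RtoC (IZR n * PI) = K * (z - pole j n)); last first.
  by rewrite /pole -kap_T (RtoC_mult (IZR n)) (RtoC_mult K) (RtoC_mult (IZR n)); ring.
by rewrite (Cmod_mult K) Cmod_R (Rabs_pos_eq K); [apply: Rmult_le_compat_l; lra|lra].
Qed.

Lemma SD_w0' : exists g', SD Om w0' g'.
Proof.
have Kp : (0 < K * Rabs x)%R by apply: Rmult_lt_0_compat; [exact: kap_pos|exact: x_pos].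
have H j := SD_scal Om (Defs.circ L j / (2 * PI * Ci)) _ _ (SD_scal Om K _ _
  (SD_affine (away (K * Rabs x)) Om K (- (K * center L j)) _ _ (fun z => away_center z j) (SD_cot _ Kp))).
eexists; apply: SD_ext (SD_csumL _ _ _ (idx M) H) => // z _.
by apply: csumL_ext => j _; congr (_ * (_ * Ccot _)); ring.
Qed.

Lemma w0_boundary k (s : C) : s <> 0 -> w0' (center L k + x * s) = Defs.circ L k / (2 * PI * Ci) * / (x * s)
  + csumL (fun j => Defs.circ L j / (2 * PI * Ci) * Kern L k j (x * s)) (idx M).
Proof.
move=> s0; have x0 := RtoC_neq0 _ xnz.
transitivity (csumL (fun j => if j == k then Defs.circ L k / (2 * PI * Ci) * / (x * s) else RtoC 0) (idx M)
   + csumL (fun j => Defs.circ L j / (2 * PI * Ci) * Kern L k j (x * s)) (idx M)); last first.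
  by rewrite -(big_csumL M (fun j => j == k)) big_pred1_eq.
rewrite /w0' -csumL_add; apply: csumL_ext => j _; rewrite /Kern eq_sym.
case: eqP => [->|ne].
  by rewrite (_ : center L j + x * s - center L j = x * s); ring.
by rewrite (_ : center L k + x * s - center L j = center L k - center L j + x * s); ring.
Qed.

(** The integral does not depend on the radius, and at small radius s it differs from that of 1/z by
    O(s), since cot y - 1/y is bounded. *)
Lemma circ_cot : circ (Rabs x) (fun z => K * Ccot (K * z)) = 2 * PI * Ci.
Proof.
have kp := kap_pos; have xp := x_pos; have kx := kap_x; have Pp : (2 < PI)%R by have := PI2_1; rewrite /PI2; lra.
have aw s z : (0 < s <= Rabs x)%R -> annulus s (Rabs x) z -> away (K * s) (K * z + 0).
  move=> Hs [z1 z2] n; have Ez : Cmod (K * z + 0) = (K * Cmod z)%R.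
    by rewrite Cplus_0_r (Cmod_mult K) Cmod_R Rabs_pos_eq; lra.
  case: (Z.eq_dec n 0) => [->|ne].
    rewrite (_ : K * z + 0 - RtoC (0 * PI) = K * z + 0) ?Ez; last by rewrite Rmult_0_l; ring.
    by apply: Rmult_le_compat_l; lra.
  have A : (1 <= Rabs (IZR n))%R by rewrite -abs_IZR; apply: IZR_le; lia.
  have := Cmod_sub_ge (RtoC (IZR n * PI)) (K * z + 0); rewrite Ez Cmod_subC Cmod_R Rabs_mult (Rabs_pos_eq PI); last lra.
  have : (1 * PI <= Rabs (IZR n) * PI)%R by apply: Rmult_le_compat_r; lra.
  have : (K * Cmod z <= K * Rabs x)%R by apply: Rmult_le_compat_l; lra.
  have : (K * s <= K * Rabs x)%R by apply: Rmult_le_compat_l; lra.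
  lra.
have near s : (0 < s <= Rabs x)%R -> (Cmod (circ (Rabs x) (fun z => K * Ccot (K * z)) - 2 * PI * Ci)%C <= 2 * PI * (K * 10) * s)%R.
  move=> Hs; have Ks : (0 < K * s)%R by apply: Rmult_lt_0_compat; lra.
  have SK := SD_scal _ K _ _ (SD_affine _ (annulus s (Rabs x)) K 0 _ _ (fun z => aw s z Hs) (SD_cot _ Ks)).
  have E : circ s (fun z => K * Ccot (K * z)) = circ (Rabs x) (fun z => K * Ccot (K * z)).
    have := circ_const s (Rabs x) _ _ ltac:(lra) SK; rewrite /circ => H.
    transitivity (cint (fun t => K * Ccot (K * (s * unit_pt t) + 0) * (Ci * (s * unit_pt t)))).
      by apply: cint_ext => t; rewrite Cplus_0_r.
    by rewrite H; apply: cint_ext => t; rewrite Cplus_0_r.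
  have Hz t : annulus s (Rabs x) (s * unit_pt t) by rewrite /annulus Cmod_circle; lra.
  have [Cg _] := SD_ccont _ _ _ (fun t => s * unit_pt t) SK Hz (ccont_circle s).
  have C1 : ccont (fun t => K * Ccot (K * (s * unit_pt t)) * (Ci * (s * unit_pt t))).
    apply: ccont_mult; last by apply: ccont_scal; exact: ccont_circle.
    by apply: ccont_ext Cg => t; rewrite Cplus_0_r.
  rewrite -E /circ -(cint_const Ci) -cint_minus //; last exact: ccont_const.
  rewrite (_ : 2 * PI * (K * 10) * s = 2 * PI * (K * 10 * s))%R; last by ring.
  have z0 t : s * unit_pt t <> 0 by move=> E0; have [H _] := Hz t; move: H; rewrite E0 Cmod_0; lra.
  have K0 : RtoC K <> 0 by apply: RtoC_neq0; lra.
  apply: cint_bound => [|t].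
    by apply: ccont_ext (ccont_plus _ _ C1 (ccont_const (- Ci))) => t; ring.
  set z := s * unit_pt t; have zn : z <> 0 := z0 t.
  rewrite (_ : _ - _ = K * (Ccot (K * z) - / (K * z)) * (Ci * z)); last by field; split.
  apply: Cmod_mult_le; last by rewrite Cmod_mult Cmod_Ci Cmod_circle; lra.
  apply: Cmod_mult_le; first by rewrite Cmod_R Rabs_pos_eq; lra.
  have [||_ [_ H]] := cot_sub_inv (K * z) => //; first exact: Cmult_neq_0.
  rewrite (Cmod_mult K) Cmod_R Cmod_circle ?Rabs_pos_eq; try lra.
  by apply: Rle_trans (_ : K * Rabs x <= _)%R; [apply: Rmult_le_compat_l; lra|lra].
apply: Cminus_eq0; apply: Cmod_eq_0; apply: Rle_antisym; last exact: Cmod_ge_0.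
apply: Rnot_lt_le => H; set c := (2 * PI * (K * 10))%R in near; have c0 : (0 < c)%R by rewrite /c; apply: Rmult_lt_0_compat; lra.
set m := Cmod _ in H near; have q0 : (0 < m / (2 * c))%R by apply: Rdiv_lt_0_compat; lra.
have Hs : (0 < Rmin (Rabs x) (m / (2 * c)) <= Rabs x)%R by split; [exact: Rmin_pos|exact: Rmin_l].
have := near _ Hs; have := Rmin_r (Rabs x) (m / (2 * c)) => A.
have : (c * Rmin (Rabs x) (m / (2 * c)) <= c * (m / (2 * c)))%R by apply: Rmult_le_compat_l; lra.
rewrite (_ : c * (m / (2 * c)) = m / 2)%R; last by field; lra.
lra.
Qed.

(** For negative rho the point rho tau runs over the same circle, starting from the opposite
    side. *)
Lemma on_circle k t : exists s, [/\ Cmod s = 1%R, RtoC (Rabs x) * unit_pt t = x * s & center L k + Rabs x * unit_pt t = center L k + x * s].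
Proof.
have x0 := RtoC_neq0 _ xnz; exists (Rabs x / x * unit_pt t)%C.
have E : RtoC (Rabs x) * unit_pt t = x * (Rabs x / x * unit_pt t) by field.
split=> //; last by rewrite E.
rewrite (Cmod_mult (_ / _)) Cmod_unit Cmod_div // !Cmod_R Rabs_Rabsolu; field.
by have := x_pos; lra.
Qed.

(** The layer part of w' is the derivative of a function that is single-valued on the circle; the
    own cotangent gives gamma_k, and those of the other vortices are regular inside the disk. *)
Lemma circulation X k : (forall j, conv r (X j)) -> (forall j, supp ext_exp (X j)) ->
  is_RInt (V := C_R_NormedModule) (fun t => (w0' (center L k + Rabs x * unit_pt t) + x * jet X 1 (center L k + Rabs x * unit_pt t))
    * (Rabs x * Ci * unit_pt t)) 0%R (2 * PI)%R (RtoC (Defs.circ L k)).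
Proof.
move=> CX SX; have x0 := RtoC_neq0 _ xnz; have P0 := CPI_neq0; have i0 := Ci_neq0; have xp := x_pos; have kp := kap_pos.
have HO t : Om (center L k + Rabs x * unit_pt t).
  by have [s [Hs _ ->]] := on_circle k t; exact: Om_boundary.
have Cz : ccont (fun t => center L k + Rabs x * unit_pt t) by apply: ccont_plus; [exact: ccont_const|exact: ccont_circle].
have Cu : ccont (fun t => Ci * (Rabs x * unit_pt t)) by apply: ccont_scal; exact: ccont_circle.
have [CJ0 CJ1] := SD_ccont _ _ _ _ (SD_jet X CX 0) HO Cz.
have J0 : cint (fun t => jet X 1 (center L k + Rabs x * unit_pt t) * (Ci * (Rabs x * unit_pt t))) = 0.
  rewrite (cint_derive (fun t => jet X 0 (center L k + Rabs x * unit_pt t))).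
  - by rewrite unit_pt_2PI; ring.
  - move=> t; apply: (SD_cder _ _ _ (fun t => center L k + Rabs x * unit_pt t) t _ (SD_jet X CX 0) HO).
    by apply: cder_eq (cder_plus _ _ _ _ _ (cder_const _ t) (cder_circle (Rabs x) t)); ring.
  exact: ccont_mult.
pose A j t := Defs.circ L j / (2 * PI * Ci) * (K * Ccot (K * (center L k - center L j + Rabs x * unit_pt t)) * (Ci * (Rabs x * unit_pt t))).
have CA j : ccont (A j).
  have Kp : (0 < K * Rabs x)%R by exact: Rmult_lt_0_compat.
  have [Cc _] := SD_ccont _ _ _ (fun t => K * (center L k + Rabs x * unit_pt t) + - (K * center L j)) (SD_cot _ Kp)
    (fun t => away_center _ j (HO t)) (ccont_plus _ _ (ccont_scal _ _ Cz) (ccont_const _)).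
  apply: ccont_scal; apply: ccont_mult => //; apply: ccont_scal; apply: ccont_ext Cc => t; congr Ccot; ring.
have IA j : cint (A j) = if j == k then RtoC (Defs.circ L k) else RtoC 0.
  rewrite /A cint_scal; last first.
    have Kp : (0 < K * Rabs x)%R by exact: Rmult_lt_0_compat.
    have [Cc _] := SD_ccont _ _ _ (fun t => K * (center L k + Rabs x * unit_pt t) + - (K * center L j)) (SD_cot _ Kp)
      (fun t => away_center _ j (HO t)) (ccont_plus _ _ (ccont_scal _ _ Cz) (ccont_const _)).
    apply: ccont_mult => //; apply: ccont_scal; apply: ccont_ext Cc => t; congr Ccot; ring.
  case: eqP => [->|ne].
    rewrite (cint_ext _ (fun t => K * Ccot (K * (Rabs x * unit_pt t)) * (Ci * (Rabs x * unit_pt t)))).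
      by rewrite -/(circ (Rabs x) (fun z => K * Ccot (K * z))) circ_cot; field.
    by move=> t; congr (_ * Ccot (_ * _) * _); ring.
  have aw z : annulus 0 (Rabs x) z -> away (K * (7 * Rabs x)) (K * z + K * (center L k - center L j)).
    move=> [_ Hz] n; have kj : k <> j by move=> E; apply: ne.
    have := sep_dist k j n kj; have := Cmod_sub_ge (center L k - pole j n) (- z); rewrite Cmod_opp => H1 H2.
    rewrite (_ : _ - RtoC (IZR n * PI) = K * (center L k - pole j n - - z)); last first.
      by rewrite /pole -kap_T (RtoC_mult (IZR n)) (RtoC_mult K) (RtoC_mult (IZR n)); ring.
    by rewrite (Cmod_mult K) Cmod_R (Rabs_pos_eq K); [apply: Rmult_le_compat_l; lra|lra].
  have Kp : (0 < K * (7 * Rabs x))%R by apply: Rmult_lt_0_compat; lra.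
  have := circ_const 0 (Rabs x) _ _ ltac:(lra) (SD_scal _ K _ _ (SD_affine _ _ _ _ _ _ aw (SD_cot _ Kp))).
  rewrite /circ => H; rewrite (cint_ext _ (fun t => K * Ccot (K * (Rabs x * unit_pt t) + K * (center L k - center L j)) * (Ci * (Rabs x * unit_pt t)))); last first.
    by move=> t; congr (_ * Ccot _ * _); ring.
  rewrite -H (cint_ext _ (fun t => 0)) ?cint_const; first by ring.
  by move=> t; ring.
have CS0 := proj1 (cint_csumL A (idx M) CA).
have E t : csumL (fun j => A j t) (idx M) + x * (jet X 1 (center L k + Rabs x * unit_pt t) * (Ci * (Rabs x * unit_pt t)))
  = (w0' (center L k + Rabs x * unit_pt t) + x * jet X 1 (center L k + Rabs x * unit_pt t)) * (Rabs x * Ci * unit_pt t).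
  have -> : csumL (fun j => A j t) (idx M) = w0' (center L k + Rabs x * unit_pt t) * (Ci * (Rabs x * unit_pt t)).
    rewrite Cmult_comm /w0' -csumL_scal; apply: csumL_ext => j _; rewrite /A.
    rewrite (_ : center L k + Rabs x * unit_pt t - center L j = center L k - center L j + Rabs x * unit_pt t); ring.
  ring.
have CJ : ccont (fun t => x * (jet X 1 (center L k + Rabs x * unit_pt t) * (Ci * (Rabs x * unit_pt t)))).
  by apply: ccont_scal; exact: ccont_mult.
have -> : RtoC (Defs.circ L k) = cint (fun t => csumL (fun j => A j t) (idx M) + x * (jet X 1 (center L k + Rabs x * unit_pt t) * (Ci * (Rabs x * unit_pt t)))).
  rewrite cint_plus // cint_scal ?J0; last exact: ccont_mult.
  rewrite (proj2 (cint_csumL A (idx M) CA)) (csumL_ext _ (fun j => if j == k then RtoC (Defs.circ L k) else RtoC 0)) //.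
  by rewrite -(big_csumL M (fun j => j == k)) big_pred1_eq; ring.
apply: (is_RInt_ext (V := C_R_NormedModule) _ _ _ _ _ (fun t _ => E t)); apply: is_cint.
exact: ccont_plus.
Qed.


Lemma Im_scal_Ci (a : R) (u : C) : Im (RtoC a * (Ci * u)) = (a * Re u)%R.
Proof. by case: u => p q; rewrite /Re /Im /=; ring. Qed.

(** The modulus of exp(s_j) fixes Re s_j, and with real circulations the imaginary part of the value
    involves these real parts only: it does not depend on the branches. *)
Lemma pv_value z v : (forall j, Csin (K * (z - center L j)) <> 0) -> pv_potential L z v ->
  Im v = rsumL (fun j => - (Defs.circ L j / (2 * PI)) * ln (Cmod (Csin (K * (z - center L j)))))%R (idx M).
Proof.
move=> S0 [s [Hs ->]]; rewrite big_csumL.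
have EK : RtoC (PI / T) = RtoC K by [].
have P0 := PI_neq0; have P0' := CPI_neq0; have i0 := Ci_neq0.
elim: (idx M) => [|j l IH]; first by [].
rewrite /csumL /rsumL [fold_right _ _ (j :: l)]/= -/(csumL _ l) -/(rsumL _ l) Im_plus IH; congr (_ + _)%R.
have E : Re (s j) = ln (Cmod (Csin (K * (z - center L j)))).
  have := f_equal Cmod (Hs j); rewrite Cmod_Cexp (_ : PI / T * (z - center L j) = K * (z - center L j)).
    by move=> <-; rewrite ln_exp.
  by rewrite -EK RtoC_div //; lra.
rewrite -E (_ : Defs.circ L j / (2 * PI * Ci) * s j = RtoC (- (Defs.circ L j / (2 * PI))) * (Ci * s j)).
  exact: Im_scal_Ci.
rewrite RtoC_opp RtoC_div; last lra.
rewrite (RtoC_mult 2); transitivity (- (Ci * Ci) * (Defs.circ L j / (2 * PI * Ci) * s j)); first by rewrite Ci_sqr; ring.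
by field.
Qed.

Lemma sin_Om z j : Om z -> Csin (K * (z - center L j)) <> 0.
Proof.
move=> Hz; have Kp : (0 < K * Rabs x)%R by apply: Rmult_lt_0_compat; [exact: kap_pos|exact: x_pos].
have := away_Csin _ _ Kp (away_center z j Hz).
by congr (Csin _ <> 0); ring.
Qed.

Lemma Cmod_conj_sqr (u : C) : u * Cconj u = RtoC (Cmod u ^ 2).
Proof. by rewrite Cmod_sqr; case: u => p q; apply: Ceq; rewrite /Cconj /Re /Im /=; ring. Qed.

Section Boundary.
Variables (mm nn : 'I_M -> ser) (q : 'I_M -> R).
Hypotheses (Cm : forall k, conv r (mm k)) (Sm : forall k, supp ext_exp (mm k)).
Hypotheses (Cn : forall k, conv r (nn k)) (Sn : forall k, supp ext_exp (nn k)).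
Hypothesis bdry_eq : forall k z, Cmod z = 1%R ->
  let P := bdry L x mm nn k z in
  let F := 1 - x * x * (val (mm k) x z - x * potl L x mm k z) in
  Cconj P = P /\ P * P = RtoC (Defs.circ L k ^ 2 / (4 * PI ^ 2) + x * (x * q k)) * F * Cconj F.

Definition fmap z := z + x * x * Phi mm Ct z.
Definition fmap' z := 1 + x * x * jet mm 1 z.
Definition hmap z := x * Phi nn Ct z.
Definition hmap' z := x * jet nn 1 z.
Definition wmap' z := w0' z + hmap' z.

Lemma bdry_alt k s : Cmod s = 1%R -> bdry L x mm nn k s
  = Ci * (x * s) * (wmap' (center L k + x * s) - speed L * fmap' (center L k + x * s)).
Proof.
move=> Hs; have s0 : s <> 0 by move=> E; move: Hs; rewrite E Cmod_0; lra.
have x0 := RtoC_neq0 _ xnz; have P0 := CPI_neq0; have i0 := Ci_neq0.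
rewrite /wmap' /hmap' /fmap' w0_boundary // !jet1_boundary // /bdry.
by field.
Qed.

Lemma F_alt k s : Cmod s = 1%R -> 1 - x * x * (val (mm k) x s - x * potl L x mm k s) = fmap' (center L k + x * s).
Proof. by move=> Hs; rewrite /fmap' jet1_boundary //; ring. Qed.

Lemma disk_point k z : disk_boundary L x k z -> exists s, Cmod s = 1%R /\ z = center L k + x * s.
Proof.
move=> H; have x0 := RtoC_neq0 _ xnz; exists ((z - center L k) / x); split; last by field.
by rewrite Cmod_div // Cmod_R H; field; have := x_pos; lra.
Qed.

(** By [pv_value] the imaginary part is an ordinary function along the circle; its angular
    derivative is Im P, which is zero. *)
Lemma kinematic k : exists m : R, forall z, disk_boundary L x k z ->
  forall v, mfun_shift (pv_potential L) hmap z v -> Im (v - speed L * fmap z) = m.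
Proof.
pose U z := (rsumL (fun j => - (Defs.circ L j / (2 * PI)) * ln (Cmod (Csin (K * (z - center L j))))) (idx M)
   + Im (hmap z - speed L * fmap z))%R.
exists (U (center L k + x * unit_pt 0)) => z /disk_point [s [Hs Ez]] v [v0 [Hv ->]].
have Oz : Om z by rewrite Ez; exact: Om_boundary.
have HvI := pv_value z v0 (fun j => sin_Om z j Oz) Hv.
rewrite (_ : v0 + hmap z - speed L * fmap z = v0 + (hmap z - speed L * fmap z)); last by ring.
rewrite Im_plus HvI -/(U z) Ez; have [t ->] := unit_pt_onto s Hs.
apply: (rder0_const (fun t => U (center L k + x * unit_pt t))) => {s Hs Ez z Oz v v0 Hv HvI t} t.
have HO u : Om (center L k + x * unit_pt u) by apply: Om_boundary; exact: Cmod_unit.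
have Dz : cder (fun u => center L k + x * unit_pt u) t (x * (Ci * unit_pt t)).
  by apply: cder_eq (cder_plus _ _ _ _ _ (cder_const _ t) (cder_scal x _ _ _ (cder_unit t))); ring.
set z := center L k + x * unit_pt t; set z' := x * (Ci * unit_pt t) in Dz.
have Df : cder (fun u => fmap (center L k + x * unit_pt u)) t (fmap' z * z').
  have D0 := SD_cder _ _ _ _ t _ (SD_jet mm Cm 0) HO Dz.
  apply: (cder_ext (fun u => (center L k + x * unit_pt u) + x * x * jet mm 0 (center L k + x * unit_pt u))).
    by move=> u; rewrite /fmap jet0.
  by apply: cder_eq (cder_plus _ _ _ _ _ Dz (cder_scal (x * x) _ _ _ D0)); rewrite /fmap' /z /z'; cbv beta; ring.
have Dh : cder (fun u => hmap (center L k + x * unit_pt u)) t (hmap' z * z').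
  have D0 := SD_cder _ _ _ _ t _ (SD_jet nn Cn 0) HO Dz.
  apply: (cder_ext (fun u => x * jet nn 0 (center L k + x * unit_pt u))); first by move=> u; rewrite /hmap jet0.
  by apply: cder_eq (cder_scal x _ _ _ D0); rewrite /hmap' /z /z'; cbv beta; ring.
have [_ DI] := cder_minus _ _ _ _ _ Dh (cder_scal (speed L) _ _ _ Df).
have Dl : is_derive (fun u => rsumL (fun j => - (Defs.circ L j / (2 * PI)) * ln (Cmod (Csin (K * (center L k + x * unit_pt u - center L j)))))%R (idx M)) t
   (Im (w0' z * z')).
  rewrite /w0'; have P0 := PI_neq0; have P0' := CPI_neq0; have i0 := Ci_neq0.
  elim: (idx M) => [|j l IH].
    by apply: is_derive_eq (is_derive_const 0%R t); rewrite [csumL _ _]/= Cmult_0_l.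
  have Dj := is_derive_ln_Cmod (fun u => Csin (K * (center L k + x * unit_pt u - center L j))) t _ (sin_Om z j (HO t))
     (cder_Csin _ _ _ (cder_scal K _ _ _ (cder_minus _ _ _ _ _ Dz (cder_const (center L j) t)))).
  apply: is_derive_eq (is_derive_Rplus _ _ _ _ _ (is_derive_scal _ t (- (Defs.circ L j / (2 * PI)))%R _ Dj) IH).
  rewrite [csumL _ (j :: l)]/= -/(csumL _ l) Cmult_plus_distr_r Im_plus; congr (_ + _)%R.
  transitivity (Im (RtoC (- (Defs.circ L j / (2 * PI))) * (Ci * (K * (z' - 0) * Ccos (K * (z - center L j)) / Csin (K * (z - center L j)))))).
    by rewrite Im_scal_Ci.
  congr Im.
  rewrite RtoC_opp RtoC_div; last lra.
  rewrite (RtoC_mult 2) /Ccot; have s0 := sin_Om z j (HO t).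
  transitivity (- (Ci * Ci) * (Defs.circ L j / (2 * PI * Ci) * (K * (Ccos (K * (z - center L j)) / Csin (K * (z - center L j)))) * z')).
    by field; split.
  by rewrite Ci_sqr; ring.
apply: is_derive_eq (is_derive_Rplus _ _ _ _ _ Dl DI).
have [HP _] := bdry_eq k (unit_pt t) (Cmod_unit t).
rewrite bdry_alt -/z in HP; last exact: Cmod_unit.
have HI : Im (Ci * (x * unit_pt t) * (wmap' z - speed L * fmap' z)) = 0%R.
  by have := f_equal Im HP; move: (Ci * _ * _) => u; rewrite /Cconj /=; rewrite /Im; lra.
rewrite -Im_plus -HI; congr Im; rewrite /wmap' /z'; ring.
Qed.

(** For real P the square is |P|^2, so the boundary equation reads rho^2 |w' - c f'|^2 = E |f'|^2
    with the constant E, and the modulus sought is sqrt E / |rho|. *)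
Lemma bernoulli_modulus k : (forall z, Om z -> fmap' z <> 0) ->
  exists p : R, (x ^ 2 * p ^ 2 = Defs.circ L k ^ 2 / (4 * PI ^ 2) + x * (x * q k))%R
   /\ forall z, disk_boundary L x k z -> Cmod (wmap' z / fmap' z - speed L) = p.
Proof.
move=> f0; set E := (_ / _ + _)%R; have xp := x_pos.
have key s : Cmod s = 1%R -> (Rabs x ^ 2 * Cmod (wmap' (center L k + x * s)%C - speed L * fmap' (center L k + x * s)%C) ^ 2
     = E * Cmod (fmap' (center L k + x * s)%C) ^ 2)%R.
  move=> Hs; have [H1 H2] := bdry_eq k s Hs; rewrite F_alt // in H2; rewrite -/E in H2.
  have H3 : bdry L x mm nn k s * bdry L x mm nn k s = RtoC (Cmod (bdry L x mm nn k s) ^ 2).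
    by rewrite -Cmod_conj_sqr H1.
  rewrite H3 -Cmult_assoc Cmod_conj_sqr -RtoC_mult in H2.
  have := f_equal Re H2; rewrite [Re (RtoC _)]/= [Re (RtoC _)]/= bdry_alt //.
  rewrite (Cmod_mult (Ci * _)) (Cmod_mult Ci) (Cmod_mult x) Cmod_Ci Cmod_R Hs => <-; ring.
(* The sign of E is read off at one boundary point, where f' is nonzero. *)
have E0 : (0 <= E)%R.
  have z0 := key (unit_pt 0) (Cmod_unit 0); have n0 := f0 _ (Om_boundary k (unit_pt 0) (Cmod_unit 0)).
  have p0 : (0 < Cmod (fmap' (center L k + x * unit_pt 0)%C) ^ 2)%R by apply: pow_lt; apply/Cmod_gt_0.
  apply: Rnot_lt_le => H; have : (0 <= Rabs x ^ 2 * Cmod (wmap' (center L k + x * unit_pt 0)%C - speed L * fmap' (center L k + x * unit_pt 0)%C) ^ 2)%R.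
    by apply: Rmult_le_pos; exact: pow2_ge_0.
  rewrite z0; nra.
exists (sqrt E / Rabs x)%R; split.
  rewrite -(pow2_abs x) (_ : Rabs x ^ 2 * (sqrt E / Rabs x) ^ 2 = sqrt E * sqrt E)%R; last by field; lra.
  exact: sqrt_sqrt.
move=> z /disk_point [s [Hs ->]]; have := key s Hs; have n0 := f0 _ (Om_boundary k s Hs).
move: (wmap' _) (fmap' _) n0 => a b b0 Hab.
have bp : (0 < Cmod b)%R by apply/Cmod_gt_0.
have -> : a / b - speed L = (a - speed L * b) / b by field.
rewrite Cmod_div //; apply: (Rmult_eq_reg_r (Rabs x * Cmod b)); last by apply: Rgt_not_eq; exact: Rmult_lt_0_compat.
rewrite (_ : Cmod (a - speed L * b) / Cmod b * (Rabs x * Cmod b) = Rabs x * Cmod (a - speed L * b))%R; last by field; lra.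
rewrite (_ : sqrt E / Rabs x * (Rabs x * Cmod b) = sqrt E * Cmod b)%R; last by field; lra.
apply: Rsqr_inj.
- by apply: Rmult_le_pos; [lra|exact: Cmod_ge_0].
- by apply: Rmult_le_pos; [exact: sqrt_pos|lra].
rewrite !Rsqr_mult Rsqr_sqrt // !Rsqr_pow2; exact: Hab.
Qed.
End Boundary.


Lemma jet1_cint X k z : (forall j, conv r (X j)) -> Om z -> forall b a : R, (forall t, (Cmod (val (muS X k) x (hc t)) <= b)%R) ->
  (forall t, (Cmod (cev (cde Ct) (- K * z + K * (x * hc t + center L k))) <= a)%R) ->
  (Cmod (/ (2 * Ci * T) * cint (fun t => val (muS X k) x (hc t) * (x * (Ci * hc t))
     * cev (cde Ct) (- K * z + K * (x * hc t + center L k))))%C <= K * (b * Rabs x * a))%R.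
Proof.
move=> CX Hz b a Hb Ha; have [_ C2] := cone.
have Cc := proj1 (SD_ccont _ _ _ (fun t => - K * z + K * (x * hc t + center L k)) (SD_cexp _ (cde Ct) Kx_pos)
  (fun t => away_Om z k t Hz) (ccont_plus _ _ (ccont_const _) (ccont_scal _ _ (ccont_plus _ _ (ccont_scal _ _ ccont_hc) (ccont_const _))))).
have n2 : 2 * Ci * T <> 0.
  by apply: Cmult_neq_0; [apply: Cmult_neq_0; [exact: C2_neq0|exact: Ci_neq0]|apply: RtoC_neq0; lra].
have e2 : Cmod (2 * Ci * T) = (2 * T)%R.
  by rewrite (Cmod_mult (2 * Ci)) (Cmod_mult 2) Cmod_Ci !Cmod_R !Rabs_pos_eq; lra.
rewrite (Cmod_mult (/ _)) Cmod_inv // e2.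
apply: Rle_trans (_ : / (2 * T) * (2 * PI * (b * Rabs x * a)) <= _)%R; last first.
  by apply: Req_le; rewrite /kap; field; lra.
apply: Rmult_le_compat_l; first by apply: Rlt_le; apply: Rinv_0_lt_compat; lra.
apply: cint_bound; first by apply: ccont_mult => //; exact: ccont_muS.
move=> t; apply: Cmod_mult_le => //; apply: Cmod_mult_le => //; have := C2 t; lra.
Qed.

Lemma jet1_bound X z : (forall j, conv r (X j)) -> Om z -> forall b a : R, (forall k t, (Cmod (val (muS X k) x (hc t)) <= b)%R) ->
  (forall k t, (Cmod (cev (cde Ct) (- K * z + K * (x * hc t + center L k))) <= a)%R) ->
  (Cmod (jet X 1 z) <= K * (K * (b * Rabs x * a)) * rsumL (fun=> 1%R) (idx M))%R.
Proof.
move=> CX Hz b a Hb Ha; have kp := kap_pos.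
rewrite /jet [Cpow _ _]/= Cmult_1_r (Cmod_mult (- K)) Cmod_opp Cmod_R (Rabs_pos_eq K); last lra.
rewrite Rmult_assoc; apply: Rmult_le_compat_l; first lra.
rewrite -rsumL_scal; apply: csumL_bound => k _; rewrite Rmult_1_r.
by apply: (jet1_cint X k z CX Hz b a).
Qed.

(** The derivative of cot is -1/sin^2, and |sin w| is at least |sinh(Im w)|, hence at least |Im
    w|. *)
Lemma far_im k t z A : (0 < A)%R -> (A / K + Rabs x + Rabs (Im (center L k)) <= Rabs (Im z))%R ->
  (Cmod (cev (cde Ct) (- K * z + K * (x * hc t + center L k))) <= / A ^ 2)%R.
Proof.
move=> A0 H; have kp := kap_pos; set w := _ + _.
have I1 : (A <= Rabs (Im w))%R.
  have E : (Im w = - (K * (Im z - Im (x * hc t + center L k))))%R by rewrite /w; rewrite /Im /Re /=; ring.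
  rewrite E Rabs_Ropp Rabs_mult (Rabs_pos_eq K); last lra.
  have B1 : (Rabs (Im (x * hc t + center L k)) <= Rabs x + Rabs (Im (center L k)))%R.
    rewrite Im_plus; apply: Rle_trans (Rabs_triang _ _) _; apply: Rplus_le_compat_r.
    apply: Rle_trans (im_le_Cmod _) _; rewrite (Cmod_mult x) Cmod_R Cmod_hc; have := x_pos; lra.
  have B2 := Rabs_triang_inv (Im z) (Im (x * hc t + center L k)).
  rewrite {1}(_ : A = K * (A / K))%R; last by field; lra.
  apply: Rmult_le_compat_l; lra.
have S1 : (A ^ 2 <= Cmod (Csin w) ^ 2)%R.
  rewrite Cmod_Csin; have := sinh_sqr_ge (Im w); have := pow2_ge_0 (sin (Re w)).
  have : (A ^ 2 <= Rabs (Im w) ^ 2)%R by apply: pow_incr; lra.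
  by rewrite pow2_abs; lra.
have A2 : (0 < A ^ 2)%R by exact: pow_lt.
have s0 : Csin w <> 0 by move=> E; move: S1; rewrite E Cmod_0 /= Rmult_0_l; rewrite /= in A2; lra.
rewrite [cev _ _]/= Ccot_sqr // (Cmod_mult (- (1))) Cmod_opp Cmod_1 Rmult_1_l Cmod_inv; last exact: Cmult_neq_0.
rewrite (Cmod_mult (Csin w)); apply: Rinv_le_contravar => //.
by rewrite (_ : Cmod (Csin w) * Cmod (Csin w) = Cmod (Csin w) ^ 2)%R //; rewrite /=; ring.
Qed.

(** Far up or down the kernel of the derivative is at most A^-2, with A growing with |Im z|, while
    the densities are bounded on the inner circle. *)
Lemma jet1_vanish X : (forall j, conv r (X j)) -> forall eps, (0 < eps)%R ->
  exists B, forall z, (B < Rabs (Im z))%R -> (Cmod (jet X 1 z) < eps)%R.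
Proof.
move=> CX eps e0; have kp := kap_pos; have xp := x_pos.
have [||b [b0 Hb]] := common_bound (idx M) (fun k b => forall t, (Cmod (val (muS X k) x (hc t)) <= b)%R).
- by move=> k b b' H le t; apply: Rle_trans (H t) le.
- by move=> k; exact: val_hc_bound (conv_muS _ _ (CX k)).
have [||c [c0 Hc]] := common_bound (idx M) (fun k b => (Rabs (Im (center L k)) <= b)%R).
- by move=> k p p' H le; lra.
- by move=> k; exists (Rabs (Im (center L k))); lra.
pose N := rsumL (fun=> 1%R) (idx M); have N0 : (0 <= N)%R by apply: rsumL_ge0 => _; lra.
pose C0 := (K * (K * (b * Rabs x)) * N)%R.
have C00 : (0 <= C0)%R.
  have P1 := Rmult_le_pos _ _ b0 (Rlt_le _ _ xp); have P2 := Rmult_le_pos _ _ (Rlt_le _ _ kp) P1.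
  exact: Rmult_le_pos _ _ (Rmult_le_pos _ _ (Rlt_le _ _ kp) P2) N0.
pose A := ((C0 + 1) / eps + 1)%R; have A1 : (1 <= A)%R.
  by have : (0 < (C0 + 1) / eps)%R; [apply: Rdiv_lt_0_compat; lra|rewrite /A; lra].
exists (A / K + Rabs x + c)%R => z Hz.
have Oz : Om z.
  move=> k n; apply: Rle_trans (im_le_Cmod _).
  have E : Im (z - pole k n) = (Im z - Im (center L k))%R by rewrite /pole /Im /=; ring.
  rewrite E; have := Rabs_triang_inv (Im z) (Im (center L k)); have := Hc k (In_idx M k).
  have : (0 < A / K)%R by apply: Rdiv_lt_0_compat; lra.
  lra.
have H := jet1_bound X z CX Oz b (/ A ^ 2) (fun k => Hb k (In_idx M k))
  (fun k t => far_im k t z A ltac:(lra) ltac:(have := Hc k (In_idx M k); lra)).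
apply: Rle_lt_trans H _; rewrite -/N (_ : K * (K * (b * Rabs x * / A ^ 2)) * N = C0 * / A ^ 2)%R; last by rewrite /C0; ring.
have A2 : (A <= A ^ 2)%R by nra.
apply: Rle_lt_trans (_ : C0 * / A < _)%R; last first.
  apply: (Rmult_lt_reg_r A); first lra.
  rewrite Rmult_assoc Rinv_l; last lra.
  have : (eps * A = C0 + 1 + eps)%R by rewrite /A; field; lra.
  lra.
by apply: Rmult_le_compat_l => //; apply: Rinv_le_contravar; lra.
Qed.

Lemma lim_im_infty (g : C -> C) (l : C) :
  (forall eps, (0 < eps)%R -> exists B, forall z, (B < Rabs (Im z))%R -> (Cmod (g z - l) < eps)%R) ->
  filterlim g at_im_infty (locally (T := C_UniformSpace) l).
Proof.
move=> H P /locally_Cmod [d [d0 Hd]]; have [B HB] := H d d0.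
by exists B => z /HB; exact: Hd.
Qed.

Section Small.
Variables (X : 'I_M -> ser) (B : R).
Hypotheses (CX : forall k, conv r (X k)) (B0 : (0 <= B)%R).
Hypothesis HB : forall k t, (Cmod (val (muS X k) x (hc t)) <= Rabs x * B)%R.

Let N := rsumL (fun=> 1%R) (idx M).

Let weight : (K * Rabs x * (1 + 3 / (K * (Rabs x / 2))) <= 7)%R.
Proof.
have kp := kap_pos; have xp := x_pos; have kx := kap_x.
by rewrite (_ : K * Rabs x * (1 + 3 / (K * (Rabs x / 2))) = K * Rabs x + 6)%R; [lra|field; lra].
Qed.

Let q := (1 + 3 / (K * (Rabs x / 2)))%R.
Let q1 : (1 <= q)%R.
Proof. by have := Kx_pos => H; have : (0 < 3 / (K * (Rabs x / 2)))%R; [apply: Rdiv_lt_0_compat; lra|rewrite /q; lra]. Qed.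
Let wq : ((K * Rabs x * q) ^ 2 <= 49)%R.
Proof.
have H := weight; rewrite -/q in H.
have P : (0 <= K * Rabs x * q)%R by have := kap_pos; have := x_pos; have := q1; move=> *; apply: Rmult_le_pos; [apply: Rmult_le_pos; lra|lra].
have := pow_incr _ 7 2 (conj P H); lra.
Qed.

(** Near the disks cot' may be of size (K |x|)^-2. One factor |x| comes from the density, another
    from the contour, and (K |x| q)^2 <= 49 makes the bound free of rho. *)
Lemma jet1_small z : Om z -> (Cmod (jet X 1 z) <= 784 * N * B)%R.
Proof.
move=> Oz; have kp := kap_pos; have xp := x_pos.
have N0 : (0 <= N)%R by apply: rsumL_ge0 => _; lra.
have Ha k t : (Cmod (cev (cde Ct) (- K * z + K * (x * hc t + center L k))) <= 2 * q ^ 2)%R.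
  have H := cot_bound _ _ Kx_pos (away_Om z k t Oz); rewrite -/q in H; rewrite [cev _ _]/=; move: (Ccot _) H => u H.
  rewrite (Cmod_mult (- (1))) Cmod_opp Cmod_1 Rmult_1_l.
  apply: Rle_trans (Cmod_triangle _ _) _; rewrite Cmod_1 (Cmod_mult u).
  by have := Cmod_ge_0 u; have := q1; move: (Cmod u) H => c; nra.
apply: Rle_trans (jet1_bound X z CX Oz _ _ HB Ha) _; rewrite -/N.
rewrite (_ : K * (K * (Rabs x * B * Rabs x * (2 * q ^ 2))) * N = 2 * (K * Rabs x * q) ^ 2 * (B * N))%R; last by ring.
have : (0 <= B * N)%R by exact: Rmult_le_pos.
have := wq; nra.
Qed.

(** A two-point estimate through [cot_lip], as [Om] is not convex; 784 is 16 times 49. *)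
Lemma Phi_lip z1 z2 : Om z1 -> Om z2 -> (Cmod (Phi X Ct z2 - Phi X Ct z1) <= 784 * N * B * Cmod (z2 - z1))%R.
Proof.
move=> O1 O2; have kp := kap_pos; have xp := x_pos; have [_ C2] := cone.
have CI z : Om z -> forall k, ccont (fun t => val (muS X k) x (hc t) * (x * (Ci * hc t)) * cev Ct (- K * z + K * (x * hc t + center L k))).
  move=> Hz k; apply: ccont_mult; first exact: ccont_muS.
  exact: (proj1 (SD_ccont _ _ _ (fun t => - K * z + K * (x * hc t + center L k)) (SD_cexp _ Ct Kx_pos)
    (fun t => away_Om z k t Hz) (ccont_plus _ _ (ccont_const _) (ccont_scal _ _ (ccont_plus _ _ (ccont_scal _ _ ccont_hc) (ccont_const _)))))).
rewrite /Phi -csumL_minus.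
have n2 : 2 * Ci * T <> 0.
  by apply: Cmult_neq_0; [apply: Cmult_neq_0; [exact: C2_neq0|exact: Ci_neq0]|apply: RtoC_neq0; lra].
have e2 : Cmod (2 * Ci * T) = (2 * T)%R.
  by rewrite (Cmod_mult (2 * Ci)) (Cmod_mult 2) Cmod_Ci !Cmod_R !Rabs_pos_eq; lra.
set dz := Cmod (z2 - z1); have dz0 : (0 <= dz)%R by exact: Cmod_ge_0.
rewrite (_ : 784 * N * B * dz = (784 * B * dz) * N)%R; last by ring.
rewrite /N -rsumL_scal; apply: csumL_bound => k _; rewrite Rmult_1_r -Cmult_minus_distr_l -cint_minus; try exact: CI.
rewrite (Cmod_mult (/ _)) Cmod_inv // e2.
apply: Rle_trans (_ : / (2 * T) * (2 * PI * (Rabs x * B * Rabs x * (16 * q ^ 2 * (K * dz)))) <= _)%R; last first.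
  have -> : (/ (2 * T) * (2 * PI * (Rabs x * B * Rabs x * (16 * q ^ 2 * (K * dz)))) = 16 * (K * Rabs x * q) ^ 2 * (B * dz))%R.
    by rewrite {2}/kap /kap; field; lra.
  have : (0 <= B * dz)%R by exact: Rmult_le_pos.
  have := wq; nra.
apply: Rmult_le_compat_l; first by apply: Rlt_le; apply: Rinv_0_lt_compat; lra.
apply: cint_bound.
  by apply: ccont_ext (ccont_plus _ _ (CI z2 O2 k) (ccont_scal (- (1)) _ (CI z1 O1 k))) => t; ring.
move=> t; rewrite -Cmult_minus_distr_l; apply: Cmod_mult_le.
  by apply: Cmod_mult_le; [exact: HB|have := C2 t; lra].
have := cot_lip _ _ _ Kx_pos (away_Om z1 k t O1) (away_Om z2 k t O2); rewrite -/q.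
by rewrite (_ : _ - (- K * z1 + _) = - K * (z2 - z1)) ?(Cmod_mult (- K)) ?Cmod_opp ?Cmod_R ?(Rabs_pos_eq K) //; [lra|ring].
Qed.
End Small.


(** Near z the quotient sin(K (y - c)) / sin(K (z - c)) is within 1/2 of 1, so the principal
    logarithm of the quotient plus one logarithm at z is a holomorphic branch. *)
Lemma log_branch z : conf_domain L x z -> exists (d : R) (g : 'I_M -> C -> C), [/\ (0 < d)%R,
  forall y, (Cmod (y - z) < d)%R -> Om y,
  forall j y, (Cmod (y - z) < d)%R -> Cexp (g j y) = Csin (K * (y - center L j)) &
  forall j, SD (fun y => (Cmod (y - z) < d)%R) (g j) (fun y => K * Ccot (K * (y - center L j)))].
Proof.
move=> Hz; have [d1 [d10 Hd1]] := open_domain z Hz; have kp := kap_pos; have xp := x_pos.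
have Oz : Om z by exact: Om_domain.
have Kx : (0 < K * Rabs x)%R by exact: Rmult_lt_0_compat.
have arg j y : K * y + - (K * center L j) = K * (y - center L j) by ring.
have SC j : SD Om (fun y => K * Ccot (K * (y - center L j))) (fun y => K * (K * - (1 + Ccot (K * (y - center L j)) * Ccot (K * (y - center L j))))).
  apply: SD_ext (SD_scal Om K _ _ (SD_affine (away (K * Rabs x)) Om K (- (K * center L j)) _ _ (fun z => away_center z j) (SD_cot _ Kx))) => y _; by rewrite !arg.
have bC j : (Cmod (Ccot (K * (z - center L j))) <= 1 + 3 / (K * Rabs x))%R.
  by rewrite -arg; apply: cot_bound => //; exact: away_center.
set b := (1 + 3 / (K * Rabs x))%R in bC.
have b1 : (1 <= b)%R by have : (0 < 3 / (K * Rabs x))%R; [apply: Rdiv_lt_0_compat; lra|rewrite /b; lra].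
(* With |h| < e both |cos h - 1| and |cot| |sin h| are at most 1/4. *)
pose e := (/ (8 * (b + 1)))%R; have e0 : (0 < e)%R by apply: Rinv_0_lt_compat; lra.
have e8 : (e * (8 * (b + 1)) = 1)%R by rewrite /e; field; lra.
have e1 : (e <= 1 / 16)%R by nra.
pose d := Rmin d1 (e / K); have d0 : (0 < d)%R by apply: Rmin_pos => //; exact: Rdiv_lt_0_compat.
have Hd y : (Cmod (y - z) < d)%R -> Om y.
  by move=> H; apply: Hd1; apply: Rlt_le_trans H (Rmin_l _ _).
pose S0 j := Csin (K * (z - center L j)).
have S00 j : S0 j <> 0 by exact: sin_Om.
pose rt j y := Csin (K * (y - center L j)) / S0 j.
have rtP j y : (Cmod (y - z) < d)%R -> (0 < Re (rt j y))%R.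
  move=> Hy; set h := K * (y - z).
  have hb : (Cmod h < e)%R.
    rewrite /h (Cmod_mult K) Cmod_R (Rabs_pos_eq K); last lra.
    rewrite (_ : e = K * (e / K))%R; last by field; lra.
    by apply: Rmult_lt_compat_l => //; apply: Rlt_le_trans Hy (Rmin_r _ _).
  have E : rt j y - 1 = (Ccos h - 1) + Ccot (K * (z - center L j)) * Csin h.
    rewrite /rt (_ : K * (y - center L j) = K * (z - center L j) + h); last by rewrite /h; ring.
    by rewrite Csin_add /Ccot -/(S0 j); field.
  have h0 := Cmod_ge_0 h.
  have A1 := Ccos_quad h ltac:(lra); have [_ A2 _ _] := small_trig h ltac:(lra).
  have D : (Cmod (rt j y - 1) <= 1 / 2)%R.
    rewrite E; apply: Rle_trans (Cmod_triangle _ _) _.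
    have := Cmod_mult_le _ _ _ _ (bC j) A2; nra.
  have := re_le_Cmod (rt j y - 1); rewrite Re_minus [Re (RtoC 1)]/= => H.
  have [_] := Rabs_le_between (Re (rt j y) - 1) (1 / 2); have [K1 _] := Rabs_le_between (Re (rt j y) - 1) (1 / 2).
  by move=> _; have := K1 (Rle_trans _ _ _ H D); lra.
have ex j : exists s, Cexp s = S0 j by exact: Clog_exists.
pose s0 j := proj1_sig (constructive_indefinite_description _ (ex j)).
have Hs0 j : Cexp (s0 j) = S0 j by rewrite /s0; case: (constructive_indefinite_description _ _).
exists d, (fun j y => s0 j + Clog (rt j y)); split=> //.
  move=> j y Hy; rewrite Cexp_add Hs0 Cexp_Clog; last exact: rtP.
  by rewrite /rt; field.
move=> j; have [B [B0 [B1 B2]]] := SC j.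
apply: (SD_ball z d B) => //.
- move=> u v t Hu Hv Ht; set y := fun s : R => u + s * (v - u).
  have Hy : (Cmod (y t - z) < d)%R.
    rewrite /y (_ : u + t * (v - u) - z = RtoC (1 - t) * (u - z) + t * (v - z)); last by rewrite RtoC_minus; ring.
    apply: Rle_lt_trans (Cmod_triangle _ _) _; rewrite (Cmod_mult (RtoC (1 - t))) (Cmod_mult t) !Cmod_R !Rabs_pos_eq; try lra.
    case: (Req_dec t 0) => [->|t0]; first lra.
    have := Rmult_lt_compat_l t _ _ ltac:(lra) Hv; have := Rmult_le_compat_l (1 - t) _ _ ltac:(lra) (Rlt_le _ _ Hu); lra.
  have Dy : cder y t (v - u).
    apply: (cder_eq _ _ (0 + (1 * (v - u) + t * 0))); first by ring.
    by apply: cder_plus; [exact: cder_const|apply: cder_mult; [apply: cder_RtoC; exact: is_derive_id|exact: cder_const]].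
  have Dr : cder (fun s => rt j (y s)) t (/ S0 j * (K * (v - u - 0) * Ccos (K * (y t - center L j)))).
    apply: (cder_ext (fun s => / S0 j * Csin (K * (y s - center L j)))); first by move=> s; rewrite /rt; field.
    by apply: cder_scal; apply: cder_Csin; apply: cder_scal; apply: cder_minus => //; exact: cder_const.
  apply: cder_eq (cder_plus _ _ _ _ _ (cder_const (s0 j) t) (cder_Clog (fun s => rt j (y s)) t _ (rtP j _ Hy) Dr)).
  rewrite /rt /Ccot -/(y t); have := sin_Om _ j (Hd _ Hy) => sn; field; split=> //.
- by move=> u /Hd Ou; have [] := B1 u Ou.
by move=> u v /Hd Ou /Hd Ov; have [] := B2 u v Ou Ov.
Qed.

Section Vortex.
Variables (mm nn : 'I_M -> ser) (q : 'I_M -> R) (B : R).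
Hypotheses (Cm : forall k, conv r (mm k)) (Sm : forall k, supp ext_exp (mm k)).
Hypotheses (Cn : forall k, conv r (nn k)) (Sn : forall k, supp ext_exp (nn k)).
Hypothesis bdry_eq : forall k z, Cmod z = 1%R ->
  let P := bdry L x mm nn k z in
  let F := 1 - x * x * (val (mm k) x z - x * potl L x mm k z) in
  Cconj P = P /\ P * P = RtoC (Defs.circ L k ^ 2 / (4 * PI ^ 2) + x * (x * q k)) * F * Cconj F.
Hypotheses (B0 : (0 <= B)%R) (HB : forall k t, (Cmod (val (muS mm k) x (hc t)) <= Rabs x * B)%R).
Hypothesis small : (x ^ 2 * (784 * rsumL (fun=> 1%R) (idx M) * B) <= 1 / 2)%R.

Lemma potential_derivative : mderivative_on (conf_domain L x) (mfun_shift (pv_potential L) (hmap nn)) (wmap' nn).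
Proof.
move=> z Hz; have [d [g [d0 HO Hg HS]]] := log_branch z Hz.
exists (fun y => csumL (fun j => Defs.circ L j / (2 * PI * Ci) * g j y) (idx M) + hmap nn y).
apply/locally_Cmod; exists d; split=> // y Hy; split.
  exists (csumL (fun j => Defs.circ L j / (2 * PI * Ci) * g j y) (idx M)); split=> //.
  exists (fun j => g j y); split; last by rewrite big_csumL.
  by move=> j; rewrite Hg // /kap RtoC_div //; lra.
have S1 := SD_csumL _ _ _ (idx M) (fun j => SD_scal _ (Defs.circ L j / (2 * PI * Ci)) _ _ (HS j)).
have S2 := SD_sub _ _ _ _ (fun y Hy => HO y Hy) (SD_scal _ x _ _ (SD_jet nn Cn 0)).
have S3 := SD_plus _ _ _ _ _ S1 S2.
have S4 : SD (fun y => (Cmod (y - z) < d)%R) (fun y => csumL (fun j => Defs.circ L j / (2 * PI * Ci) * g j y) (idx M) + hmap nn y) (wmap' nn).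
  by apply: SD_ext S3 => u _ //; rewrite /hmap jet0.
apply: (SD_is_derive _ _ _ _ (d - Cmod (y - z)) S4); first lra.
move=> u Hu; rewrite (_ : u - z = (u - y) + (y - z)); last by ring.
by apply: Rle_lt_trans (Cmod_triangle _ _) _; lra.
Qed.

Lemma fmap'_neq0 z : Om z -> fmap' mm z <> 0.
Proof.
move=> Oz E; have H := jet1_small mm B Cm B0 HB z Oz.
have : (1 <= x ^ 2 * Cmod (jet mm 1 z))%R.
  rewrite -(pow2_abs x) -Cmod_1 (_ : RtoC 1 = - (x * x * jet mm 1 z)).
    by rewrite Cmod_opp (Cmod_mult (x * x)) (Cmod_mult x) Cmod_R /=; apply: Req_le; ring.
  by apply: Cminus_eq0; rewrite -[RHS]E /fmap'; ring.
have := Rmult_le_compat_l (x ^ 2) _ _ (pow2_ge_0 x) H; lra.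
Qed.

(** f is the identity plus a map of Lipschitz constant at most 1/2 on [Om], by [Phi_lip] and the
    smallness of rho. *)
Lemma fmap_inj z1 z2 : Om z1 -> Om z2 -> fmap mm z1 = fmap mm z2 -> z1 = z2.
Proof.
move=> O1 O2 E; have H := Phi_lip mm B Cm B0 HB z1 z2 O1 O2.
have E2 : z1 - z2 = x * x * (Phi mm Ct z2 - Phi mm Ct z1).
  by move: E; rewrite /fmap => E; transitivity ((z1 + x * x * Phi mm Ct z1) - z2 - x * x * Phi mm Ct z1); [ring|rewrite E; ring].
have := f_equal Cmod E2; rewrite (Cmod_mult (x * x)) (Cmod_mult x) Cmod_R => E3.
have := Rmult_le_compat_l (x ^ 2) _ _ (pow2_ge_0 x) H; rewrite -{1}(pow2_abs x) (Cmod_subC z2).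
move=> H2; apply: Cminus_eq0; apply: Cmod_eq_0; have h0 := Cmod_ge_0 (z1 - z2).
have : (Rabs x * Rabs x * Cmod (Phi mm Ct z2 - Phi mm Ct z1)%C <= x ^ 2 * (784 * rsumL (fun=> 1%R) (idx M) * B) * Cmod (z1 - z2))%R.
  by rewrite /= Rmult_1_r in H2 *; lra.
by rewrite -E3; nra.
Qed.

Lemma vortex_hollow (l : nat) (a : R) : (0 < a < 1)%R ->
  hollow_vortex l a (fmap mm) (mfun_shift (pv_potential L) (hmap nn)) (fun k => (x * q k)%R) L x.
Proof.
move=> Ha; split=> //; split; first exact: disks_disjoint.
have Der X c : (forall k, conv r (X k)) -> derivative_on (conf_domain L x) (fun z => c * Phi X Ct z) (fun z => c * jet X 1 z).
  move=> CX z Hz; have [d [d0 Hd]] := open_domain z Hz.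
  apply: (SD_is_derive Om _ (fun z => c * jet X 1 z) z d _ d0 Hd).
  by apply: SD_ext (SD_scal _ c _ _ (SD_jet X CX 0)) => // y _; rewrite jet0.
have Cont X c : (forall k, conv r (X k)) -> continuous_within (Cclosure (conf_domain L x)) (fun z => c * jet X 1 z).
  by move=> CX; exact: (proj1 (SD_continuous_within Om _ _ _ Om_closure (SD_scal _ c _ _ (SD_jet X CX 1)))).
have Lim X (c : C) (l0 : C) (g : C -> C) : (forall k, conv r (X k)) -> (forall z, g z - l0 = c * jet X 1 z) ->
   filterlim g at_im_infty (locally (T := C_UniformSpace) l0).
  move=> CX Eg; apply: lim_im_infty => eps e0; have c0 := Cmod_ge_0 c.
  have [b Hb] := jet1_vanish X CX (eps / (Cmod c + 1)) ltac:(apply: Rdiv_lt_0_compat; lra).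
  exists b => z /Hb H; rewrite Eg (Cmod_mult c).
  have := Rmult_le_compat_l _ _ _ c0 (Rlt_le _ _ H).
  rewrite (_ : eps = (Cmod c + 1) * (eps / (Cmod c + 1)))%R; last by field; lra.
  by have : (0 < eps / (Cmod c + 1))%R; [apply: Rdiv_lt_0_compat; lra|move=> H1 H2; rewrite (_ : (_ + 1) * (eps / (Cmod c + 1)) / _ = eps / (Cmod c + 1))%R in H2; [lra|field; lra]].
exists (fmap' mm), (wmap' nn), (hmap nn), (hmap' nn).
split.
  move=> z Hz; have [d [d0 Hd]] := open_domain z Hz.
  have Oz := Om_domain z Hz.
  have S1 := SD_scal Om (x * x) _ _ (SD_jet mm Cm 0).
  have bnd : SD (fun y => Om y /\ (Cmod (y - z) < d)%R) (fmap mm) (fmap' mm).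
    have Sid : SD (fun y => Om y /\ (Cmod (y - z) < d)%R) id (fun=> 1).
      apply: (SD_id _ (Cmod z + d)) => y [_ Hy]; have := Cmod_triangle (y - z) z.
      by rewrite (_ : y - z + z = y); [lra|ring].
    apply: SD_ext (SD_plus _ _ _ _ _ Sid (SD_sub _ _ _ _ (fun y H => proj1 H) S1)) => // y _.
    by rewrite /fmap jet0.
  by apply: (SD_is_derive _ _ _ _ d bnd d0) => y Hy; split=> //; exact: Hd.
split.
  by exact: (proj1 (SD_continuous_within Om _ _ _ Om_closure (SD_plus _ _ _ _ _ (SD_const Om 1) (SD_scal _ (x * x) _ _ (SD_jet mm Cm 1))))).
split; first by move=> z _; rewrite /fmap Phi_period; ring.
split.
  have := holder_Phi mm Cm l a (x * x) Ha; congr (holder_holomorphic _ _ _ _).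
  by apply: functional_extensionality => z; rewrite /fmap; ring.
split; first by move=> z1 z2 /Om_closure O1 /Om_closure O2; exact: fmap_inj.
split; first by move=> z /Om_closure; exact: fmap'_neq0.
split; first by apply: (Lim mm (x * x)) => // z; rewrite /fmap'; ring.
split; first by [].
split; first exact: Der.
split; first by move=> z _; rewrite /hmap Phi_period.
split; first exact: holder_Phi.
split; first by apply: (Lim nn x) => // z; rewrite /hmap'; ring.
split; first exact: potential_derivative.
split.
  have [g' Hg] := SD_w0'.
  exact: (proj1 (SD_continuous_within Om _ _ _ Om_closure (SD_plus _ _ _ _ _ Hg (SD_scal _ x _ _ (SD_jet nn Cn 1))))).
move=> k; split; first exact: circulation.
split.
  have [m Hm] := kinematic mm nn q Cm Sm Cn Sn bdry_eq k.
  by exists m => z Hz v; exact: Hm.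
have [p [Hp1 Hp2]] := bernoulli_modulus mm nn q Cm Sm Cn Sn bdry_eq k fmap'_neq0.
by exists p.
Qed.
End Vortex.

End Hollow.

(** * Hoelder norms of densities on the circle *)

(** Induction on j with q split into two factors sqrt q: one absorbs n by Bernoulli's inequality,
    the other n^j. *)
Lemma pow_exp_bound (j : nat) : forall q : R, (1 < q)%R -> exists E, (0 < E)%R /\ forall n : nat, (INR n ^ j <= E * q ^ n)%R.
Proof.
elim: j => [|j IH] q Hq.
  exists 1%R; split; first lra; move=> n; rewrite /= Rmult_1_l; apply: pow_R1_Rle; lra.
have sq : (1 < sqrt q)%R by rewrite -sqrt_1; apply: sqrt_lt_1; lra.
have [E [E0 HE]] := IH _ sq; have d0 : (0 < sqrt q - 1)%R by lra.
exists (/ (sqrt q - 1) * E)%R; split; first by apply: Rmult_lt_0_compat => //; exact: Rinv_0_lt_compat.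
move=> n; have P := poly n _ d0; rewrite (_ : 1 + (sqrt q - 1) = sqrt q)%R in P; last by ring.
have A : (INR n <= / (sqrt q - 1) * sqrt q ^ n)%R.
  apply: (Rmult_le_reg_l (sqrt q - 1)) => //; rewrite -Rmult_assoc Rinv_r; lra.
have -> : (q ^ n = sqrt q ^ n * sqrt q ^ n)%R by rewrite -Rpow_mult_distr sqrt_sqrt //; lra.
rewrite /= (_ : / (sqrt q - 1) * E * (sqrt q ^ n * sqrt q ^ n) = (/ (sqrt q - 1) * sqrt q ^ n) * (E * sqrt q ^ n))%R; last by ring.
by apply: Rmult_le_compat => //; [exact: pos_INR|apply: pow_le; exact: pos_INR].
Qed.

Lemma unit_quad (d : R) : (Cmod (unit_pt d - 1 - d * Ci) <= 3 * d ^ 2)%R.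
Proof.
apply: Rle_trans (Cmod_le_abs _) _.
rewrite (_ : Re (unit_pt d - 1 - d * Ci) = cos d - 1)%R; last by rewrite /unit_pt /Re /=; ring.
rewrite (_ : Im (unit_pt d - 1 - d * Ci) = sin d - d)%R; last by rewrite /unit_pt /Im /=; ring.
have C1 := cos_quad d; have d2 := pow2_ge_0 d.
suff : (Rabs (sin d - d) <= 2 * d ^ 2)%R by lra.
have a0 := Rabs_pos d; have E : (d ^ 2 = Rabs d ^ 2)%R by rewrite pow2_abs.
case: (Rle_lt_dec (Rabs d) 1) => H.
  by apply: Rle_trans (sin_quad d) _; rewrite E; move: (Rabs d) a0 H => u *; rewrite /=; nra.
apply: Rle_trans (Rabs_triang _ _) _; rewrite Rabs_Ropp; have := sin_abs_le d.
by rewrite E; move: (Rabs d) H => u H ?; rewrite /=; nra.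
Qed.

Lemma unit_add (s t : R) : unit_pt (s + t) = unit_pt s * unit_pt t.
Proof. by apply: Ceq; rewrite /unit_pt /Re /Im /=; rewrite ?cos_plus ?sin_plus; ring. Qed.

(* The [j]-th derivative in the angle of a monomial on the unit circle. *)
Definition mder (j : nat) (y : mono) : mono := (Cpow (IZR y.2 * Ci) j * y.1, y.2).

(** The angular derivatives with rho set to 1: powers of rho are put into the coefficients, so that
    a single estimate serves points of the curve, Taylor coefficients and remainders alike. *)
Definition V (j : nat) (Z : ser) (t : R) : C := CS (fun n => lev (map (mder j) (Z n)) (unit_pt t)) 1.

Lemma Cmod_zpow_unit t e : Cmod (zpow (unit_pt t) e) = 1%R.
Proof. by rewrite zpow_unit Cmod_unit. Qed.

Lemma wt_pow j : exists E, (0 < E)%R /\ forall e, (Rabs (IZR e) ^ j <= E * wt e)%R.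
Proof.
have [E [E0 H]] := pow_exp_bound j 4 ltac:(lra); exists E; split=> // e.
have := H (Z.abs_nat e); rewrite /wt INR_IZR_INZ Zabs2Nat.id_abs abs_IZR; exact.
Qed.

Lemma Cmod_mder j y : Cmod (mder j y).1 = (Rabs (IZR y.2) ^ j * Cmod y.1)%R.
Proof. by rewrite /mder /= Cmod_mult Cmod_pow Cmod_mult Cmod_R Cmod_Ci Rmult_1_r. Qed.

Section Circle.
Variables (Z : ser) (b : R).
Hypothesis Hb : forall m, (rs m (fun n => lnorm (Z n)) <= b)%R.

Lemma circle_bound (c : nat -> C) (K : R) : (0 <= K)%R -> (forall n, (Cmod (c n) <= K * lnorm (Z n))%R) ->
  asum c 1 /\ (Cmod (CS c 1) <= K * b)%R.
Proof.
move=> K0 H; have B : bsum c 1 (K * b).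
  move=> m; apply: Rle_trans (_ : K * rs m (fun n => lnorm (Z n)) <= _)%R; last exact: Rmult_le_compat_l.
  rewrite -rs_scal; apply: rs_le => n _; rewrite Rabs_R1 pow1 Rmult_1_r; exact: H.
by split; [exact: bsum_asum B|exact: bsum_CS].
Qed.

Lemma term_bound j : exists K, (0 <= K)%R /\ forall n t, (Cmod (lev (map (mder j) (Z n)) (unit_pt t)) <= K * lnorm (Z n))%R.
Proof.
have [E [E0 HE]] := wt_pow j; exists E; split; first lra.
move=> n t; rewrite /lev csumL_map /lnorm -rsumL_scal; apply: csumL_bound => y _.
rewrite (Cmod_mult (mder j y).1) Cmod_zpow_unit Cmod_mder Rmult_1_r /wn.
have := Rmult_le_compat_r _ _ _ (Cmod_ge_0 y.1) (HE y.2); lra.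
Qed.

Lemma quad_bound j : exists K, (0 <= K)%R /\ forall n s t,
  (Cmod (lev (map (mder j) (Z n)) (unit_pt s) - lev (map (mder j) (Z n)) (unit_pt t)
     - RtoC (s - t) * lev (map (mder (S j)) (Z n)) (unit_pt t)) <= K * (s - t) ^ 2 * lnorm (Z n))%R.
Proof.
have [E [E0 HE]] := wt_pow (S (S j)); exists (3 * E)%R; split; first lra.
move=> n s t; rewrite /lev !csumL_map -csumL_scal -!csumL_minus /lnorm -rsumL_scal.
apply: csumL_bound => y _; set e := y.2; set D := (IZR e * (s - t))%R.
have -> : (mder j y).1 * zpow (unit_pt s) (mder j y).2 - (mder j y).1 * zpow (unit_pt t) (mder j y).2
    - RtoC (s - t) * ((mder (S j) y).1 * zpow (unit_pt t) (mder (S j) y).2)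
   = (mder j y).1 * zpow (unit_pt t) e * (unit_pt D - 1 - D * Ci).
  rewrite /mder /= -/e !zpow_unit (_ : IZR e * s = D + IZR e * t)%R; last by rewrite /D; ring.
  by rewrite unit_add {3}/D RtoC_mult; ring.
rewrite (Cmod_mult ((mder j y).1 * zpow (unit_pt t) e)) (Cmod_mult (mder j y).1) Cmod_zpow_unit Cmod_mder Rmult_1_r -/e.
apply: Rle_trans (_ : Rabs (IZR e) ^ j * Cmod y.1 * (3 * D ^ 2) <= _)%R.
  apply: Rmult_le_compat_l (unit_quad D).
  by apply: Rmult_le_pos; [apply: pow_le; exact: Rabs_pos|exact: Cmod_ge_0].
have := HE e; rewrite /wn /= -/e => H.
have E2 : (D * (D * 1) = (Rabs (IZR e) * Rabs (IZR e)) * (s - t) ^ 2)%R.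
  by rewrite /D -Rabs_mult Rabs_pos_eq; [ring|nra].
rewrite /= E2; have h2 := pow2_ge_0 (s - t); have c0 := Cmod_ge_0 y.1.
have P : (0 <= 3 * (s - t) ^ 2 * Cmod y.1)%R by apply: Rmult_le_pos => //; lra.
have := Rmult_le_compat_l _ _ _ P H; rewrite /=; move: (Rabs _) (Cmod y.1) (wt e) => u c v; lra.
Qed.

Lemma V_bound j : exists K, (0 <= K)%R /\ forall t, (Cmod (V j Z t) <= K * b)%R.
Proof.
have [K [K0 HK]] := term_bound j; exists K; split=> // t.
exact: (proj2 (circle_bound _ K K0 (fun n => HK n t))).
Qed.

Lemma b_ge0 : (0 <= b)%R. Proof. exact: Rle_trans (Rle_refl 0) (Hb 0%nat). Qed.

Lemma V_cder j t : cder (V j Z) t (V (S j) Z t).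
Proof.
have [K [K0 HK]] := quad_bound j; have [K1 [K10 HK1]] := term_bound j; have [K2 [K20 HK2]] := term_bound (S j).
have b0 := b_ge0; apply/cder_epsP => eps e0.
have Kb : (0 <= K * b)%R by exact: Rmult_le_pos.
exists (eps / (K * b + 1))%R; split; first by apply: Rdiv_lt_0_compat; lra.
move=> s Hs.
have A1 := proj1 (circle_bound _ K1 K10 (fun n => HK1 n s)).
have A2 := proj1 (circle_bound _ K1 K10 (fun n => HK1 n t)).
have A3 := proj1 (circle_bound _ K2 K20 (fun n => HK2 n t)).
have h2 := pow2_ge_0 (s - t).
have [A4 B4] := circle_bound _ (K * (s - t) ^ 2)%R (Rmult_le_pos _ _ K0 h2) (fun n => HK n s t).
have E : V j Z s - V j Z t - RtoC (s - t) * V (S j) Z t = CS (fun n => lev (map (mder j) (Z n)) (unit_pt s) - lev (map (mder j) (Z n)) (unit_pt t)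
     - RtoC (s - t) * lev (map (mder (S j)) (Z n)) (unit_pt t)) 1.
  have B2 := proj1 (circle_bound (fun n => - (1) * lev (map (mder j) (Z n)) (unit_pt t)) K1 K10 ltac:(move=> n; rewrite Cmod_mult Cmod_opp Cmod_1 Rmult_1_l; exact: HK1)).
  have B3 := proj1 (circle_bound (fun n => - RtoC (s - t) * lev (map (mder (S j)) (Z n)) (unit_pt t)) (Rabs (s - t) * K2)
     (Rmult_le_pos _ _ (Rabs_pos _) K20) ltac:(move=> n; rewrite Cmod_mult Cmod_opp Cmod_R Rmult_assoc; apply: Rmult_le_compat_l; [exact: Rabs_pos|exact: HK2])).
  have B12 := proj1 (circle_bound (fun n => lev (map (mder j) (Z n)) (unit_pt s) + - (1) * lev (map (mder j) (Z n)) (unit_pt t)) (K1 + K1) ltac:(lra)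
    ltac:(move=> n; apply: Rle_trans (Cmod_triangle _ _) _; rewrite (Cmod_mult (- (1))) Cmod_opp Cmod_1 Rmult_1_l Rmult_plus_distr_r; apply: Rplus_le_compat; exact: HK1)).
  rewrite (CS_ext _ (fun n => (lev (map (mder j) (Z n)) (unit_pt s) + - (1) * lev (map (mder j) (Z n)) (unit_pt t)) + - RtoC (s - t) * lev (map (mder (S j)) (Z n)) (unit_pt t))); last by move=> n; ring.
  by rewrite CS_plus // CS_plus // !CS_scal // /V; ring.
rewrite E; apply: Rle_trans B4 _.
have a0 := Rabs_pos (s - t); rewrite -(pow2_abs (s - t)).
have Ed : (eps = eps / (K * b + 1) * (K * b + 1))%R by field; lra.
move: Hs; rewrite {2}Ed; move: (eps / _)%R (Rabs (s - t)) a0 => d h h0 Hd.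
have := Rmult_le_compat_l (K * b) _ _ Kb (Rlt_le _ _ Hd); have d0 : (0 <= d)%R by lra.
move=> H; apply: Rle_trans (_ : (K * b * d) * h <= _)%R; last by apply: Rmult_le_compat_r => //; nra.
by rewrite (_ : K * h ^ 2 * b = K * b * h * h)%R; [apply: Rmult_le_compat_r|rewrite /=; ring].
Qed.

Definition uf (t : R) : R := (2 * Re (V 0 Z t))%R.

Lemma uf_derive j t : is_derive (fun t => 2 * Re (V j Z t))%R t (2 * Re (V (S j) Z t))%R.
Proof. by apply: is_derive_scal; case: (V_cder j t). Qed.

Lemma uf_Derive_n j t : ex_derive_n uf j t /\ Derive_n uf j t = (2 * Re (V j Z t))%R.
Proof.
have D p : forall s, Derive_n uf p s = (2 * Re (V p Z s))%R.
  elim: p => [|p IH] s //=; rewrite (Derive_ext _ _ _ IH); apply: is_derive_unique; exact: uf_derive.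
split; last exact: D.
case: j => [|j] //=; exists (2 * Re (V (S j) Z t))%R.
by apply: (is_derive_ext (fun s => 2 * Re (V j Z s))%R); [move=> s; rewrite D|exact: uf_derive].
Qed.
End Circle.

(** The weight 4^|e| dominates |e|^j up to j = l + 1, so derivatives of order up to l + 1 are
    bounded by the norm; the last one makes the l-th derivative Lipschitz, hence Hoelder. *)
Lemma holder_unit (l : nat) (a : R) : (0 < a < 1)%R -> exists K, (0 <= K)%R /\ forall (Z : ser) (b : R),
  (forall m, (rs m (fun n => lnorm (Z n)) <= b)%R) -> supp (fun e => e <= -1)%Z Z ->
  holder_circle0 l a (uf Z) /\ (0 <= real (holder_norm l a (uf Z)) <= K * b)%R.
Proof.
move=> Ha.
have EJ j : exists E, (0 < E)%R /\ forall e, (Rabs (IZR e) ^ j <= E * wt e)%R by exact: wt_pow.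
have [E [E0 HE]] : exists E, (0 < E)%R /\ forall j e, (j <= S l)%nat -> (Rabs (IZR e) ^ j <= E * wt e)%R.
  elim: (S l) => [|p [E [E0 HE]]].
    by have [E [E0 H]] := EJ 0%nat; exists E; split=> // j e Hj; rewrite (_ : j = 0%nat); [exact: H|lia].
  have [E' [E0' H']] := EJ (S p); exists (Rmax E E'); split; first by apply: Rlt_le_trans E0 (Rmax_l _ _).
  have W e : (0 <= wt e)%R by have := wt_ge1 e; lra.
  move=> j e Hj; case: (Nat.eq_dec j (S p)) => [->|n].
    by apply: Rle_trans (H' e) _; apply: Rmult_le_compat_r => //; exact: Rmax_r.
  by apply: Rle_trans (HE j e ltac:(lia)) _; apply: Rmult_le_compat_r => //; exact: Rmax_l.
exists (4 * E)%R; split; first lra; move=> Z b Hb SZ; have b0 := b_ge0 Z b Hb.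
have HV j t : (j <= S l)%nat -> (Cmod (V j Z t) <= E * b)%R.
  move=> Hj; apply: (proj2 (circle_bound Z b Hb _ E (Rlt_le _ _ E0) _)) => n.
  rewrite /lev csumL_map /lnorm -rsumL_scal; apply: csumL_bound => y _.
  rewrite (Cmod_mult (mder j y).1) Cmod_zpow_unit Cmod_mder Rmult_1_r /wn.
  have := Rmult_le_compat_r _ _ _ (Cmod_ge_0 y.1) (HE j y.2 Hj); lra.
have HR j t : (j <= S l)%nat -> (Rabs (2 * Re (V j Z t)) <= 2 * (E * b))%R.
  move=> Hj; rewrite Rabs_mult (Rabs_pos_eq 2); last lra.
  by apply: Rmult_le_compat_l; [lra|apply: Rle_trans (re_le_Cmod _) (HV j t Hj)].
have Eb : (0 <= E * b)%R by apply: Rmult_le_pos; lra.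
have Lip s t : (Rabs (2 * Re (V l Z s) - 2 * Re (V l Z t)) <= 2 * (E * b) * Rabs (s - t))%R.
  have [||c [_ Hc]] := MVT_gen (fun t => 2 * Re (V l Z t))%R t s (fun t => 2 * Re (V (S l) Z t))%R.
  - by move=> u _; exact: (uf_derive Z b Hb).
  - by move=> u _; apply: derivable_continuous_pt; apply/ex_derive_Reals_0; eexists; exact: (uf_derive Z b Hb).
  by rewrite Hc Rabs_mult; apply: Rmult_le_compat_r; [exact: Rabs_pos|exact: HR].
pose P y := (exists j x, (j <= l)%nat /\ y = Rabs (Derive_n (uf Z) j x)) \/
    (exists x x', x <> x' /\ y = (Rabs (Derive_n (uf Z) l x - Derive_n (uf Z) l x') / Rpower (Rabs (x - x')) a)%R).
have UB y : P y -> (y <= 4 * E * b)%R.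
  move=> [[j [t [Hj ->]]]|[s [t [st ->]]]].
    by rewrite (proj2 (uf_Derive_n Z b Hb j t)); have := HR j t ltac:(lia); lra.
  rewrite !(proj2 (uf_Derive_n Z b Hb l _)).
  have h0 : (0 < Rabs (s - t))%R by apply: Rabs_pos_lt; lra.
  have p0 : (0 < Rpower (Rabs (s - t)) a)%R by exact: exp_pos.
  apply: (Rmult_le_reg_r (Rpower (Rabs (s - t)) a)) => //; rewrite /Rdiv Rmult_assoc Rinv_l; last lra.
  rewrite Rmult_1_r; case: (Rle_lt_dec 1 (Rabs (s - t))) => Hh.
    have Q : (1 <= Rpower (Rabs (s - t)) a)%R by rewrite -(Rpower_O (Rabs (s - t))) //; apply: Rle_Rpower; lra.
    have := HR l s ltac:(lia); have := HR l t ltac:(lia).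
    have := Rabs_triang (2 * Re (V l Z s)) (- (2 * Re (V l Z t))); rewrite Rabs_Ropp.
    have : (4 * E * b * 1 <= 4 * E * b * Rpower (Rabs (s - t)) a)%R by apply: Rmult_le_compat_l; lra.
    rewrite /Rminus; lra.
  apply: Rle_trans (Lip s t) _; apply: Rmult_le_compat; [lra|lra|lra|].
  rewrite -{1}(Rpower_1 (Rabs (s - t))) // /Rpower; apply: Rnot_lt_le => /exp_lt_inv.
  have L : (ln (Rabs (s - t)) <= 0)%R by rewrite -ln_1; apply: ln_le; lra.
  nra.
have P0 : P (Rabs (Derive_n (uf Z) 0 0)) by left; exists 0%nat, 0%R; split=> //; lia.
have [L1 L2] := Lub_Rbar_correct P.
have U1 : Rbar_le (Lub_Rbar P) (4 * E * b)%R by apply: L2 => y Py; exact: UB.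
have U2 := L1 _ P0.
have Fin : is_finite (Lub_Rbar P) by move: U1 U2; case: (Lub_Rbar P).
have EF : Finite (real (Lub_Rbar P)) = Lub_Rbar P by exact: Fin.
rewrite -EF /= in U1 U2.
split; last by split=> //; apply: Rle_trans U2; exact: Rabs_pos.
split; first by move=> t; rewrite /uf /V unit_pt_period.
split; first by move=> j t _; exact: (proj1 (uf_Derive_n Z b Hb j t)).
split=> //.
(* The exponent 0 is absent, so there is a periodic antiderivative in the angle, and the mean is
   zero. *)
pose Z' := slin (fun y => (/ (IZR y.2 * Ci) * y.1, y.2)) Z.
have Hb' m : (rs m (fun n => lnorm (Z' n)) <= b)%R.
  apply: Rle_trans (Hb m); apply: rs_le => n _; rewrite /lnorm /Z' /slin rsumL_map; apply: rsumL_le => y Hy.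
  have He : (y.2 <= -1)%Z := SZ n y Hy.
  have e0 : IZR y.2 <> 0%R by apply: not_0_IZR; lia.
  have i0 : IZR y.2 * Ci <> 0 by apply: Cmult_neq_0; [exact: RtoC_neq0|exact: Ci_neq0].
  rewrite /wn /= (Cmod_mult (/ _)) Cmod_inv // (Cmod_mult (IZR y.2)) Cmod_R Cmod_Ci Rmult_1_r -Rabs_inv.
  apply: Rmult_le_compat_r; first by have := wt_ge1 y.2; lra.
  by have := Rmult_le_compat_r _ _ _ (Cmod_ge_0 y.1) (inv_IZR_le1 y.2); lra.
have EV t : V 1 Z' t = V 0 Z t.
  apply: CS_ext => n; rewrite /Z' /slin map_map /lev !csumL_map; apply: csumL_ext => y Hy.
  have He : (y.2 <= -1)%Z := SZ n y Hy.
  have e0 : RtoC (IZR y.2) <> 0 by apply: RtoC_neq0; apply: not_0_IZR; lia.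
  by rewrite /mder /=; field; split=> //; exact: Ci_neq0.
have E0' : minus (2 * Re (V 0 Z' (2 * PI)))%R (2 * Re (V 0 Z' 0))%R = 0%R.
  by rewrite /V unit_pt_2PI; exact: minus_eq_zero.
rewrite -[X in is_RInt _ _ _ X]E0'.
apply: (is_RInt_derive (fun t => 2 * Re (V 0 Z' t))%R) => t _.
  by rewrite /uf -EV; exact: (uf_derive Z' b Hb').
by apply: ex_derive_continuous; eexists; exact: (uf_derive Z b Hb 0).
Qed.

(** * Weights on the coefficients and analytic dependence on rho *)

Definition wser (w : nat -> R) (X : ser) : ser := fun n => map (mscal (RtoC (w n))) (X n).

Lemma lnorm_wser w X n : lnorm (wser w X n) = (Rabs (w n) * lnorm (X n))%R.
Proof.
rewrite /wser /lnorm rsumL_map -rsumL_scal; elim: (X n) => //= y l ->.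
by rewrite /wn /mscal /= (Cmod_mult (RtoC (w n))) Cmod_R; ring.
Qed.

Lemma V0_pow X x t : V 0 (wser (fun n => x ^ n)%R X) t = val X x (unit_pt t).
Proof.
rewrite /V /val /CS; have E n : lev (map (mder 0) (wser (fun n => x ^ n)%R X n)) (unit_pt t) = RtoC (x ^ n) * lev (X n) (unit_pt t).
  rewrite /wser map_map /lev csumL_map -csumL_scal; apply: csumL_ext => y _; rewrite /mder /mscal [Cpow _ _]/= [fst _]/= [snd _]/=; ring.
congr (_, _); apply: Series_ext => n; rewrite E pow1 Rmult_1_r ?Re_mult ?Im_mult [Re (RtoC _)]/= [Im (RtoC _)]/=; ring.
Qed.

Lemma V0_bound Z b t : (forall m, (rs m (fun n => lnorm (Z n)) <= b)%R) ->
  asum (fun n => lev (map (mder 0) (Z n)) (unit_pt t)) 1 /\ (Cmod (V 0 Z t) <= b)%R.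
Proof.
move=> Hb; have H n : (Cmod (lev (map (mder 0) (Z n)) (unit_pt t)) <= 1%R * lnorm (Z n))%R.
  have -> : lev (map (mder 0) (Z n)) (unit_pt t) = lev (Z n) (unit_pt t).
    by rewrite /lev csumL_map; apply: csumL_ext => y _; rewrite /mder [Cpow _ _]/= Cmult_1_l.
  have := OK_lev (unit_pt t) Z n ltac:(left; rewrite /ann Cmod_unit; lra); lra.
have [H1 H2] := circle_bound Z b Hb _ 1%R ltac:(lra) H.
by split=> //; rewrite /V; lra.
Qed.

Lemma V0_lin w v c X t b b' : (forall m, (rs m (fun n => lnorm (wser w X n)) <= b)%R) ->
  (forall m, (rs m (fun n => lnorm (wser v X n)) <= b')%R) ->
  V 0 (wser (fun n => w n - c * v n)%R X) t = V 0 (wser w X) t - c * V 0 (wser v X) t.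
Proof.
move=> Hw Hv; have [A1 _] := V0_bound _ _ t Hw; have [A2 _] := V0_bound _ _ t Hv.
have E n : lev (map (mder 0) (wser (fun n => w n - c * v n)%R X n)) (unit_pt t)
  = lev (map (mder 0) (wser w X n)) (unit_pt t) + - RtoC c * lev (map (mder 0) (wser v X n)) (unit_pt t).
  rewrite /wser !map_map /lev !csumL_map -csumL_scal -csumL_add; apply: csumL_ext => y _.
  cbn beta; rewrite RtoC_minus RtoC_mult /mder /mscal.
  have c0 (u : C) : Cpow u 0 = 1 by [].
  by rewrite !c0; cbn [fst snd]; ring.
have A3 : asum (fun n => - RtoC c * lev (map (mder 0) (wser v X n)) (unit_pt t)) 1.
  apply: (proj1 (circle_bound (wser v X) b' Hv _ (Rabs c) (Rabs_pos c) _)) => n.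
  rewrite (Cmod_mult (- RtoC c)) Cmod_opp Cmod_R; apply: Rmult_le_compat_l; first exact: Rabs_pos.
  have -> : lev (map (mder 0) (wser v X n)) (unit_pt t) = lev (wser v X n) (unit_pt t).
    by rewrite /lev csumL_map; apply: csumL_ext => y _; rewrite /mder [Cpow _ _]/= Cmult_1_l.
  by apply: (OK_lev _ (wser v X)); left; rewrite /ann Cmod_unit; lra.
by rewrite /V (CS_ext _ _ _ E) CS_plus // CS_scal //; ring.
Qed.

Lemma norm_pair_le (U W : NormedModule R_AbsRing) (u : U) (w : W) (b : R) :
  (norm u <= b)%R -> (norm w <= b)%R -> (norm (u, w) <= 2 * b)%R.
Proof.
move=> Hu Hw; apply: Rle_trans (proj2 (norm_prod u w)) _.
have s2 : (sqrt 2 <= 2)%R by rewrite -{2}(sqrt_square 2); [apply: sqrt_le_1|]; lra.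
have m0 : (0 <= Rmax (norm u) (norm w))%R by apply: Rle_trans (norm_ge_0 u) (Rmax_l _ _).
by apply: Rmult_le_compat => //; [exact: sqrt_pos|exact: Rmax_lub].
Qed.

Lemma bigmax_le M (F : 'I_M -> R) (b : R) : (0 <= b)%R -> (forall k, (F k <= b)%R) ->
  (0 <= \big[Rmax/0%R]_(k < M) F k <= b)%R.
Proof.
move=> b0 H; elim/big_rec: _ => [|i y _ [H1 H2]]; first by lra.
by split; [apply: Rle_trans H1 (Rmax_r _ _)|exact: Rmax_lub].
Qed.

(* Weights of the Taylor expansion at [s] of the [N]-th power. *)
Definition tw (s : R) (m N : nat) : R := if Nat.leb m N then (Binomial.C N m * s ^ (N - m))%R else 0%R.

Lemma sum_f_rs f n : sum_f_R0 f n = rs (S n) f.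
Proof. by elim: n => [|n IH] /=; [ring|rewrite IH]. Qed.

Lemma tw_sum s h N : ((h + s) ^ N = rs (S N) (fun m => h ^ m * tw s m N))%R.
Proof.
rewrite binomial sum_f_rs; apply: rs_ext => m Hm; rewrite /tw (_ : Nat.leb m N = true); last by apply/Nat.leb_le; lia.
ring.
Qed.

Lemma binom_ge0 n m : (0 <= Binomial.C n m)%R.
Proof.
apply: Rmult_le_pos; first by apply: pos_INR.
by apply: Rlt_le; apply: Rinv_0_lt_compat; apply: Rmult_lt_0_compat; apply: lt_0_INR; exact: lt_O_fact.
Qed.

Lemma tw_abs s m N : Rabs (tw s m N) = tw (Rabs s) m N.
Proof.
rewrite /tw; case: (Nat.leb m N); last by rewrite Rabs_R0.
by rewrite Rabs_mult Rabs_pos_eq ?RPow_abs //; exact: binom_ge0.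
Qed.

Lemma tw_ge0 s m N : (0 <= s)%R -> (0 <= tw s m N)%R.
Proof. by move=> H; rewrite -(Rabs_pos_eq s) // -tw_abs; exact: Rabs_pos. Qed.

(** d^m times the weight is one term of the binomial expansion of (d + s)^N, all of whose terms are
    nonnegative. *)
Lemma tw_le s d m N : (0 <= s)%R -> (0 < d)%R -> (tw s m N <= / d ^ m * (d + s) ^ N)%R.
Proof.
move=> s0 d0; have dm : (0 < d ^ m)%R by exact: pow_lt.
have T i : (0 <= d ^ i * tw s i N)%R by apply: Rmult_le_pos; [apply: pow_le; lra|exact: tw_ge0].
have dN : (0 <= (d + s) ^ N)%R by apply: pow_le; lra.
apply: (Rmult_le_reg_l (d ^ m)) => //; rewrite -Rmult_assoc Rinv_r ?Rmult_1_l; last lra.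
case: (Nat.le_gt_cases m N) => H; last first.
  by rewrite /tw (_ : Nat.leb m N = false) ?Rmult_0_r //; apply/Nat.leb_gt.
rewrite tw_sum; apply: Rle_trans (_ : rs (S m) (fun i => d ^ i * tw s i N) <= _)%R; last by apply: rs_mono => //; lia.
by rewrite /=; have := rs_ge0 m _ T; lra.
Qed.

(* The remainder of the Taylor expansion vanishes up to order [n]. *)
Lemma tw_rem s h n N : (Rabs ((h + s) ^ N - rs (S n) (fun m => h ^ m * tw s m N))
  <= if Nat.leb N n then 0 else (Rabs h + Rabs s) ^ N)%R.
Proof.
have Z m p : (N < m)%nat -> rs (m + p) (fun i => h ^ i * tw s i N)%R = rs m (fun i => h ^ i * tw s i N)%R.
  move=> Hm; elim: p => [|p IH]; first by rewrite Nat.add_0_r.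
  rewrite Nat.add_succ_r /= IH /tw (_ : Nat.leb (m + p) N = false); last by apply/Nat.leb_gt; lia.
  ring.
case: (Nat.leb_spec N n) => H.
  have Z' := Z (S N) (n - N)%nat (Nat.lt_succ_diag_r N).
  have E : (S N + (n - N) = S n)%nat by lia.
  rewrite E in Z'; rewrite tw_sum Z' Rminus_diag_eq // Rabs_R0; exact: Rle_refl.
have T i : (0 <= Rabs h ^ i * tw (Rabs s) i N)%R.
  by apply: Rmult_le_pos; [apply: pow_le; exact: Rabs_pos|apply: tw_ge0; exact: Rabs_pos].
rewrite (tw_sum (Rabs s)) tw_sum.
have rsS F q : rs (S q) F = (rs q F + F q)%R by [].
have D p : (n <= p)%nat -> (Rabs (rs (S p) (fun i => h ^ i * tw s i N) - rs (S n) (fun i => h ^ i * tw s i N))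
   <= rs (S p) (fun i => Rabs h ^ i * tw (Rabs s) i N) - rs (S n) (fun i => Rabs h ^ i * tw (Rabs s) i N))%R.
  elim=> [|p' _ IH]; first by rewrite !Rminus_diag_eq // Rabs_R0; exact: Rle_refl.
  set f := (fun i : nat => _) in IH *; set g := (fun i : nat => Rabs h ^ i * _)%R in IH *.
  have -> : (rs (S (S p')) f - rs (S n) f = (rs (S p') f - rs (S n) f) + f (S p'))%R by rewrite (rsS f (S p')); ring.
  have -> : (rs (S (S p')) g - rs (S n) g = (rs (S p') g - rs (S n) g) + g (S p'))%R by rewrite (rsS g (S p')); ring.
  apply: Rle_trans (Rabs_triang _ _) _; apply: Rplus_le_compat => //.
  by rewrite /f /g Rabs_mult tw_abs RPow_abs; exact: Rle_refl.
have := D N ltac:(lia); have := rs_ge0 (S n) _ T; lra.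
Qed.

Section Curve.
Variables (M l : nat) (a r : R).
Variables (Smu Snu SQ Sz Sg : 'I_M -> ser) (Sc ST : ser).
Hypotheses (Ha : (0 < a < 1)%R) (r0 : (0 < r)%R).

Definition rv (w : nat -> R) (X : ser) : R := Re (V 0 (wser w X) 0).
(** The tuple of unknowns as a linear function of the weights: w n = x^n gives the point of the
    curve at x, and [tw x0 m] gives the m-th Taylor coefficient at x0. *)
Definition Bld (w : nat -> R) : unknowns M :=
  (fun k => uf (wser w (Smu k)), fun k => uf (wser w (Snu k)), fun k => rv w (SQ k),
    ((fun k => V 0 (wser w (Sz k)) 0, fun k => rv w (Sg k)), V 0 (wser w Sc) 0, rv w ST)).

Definition fam : list ser :=
  Sc :: ST :: map Smu (idx M) ++ map Snu (idx M) ++ map SQ (idx M) ++ map Sz (idx M) ++ map Sg (idx M).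
Definition maj (n : nat) : R := rsumL (fun X => lnorm (X n)) fam.

Hypothesis Cfam : forall X, In X fam -> conv r X.
Hypotheses (Hmu : forall k, supp (fun e => e <= -1)%Z (Smu k)) (Hnu : forall k, supp (fun e => e <= -1)%Z (Snu k)).

Definition adm (w : nat -> R) (b : R) : Prop := forall m, (rs m (fun n => Rabs (w n) * maj n) <= b)%R.

Lemma adm_ser w b X : adm w b -> In X fam -> forall m, (rs m (fun n => lnorm (wser w X n)) <= b)%R.
Proof.
move=> H HX m; apply: Rle_trans (H m); apply: rs_le => n _; rewrite lnorm_wser.
apply: Rmult_le_compat_l; first exact: Rabs_pos.
rewrite /maj; elim: fam HX => //= W s IH [->|/IH K].
  by have := rsumL_ge0 (fun X0 => lnorm (X0 n)) s (fun X0 => lnorm_ge0 (X0 n)); lra.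
by have := lnorm_ge0 (W n); lra.
Qed.

Lemma in_fam k : [/\ In (Smu k) fam, In (Snu k) fam, In (SQ k) fam, In (Sz k) fam & In (Sg k) fam].
Proof.
have I (F : 'I_M -> ser) : In (F k) (map F (idx M)) by apply: in_map; exact: In_idx.
by split; do 2 right; rewrite !in_app_iff; auto 10.
Qed.

Lemma maj_ge0 n : (0 <= maj n)%R.
Proof. by apply: rsumL_ge0 => X; exact: lnorm_ge0. Qed.

Lemma adm_r : exists b, forall m, (rs m (fun n => maj n * r ^ n) <= b)%R.
Proof.
rewrite /maj; elim: fam Cfam => [|W s IH] H.
  by exists 0%R => m; rewrite (rs_ext _ _ (fun _ => 0 * 0)%R) ?rs_scal; [lra|move=> i _ /=; ring].
have [b1 H1] := H W (or_introl erefl); have [b2 H2] := IH (fun X HX => H X (or_intror HX)).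
exists (b1 + b2)%R => m; rewrite (rs_ext _ _ (fun n => lnorm (W n) * r ^ n + rsumL (fun X => lnorm (X n)) s * r ^ n)%R); last by move=> i _ /=; ring.
by rewrite rs_add; apply: Rplus_le_compat; [exact: H1|exact: H2].
Qed.

Lemma Bld_lin w v c b b' : adm w b -> adm v b' ->
  Bld (fun n => w n - c * v n)%R = minus (Bld w) (scal c (Bld v)).
Proof.
move=> Aw Av.
have E X t : In X fam -> V 0 (wser (fun n => w n - c * v n)%R X) t = V 0 (wser w X) t - c * V 0 (wser v X) t.
  by move=> HX; exact: (V0_lin _ _ _ _ _ b b' (adm_ser w b X Aw HX) (adm_ser v b' X Av HX)).
have ER X t : In X fam -> Re (V 0 (wser (fun n => w n - c * v n)%R X) t) = (Re (V 0 (wser w X) t) - c * Re (V 0 (wser v X) t))%R.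
  by move=> HX; rewrite E // Re_minus Re_mult [Re (RtoC _)]/= [Im (RtoC _)]/=; ring.
have pe (x y : unknowns M) : x.1.1.1 = y.1.1.1 -> x.1.1.2 = y.1.1.2 -> x.1.2 = y.1.2 ->
   x.2.1.1.1 = y.2.1.1.1 -> x.2.1.1.2 = y.2.1.1.2 -> x.2.1.2 = y.2.1.2 -> x.2.2 = y.2.2 -> x = y.
  by case: x => [[[? ?] ?] [[[? ?] ?] ?]]; case: y => [[[? ?] ?] [[[? ?] ?] ?]] /= -> -> -> -> -> -> ->.
apply: pe.
- apply: functional_extensionality => k; apply: functional_extensionality => t; have [F _ _ _ _] := in_fam k.
  change (uf (wser (fun n => w n - c * v n)%R (Smu k)) t = (uf (wser w (Smu k)) t + - (c * uf (wser v (Smu k)) t))%R).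
  by rewrite /uf ER //; ring.
- apply: functional_extensionality => k; apply: functional_extensionality => t; have [_ F _ _ _] := in_fam k.
  change (uf (wser (fun n => w n - c * v n)%R (Snu k)) t = (uf (wser w (Snu k)) t + - (c * uf (wser v (Snu k)) t))%R).
  by rewrite /uf ER //; ring.
- apply: functional_extensionality => k; have [_ _ F _ _] := in_fam k.
  change (rv (fun n => w n - c * v n)%R (SQ k) = (rv w (SQ k) + - (c * rv v (SQ k)))%R).
  by rewrite /rv ER.
- apply: functional_extensionality => k; have [_ _ _ F _] := in_fam k.
  change (V 0 (wser (fun n => w n - c * v n)%R (Sz k)) 0 = V 0 (wser w (Sz k)) 0 + - (scal c (V 0 (wser v (Sz k)) 0 : C_R_NormedModule))).
  by rewrite E // scal_C.
- apply: functional_extensionality => k; have [_ _ _ _ F] := in_fam k.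
  change (rv (fun n => w n - c * v n)%R (Sg k) = (rv w (Sg k) + - (c * rv v (Sg k)))%R).
  by rewrite /rv ER.
- change (V 0 (wser (fun n => w n - c * v n)%R Sc) 0 = V 0 (wser w Sc) 0 + - (scal c (V 0 (wser v Sc) 0 : C_R_NormedModule))).
  by rewrite E ?scal_C //; left.
change (rv (fun n => w n - c * v n)%R ST = (rv w ST + - (c * rv v ST))%R).
by rewrite /rv ER //; right; left.
Qed.

Lemma Bld_bound : exists K, (0 <= K)%R /\ forall w b, adm w b ->
  unknowns_mem l a (Bld w) /\ (0 <= unknowns_norm l a (Bld w) <= K * b)%R.
Proof.
have [K [K0 HK]] := holder_unit l a Ha.
exists (K + K + 2 + 16)%R; split; first lra; move=> w b Aw.
have b0 : (0 <= b)%R by exact: Rle_trans (Rle_refl 0) (Aw 0%nat).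
have SW X : supp (fun e => e <= -1)%Z X -> supp (fun e => e <= -1)%Z (wser w X).
  by move=> H n y /in_map_iff [y' [<- /H]].
have Fm k := HK (wser w (Smu k)) b (adm_ser _ _ _ Aw (let: And5 F _ _ _ _ := in_fam k in F)) (SW _ (Hmu k)).
have Fn k := HK (wser w (Snu k)) b (adm_ser _ _ _ Aw (let: And5 _ F _ _ _ := in_fam k in F)) (SW _ (Hnu k)).
have VB X : In X fam -> (Cmod (V 0 (wser w X) 0) <= b)%R.
  by move=> HX; exact: (proj2 (V0_bound _ _ 0 (adm_ser _ _ _ Aw HX))).
have RB X : In X fam -> (Rabs (rv w X) <= b)%R by move=> HX; apply: Rle_trans (re_le_Cmod _) (VB X HX).
split; first by move=> k; split; [exact: (proj1 (Fm k))|exact: (proj1 (Fn k))].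
have Kb : (0 <= K * b)%R by exact: Rmult_le_pos.
have NC (u : C) : (Cmod u <= b)%R -> (norm (u : C_R_NormedModule) <= 2 * b)%R.
  move=> H; case: u H => p q H; apply: (norm_pair_le R_NormedModule R_NormedModule).
    by apply: Rle_trans H; exact: (re_le_Cmod (p, q)).
  by apply: Rle_trans H; exact: (im_le_Cmod (p, q)).
have P1 := bigmax_le M (fun k => real (holder_norm l a (uf (wser w (Smu k))))) _ Kb (fun k => proj2 (proj2 (Fm k))).
have P2 := bigmax_le M (fun k => real (holder_norm l a (uf (wser w (Snu k))))) _ Kb (fun k => proj2 (proj2 (Fn k))).
have FR (F : 'I_M -> ser) : (forall k, In (F k) fam) -> (norm (V := fin_NormedModule 'I_M R_NormedModule) (fun k => rv w (F k)) <= b)%R.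
  by move=> HF; apply: (fin_norm_le (K := R_AbsRing)) => // k; exact: RB.
have P3 := FR SQ (fun k => let: And5 _ _ F _ _ := in_fam k in F).
have P4 := FR Sg (fun k => let: And5 _ _ _ _ F := in_fam k in F).
have P5 : (norm (V := fin_NormedModule 'I_M C_R_NormedModule) (fun k => V 0 (wser w (Sz k)) 0) <= 2 * b)%R.
  apply: (fin_norm_le (K := R_AbsRing)) => [|k]; first lra.
  by apply: NC; apply: VB; have [] := in_fam k.
have P6 : (norm (V := params_NormedModule M) ((fun k => V 0 (wser w (Sz k)) 0, fun k => rv w (Sg k)), V 0 (wser w Sc) 0, rv w ST) <= 2 * (2 * (2 * (2 * b))))%R.
  apply: norm_pair_le; last first.
    by apply: Rle_trans (RB ST (or_intror (or_introl erefl))) _; lra.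
  apply: norm_pair_le; last by apply: Rle_trans (NC _ (VB Sc (or_introl erefl))) _; lra.
  by apply: norm_pair_le; [exact: P5|apply: Rle_trans P4 _; lra].
have N3 := norm_ge_0 (V := fin_NormedModule 'I_M R_NormedModule) (fun k => rv w (SQ k)).
have N6 := norm_ge_0 (V := params_NormedModule M) ((fun k => V 0 (wser w (Sz k)) 0, fun k => rv w (Sg k)), V 0 (wser w Sc) 0, rv w ST).
rewrite /unknowns_norm /Bld /=; split.
  apply: Rplus_le_le_0_compat; last exact: N6.
  apply: Rplus_le_le_0_compat; last exact: N3.
  by apply: Rplus_le_le_0_compat; [exact: (proj1 P1)|exact: (proj1 P2)].
by apply: Rle_trans (Rplus_le_compat _ _ _ _ (Rplus_le_compat _ _ _ _ (Rplus_le_compat _ _ _ _ (proj2 P1) (proj2 P2)) P3) P6) _; lra.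
Qed.

(** By linearity the Taylor remainder at x0 is the tuple built from the remainders of the scalar
    powers x^N, so its norm is at most K times the tail of one convergent numerical series. *)
Lemma curve_analytic (r1 : R) : (r1 <= r)%R ->
  analytic_curve (V := unknowns M) (unknowns_mem l a) (unknowns_norm l a) r1 (fun x => Bld (fun n => x ^ n)%R).
Proof.
move=> Hr; have [b Hb] := adm_r; have [K [K0 HK]] := Bld_bound.
have mono (w : nat -> R) c s : (0 <= c)%R -> (0 <= s <= r)%R -> (forall n, (Rabs (w n) <= c * s ^ n)%R) -> adm w (c * b).
  move=> c0 Hs H m; apply: Rle_trans (_ : c * rs m (fun n => maj n * r ^ n) <= _)%R; last exact: Rmult_le_compat_l.
  rewrite -rs_scal; apply: rs_le => n _; rewrite (_ : c * (maj n * r ^ n) = (c * r ^ n) * maj n)%R; last by ring.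
  apply: Rmult_le_compat_r; first exact: maj_ge0.
  by apply: Rle_trans (H n) _; apply: Rmult_le_compat_l => //; exact: pow_incr.
have Apow x : (Rabs x < r1)%R -> adm (fun n => x ^ n)%R (1 * b).
  by move=> Hx; apply: (mono _ 1%R (Rabs x)); [lra|split; [exact: Rabs_pos|lra]|move=> n; rewrite RPow_abs; lra].
split; first by move=> x Hx; exact: (proj1 (HK _ _ (Apow x Hx))).
(* Half the distance to r: d + |x0| is still below r, so the majorant converges there. *)
move=> x0 Hx0; have ax0 := Rabs_pos x0; pose d := ((r - Rabs x0) / 2)%R; have d0 : (0 < d)%R by rewrite /d; lra.
have Atw m : adm (tw x0 m) (/ d ^ m * b).
  apply: (mono _ _ (d + Rabs x0)%R); [by apply: Rlt_le; apply: Rinv_0_lt_compat; exact: pow_lt|by rewrite /d; lra|].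
  by move=> n; rewrite tw_abs; exact: tw_le.
exists (fun m => Bld (tw x0 m)), (mkposreal d d0); split; first by move=> m; exact: (proj1 (HK _ _ (Atw m))).
move=> x Hx Hxd; rewrite /= in Hxd; set h := (x - x0)%R in Hxd *.
have Ex : x = (h + x0)%R by rewrite /h; ring.
pose W n N := ((h + x0) ^ N - rs (S n) (fun m => h ^ m * tw x0 m N))%R.
set s := (Rabs h + Rabs x0)%R; have ah := Rabs_pos h; have Hs : (0 <= s <= r)%R by rewrite /s; move: Hxd; rewrite /d; lra.
have AW n : adm (W n) (1 * b).
  apply: (mono _ 1%R s) => //; first lra; move=> N; apply: Rle_trans (tw_rem x0 h n N) _; rewrite Rmult_1_l -/s.
  by case: (Nat.leb N n); [apply: pow_le; lra|exact: Rle_refl].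
have EW n : minus (Bld (fun N => x ^ N)%R) (sum_n (fun m => scal (h ^ m)%R (Bld (tw x0 m))) n) = Bld (W n).
  elim: n => [|n IH].
    rewrite sum_O /= -(Bld_lin _ _ _ _ _ (Apow x Hx) (Atw 0%nat)); congr Bld.
    by apply: functional_extensionality => N; rewrite /W -Ex /=; ring.
  have mp (G : AbelianGroup) (u v w : G) : minus u (plus v w) = minus (minus u v) w.
    by rewrite /minus opp_plus plus_assoc.
  rewrite sum_Sn mp IH -(Bld_lin _ _ _ _ _ (AW n) (Atw (S n))); congr Bld.
  by apply: functional_extensionality => N; rewrite /W [rs (S (S n)) _]/=; rewrite /=; ring.
pose y N := (s ^ N * maj N)%R.
have y0 N : (0 <= y N)%R by apply: Rmult_le_pos; [apply: pow_le; lra|exact: maj_ge0].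
have yb m : (rs m y <= 1 * b)%R.
  have := mono (fun N => s ^ N)%R 1%R s ltac:(lra) Hs ltac:(move=> n; rewrite Rabs_pos_eq; [lra|apply: pow_le; lra]) m.
  by congr (_ <= _)%R; apply: rs_ext => i _; rewrite /y Rabs_pos_eq //; apply: pow_le; lra.
have [B [HB HB']] := rs_bounded_lim y _ y0 yb.
have rsS F q : rs (S q) F = (rs q F + F q)%R by [].
(* The weight [W n] vanishes at indices N <= n and is at most s^N beyond, so its sums are bounded by
   the tail of [y]. *)
have tail n : adm (W n) (B - rs (S n) y).
  have R0 m : (rs m (fun N => Rabs (W n N) * maj N) + rs (S n) y <= rs (S n + m) y)%R.
    have Q p : (rs p (fun N => Rabs (W n N) * maj N) <= rs p (fun N => if Nat.leb N n then 0 else y N))%R.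
      apply: rs_le => N _; have := tw_rem x0 h n N; rewrite -/(W n N) -/s; case: (Nat.leb N n) => H.
        by have := Rmult_le_compat_r _ _ _ (maj_ge0 N) H; lra.
      exact: Rmult_le_compat_r (maj_ge0 N) H.
    have Q2 : rs (S n) (fun N => if Nat.leb N n then 0%R else y N) = 0%R.
      rewrite (rs_ext _ _ (fun _ => 0 * 0)%R) ?rs_scal; first by ring.
      by move=> i Hi; rewrite (_ : Nat.leb i n = true); [ring|apply/Nat.leb_le; lia].
    have Q3 p : (rs (S n + p) (fun N => if Nat.leb N n then 0%R else y N) + rs (S n) y = rs (S n + p) y)%R.
      elim: p => [|p IH]; first by rewrite Nat.add_0_r Q2; ring.
      rewrite Nat.add_succ_r (rsS _ (S n + p)%nat) (rsS y (S n + p)%nat) -IH (_ : Nat.leb (S n + p) n = false) //.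
        by rewrite /=; ring.
      by apply/Nat.leb_gt; lia.
    rewrite -(Q3 m); apply: Rplus_le_compat_r; apply: Rle_trans (Q m) _.
    by apply: rs_mono; [move=> i; case: (Nat.leb i n); [lra|exact: y0]|lia].
  by move=> m; have := R0 m; have := HB (S n + m)%nat; lra.
have bd n : (0 <= unknowns_norm l a (Bld (W n)) <= K * (B - rs (S n) y))%R by exact: (proj2 (HK _ _ (tail n))).
apply: (is_lim_seq_ext (fun n => unknowns_norm l a (Bld (W n)))); first by move=> n; rewrite EW.
apply: (is_lim_seq_le_le (fun _ => 0%R) _ (fun n => K * (B - rs (S n) y))%R) => //; first exact: is_lim_seq_const.
apply/is_lim_seq_spec => eps; have [P HP] := HB' (eps / (K + 1))%R ltac:(apply: Rdiv_lt_0_compat; [exact: cond_pos|lra]).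
have e0 : (0 < eps / (K + 1))%R by apply: Rdiv_lt_0_compat; [exact: cond_pos|lra].
have Ee : (pos eps = K * (eps / (K + 1)) + eps / (K + 1))%R by field; lra.
exists P => n Hn; have H1 := HP (S n) ltac:(lia); have H2 := HB (S n).
rewrite Rminus_0_r Rabs_pos_eq; last by apply: Rmult_le_pos; lra.
have : (K * (B - rs (S n) y) <= K * (eps / (K + 1)))%R by apply: Rmult_le_compat_l; lra.
lra.
Qed.
End Curve.

(** * The curve of densities and parameters, and the theorem *)

Lemma unit_pt_0 : unit_pt 0 = 1.
Proof. by rewrite /unit_pt cos_0 sin_0. Qed.

Lemma RtoC_Re_scal (x : R) (u : C) : Re (x * u) = (x * Re u)%R.
Proof. by rewrite Re_mult [Re (RtoC _)]/= [Im (RtoC _)]/=; ring. Qed.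

Lemma RtoC_Im_scal (x : R) (u : C) : Im (x * u) = (x * Im u)%R.
Proof. by rewrite Im_mult [Re (RtoC _)]/= [Im (RtoC _)]/=; ring. Qed.

Lemma conv_scal r c X : (0 < r)%R -> conv r X -> conv r (c [:] X).
Proof. by move=> r0 H; apply: conv_slin => //; exact: bounded_mscal. Qed.

Lemma params_eq M (L L' : params M) : (forall k, center L k = center L' k) ->
  (forall k, Defs.circ L k = Defs.circ L' k) -> speed L = speed L' -> period L = period L' -> L = L'.
Proof.
case: L => [[[z g] c] T]; case: L' => [[[z' g'] c'] T']; rewrite /center /Defs.circ /speed /period /=.
by move=> /functional_extensionality -> /functional_extensionality -> -> ->.
Qed.

Section ParameterCurve.
Variables (M : nat) (z0 : 'I_M -> C) (g0 : 'I_M -> R) (c0 : C) (T0 : R) (Y : comp M -> ser) (r : R).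
Hypotheses (r0 : (0 < r)%R) (Yconv : forall i, conv r (Y i)).

Definition ctr_ser k : ser := sK (z0 k) [+] ssh (zh M Y k).
Definition per_ser : ser := sK T0 [+] ssh (Y (YC (Period M))).

Lemma conv_ctr k : conv r (ctr_ser k).
Proof.
apply: conv_sadd; first exact: conv_scst.
by apply: conv_ssh => //; apply: conv_sadd => //; exact: conv_scal.
Qed.

Lemma conv_per : conv r per_ser.
Proof.
by rewrite /per_ser; apply: conv_sadd; [exact: conv_scst|apply: (conv_ssh _ _ r0); exact: Yconv].
Qed.

Lemma conv_gam k : conv r (gam M g0 Y k).
Proof.
by rewrite /gam; apply: conv_sadd; [exact: conv_scst|apply: (conv_ssh _ _ r0); exact: Yconv].
Qed.

Lemma conv_spd : conv r (spd M c0 Y).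
Proof.
apply: conv_sadd; first exact: conv_scst.
by apply: conv_ssh => //; apply: conv_sadd => //; exact: conv_scal.
Qed.

(** The curve used for the flow is the linear construction with weights x^n; parameter series are
    evaluated at tau = 1. *)
Lemma curve_eq x : (Rabs x < r)%R ->
  Bld M (muS M (fun k => Y (MM k))) (muS M (fun k => Y (NN k))) (fun k => ssh (Y (QQ k)))
    ctr_ser (gam M g0 Y) (spd M c0 Y) per_ser (fun n => x ^ n)%R
  = (dens M x (fun k => Y (MM k)), dens M x (fun k => Y (NN k)), fun k => (x * qr M Y x k)%R, Lx M z0 g0 c0 T0 Y x).
Proof.
move=> Hx; have C1 : (Cmod 1 <= 4)%R by rewrite Cmod_1; lra.
have H0 i : hv r x 1 (Y i) (val (Y i) x 1) by apply: hv_self => //; exact: OK1.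
have Hz k : hv r x 1 (zh M Y k) (zhv M Y x k).
  by apply: (hv_add r x 1 Hx); [exact: H0|apply: (hv_scal r x 1 Hx); exact: H0].
have D X : (fun k t => 2 * Re (V 0 (wser (fun n => x ^ n)%R (muS M X k)) t))%R = dens M x X.
  by apply: functional_extensionality => k; apply: functional_extensionality => t; rewrite V0_pow.
rewrite /Bld /rv; congr (_, _, _, _).
- exact: D.
- exact: D.
- apply: functional_extensionality => k; rewrite V0_pow unit_pt_0.
  by rewrite (hv_val _ _ _ _ _ (hv_sh r x 1 Hx _ _ (H0 (QQ k)))) RtoC_Re_scal.
apply: params_eq => [k|k||]; rewrite /Lx /center /Defs.circ /speed /period; cbn [fst snd]; rewrite V0_pow unit_pt_0.
- exact: (hv_val _ _ _ _ _ (hv_add r x 1 Hx _ _ _ _ (hv_cst r x 1 _ C1) (hv_sh r x 1 Hx _ _ (Hz k)))).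
- rewrite (hv_val _ _ _ _ _ (hv_add r x 1 Hx _ _ _ _ (hv_cst r x 1 _ C1) (hv_sh r x 1 Hx _ _ (H0 (YC (Circulation k)))))).
  by rewrite Re_plus RtoC_Re_scal.
- apply: (hv_val r x _ 1); apply: (hv_add r x 1 Hx _ _ _ _ (hv_cst r x 1 _ C1)); apply: (hv_sh r x 1 Hx).
  by apply: (hv_add r x 1 Hx); [exact: H0|apply: (hv_scal r x 1 Hx); exact: H0].
rewrite (hv_val _ _ _ _ _ (hv_add r x 1 Hx _ _ _ _ (hv_cst r x 1 _ C1) (hv_sh r x 1 Hx _ _ (H0 (YC (Period M)))))).
by rewrite Re_plus RtoC_Re_scal.
Qed.

Lemma parameter_curve_analytic l a r1 : (0 < a < 1)%R -> (r1 <= r)%R ->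
  (forall k, supp ext_exp (Y (MM k)) /\ supp ext_exp (Y (NN k))) ->
  analytic_curve (V := unknowns M) (unknowns_mem l a) (unknowns_norm l a) r1
    (fun x => (dens M x (fun k => Y (MM k)), dens M x (fun k => Y (NN k)), fun k => (x * qr M Y x k)%R, Lx M z0 g0 c0 T0 Y x)).
Proof.
move=> Ha Hr HY.
have Sm (X : 'I_M -> ser) : (forall k, supp ext_exp (X k)) -> forall k, supp (fun e => e <= -1)%Z (muS M X k).
  by move=> H k; apply: supp_ssh; apply: supp_slin (H k) => y; rewrite /ext_exp /=; lia.
have Cm (X : 'I_M -> ser) : (forall k, conv r (X k)) -> forall k, conv r (muS M X k).
  by move=> H k; apply: conv_ssh => //; apply: conv_slin => //; exact: bounded_mint.
have [|A1 A2] := curve_analytic M l a r (muS M (fun k => Y (MM k))) (muS M (fun k => Y (NN k))) (fun k => ssh (Y (QQ k)))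
    ctr_ser (gam M g0 Y) (spd M c0 Y) per_ser Ha r0 _ (Sm _ (fun k => proj1 (HY k))) (Sm _ (fun k => proj2 (HY k))) r1 Hr.
  move=> X; rewrite /fam /= !in_app_iff => -[<-|[<-|[|[|[|[|]]]]]]; first exact: conv_spd.
  - exact: conv_per.
  - by move=> /in_map_iff [k [<- _]]; exact: Cm.
  - by move=> /in_map_iff [k [<- _]]; exact: Cm.
  - by move=> /in_map_iff [k [<- _]]; exact: conv_ssh.
  - by move=> /in_map_iff [k [<- _]]; exact: conv_ctr.
  by move=> /in_map_iff [k [<- _]]; exact: conv_gam.
split.
  by move=> x Hx; rewrite -curve_eq; [exact: A1|lra].
move=> x0 Hx0; have [A [d [H1 H2]]] := A2 x0 Hx0; exists A, d; split=> // x Hx Hd.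
by rewrite -curve_eq; [exact: H2|lra].
Qed.
End ParameterCurve.

Lemma mfun_shift_pt w (g h : C -> C) z v : g z = h z -> mfun_shift w g z v <-> mfun_shift w h z v.
Proof. by rewrite /mfun_shift => ->. Qed.


From mathcomp Require Import boot.ssrnat boot.seq.

Theorem theorem1p1 (M : nat) (hM : (1 <= M)%coq_nat)
    (l : nat) (hl : (2 <= l)%coq_nat) (a : R) (ha : (0 < a < 1)%R)
    (L0 : params M) (hL0 : steady_point_vortex L0) (hnd : nondegenerate L0)
    (sel : coord M -> bool) (hsel : splitting sel L0) :
  exists (rho1 : R) (f : R -> C -> C) (w : R -> mfun)
         (mu nu : R -> 'I_M -> R -> R) (Q : R -> 'I_M -> R) (L : R -> params M),
    (0 < rho1)%R
    /\ analytic_curve (V := unknowns M) (unknowns_mem l a) (unknowns_norm l a)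
         rho1 (fun rho => (mu rho, nu rho, Q rho, L rho))
    /\ (forall rho, (Rabs rho < rho1)%R ->
          (forall i, sel i = false -> coord_val i (L rho) = coord_val i L0)
          /\ (forall z, conf_domain (L rho) rho z ->
                f rho z = z + RtoC (rho ^ 2) * layer (L rho) rho (mu rho) z)
          /\ (forall z, conf_domain (L rho) rho z -> forall v,
                w rho z v <->
                mfun_shift (pv_potential (L rho))
                  (fun y => RtoC rho * layer (L rho) rho (nu rho) y) z v))
    /\ (forall rho, (0 < Rabs rho < rho1)%R ->
          hollow_vortex l a (f rho) (w rho) (Q rho) (L rho) rho)
    /\ (forall z, f 0%R z = z)
    /\ (forall z v, w 0%R z v <-> pv_potential L0 z v)
    /\ (forall k, Q 0%R k = 0%R)
    /\ L 0%R = L0.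
Proof.
have [zm [zm0 zms]] := velocity_matrix M L0 hL0 sel hsel; have [_ [T0p [g0nz _]]] := hL0.
have [Y [r [b [r0 b0 Yc Ys HY]]]] := vortex_series M (center L0) (Defs.circ L0) (speed L0) (period L0) zm
  T0p g0nz (steady_sin M L0 hL0) (steady_vel M L0 hL0) zms.
pose mm k := Y (MM k); pose nn k := Y (NN k).
pose L x := Lx M (center L0) (Defs.circ L0) (speed L0) (period L0) Y x.
(* One bound for all |x| <= r, found before rho1 is chosen. *)
have [B [B0 HB]] : exists B, (0 <= B)%R /\ forall k, In k (idx M) ->
    forall x z, (Rabs x <= r)%R -> OK z (slin mint (mm k)) -> (Cmod (val (slin mint (mm k)) x z) <= B)%R.
  apply: common_bound => [k B B' H HB x z H1 H2|k]; first by apply: Rle_trans (H x z H1 H2) HB.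
  have [B [_ H]] := val_uniform r (slin mint (mm k)) r0 (conv_slin _ _ _ r0 bounded_mint (Yc _)).
  by exists B.
pose D := (784 * rsumL (fun=> 1) (idx M) * B)%R.
have D0 : (0 <= D)%R.
  apply: Rmult_le_pos => //; apply: Rmult_le_pos; first lra.
  by apply: rsumL_ge0 => _; lra.
have Dp : (0 < / (2 * (D + 1)))%R by apply: Rinv_0_lt_compat; lra.
(* The second entry gives rho^2 D <= 1/2, the smallness that makes f injective with nonvanishing
   derivative. *)
pose rho1 := Rmin r (/ (2 * (D + 1))).
have Hr x : (Rabs x < rho1)%R -> (Rabs x < r)%R by move=> H; apply: Rlt_le_trans H (Rmin_l _ _).
have small x : (Rabs x < rho1)%R -> (x ^ 2 * D <= 1 / 2)%R.
  move=> H; have {}H : (Rabs x < / (2 * (D + 1)))%R by apply: Rlt_le_trans H (Rmin_r _ _).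
  have E : (/ (2 * (D + 1)) * (2 * (D + 1)) = 1)%R by field; lra.
  rewrite -pow2_abs; move: (Rabs x) (Rabs_pos x) (/ _)%R Dp H E => y y0 e e0 ye E.
  have y1 : (y * (2 * (D + 1)) <= e * (2 * (D + 1)))%R by apply: Rmult_le_compat_r; lra.
  rewrite E in y1; have yD : (0 <= y * D)%R by exact: Rmult_le_pos.
  have := Rmult_le_compat_l y (y * D) (1 / 2) y0 ltac:(lra); rewrite /=; lra.
have HL0 : L 0%R = L0.
  apply: params_eq => [k|k||]; rewrite /L /Lx /center /Defs.circ /speed /period /= /gamr /spdv /Tr; ring.
have LP x X : (Rabs x < rho1)%R -> x <> 0%R -> (forall k, conv r (X k)) -> (forall k, supp ext_exp (X k)) ->
    forall z, conf_domain (L x) x z -> layer (L x) x (dens M x X) z = Phi M (L x) x X Ct z.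
  move=> Hx xnz HX SX z Hz; have [HT xs _ _ _] := HY x (Hr x Hx).
  by apply: (layer_Phi M (L x) x r (Hr x Hx) xnz _ xs X z HX SX Hz); rewrite /L; lra.
exists rho1, (fun x => fmap M (L x) x mm), (fun x => mfun_shift (pv_potential (L x)) (hmap M (L x) x nn)),
  (fun x => dens M x mm), (fun x => dens M x nn), (fun x k => (x * qr M Y x k)%R), L.
split; first exact: Rmin_glb_lt.
split; first by apply: (parameter_curve_analytic M _ _ _ _ Y r r0 Yc l a rho1 ha _ Ys); exact: Rmin_l.
split.
  move=> x Hx; split.
    move=> i Hi; have [_ _ _ Hy _] := HY x (Hr x Hx).
    (* An unselected coordinate has a zero row in [zm], so its increment vanishes; reality of the
       increments then separates real and imaginary coordinates. *)
    have Y0 : yi M Y x i = 0 by rewrite (proj1 (Hy i)) (proj2 (Hy i) (zm0 i Hi)).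
    have Yr j : Im (yi M Y x j) = 0%R by rewrite (proj1 (Hy j)).
    case: i Hi Y0 => [k|k|k|||] Hi Y0; rewrite /L /Lx /coord_val /center /Defs.circ /speed /period; cbn [fst snd].
    - rewrite Re_plus RtoC_Re_scal /zhv Re_plus Y0 Re_mult Yr /=; ring.
    - rewrite Im_plus RtoC_Im_scal /zhv Im_plus Y0 Im_mult Yr /=; ring.
    - by rewrite /gamr /yr Y0 /=; ring.
    - rewrite /spdv Re_plus RtoC_Re_scal /chv Re_plus Y0 Re_mult Yr /=; ring.
    - rewrite /spdv Im_plus RtoC_Im_scal /chv Im_plus Y0 Im_mult Yr /=; ring.
    by rewrite /Tr /yr Y0 /=; ring.
  (* At rho = 0 both correction terms carry a factor 0; the identification of the layer potential is
     used for rho nonzero only. *)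
  case: (Req_dec x 0) => xnz.
    rewrite xnz; split=> [z _|z _ v].
      by rewrite /fmap (_ : (0 ^ 2 = 0)%R); [ring|ring].
    by apply: mfun_shift_pt; rewrite /hmap; ring.
  split=> [z Hz|z Hz v].
    rewrite (LP x mm) //; first by rewrite /fmap /= !RtoC_mult; ring.
      by move=> k; exact: Yc.
    by move=> k; exact: (proj1 (Ys k)).
  apply: mfun_shift_pt; rewrite (LP x nn) //; first by move=> k; exact: Yc.
  by move=> k; exact: (proj2 (Ys k)).
split.
  move=> x [x0 Hx]; have xnz : x <> 0%R by move=> E; rewrite E Rabs_R0 in x0; lra.
  have [HT xs _ _ H] := HY x (Hr x Hx); have [sep bd] := H xnz.
  apply: (vortex_hollow M (L x) x r (Hr x Hx) xnz _ xs sep mm nn (qr M Y x) B) => //.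
  - by rewrite /L; lra.
  - by move=> k; exact: Yc.
  - by move=> k; exact: (proj1 (Ys k)).
  - by move=> k; exact: Yc.
  - by move=> k; exact: (proj2 (Ys k)).
  - move=> k t; have rx := Hr x Hx.
    have O : OK (hc t) (slin mint (mm k)) by left; exact: ann_hc.
    have E : hv r x (hc t) (slin mint (mm k)) (val (slin mint (mm k)) x (hc t)).
      by apply: hv_self => //; apply: conv_slin => //; [exact: bounded_mint|exact: Yc].
    rewrite /muS (hv_val _ _ _ _ _ (hv_sh r x (hc t) rx _ _ E)) (Cmod_mult x) Cmod_R.
    by apply: Rmult_le_compat_l; [exact: Rabs_pos|apply: HB => //; [exact: In_idx|lra]].
  exact: small.
split; first by move=> z; rewrite /fmap; ring.
split.
  move=> z v; rewrite HL0; split; first by move=> [v0 [H ->]]; rewrite /hmap (_ : v0 + _ = v0) //; ring.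
  by move=> H; exists v; split=> //; rewrite /hmap; ring.
by split=> // k; ring.
Qed.
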